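(* Let $d\ge1$, $0<\alpha,\rho,s<1$ and $c>0$, and set $\beta=\frac1\alpha$. (i) Let $\Lambda,M\subset\mathbb{R}^d$ be discrete with $\mathrm{D}^-_{\Phi_{1,c}}(\Lambda)$ and $\mathrm{D}^-_{\Phi_{\beta,c}}(M)$ positive, and let $f\in\mathcal{S}(\mathbb{R}^d)$ with extension $u_f$. If the trace of $u_f$ vanishes on $\Lambda$ and $\lim_{y\to0^+}y^{1-2s}\partial_yu_f(x,y)=0$ for every $x\in M$, then $u_f\equiv0$ in $\mathbb{R}^{d+1}_+$. (ii) Given two $\rho$-separated sets $\Lambda,M\subset\mathbb{R}^d$, there exists a nontrivial solution $u_f$ (for some $f\in\mathcal{S}(\mathbb{R}^d)$) whose trace vanishes on $\Lambda$ and whose weighted normal derivative $\lim_{y\to0^+}y^{1-2s}\partial_yu_f(x,y)$ vanishes for every $x\in M$.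
   Context: $\mathbb{R}^{d+1}_+=\mathbb{R}^d\times(0,\infty)$ with variables $(x,y)$; $\mathcal{S}(\mathbb{R}^d)$ is the Schwartz space (complex-valued functions). For $0<s<1$ and $f\in\mathcal{S}(\mathbb{R}^d)$, $u_f:\mathbb{R}^{d+1}_+\to\mathbb{C}$ denotes the Caffarelli–Silvestre extension of $f$: the smooth function, weakly vanishing as $y\to\infty$, satisfying $\mathrm{div}(y^{1-2s}\nabla u_f)=0$ in $\mathbb{R}^{d+1}_+$ and $u_f(\cdot,0)=f$ on $\mathbb{R}^d$ (so its trace is $f$). It is a known fact that $(-\Delta)^sf(x)=-C_s\lim_{y\to0^+}y^{1-2s}\partial_yu_f(x,y)$ for a constant $C_s$ depending only on $s$, where $(-\Delta)^sf$ is defined by $\widehat{(-\Delta)^sf}(\xi)=|\xi|^{2s}\widehat f(\xi)$ with $\widehat f(\xi)=\int_{\mathbb{R}^d} f(x)e^{-2\pi i\xi\cdot x}\,dx$. A set in $\mathbb{R}^d$ is discrete if it has no accumulation point in $\mathbb{R}^d$. A discrete set $\Gamma\subset\mathbb{R}^d$ is $\rho$-separated if there exist $A,B>0$ such that $\operatorname{dist}(\gamma,\Gamma\setminus\{\gamma\})\ge Ae^{-B|\gamma|^\rho}$ for all $\gamma\in\Gamma$ (the distance to the empty set being $+\infty$). For $a,c>0$, $\Phi_{a,c}:\mathbb{R}^d\to\mathbb{R}^d$ is the injective map $\Phi_{a,c}(x)=\frac{x}{|x|}e^{(|x|/c)^{1/a}}$ for $x\ne0$, $\Phi_{a,c}(0)=0$.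 For $\Gamma\subset\mathbb{R}^d$ discrete, $$\mathrm{D}^-_{\Phi_{a,c}}(\Gamma)=\liminf_{r\to\infty}\ \inf\Big\{\tfrac{\#(\Phi_{a,c}(\Gamma)\cap B)}{|B|}:B\subset\Phi_{a,c}(\mathbb{R}^d)\text{ a ball},\ |B|=r\Big\}\in[0,\infty],$$ where $|B|$ is Lebesgue measure. *)

(* Defs.v *)
From HB Require Import structures.
From mathcomp Require Import all_boot all_order all_algebra.
From mathcomp Require Import all_classical all_reals all_analysis.
From mathcomp Require Import complex.

Set Implicit Arguments.
Unset Strict Implicit.
Unset Printing Implicit Defensive.

Import Order.TTheory GRing.Theory Num.Theory.
Import numFieldNormedType.Exports.
Import ComplexField.Normc.

Local Open Scope classical_set_scope.
Local Open Scope ring_scope.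
Local Open Scope complex_scope.

(** ** Lebesgue measure on R^d

    The n-fold product of the one-dimensional Lebesgue measure, carried by
    [n.-tuple RT] because that type already has the product (= Borel)
    sigma-algebra. *)

Section lebesgue_tuple.
Variable R : realType.
Local Notation RT := (measurableTypeR R).

Definition tuple_cons n (p : RT * n.-tuple RT) : n.+1.-tuple RT :=
  [the n.+1.-tuple RT of p.1 :: p.2].

Lemma measurable_tuple_cons n : measurable_fun [set: _] (@tuple_cons n).
Proof. exact: measurable_cons measurable_fst measurable_snd. Qed.

Section step.
Local Open Scope ereal_scope.
Variables (n : nat) (mu : {sigma_finite_measure set (n.-tuple RT) -> \bar R}).

Definition leb_step : set (n.+1.-tuple RT) -> \bar R :=
  pushforward (@lebesgue_measure R \x mu) (@tuple_cons n).

Let leb_step_preimage A : measurable A -> measurable (@tuple_cons n @^-1` A).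
Proof.
by move=> mA; rewrite -[X in measurable X]setTI; exact: measurable_tuple_cons.
Qed.

Let leb_step0 : leb_step set0 = 0.
Proof. by rewrite /leb_step /pushforward preimage_set0 measure0. Qed.

Let leb_step_ge0 A : 0 <= leb_step A.
Proof. by rewrite /leb_step /pushforward; exact: measure_ge0. Qed.

Let leb_step_sigma_additive : semi_sigma_additive leb_step.
Proof.
move=> F mF tF mUF; rewrite /leb_step /pushforward preimage_bigcup.
apply: measure_semi_sigma_additive.
- by move=> k; exact: leb_step_preimage.
- apply/trivIsetP => /= i j _ _ ij; rewrite -preimage_setI.
  by move/trivIsetP : tF => /(_ _ _ _ _ ij) ->//; rewrite preimage_set0.
- by rewrite -preimage_bigcup; exact: leb_step_preimage.
Qed.

HB.instance Definition _ := isMeasure.Build _ _ _ leb_step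
  leb_step0 leb_step_ge0 leb_step_sigma_additive.

Let leb_step_sigma_finite : sigma_finite setT leb_step.
Proof.
have /sigma_finiteP[F [TF ndF Foo]] := sigma_finiteT (@lebesgue_measure R).
have /sigma_finiteP[G [TG ndG Goo]] := sigma_finiteT mu.
pose uncons (t : n.+1.-tuple RT) : RT * n.-tuple RT :=
  (thead t, [tuple of behead t]).
have mthead : measurable_fun [set: n.+1.-tuple RT] (fun t => thead t).
  exact: (measurable_tnth ord0).
have munc : measurable_fun [set: n.+1.-tuple RT] uncons.
  by apply: measurable_fun_pair; [exact: mthead|exact: measurable_behead].
have unconsK p : uncons (tuple_cons p) = p.
  case: p => a t; rewrite /uncons /tuple_cons /=; congr pair.
  exact: val_inj.
exists (fun k => uncons @^-1` (F k `*` G k)).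
  apply/seteqP; split=> // t _.
  have [i _ Fi] : (\bigcup_k F k) (uncons t).1 by rewrite -TF.
  have [j _ Gj] : (\bigcup_k G k) (uncons t).2 by rewrite -TG.
  exists (maxn i j) => //; split.
  - by move: Fi; exact/subsetPset/ndF/leq_maxl.
  - by move: Gj; exact/subsetPset/ndG/leq_maxr.
move=> k; have [mF Fk] := Foo k; have [mG Gk] := Goo k.
have mFG : measurable (F k `*` G k) by exact: measurableX.
split; first by rewrite -[X in measurable X]setTI; exact: munc.
rewrite /leb_step /pushforward.
suff -> : @tuple_cons n @^-1` (uncons @^-1` (F k `*` G k)) = F k `*` G k.
  by rewrite product_measure1E// lte_mul_pinfty// ge0_fin_numE.
by apply/seteqP; split=> p; rewrite /preimage /mkset unconsK.
Qed.

HB.instance Definition _ := Measure_isSigmaFinite.Build _ _ _ leb_step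
  leb_step_sigma_finite.

End step.

Fixpoint leb_tuple n : {sigma_finite_measure set (n.-tuple RT) -> \bar R} :=
  match n with
  | 0 => \d_[tuple]
  | m.+1 => leb_step (leb_tuple m)
  end.

End lebesgue_tuple.

Section euclidean.
Variable R : realType.

(** The library norm on ['rV[R]_n] is the sup norm; it has the right topology
    but not the right balls. *)
Definition enorm n (x : 'rV[R]_n) : R := Num.sqrt (\sum_i x 0 i ^+ 2).

Definition eball n (z : 'rV[R]_n) (t : R) : set 'rV[R]_n :=
  [set x | enorm (x - z) < t].

Definition rV_of_tuple n (t : n.-tuple R) : 'rV[R]_n := \row_i tnth t i.

Definition volume n (A : set 'rV[R]_n) : \bar R :=
  leb_tuple R n (@rV_of_tuple n @^-1` A).

Definition cintegral n (g : 'rV[R]_n -> R[i]) : R[i] :=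
  Rintegral (leb_tuple R n) setT (fun t => complex.Re (g (rV_of_tuple t)))
  +i* Rintegral (leb_tuple R n) setT (fun t => complex.Im (g (rV_of_tuple t))).

Definition L2norm n (g : 'rV[R]_n -> R[i]) : \bar R :=
  Lnorm (leb_tuple R n) 2%:E (fun t => (normc (g (rV_of_tuple t)))%:E).

Definition L2 n (g : 'rV[R]_n -> R[i]) : Prop :=
  [/\ measurable_fun [set: n.-tuple (measurableTypeR R)]
        (fun t => complex.Re (g (rV_of_tuple t))),
      measurable_fun [set: n.-tuple (measurableTypeR R)]
        (fun t => complex.Im (g (rV_of_tuple t)))
    & (L2norm g < +oo)%E].

Definition ccvg (T : Type) (F : set_system T) (g : T -> R[i]) (l : R[i]) : Prop :=
  normc (g t - l) @[t --> F] --> (0 : R).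

End euclidean.

(** [R[i]] is not a normed space over [R] in the library, so differentiation is
    done on real and imaginary parts. *)

Section smooth.
Variables (R : realType) (n : nat).
Implicit Types (g : 'rV[R]_n -> R[i]) (z : 'rV[R]_n).

Definition cdifferentiable g z : Prop :=
  differentiable (fun w => complex.Re (g w)) z /\
  differentiable (fun w => complex.Im (g w)) z.

Definition partial (i : 'I_n) g z : R[i] :=
  'D_(delta_mx 0 i) (fun w => complex.Re (g w)) z
  +i* 'D_(delta_mx 0 i) (fun w => complex.Im (g w)) z.

(** A multi-index is given as the list of coordinates to differentiate in. *)
Definition partials (s : seq 'I_n) g : 'rV[R]_n -> R[i] := foldr partial g s.

(** For [U] open this is C^oo(U). *)
Definition smooth_on (U : set 'rV[R]_n) g : Prop :=
  forall (s : seq 'I_n) z, U z -> cdifferentiable (partials s g) z.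

Definition schwartz g : Prop :=
  smooth_on setT g /\
  forall (k : nat) (s : seq 'I_n),
    exists C : R, forall x, enorm x ^+ k * normc (partials s g x) <= C.

End smooth.

(** A point (x, y) of R^(d+1) is a row vector whose last coordinate is y.
    Functions on the open half-space are total functions of which only the
    values at y > 0 matter. *)

Section extension.
Variables (R : realType) (d : nat).
Implicit Types (x : 'rV[R]_d) (y : R) (z : 'rV[R]_(d + 1)).
Implicit Types (u : 'rV[R]_(d + 1) -> R[i]).

Definition ycoord : 'I_(d + 1) := rshift d ord0.
Definition height z : R := z 0 ycoord.
Definition half_point x y : 'rV[R]_(d + 1) := row_mx x (const_mx y).
Definition half_space : set 'rV[R]_(d + 1) := [set z | 0 < height z].
Definition slice u y : 'rV[R]_d -> R[i] := fun x => u (half_point x y).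

Definition weighted_div_grad (s : R) u z : R[i] :=
  \sum_(i < d + 1)
    partial i (fun w => (height w `^ (1 - 2 * s))%:C * partial i u w) z.

Definition weighted_dy (s : R) u x y : R[i] :=
  (y `^ (1 - 2 * s))%:C * partial ycoord u (half_point x y).

(** [u] is the extension of [f].  "Weakly vanishing" is meant weakly in L^2:
    u(., y) lies in L^2(R^d), depends continuously on y in [0, +oo[ with value
    f at y = 0, and converges weakly to 0 in L^2(R^d) as y -> +oo.  This is the
    usual class in which the extension exists and is unique; weak decay alone,
    without continuity in L^2, does not determine [u] from [f]. *)
Definition cs_extension (s : R) (f : 'rV[R]_d -> R[i]) u : Prop :=
  [/\ smooth_on half_space u,
      forall z, half_space z -> weighted_div_grad s u z = 0,
      forall x, ccvg (within half_space (nbhs (half_point x 0))) u (f x),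
      [/\ forall y, 0 < y -> L2 (slice u y),
          forall y0, 0 < y0 ->
            L2norm (fun x => slice u y x - slice u y0 x) @[y --> y0] --> 0%E
        & L2norm (fun x => slice u y x - f x) @[y --> 0^'+] --> 0%E]
    & forall g, L2 g ->
        ccvg +oo (fun y => cintegral (fun x => slice u y x * (g x)^*)) 0].

Definition trace_vanishes_at u x : Prop := ccvg 0^'+ (fun y => slice u y x) 0.

Definition weighted_normal_vanishes_at (s : R) u x : Prop :=
  ccvg 0^'+ (weighted_dy s u x) 0.

End extension.

Section density.
Variables (R : realType) (d : nat).
Implicit Types (G : set 'rV[R]_d).

Definition discrete_in G : Prop := limit_point G = set0.

Definition dist_to (x : 'rV[R]_d) G : \bar R :=
  ereal_inf [set (enorm (x - y))%:E | y in G].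

Definition rho_separated (rho : R) G : Prop :=
  discrete_in G /\
  exists A B : R, [/\ 0 < A, 0 < B &
    forall x, G x ->
      ((A * expR (- B * enorm x `^ rho))%:E <= dist_to x (G `\ x))%E].

Definition Phi (a c : R) (x : 'rV[R]_d) : 'rV[R]_d :=
  if x == 0 then 0
  else expR ((enorm x / c) `^ (1 / a)) *: ((enorm x)^-1 *: x).

(** For r <= 0, or when no ball of volume r fits in the range of [Phi a c], the
    infimum below is +oo; this does not affect the liminf as r -> +oo. *)
Definition lower_density (a c : R) G : \bar R :=
  limf_einf (fun r : R =>
    ereal_inf [set q : \bar R | exists (z : 'rV[R]_d) (t : R),
      let B := eball z t in
      [/\ 0 < t, B `<=` range (Phi a c), volume B = r%:E
        & q = (counting ((Phi a c @` G) `&` B) / volume B)%E]])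
    (+oo : set_system R).

End density.

(* Main.v *)
(** Real and imaginary parts are treated separately.  The extension [u_f] is the Poisson integral of
    [f] with kernel [C y^(2s) / (y^2 + |x|^2)^((d+2s)/2)].  It is the only one: averaged over a small
    cube in [x], the difference of two extensions is bounded, because weakly convergent
    sequences in L^2 are bounded (gliding hump), and the maximum principle with the barrier
    [e (y^(2s) + |x|^2 + k (Y^2 - y^2))] shows that it vanishes.  The weighted normal derivative is a
    nonzero multiple of [L f (x) = int (f(x+z) + f(x-z) - 2 f(x)) |z|^(-d-2s) dz].

    (i) Positive density puts every [x] within [e^(-|x|/(2c))] of [Lambda], up to a constant, and
    within [e^(-(|x|/c)^alpha/2)] of [M], so [f] decays exponentially and [L f] faster than any power.
    On a line through the origin the transform of [f] is given by its Taylor series, that of [L f] is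
    smooth, and the two differ by the factor [|k|^(2s)]; as [2s] is not an even integer, all moments
    of [f] vanish.  Hence its transform vanishes near 0, and, repeating the argument after a
    modulation of [f], everywhere.

    (ii) Smooth bumps [phi] that are limits of trigonometric polynomials with frequencies away from
    0 have [phi] and [L phi] of size [e^(-k|x|^tau)], [tau < 1].  Placed at the points of
    [Lambda], [M] and at an extra point [p] at width [e^(-|p|^sg)] with [rho < sg < tau], they
    interpolate the values [f = 0] on [Lambda], [L f = 0] on [M] and [f p = 1] up to an operator of
    small norm on a weighted l^oo space, which a Neumann series inverts. *)

Require Import Defs.
From HB Require Import structures.
From mathcomp Require Import all_boot all_order all_algebra.
From mathcomp Require Import all_classical all_reals all_analysis.
From mathcomp Require Import measurable_realfun complex.
From mathcomp Require Import ring lra.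

Set Implicit Arguments.
Unset Strict Implicit.
Unset Printing Implicit Defensive.

Import Order.TTheory GRing.Theory Num.Theory.
Import numFieldNormedType.Exports.

Local Open Scope classical_set_scope.
Local Open Scope ring_scope.

(** * Integration on R^d *)

(** The two zero sets act asymmetrically. Density for [Phi 1 c] gives exponential decay of [f], so
    that the Taylor series of its transform converge with a fixed radius at every frequency; the
    weaker decay of [Lop s f] only gives an expansion at 0. For s = 1/2 the factor |k|^(2s) is a
    plain power on a ray and only parity reveals it, which is why cosine and sine are expanded
    separately. In (ii) the obstacle is the tail of [Lop s phi], in general of order |x|^(-d-2s)
    because the symbol is not smooth at 0; frequencies away from 0 remove it. Decay of order tau
    with bounded spectrum needs the sum of 2^(m(tau-1)) to be finite, hence tau < 1. Widths
    e^(-|p|^sg) must be far below separations e^(-B|p|^rho), coefficients e^(-|p|^sg') must absorb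
    powers of 1/width, and the decay of the bumps must absorb the variation of both: rho < sg < sg'
    < tau. Transforms are real integrals against cos and sin. Derivatives under integrals and limits
    come from quadratic Taylor remainders, and Gaussians obtained as limits of powers of cosines
    replace Fourier inversion. *)

Section real_integral.
Context d (T : measurableType d) (R : realType) (mu : {measure set T -> \bar R}).
Implicit Types f g : T -> R.

Definition L1 f := mu.-integrable setT (EFin \o f).
Definition Int f : R := Rintegral mu setT f.

Lemma L1_meas f : L1 f -> measurable_fun setT f.
Proof. by move=> /measurable_int/measurable_EFinP. Qed.

Lemma L1_le g f : measurable_fun setT f -> (forall x, `|f x| <= g x) ->
  L1 g -> L1 f.
Proof.
move=> mf fg; apply: le_integrable => //; first exact/measurable_EFinP.
by move=> x _; rewrite /= lee_fin (le_trans (fg x))// ler_norm.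
Qed.

Lemma L1D f g : L1 f -> L1 g -> L1 (fun x => f x + g x).
Proof. by move=> hf hg; have := integrableD measurableT hf hg; apply: eq_integrable. Qed.

Lemma L1N f : L1 f -> L1 (fun x => - f x).
Proof. by move=> hf; have := integrableN hf; apply: eq_integrable. Qed.

Lemma L1B f g : L1 f -> L1 g -> L1 (fun x => f x - g x).
Proof. by move=> hf hg; apply: L1D => //; apply: L1N. Qed.

Lemma L1Z r f : L1 f -> L1 (fun x => r * f x).
Proof. by move=> hf; have := integrableZl measurableT r hf; apply: eq_integrable. Qed.

Lemma L1_norm f : L1 f -> L1 (fun x => `|f x|).
Proof. exact: integrable_norm. Qed.

Lemma L1_0 : L1 (fun=> 0).
Proof. by have := @integrable0 _ T R mu setT; apply: eq_integrable. Qed.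

Lemma L1_sum I (s : seq I) (P : pred I) (h : I -> T -> R) :
  (forall i, P i -> L1 (h i)) -> L1 (fun x => \sum_(i <- s | P i) h i x).
Proof.
move=> hh; elim: s => [|i s ih].
  by apply: eq_integrable L1_0 => // x _; rewrite /= big_nil.
have [Pi|Pi] := boolP (P i); last first.
  by apply: eq_integrable ih => // x _; rewrite /= big_cons (negbTE Pi).
by apply: eq_integrable (L1D (hh i Pi) ih) => // x _; rewrite /= big_cons Pi.
Qed.

Lemma IntD f g : L1 f -> L1 g -> Int (fun x => f x + g x) = Int f + Int g.
Proof. exact: RintegralD. Qed.

Lemma IntB f g : L1 f -> L1 g -> Int (fun x => f x - g x) = Int f - Int g.
Proof. exact: RintegralB. Qed.

Lemma IntZ r f : L1 f -> Int (fun x => r * f x) = r * Int f.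
Proof. exact: RintegralZl. Qed.

Lemma Int0 : Int (fun=> 0) = 0.
Proof. by rewrite /Int /Rintegral integral0. Qed.

Lemma IntN f : L1 f -> Int (fun x => - f x) = - Int f.
Proof.
move=> hf; rewrite -mulN1r -IntZ//; congr Int.
by apply/funext => x; rewrite mulN1r.
Qed.

Lemma Int_sum I (s : seq I) (P : pred I) (h : I -> T -> R) :
  (forall i, P i -> L1 (h i)) ->
  Int (fun x => \sum_(i <- s | P i) h i x) = \sum_(i <- s | P i) Int (h i).
Proof.
move=> hh; elim: s => [|i s ih].
  by rewrite big_nil -[RHS]Int0; congr Int; apply/funext => x; rewrite big_nil.
rewrite big_cons; have [Pi|Pi] := boolP (P i); last first.
  by rewrite -ih; congr Int; apply/funext => x; rewrite big_cons (negbTE Pi).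
rewrite -ih -IntD; [|exact: hh|exact: L1_sum].
by congr Int; apply/funext => x; rewrite big_cons Pi.
Qed.

Lemma le_Int f g : L1 f -> L1 g -> (forall x, f x <= g x) -> Int f <= Int g.
Proof. by move=> hf hg fg; apply: le_Rintegral => // x _; exact: fg. Qed.

Lemma Int_ge0 f : (forall x, 0 <= f x) -> 0 <= Int f.
Proof. by move=> f0; apply: Rintegral_ge0 => x _; exact: f0. Qed.

Lemma norm_Int f : L1 f -> `|Int f| <= Int (fun x => `|f x|).
Proof. exact: le_normr_Rintegral. Qed.

Lemma norm_Int_le f g : L1 f -> L1 g -> (forall x, `|f x| <= g x) ->
  `|Int f| <= Int g.
Proof.
by move=> hf hg fg; rewrite (le_trans (norm_Int hf))// le_Int//; exact: L1_norm.
Qed.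

Lemma Int_EFin f : L1 f -> (\int[mu]_x (f x)%:E)%E = (Int f)%:E.
Proof. by move=> hf; rewrite /Int /Rintegral fineK//; exact: integrable_fin_num. Qed.

Lemma L1_ge0P f C : measurable_fun setT f -> (forall x, 0 <= f x) ->
  (\int[mu]_x (f x)%:E <= C%:E)%E -> L1 f /\ Int f <= C.
Proof.
move=> mf f0 fC; have hf : L1 f.
  apply/integrableP; split; first exact/measurable_EFinP.
  rewrite (_ : (fun x => _) = (fun x => (f x)%:E)).
    by rewrite (le_lt_trans fC)// ltry.
  by apply/funext => x /=; rewrite ger0_norm.
by split=> //; rewrite -lee_fin -Int_EFin.
Qed.

Lemma Int_lim (f_ : nat -> T -> R) f g :
  (forall k, measurable_fun setT (f_ k)) ->
  (forall x, (fun k => f_ k x) @ \oo --> f x) ->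
  (forall k x, `|f_ k x| <= g x) -> L1 g ->
  L1 f /\ (fun k => Int (f_ k)) @ \oo --> Int f.
Proof.
move=> mf_ cf fg ig.
have mf : measurable_fun setT f.
  by apply: (@measurable_fun_cvg _ _ _ setT f_) => // x _; exact: cf.
have hf_ k : L1 (f_ k) by apply: L1_le ig => // x; exact: fg.
have [] := @dominated_convergence _ T R mu setT measurableT
  (fun k x => (f_ k x)%:E) (EFin \o f) (EFin \o g).
- by move=> k; exact/measurable_EFinP.
- exact/measurable_EFinP.
- by apply: aeW => /= x _; apply: cvg_EFin; [exact: nearW|exact: cf].
- exact: ig.
- by apply: aeW => x k _ /=; rewrite lee_fin.
move=> i1 _ i2; split=> //.
by move: i2; rewrite Int_EFin// => i2; exact: (fine_cvg i2).
Qed.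

(** The truncations min(f, S_k) increase and are eventually equal to [f] at each point, so monotone
    convergence bounds the integral of [f] before anything is known about its integrability. This is
    how majorants built from countably many cubes enter. *)
Lemma L1_exhaust (S_ : nat -> T -> R) f C :
  measurable_fun setT f -> (forall x, 0 <= f x) ->
  (forall k, L1 (S_ k)) -> (forall k x, 0 <= S_ k x <= S_ k.+1 x) ->
  (forall k, Int (S_ k) <= C) -> (forall x, exists k, f x <= S_ k x) ->
  L1 f /\ Int f <= C.
Proof.
move=> mf f0 hS ndS SC fS.
pose g k x := Num.min (f x) (S_ k x).
have S_nd k m x : (k <= m)%N -> S_ k x <= S_ m x.
  elim: m => [|m ih]; first by rewrite leqn0 => /eqP->.
  rewrite leq_eqVlt => /orP[/eqP->//|]; rewrite ltnS => /ih /le_trans; apply.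
  by case/andP: (ndS m x).
have g0 k x : 0 <= g k x by rewrite le_min f0; case/andP: (ndS k x).
have mg k : measurable_fun setT (g k).
  by apply: measurable_minr => //; apply: L1_meas.
have gS k x : g k x <= S_ k x by rewrite ge_min lexx orbT.
have hg k : L1 (g k).
  by apply: L1_le (hS k) => // x; rewrite ger0_norm.
have gnd x : nondecreasing_seq (fun k => (g k x)%:E).
  move=> k m km /=; rewrite lee_fin le_min ge_min lexx/=.
  by rewrite (le_trans (gS k x))// S_nd.
have limg x : limn (fun k => (g k x)%:E) = (f x)%:E.
  apply: cvg_lim => //; apply: cvg_near_cst.
  have [k0 hk0] := fS x; near=> k; congr EFin.
  by apply/min_idPl; rewrite (le_trans hk0)// S_nd//; near: k; exact: nbhs_infty_ge.
apply: L1_ge0P => //.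
under eq_integral do rewrite -limg.
rewrite monotone_convergence//; last 2 first.
- by move=> k; exact/measurable_EFinP.
- by move=> k x _; rewrite lee_fin.
apply: lime_le.
  apply: ereal_nondecreasing_is_cvgn => k m km.
  apply: ge0_le_integral => //; try (by move=> x _; rewrite lee_fin);
    try exact/measurable_EFinP.
  by move=> x _; exact: gnd.
near=> k; rewrite Int_EFin// lee_fin (le_trans _ (SC k))//.
exact: le_Int.
Unshelve. all: by end_near. Qed.

End real_integral.

(** * Iterated integrals of finite-valued functions *)

Section fubini.
Context d1 d2 (T1 : measurableType d1) (T2 : measurableType d2) (R : realType).
Variables (m1 : {sigma_finite_measure set T1 -> \bar R})
          (m2 : {sigma_finite_measure set T2 -> \bar R}).
Implicit Types F : T1 * T2 -> R.

Lemma L1_tonelli1 F G : measurable_fun setT F ->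
  (forall x, L1 m2 (fun y => F (x, y))) ->
  (forall x, Int m2 (fun y => `|F (x, y)|) <= G x) -> L1 m1 G ->
  L1 (m1 \x m2)%E F.
Proof.
move=> mF hF FG hG.
have mE : measurable_fun setT (EFin \o F) by exact/measurable_EFinP.
have mN : measurable_fun setT (EFin \o (fun p => `|F p|)).
  by apply/measurable_EFinP; apply: measurableT_comp.
apply/(integrable12ltyP _ _ mE).
rewrite (_ : (fun x => _) = (fun x => (Int m2 (fun y => `|F (x, y)|))%:E)); last first.
  by apply/funext => x; rewrite -Int_EFin//; exact: L1_norm.
apply: (@le_lt_trans _ _ (\int[m1]_x (G x)%:E)%E); last first.
  by rewrite Int_EFin// ltry.
apply: ge0_le_integral => //.
- by move=> x _; rewrite lee_fin Int_ge0.
- rewrite (_ : (fun x => _) = fubini_F m2 (abse \o (EFin \o F))).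
    by apply: (measurable_fun_fubini_tonelli_F (EFin \o (fun p => `|F p|))) => // p; rewrite lee_fin.
  by apply/funext => x; rewrite -Int_EFin//; exact: L1_norm.
- by apply/measurable_EFinP; exact: L1_meas hG.
- by move=> x _; rewrite lee_fin.
Qed.

Lemma L1_tonelli2 F G : measurable_fun setT F ->
  (forall y, L1 m1 (fun x => F (x, y))) ->
  (forall y, Int m1 (fun x => `|F (x, y)|) <= G y) -> L1 m2 G ->
  L1 (m1 \x m2)%E F.
Proof.
move=> mF hF FG hG.
have mE : measurable_fun setT (EFin \o F) by exact/measurable_EFinP.
have mN : measurable_fun setT (EFin \o (fun p => `|F p|)).
  by apply/measurable_EFinP; apply: measurableT_comp.
apply/(integrable21ltyP _ _ mE).
rewrite (_ : (fun x => _) = (fun y => (Int m1 (fun x => `|F (x, y)|))%:E)); last first.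
  by apply/funext => x; rewrite -Int_EFin//; exact: L1_norm.
apply: (@le_lt_trans _ _ (\int[m2]_x (G x)%:E)%E); last first.
  by rewrite Int_EFin// ltry.
apply: ge0_le_integral => //.
- by move=> x _; rewrite lee_fin Int_ge0.
- rewrite (_ : (fun x => _) = fubini_G m1 (abse \o (EFin \o F))).
    by apply: (measurable_fun_fubini_tonelli_G (EFin \o (fun p => `|F p|))) => // p; rewrite lee_fin.
  by apply/funext => x; rewrite -Int_EFin//; exact: L1_norm.
- by apply/measurable_EFinP; exact: L1_meas hG.
- by move=> x _; rewrite lee_fin.
Qed.

Section iterated.
Variable F : T1 * T2 -> R.
Hypothesis hF : L1 (m1 \x m2)%E F.

(** Integrability of every section, not just of almost every one, identifies the real-valued inner
    integral with [fubini_F] at every point, so that the extended-valued theorem applies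
    directly. *)
Lemma Int_prod12 : (forall x, L1 m2 (fun y => F (x, y))) ->
  L1 m1 (fun x => Int m2 (fun y => F (x, y))) /\
  Int (m1 \x m2)%E F = Int m1 (fun x => Int m2 (fun y => F (x, y))).
Proof.
move=> h1.
have e1 : EFin \o (fun x => Int m2 (fun y => F (x, y))) =
          fubini_F m2 (EFin \o F).
  by apply/funext => x; rewrite /= -Int_EFin.
split; first by rewrite /L1 e1; exact: integrable_fubini_F.
rewrite {1}/Int /Rintegral -integral12_prod_meas1//.
by congr fine; apply: eq_integral => x _; rewrite -Int_EFin.
Qed.

Lemma Int_prod21 : (forall y, L1 m1 (fun x => F (x, y))) ->
  L1 m2 (fun y => Int m1 (fun x => F (x, y))) /\
  Int (m1 \x m2)%E F = Int m2 (fun y => Int m1 (fun x => F (x, y))).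
Proof.
move=> h1.
have e1 : EFin \o (fun y => Int m1 (fun x => F (x, y))) =
          fubini_G m1 (EFin \o F).
  by apply/funext => x; rewrite /= -Int_EFin.
split.
  rewrite /L1 e1; apply/integrableP; split; first exact: (measurable_fubini_G hF).
  have /(integrable21ltyP _ _ (measurable_int _ hF)) := hF.
  apply: le_lt_trans; apply: ge0_le_integral => //.
  - by apply: measurableT_comp => //; exact: (measurable_fubini_G hF).
  - have mN : measurable_fun setT (EFin \o (fun p => `|F p|)).
      apply/measurable_EFinP; apply: measurableT_comp => //.
      exact: L1_meas hF.
    by apply: (measurable_fun_fubini_tonelli_G (EFin \o (fun p => `|F p|))) => // p; rewrite lee_fin.
  - by move=> y _; apply: le_abse_integral => //; exact: measurable_int (h1 y).
rewrite {1}/Int /Rintegral -integral21_prod_meas1//.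
by congr fine; apply: eq_integral => x _; rewrite -Int_EFin.
Qed.

End iterated.

Lemma Int_prod f g : L1 m1 f -> L1 m2 g ->
  L1 (m1 \x m2)%E (fun p => f p.1 * g p.2) /\
  Int (m1 \x m2)%E (fun p => f p.1 * g p.2) = Int m1 f * Int m2 g.
Proof.
move=> hf hg.
have mfg : measurable_fun setT (fun p : T1 * T2 => f p.1 * g p.2).
  apply: measurable_funM.
  - by apply: measurableT_comp => //; exact: L1_meas hf.
  - by apply: measurableT_comp => //; exact: L1_meas hg.
have h1 x : L1 m2 (fun y => f x * g y) by exact: L1Z.
have hP : L1 (m1 \x m2)%E (fun p => f p.1 * g p.2).
  apply: (@L1_tonelli1 _ (fun x => Int m2 (fun y => `|g y|) * `|f x|)) => //=.
  - move=> x; rewrite mulrC -IntZ; last exact: L1_norm.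
    rewrite le_eqVlt; apply/orP; left; apply/eqP; congr Int.
    by apply/funext => y; rewrite normrM.
  - by apply: L1Z; exact: L1_norm.
split=> //; have [_ ->] := Int_prod12 hP h1.
rewrite mulrC -IntZ//; congr Int; apply/funext => x /=.
by rewrite IntZ// mulrC.
Qed.
End fubini.

(** * Calculus of real partial derivatives *)

Section multivariate.
Variables (R : realType) (n : nat).
Local Notation V := 'rV[R]_n.
Implicit Types (g k : V -> R) (z h : V) (i : 'I_n).

Definition rpartial i g z : R := 'D_(delta_mx 0 i) g z.
Definition rpartials (s : seq 'I_n) g : V -> R := foldr rpartial g s.
Definition rsmooth (U : set V) g := forall s z, U z -> differentiable (rpartials s g) z.

Lemma rpartials_rcons s i g : rpartials (rcons s i) g = rpartials s (rpartial i g).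
Proof. by rewrite /rpartials foldr_rcons. Qed.

(** The linear form with gradient [a]: the candidate for a differential. Its linear structure,
    declared below, is what [diff_unique] works with. *)
Definition lincomb (a : 'I_n -> R) h : R := \sum_i h 0 i * a i.

Lemma lincomb_linear a : linear (lincomb a).
Proof.
move=> c u v; rewrite /lincomb scaler_sumr -big_split/=; apply: eq_bigr => i _.
by rewrite !mxE mulrDl /GRing.scale/= mulrA.
Qed.

HB.instance Definition _ a :=
  GRing.isLinear.Build R V R _ (lincomb a) (lincomb_linear a).

Lemma norm_coord h i : `|h 0 i| <= `|h|.
Proof.
rewrite [leRHS]/Num.norm/= mx_normrE.
by apply: (le_bigmax _ (fun ij => `|h ij.1 ij.2|) (0, i)).
Qed.

Lemma norm_lincomb a C h : (forall i, `|a i| <= C) -> `|lincomb a h| <= n%:R * C * `|h|.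
Proof.
move=> aC; rewrite (le_trans (ler_norm_sum _ _ _))//.
rewrite -[n in n%:R]card_ord -sum1_card natr_sum !mulr_suml.
apply: ler_sum => i _; rewrite normrM mul1r mulrC.
by apply: ler_pM => //; exact: norm_coord.
Qed.

Lemma lincomb_continuous a : continuous (lincomb a).
Proof.
move=> z; rewrite (_ : lincomb a = \sum_i (fun h : V => h 0 i * a i)); last first.
  by apply/funext => h; rewrite fct_sumE.
apply: differentiable_continuous; apply: differentiable_sum => i.
by apply: differentiableM => //; exact: differentiable_coord.
Qed.

Lemma derive_lincomb g z h : differentiable g z ->
  'D_h g z = lincomb (fun i => rpartial i g z) h.
Proof.
move=> dg; rewrite deriveE// {1}(row_sum_delta h) linear_sum/=.
by apply: eq_bigr => i _; rewrite linearZ/= /rpartial deriveE.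
Qed.

Lemma is_derive_line g z h (t : R) : differentiable g (z + t *: h) ->
  is_derive t 1 (fun u : R => g (z + u *: h)) ('D_h g (z + t *: h)).
Proof.
move=> dg; have dv : derivable g (z + t *: h) h by exact: diff_derivable.
have e : (fun u : R => u^-1 *: ((fun u : R => g (z + u *: h)) (u *: (1 : R^o) + t) -
    g (z + t *: h))) = (fun u => u^-1 *: (g (u *: h + (z + t *: h)) - g (z + t *: h))).
  apply/funext => u; congr (_ *: (g _ - _)).
  by rewrite [u *: 1]mulr1 scalerDl addrCA addrA.
by apply: DeriveDef; [rewrite /derivable /= e; exact: dv|rewrite /derive /= e].
Qed.

Lemma MVT_line g z h :
  (forall t : R, 0 <= t <= 1 -> differentiable g (z + t *: h)) ->
  exists2 t : R, 0 <= t <= 1 &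
    g (z + h) - g z = lincomb (fun i => rpartial i g (z + t *: h)) h.
Proof.
move=> dg; have dl (t : R) : 0 <= t <= 1 -> is_derive t 1 (fun u : R => g (z + u *: h))
    ('D_h g (z + t *: h)) by move=> t01; apply: is_derive_line; exact: dg.
have [t|t|c] := @MVT R (fun u => g (z + u *: h))
    (fun u => 'D_h g (z + u *: h)) 0 1 ltr01.
- by rewrite in_itv/= => /andP[t0 t1]; apply: dl; rewrite !ltW.
- apply: derivable_within_continuous => u; rewrite in_itv/= => /dl ud.
  by case: ud.
rewrite in_itv/= => /andP[c0 c1]; rewrite scale1r scale0r addr0 subr0 mulr1 => ->.
have c01 : 0 <= c <= 1 by rewrite !ltW.
by exists c => //; rewrite derive_lincomb//; exact: dg.
Qed.

Lemma lip_line g z h C :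
  (forall t : R, 0 <= t <= 1 -> differentiable g (z + t *: h)) ->
  (forall i (t : R), 0 <= t <= 1 -> `|rpartial i g (z + t *: h)| <= C) ->
  `|g (z + h) - g z| <= n%:R * C * `|h|.
Proof.
move=> dg gC; have [t t01 ->] := MVT_line dg.
by apply: norm_lincomb => i; exact: gC.
Qed.

(** The mean value theorem is applied along the segment and then to the gradient at the intermediate
    point; each application costs a factor [n] in the sup norm. *)
Lemma taylor2 g z h C :
  (forall t : R, 0 <= t <= 1 -> differentiable g (z + t *: h)) ->
  (forall i (t : R), 0 <= t <= 1 -> differentiable (rpartial i g) (z + t *: h)) ->
  (forall i j (t : R), 0 <= t <= 1 -> `|rpartial j (rpartial i g) (z + t *: h)| <= C) ->
  `|g (z + h) - g z - lincomb (fun i => rpartial i g z) h| <= n%:R ^+ 2 * C * `|h| ^+ 2.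
Proof.
move=> dg d2 gC; have [t t01 ->] := MVT_line dg.
have -> : lincomb (fun i => rpartial i g (z + t *: h)) h -
    lincomb (fun i => rpartial i g z) h =
    lincomb (fun i => rpartial i g (z + t *: h) - rpartial i g z) h.
  by rewrite /lincomb -sumrB; apply: eq_bigr => i _; rewrite -mulrBr.
apply: (le_trans (@norm_lincomb _ (n%:R * C * `|h|) h _)); last first.
  by rewrite le_eqVlt; apply/orP; left; apply/eqP; ring.
move=> i.
have tu (u : R) : 0 <= u <= 1 -> 0 <= u * t <= 1.
  case/andP: t01 => t0 t1 /andP[u0 u1]; rewrite mulr_ge0//=.
  by rewrite (le_trans _ u1)// ler_piMr.
have := @lip_line (rpartial i g) z (t *: h) C; rewrite normrZ => H.
have C0 : 0 <= C by apply: le_trans (gC i i t t01).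
apply: (@le_trans _ _ (n%:R * C * (`|t| * `|h|))).
  apply: H.
  - by move=> u u01; rewrite scalerA; apply: d2; exact: tu.
  - by move=> j u u01; rewrite scalerA; apply: gC; exact: tu.
rewrite ler_wpM2l ?mulr_ge0// ler_piMl//.
by case/andP: t01 => t0 t1; rewrite ger0_norm.
Qed.

Lemma near0_norm_lt (e : R) : 0 < e -> \forall h \near (0 : V), `|h| < e.
Proof. by move=> e0; apply: (@cvgr0_norm_lt _ _ _ (nbhs (0 : V)) _ id _ _ e0). Qed.

(** A quadratic remainder is more than differentiability asks for, but it survives integration and
    pointwise limits, so this is the common exit of all later arguments. Uniqueness of the
    differential then reads off the partial derivatives. *)
Lemma diff_quad g z (a : 'I_n -> R) (del C : R) : 0 < del ->
  (forall h, `|h| < del -> `|g (z + h) - g z - lincomb a h| <= C * `|h| ^+ 2) ->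
  differentiable g z /\ forall i, rpartial i g z = a i.
Proof.
move=> d0 H.
have o : g \o shift z = cst (g z) + lincomb a +o_ (0 : V) id.
  apply/eqaddoP => _/posnumP[e]; near=> h.
  rewrite /= !fctE /= opprD addrA [h + z]addrC.
  have hd : `|h| < del by near: h; exact: near0_norm_lt.
  apply: (le_trans (H h hd)); rewrite expr2 mulrA ler_wpM2r//.
  have C0 : 0 < `|C| + 1 by rewrite ltr_pwDr.
  have : `|h| < e%:num / (`|C| + 1) by near: h; apply: near0_norm_lt; rewrite divr_gt0.
  rewrite ltr_pdivlMr// => /ltW; apply: le_trans; rewrite mulrC ler_wpM2l//.
  by rewrite (le_trans (ler_norm C))// lerDl.
have dE := diff_unique (@lincomb_continuous a) o.
have dg : differentiable g z.
  by apply/diff_locallyP; rewrite dE; split => //; exact: lincomb_continuous.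
split=> // i; rewrite /rpartial deriveE// [LHS](_ : _ = lincomb a (delta_mx 0 i)); last by rewrite dE.
rewrite /lincomb (bigD1 i)//= big1 ?addr0.
  by rewrite mxE !eqxx mul1r.
by move=> j ji; rewrite mxE eqxx/= (negbTE ji) mul0r.
Unshelve. all: by end_near. Qed.

Lemma diff_near g k z : (\forall w \near z, g w = k w) -> differentiable k z ->
  differentiable g z /\ forall i, rpartial i g z = rpartial i k z.
Proof.
move=> gk dk.
have o : g \o shift z = cst (g z) + 'd k z +o_ (0 : V) id.
  have [_ ok] : continuous ('d k z) /\ k \o shift z = cst (k z) + 'd k z +o_ (0 : V) id by apply/diff_locallyP.
  apply/eqaddoP => e e0.
  have /eqaddoP/(_ e e0) H := ok; near=> h.
  have gz : g z = k z by exact: nbhs_singleton gk.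
  have gh : g (h + z) = k (h + z).
    by rewrite addrC; near: h; move/nbhs0P : gk.
  rewrite /= !fctE/= gz gh; near: h; exact: H.
have ck : continuous ('d k z) by exact: diff_continuous.
have dE := diff_unique ck o.
have dg : differentiable g z.
  by apply/diff_locallyP; rewrite dE; split => //; exact: diff_continuous.
by split=> // i; exact: near_eq_derive.
Unshelve. all: by end_near. Qed.

Section closed_class.
Variables (U : set V) (P : (V -> R) -> Prop).
Hypothesis oU : open U.
Hypothesis dP : forall g, P g -> forall z, U z -> differentiable g z.
Hypothesis cP : forall g i, P g -> exists2 k, P k & forall z, U z -> rpartial i g z = k z.

Lemma rpartials_closed g s : P g ->
  exists2 k, P k & forall z, U z -> rpartials s g z = k z.
Proof.
move=> Pg; elim: s => [|i s [k Pk gk]]; first by exists g.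
have [k' Pk' kk'] := cP i Pk; exists k' => // z Uz /=.
rewrite -kk'//; apply: (@diff_near _ k z _ _).2; last exact: dP.
by apply: filterS (open_nbhs_nbhs (conj oU Uz)) => w Uw; exact: gk.
Qed.

(** Reduces smoothness to two checks on a class of functions: its members are differentiable, and
    their partial derivatives agree on [U] with members again. Agreement on the open set [U] is
    enough because differentiability is local ([diff_near]). *)
Lemma rsmooth_closed g : P g -> rsmooth U g.
Proof.
move=> Pg s z Uz; have [k Pk gk] := rpartials_closed s Pg.
apply: (@diff_near _ k z _ _).1; last exact: dP.
by apply: filterS (open_nbhs_nbhs (conj oU Uz)) => w Uw; exact: gk.
Qed.
End closed_class.

Lemma rsmooth_diff U g : rsmooth U g -> forall z, U z -> differentiable g z.
Proof. by move=> sg z Uz; exact: (sg [::]). Qed.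

Lemma rsmooth_rpartial U g i : rsmooth U g -> rsmooth U (rpartial i g).
Proof. by move=> sg s z Uz; rewrite -rpartials_rcons; exact: sg. Qed.

Lemma rsmooth_rpartials U g s : rsmooth U g -> rsmooth U (rpartials s g).
Proof. by move=> sg t z Uz; rewrite /rpartials -foldr_cat; exact: sg. Qed.

Lemma rpartialD i g k z : differentiable g z -> differentiable k z ->
  rpartial i (fun w => g w + k w) z = rpartial i g z + rpartial i k z.
Proof. by move=> dg dk; rewrite /rpartial deriveD//; exact: diff_derivable. Qed.

Lemma rpartialM i g k z : differentiable g z -> differentiable k z ->
  rpartial i (fun w => g w * k w) z = g z * rpartial i k z + k z * rpartial i g z.
Proof. by move=> dg dk; rewrite /rpartial deriveM//; exact: diff_derivable. Qed.

Lemma rpartial_cst i c z : rpartial i (fun=> c) z = 0.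
Proof. exact: derive_cst. Qed.

Lemma rpartialZ i c g z : differentiable g z ->
  rpartial i (fun w => c * g w) z = c * rpartial i g z.
Proof.
move=> dg; rewrite rpartialM//; by rewrite rpartial_cst mulr0 addr0.
Qed.

Lemma rsmoothD U g k : open U -> rsmooth U g -> rsmooth U k ->
  rsmooth U (fun z => g z + k z).
Proof.
move=> oU sg sk.
pose P (f : V -> R) := exists a b, [/\ rsmooth U a, rsmooth U b & f = fun z => a z + b z].
apply: (@rsmooth_closed U P oU) => [f [a [b [sa sb ->]]] z Uz|f i [a [b [sa sb ->]]]|].
- exact: differentiableD (rsmooth_diff sa Uz) (rsmooth_diff sb Uz).
- exists (fun z => rpartial i a z + rpartial i b z).
    by exists (rpartial i a), (rpartial i b); split => //; exact: rsmooth_rpartial.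
  move=> z Uz; rewrite rpartialD//; exact: rsmooth_diff Uz.
- by exists g, k.
Qed.

Lemma rpartialsD s g k z : rsmooth setT g -> rsmooth setT k ->
  rpartials s (fun w => g w + k w) z = rpartials s g z + rpartials s k z.
Proof.
move=> sg sk; elim: s z => [//|i s ih] z /=.
rewrite -rpartialD; [|exact: sg|exact: sk].
by congr ('D_ _ _ _); apply/funext => w; exact: ih.
Qed.

Lemma rpartialsZ s c g z : rsmooth setT g ->
  rpartials s (fun w => c * g w) z = c * rpartials s g z.
Proof.
move=> sg; elim: s z => [//|i s ih] z /=.
rewrite -rpartialZ; last exact: sg.
by congr ('D_ _ _ _); apply/funext => w; exact: ih.
Qed.

Lemma rsmoothZ U c g : open U -> rsmooth U g -> rsmooth U (fun z => c * g z).
Proof.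
move=> oU sg.
pose P (f : V -> R) := exists2 a, rsmooth U a & f = fun z => c * a z.
apply: (@rsmooth_closed U P oU) => [f [a sa ->] z Uz|f i [a sa ->]|].
- by apply: differentiableM => //; exact: rsmooth_diff Uz.
- exists (fun z => c * rpartial i a z).
    by exists (rpartial i a) => //; exact: rsmooth_rpartial.
  by move=> z Uz; rewrite rpartialZ//; exact: rsmooth_diff Uz.
- by exists g.
Qed.

Lemma rsmooth_cst U c : open U -> rsmooth U (fun=> c).
Proof.
move=> oU; pose P (f : V -> R) := exists a, f = fun=> a.
apply: (@rsmooth_closed U P oU) => [f [a ->] z Uz|f i [a ->]|].
- exact: differentiable_cst.
- by exists (fun=> 0); [exists 0|move=> z Uz; rewrite rpartial_cst].
- by exists c.
Qed.

Lemma rsmooth_sum U I (r : seq I) (F : I -> V -> R) : open U ->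
  (forall j, rsmooth U (F j)) -> rsmooth U (fun z => \sum_(j <- r) F j z).
Proof.
move=> oU sF; elim: r => [|j r ih].
  by under eq_fun do rewrite big_nil; exact: rsmooth_cst.
by under eq_fun do rewrite big_cons; exact: rsmoothD.
Qed.

Lemma rpartials_sum s I (r : seq I) (F : I -> V -> R) z :
  (forall j, rsmooth setT (F j)) ->
  rpartials s (fun w => \sum_(j <- r) F j w) z = \sum_(j <- r) rpartials s (F j) z.
Proof.
move=> sF; elim: r => [|j r ih].
  under eq_fun do rewrite big_nil; rewrite big_nil.
  elim: s z {sF} => [//|i s ih] z /=.
  by rewrite (_ : rpartials _ _ = fun=> 0) ?rpartial_cst//; apply/funext.
under eq_fun do rewrite big_cons; rewrite big_cons.
by rewrite rpartialsD ?ih//; apply: rsmooth_sum => //; exact: openT.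
Qed.

Lemma diff_affine (a : R) (b : V) g z : differentiable g (a *: z + b) ->
  differentiable (fun w => g (a *: w + b)) z /\
  forall i, rpartial i (fun w => g (a *: w + b)) z = a * rpartial i g (a *: z + b).
Proof.
move=> dg.
have dc : differentiable (fun w => g (a *: w + b)) z.
  by apply: (@differentiable_comp _ _ _ _ (fun w : V => a *: w + b) g).
split=> // i; set h : V := delta_mx 0 i.
have dc0 : differentiable (fun w => g (a *: w + b)) (z + (0 : R) *: h).
  by rewrite scale0r addr0.
have dg0 : differentiable g ((a *: z + b) + (0 : R) *: (a *: h)).
  by rewrite scale0r addr0.
have [_ e1] := is_derive_line dc0; rewrite scale0r addr0 in e1.
have [_ e2] := is_derive_line dg0.
rewrite /rpartial -/h.
transitivity ('D_(a *: h) g (a *: z + b)); last first.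
  by rewrite !derive_lincomb// linearZ.
rewrite -e1; rewrite scale0r addr0 in e2; rewrite -e2.
rewrite (_ : (fun u : R => _) = (fun u : R => g (a *: z + b + u *: (a *: h))))//.
apply/funext => u; congr (g _); rewrite scalerDr !scalerA addrAC.
by rewrite [a * u]mulrC.
Qed.

Lemma rpartials_affine g s (a : R) (b : V) z : rsmooth setT g ->
  rpartials s (fun w => g (a *: w + b)) z = a ^+ size s * rpartials s g (a *: z + b).
Proof.
move=> sg; elim: s z => [|i s ih] z /=; first by rewrite expr0 mul1r.
rewrite exprSr -mulrA.
have [d1 <-] := @diff_affine a b (rpartials s g) z (sg s _ I).
rewrite -rpartialZ//; congr ('D_ _ _ _); apply/funext => w; exact: ih.
Qed.

Lemma rsmooth_affine g (a : R) (b : V) : rsmooth setT g ->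
  rsmooth setT (fun w => g (a *: w + b)).
Proof.
move=> sg s z _.
rewrite (_ : rpartials s _ = fun w => a ^+ size s * rpartials s g (a *: w + b)).
  apply: differentiableM => //.
  exact: (@diff_affine a b (rpartials s g) z (sg s _ I)).1.
by apply/funext => w; rewrite rpartials_affine.
Qed.

Lemma cvg_norm_le (u : nat -> R) l C : u @ \oo --> l ->
  (forall m, `|u m| <= C) -> `|l| <= C.
Proof.
move=> ul uC; rewrite leNgt; apply/negP => Cl.
have e0 : 0 < `|l| - C by rewrite subr_gt0.
have /cvgrPdist_lt/(_ _ e0)[N _ /(_ N (leqnn N))] := ul.
rewrite ltNge => /negP; apply; rewrite lerBlDr (le_trans _ (lerD (lexx _) (uC N)))//.
by rewrite -{1}[l](subrK (u N)) ler_normD.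
Qed.

Section limits.

Let bounded_cvg (F : nat -> V -> R) g :=
  [/\ forall m, rsmooth setT (F m),
      forall s, exists C, forall m z, `|rpartials s (F m) z| <= C
    & forall z, F^~ z @ \oo --> g z].

(* The second-order Taylor bound is uniform in the index, so difference
   quotients show that the gradients converge, to the gradient of the limit. *)
Let bounded_cvg_diff F g : bounded_cvg F g ->
  (forall z, differentiable g z) /\
  (forall i, bounded_cvg (fun m => rpartial i (F m)) (rpartial i g)).
Proof.
move=> [sF bF cF].
have [C C0 HC] : exists2 C, 0 < C & forall m i j z, `|rpartials [:: j; i] (F m) z| <= C.
  have /choice[Cf HCf] : forall ij : 'I_n * 'I_n, exists C, forall m z,
      `|rpartials [:: ij.2; ij.1] (F m) z| <= C by move=> ij; exact: bF.
  exists (1 + \sum_ij `|Cf ij|); first by rewrite ltr_pwDl// sumr_ge0.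
  move=> m i j z; rewrite (le_trans (HCf (i, j) m z))// (bigD1 (i, j))//=.
  rewrite addrCA (le_trans (ler_norm _))// lerDl addr_ge0//.
  by rewrite sumr_ge0.
have T m z h : `|F m (z + h) - F m z - lincomb (fun i => rpartial i (F m) z) h|
    <= n%:R ^+ 2 * C * `|h| ^+ 2.
  apply: taylor2.
  - by move=> t _; exact: (sF m [::]).
  - by move=> i t _; exact: (sF m [:: i]).
  - by move=> i j t _; exact: (HC m i j).
set K := n%:R ^+ 2 * C in T.
have K0 : 0 <= K by rewrite mulr_ge0// ltW.
have De a i (t : R) : lincomb a (t *: delta_mx 0 i) = t * a i.
  rewrite linearZ/= /lincomb (bigD1 i)//= big1 ?addr0.
    by rewrite mxE !eqxx mul1r.
  by move=> j ji; rewrite mxE eqxx/= (negbTE ji) mul0r.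
have nd (i : 'I_n) : `|delta_mx 0 i : V| <= 1.
  rewrite [leLHS]/Num.norm/= mx_normrE; apply: bigmax_le => // -[a b] _ /=.
  by rewrite mxE; case: (_ && _); rewrite ?normr0 ?normr1.
have cvgp i z : cvg ((fun m => rpartial i (F m) z) @ \oo).
  apply/cauchy_cvgP/cauchy_exP => e e0.
  have K1 : 0 < K + 1 by rewrite ltr_pwDr.
  have e2 : 0 < e / 2 by rewrite divr_gt0.
  have [t t0 P2] : exists2 t, 0 < t & K * t <= e / 2.
    exists (e / 2 / (K + 1)); first by rewrite !divr_gt0.
    by rewrite mulrA ler_pdivrMr// mulrC ler_wpM2l ?(ltW e2)// lerDl.
  pose D := (g (z + t *: delta_mx 0 i) - g z) / t.
  exists D.
  have cD : (fun m => (F m (z + t *: delta_mx 0 i) - F m z) / t) @ \oo --> D.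
    by apply: cvgMr_tmp; apply: cvgB; exact: cF.
  move/cvgrPdist_lt : cD => /(_ _ e2); apply: filterS => m Hm.
  rewrite /ball/=; move: (T m z (t *: delta_mx 0 i)).
  rewrite De => HT.
  have {}HT : `|(F m (z + t *: delta_mx 0 i) - F m z) / t - rpartial i (F m) z| <= e / 2.
    rewrite -(ler_pM2l t0) -{1}(gtr0_norm t0) -normrM mulrBr mulrC divfK ?gt_eqF//.
    apply: (le_trans HT); rewrite normrZ (gtr0_norm t0).
    have P1 : (t * `|delta_mx 0 i : V|) ^+ 2 <= t ^+ 2.
      have n0 : 0 <= t * `|delta_mx 0 i : V| by rewrite mulr_ge0// ltW.
      have n1 : t * `|delta_mx 0 i : V| <= t by rewrite ler_piMr// ltW.
      by rewrite lerXn2r ?nnegrE// ltW.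
    rewrite (le_trans (ler_wpM2l K0 P1))// expr2 mulrA [leLHS]mulrC.
    by rewrite ler_wpM2l ?(ltW t0).
  change (`|D - rpartial i (F m) z| < e); rewrite [e]splitr.
  apply: (le_lt_trans (ler_distD ((F m (z + t *: delta_mx 0 i) - F m z) / t) _ _)).
  by rewrite ltr_leD.
have Q z h : `|g (z + h) - g z - lincomb (fun i => lim ((fun m => rpartial i (F m) z) @ \oo)) h|
    <= K * `|h| ^+ 2.
  apply: (@cvg_norm_le (fun m => F m (z + h) - F m z -
    lincomb (fun i => rpartial i (F m) z) h)) => //.
  apply: cvgB; first by apply: cvgB; exact: cF.
  apply: cvg_big => [|i _]; last by apply: cvgMl_tmp; exact: cvgp.
  exact: add_continuous.
have dgz z := @diff_quad g z _ 1 K ltr01 (fun h _ => Q z h).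
split; first by move=> z; exact: (dgz z).1.
move=> i; split.
- by move=> m; exact: rsmooth_rpartial.
- by move=> s; have [C' HC'] := bF (rcons s i); exists C' => m z; rewrite -rpartials_rcons.
- by move=> z; rewrite (dgz z).2; exact: cvgp.
Qed.

Lemma smooth_limit (F : nat -> V -> R) g :
  (forall m, rsmooth setT (F m)) ->
  (forall s, exists C, forall m z, `|rpartials s (F m) z| <= C) ->
  (forall z, F^~ z @ \oo --> g z) ->
  rsmooth setT g /\ forall s z, (fun m => rpartials s (F m) z) @ \oo --> rpartials s g z.
Proof.
move=> sF bF cF.
have H s : bounded_cvg (fun m => rpartials s (F m)) (rpartials s g).
  by elim: s => [//|i s ih]; exact: (bounded_cvg_diff ih).2.
split=> [s z _|s z]; first exact: (bounded_cvg_diff (H s)).1.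
by have [_ _] := H s.
Qed.
End limits.

(** The integral of a quadratic Taylor remainder is a quadratic remainder, so [diff_quad] applies to
    the integral and no passage to the limit under the integral sign occurs. *)
Lemma diff_under_Int d (T : measurableType d) (mu : {measure set T -> \bar R})
    (k : T -> V -> R) (p : T -> 'I_n -> R) (H : T -> R) z (del : R) : 0 < del ->
  (forall h, `|h| < del -> L1 mu (k^~ (z + h))) ->
  (forall i, L1 mu (p^~ i)) -> L1 mu H ->
  (forall w h, `|h| < del ->
    `|k w (z + h) - k w z - lincomb (p w) h| <= `|h| ^+ 2 * H w) ->
  differentiable (fun z => Int mu (k^~ z)) z /\
  forall i, rpartial i (fun z => Int mu (k^~ z)) z = Int mu (p^~ i).
Proof.
move=> d0 hk hp hH kH; apply: (@diff_quad _ z _ del (Int mu H) d0) => h hd.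
have hz : L1 mu (k^~ z) by rewrite -[z]addr0; apply: hk; rewrite normr0.
have hl : L1 mu (fun w => lincomb (p w) h).
  by apply: L1_sum => i _; exact: L1Z.
have -> : lincomb (fun i => Int mu (p^~ i)) h = Int mu (fun w => lincomb (p w) h).
  rewrite /lincomb Int_sum; last by move=> i _; exact: L1Z.
  by apply: eq_bigr => i _; rewrite IntZ.
rewrite -IntB//; last exact: hk.
rewrite -IntB//; last by apply: L1B => //; exact: hk.
rewrite mulrC -IntZ//; apply: norm_Int_le.
- by do 2 apply: L1B => //; exact: hk.
- exact: L1Z.
- by move=> w; exact: kH.
Qed.

Lemma partialsE s (g : V -> R[i]) : partials s g = fun z =>
  Complex (rpartials s (fun w => complex.Re (g w)) z)
          (rpartials s (fun w => complex.Im (g w)) z).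
Proof.
elim: s => [|i s ih]; first by apply/funext => z /=; case: (g z).
by apply/funext => z; rewrite /= ih.
Qed.

Lemma smooth_onE U (g : V -> R[i]) : smooth_on U g <->
  rsmooth U (fun w => complex.Re (g w)) /\ rsmooth U (fun w => complex.Im (g w)).
Proof.
split=> [sg|[s1 s2] s z Uz].
  by split=> s z Uz; have [] := sg s z Uz; rewrite partialsE.
by rewrite partialsE; split; [exact: s1|exact: s2].
Qed.
End multivariate.

(** * Measurability in coordinates *)

Section measurability.
Variable R : realType.
Local Notation RT := (measurableTypeR R).

Definition mR n (f : 'rV[R]_n -> R) :=
  measurable_fun [set: n.-tuple RT] (fun t => f (rV_of_tuple t)).

(** Measurability of vector-valued maps is expressed coordinate by coordinate; [mR_comp] recovers
    measurability of compositions by rebuilding the tuple of coordinates. *)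
Definition mcoord d (T : measurableType d) n (g : T -> 'rV[R]_n) :=
  forall i, measurable_fun [set: T] (fun t => g t 0 i : RT).

Lemma rV_of_tupleE n (t : n.-tuple R) i : rV_of_tuple t 0 i = tnth t i.
Proof. by rewrite mxE. Qed.

Lemma mcoord_tuple n : mcoord (@rV_of_tuple R n : n.-tuple RT -> _).
Proof.
move=> i; rewrite (_ : (fun _ => _) = fun t : n.-tuple RT => tnth t i).
  exact: measurable_tnth.
by apply/funext => t; rewrite rV_of_tupleE.
Qed.

Lemma mR_comp d (T : measurableType d) n (g : T -> 'rV[R]_n) f :
  mcoord g -> mR f -> measurable_fun setT (fun t => f (g t)).
Proof.
move=> mg mf.
rewrite (_ : (fun t => f (g t)) = (fun t : n.-tuple RT => f (rV_of_tuple t)) \o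
    (fun t => [tuple g t 0 i | i < n])); last first.
  apply/funext => t /=; congr f; apply/rowP => i.
  by rewrite mxE tnth_mktuple.
apply: measurableT_comp; first exact: mf.
apply/measurable_fun_tnthP => i.
rewrite (_ : _ \o _ = fun t => g t 0 i); first exact: mg.
by apply/funext => t /=; rewrite tnth_mktuple.
Qed.

(* A continuous function is the limit of its values at the grid points of
   mesh 1/k below the argument, and these take countably many values. *)
Lemma measurable_cont d (T : measurableType d) n (g : T -> 'rV[R]_n)
  (f : 'rV[R]_n -> R) : mcoord g -> continuous f -> measurable_fun setT (fun t => f (g t)).
Proof.
move=> mg cf.
pose q k (t : T) : 'rV[int]_n := \row_i Num.floor (k.+1%:R * g t 0 i).
pose a k (c : 'rV[int]_n) : 'rV[R]_n := \row_i ((c 0 i)%:~R / k.+1%:R).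
have mq k c : measurable (q k @^-1` [set c]).
  have -> : q k @^-1` [set c] = \bigcap_(i in [set: 'I_n])
      ((fun t => k.+1%:R * g t 0 i : RT) @^-1` `[(c 0 i)%:~R, (c 0 i + 1)%:~R[%classic).
    apply/seteqP; split=> t /=.
      move=> <- i _ /=; rewrite in_itv/= mxE; exact: floor_itv.
    move=> H; apply/rowP => i; rewrite mxE; have := H i I.
    by rewrite /= in_itv/= => /floor_def.
  apply: fin_bigcap_measurable => // i _.
  rewrite -[X in measurable X]setTI.
  by apply: (measurable_funM (measurable_cst _) (mg i)) => //; exact: measurable_itv.
apply: (@measurable_fun_cvg _ _ _ setT (fun k t => f (a k (q k t)))) => [k|t _].
  move=> _ Y mY; rewrite setTI.
  have -> : (fun t => f (a k (q k t))) @^-1` Y =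
      \bigcup_(c in [set c | Y (f (a k c))]) (q k @^-1` [set c]).
    apply/seteqP; split=> t /=; first by move=> Yt; exists (q k t).
    by move=> [c /= Yc qc]; rewrite qc.
  by rewrite bigcup_mkcond; apply: countable_bigcupT_measurable => // c; case: ifP.
apply: continuous_cvg; first exact: cf.
apply/cvgrPdist_lt => e e0; near=> k.
have k0 : 0 < k.+1%:R :> R by rewrite ltr0n.
rewrite [ltLHS]/Num.norm/= mx_normrE; apply: bigmax_lt => // -[i0 i] _ /=.
rewrite ord1 !mxE.
have /andP[h1 h2] := floor_itv (k.+1%:R * g t 0 i).
have -> : g t 0 i - (Num.floor (k.+1%:R * g t 0 i))%:~R / k.+1%:R =
   (k.+1%:R * g t 0 i - (Num.floor (k.+1%:R * g t 0 i))%:~R) / k.+1%:R.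
  by field; rewrite gt_eqF.
rewrite ger0_norm; last by rewrite divr_ge0// subr_ge0.
rewrite ltr_pdivrMr// (@lt_le_trans _ _ 1)//.
  by rewrite ltrBlDl; move: h2; rewrite intrD.
rewrite mulrC -ler_pdivrMr// div1r.
apply: ltW; rewrite -[ltRHS]natr1 (@lt_le_trans _ _ k%:R) ?lerDl//.
by near: k; exact: nbhs_infty_gtr.
Unshelve. all: by end_near. Qed.

Lemma mR_cont n (f : 'rV[R]_n -> R) : continuous f -> mR f.
Proof. exact: measurable_cont (@mcoord_tuple n). Qed.

Lemma mR_coord n i : mR (fun x : 'rV[R]_n => x 0 i).
Proof. exact: mcoord_tuple. Qed.

Lemma mcoordD d (T : measurableType d) n (g k : T -> 'rV[R]_n) :
  mcoord g -> mcoord k -> mcoord (fun t => g t + k t).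
Proof.
move=> mg mk i; under eq_fun do rewrite mxE.
exact: measurable_funD (mg i) (mk i).
Qed.

Lemma mcoordZ d (T : measurableType d) n (a : T -> R) (g : T -> 'rV[R]_n) :
  measurable_fun setT a -> mcoord g -> mcoord (fun t => a t *: g t).
Proof.
move=> ma mg i; under eq_fun do rewrite mxE.
exact: measurable_funM ma (mg i).
Qed.

Lemma mcoordN d (T : measurableType d) n (g : T -> 'rV[R]_n) :
  mcoord g -> mcoord (fun t => - g t).
Proof.
move=> mg; under eq_fun do rewrite -scaleN1r.
by apply: mcoordZ => //; exact: measurable_cst.
Qed.

Lemma mcoord_cst d (T : measurableType d) n (b : 'rV[R]_n) : mcoord (fun _ : T => b).
Proof. by move=> i; exact: measurable_cst. Qed.

Lemma mcoord_fst n m : mcoord (fun p : n.-tuple RT * m.-tuple RT => rV_of_tuple p.1).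
Proof.
by move=> i; apply: (measurableT_comp (@mcoord_tuple n i)); exact: measurable_fst.
Qed.

Lemma mcoord_snd n m : mcoord (fun p : n.-tuple RT * m.-tuple RT => rV_of_tuple p.2).
Proof.
by move=> i; apply: (measurableT_comp (@mcoord_tuple m i)); exact: measurable_snd.
Qed.
End measurability.

(** * Lebesgue measure under dilations and translations *)

Section lebesgue_affine.
Variable R : realType.
Local Notation RT := (measurableTypeR R).
Local Notation leb := (@lebesgue_measure R).

Lemma measurable_affine1 (a b : R) : measurable_fun [set: RT] (fun x : RT => a * x + b : RT).
Proof. by apply: measurable_funD => //; apply: measurable_funM. Qed.

(** The image of Lebesgue measure under x -> a x + b, multiplied by |a|, gives half-open intervals
    their length; uniqueness of Lebesgue measure does the rest. *)
Lemma ge0_integral_affine1 (a b : R) (G : RT -> \bar R) : a != 0 ->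
  measurable_fun setT G -> (forall x, 0 <= G x)%E ->
  (\int[leb]_x G (a * x + b)%R = (`|a|^-1)%:E * \int[leb]_x G x)%E.
Proof.
move=> a0 mG G0.
have mphi := measurable_affine1 a b.
have an0 : 0 < `|a| by rewrite normr_gt0.
pose nu := (mscale (NngNum (normr_ge0 a)) (pushforward leb (fun x : RT => a * x + b : RT))
  : {measure set RT -> \bar R}).
have E : forall A, measurable A -> leb A = nu mphi A.
  apply: lebesgue_measure_unique => X [[c e] _ <-].
  pose phi (x : RT) : RT := a * x + b.
  rewrite /=; have -> : nu mphi `]c, e]%classic = (`|a|%:E * leb (phi @^-1` `]c, e]%classic))%E by [].
  have [ap|an] := ltP 0 a.
    have -> : phi @^-1` `]c, e]%classic =
        `](c - b) / a, (e - b) / a]%classic.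
      apply/seteqP; split=> x /=; rewrite /phi !in_itv/= ltr_pdivrMr// ler_pdivlMr//;
      move=> /andP[h1 h2]; apply/andP; split; lra.
    rewrite !lebesgue_measure_itv/= !lte_fin ltr_pM2r ?invr_gt0// ltrD2r.
    case: ifPn => _; last by rewrite mule0.
    rewrite -!EFinB -EFinM (gtr0_norm ap); congr EFin; field; lra.
  (* For negative [a] the preimage is half-open on the other side, which does not change its
     length. *)
  have {}an : a < 0 by rewrite lt_neqAle a0.
  have -> : phi @^-1` `]c, e]%classic =
      `[(e - b) / a, (c - b) / a[%classic.
    apply/seteqP; split=> x /=; rewrite /phi !in_itv/= ltr_ndivlMr// ler_ndivrMr//;
    move=> /andP[h1 h2]; apply/andP; split; lra.
  rewrite !lebesgue_measure_itv/= !lte_fin ltr_nM2r ?invr_lt0// ltrD2r.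
  case: ifPn => _; last by rewrite mule0.
  rewrite -!EFinB -EFinM (ltr0_norm an); congr EFin; field; lra.
have -> : (\int[leb]_x G x = `|a|%:E * \int[leb]_x G (a * x + b)%R)%E.
  rewrite (eq_measure_integral (nu mphi)); last by move=> A mA _; exact: E.
  rewrite ge0_integral_mscale//; congr (_ * _)%E.
  by rewrite ge0_integral_pushforward.
rewrite muleA -EFinM mulVf ?mul1e//; exact: lt0r_neq0.
Qed.

Lemma measurable_uncons n : measurable_fun [set: RT * n.-tuple RT] (@tuple_cons R n).
Proof. exact: measurable_tuple_cons. Qed.

Lemma ge0_integral_leb_step n (G : n.+1.-tuple RT -> \bar R) :
  measurable_fun setT G -> (forall x, 0 <= G x)%E ->
  (\int[leb_tuple R n.+1]_t G t =
   \int[leb]_x \int[leb_tuple R n]_t G (tuple_cons (x, t)))%E.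
Proof.
move=> mG G0 /=.
rewrite -[LHS]/(\int[pushforward (leb \x leb_tuple R n)%E (@tuple_cons R n)]_t G t)%E.
rewrite ge0_integral_pushforward//; last exact: measurable_uncons.
have mG' : measurable_fun setT (G \o @tuple_cons R n).
  by apply: measurableT_comp => //; exact: measurable_uncons.
have G0' p : (0 <= (G \o @tuple_cons R n) p)%E by exact: G0.
by rewrite preimage_setT (fubini_tonelli1 _ mG' G0').
Qed.

Definition tuple_affine n (a : R) (b : 'rV[R]_n) (t : n.-tuple RT) : n.-tuple RT :=
  [tuple a * tnth t i + b 0 i | i < n].

Lemma measurable_tuple_affine n a b : measurable_fun setT (@tuple_affine n a b).
Proof.
apply/measurable_fun_tnthP => i.
rewrite (_ : _ \o _ = (fun x : RT => a * x + b 0 i : RT) \o (@tnth n RT ^~ i)).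
  by apply: measurableT_comp; [exact: measurable_affine1|exact: measurable_tnth].
by apply/funext => t /=; rewrite tnth_mktuple.
Qed.

Lemma tnth_cons_lift n (x : RT) (t : n.-tuple RT) j :
  tnth (tuple_cons (x, t)) (lift ord0 j) = tnth t j.
Proof. by rewrite !(tnth_nth x). Qed.

Lemma tuple_affine_cons n a (b : 'rV[R]_n.+1) x (t : n.-tuple RT) :
  tuple_affine a b (tuple_cons (x, t)) =
  tuple_cons (a * x + b 0 0, tuple_affine a (\row_i b 0 (lift ord0 i)) t).
Proof.
apply: eq_from_tnth => i; rewrite tnth_mktuple.
case: (unliftP ord0 i) => [j|] ->; last by [].
by rewrite !tnth_cons_lift tnth_mktuple mxE.
Qed.

(** Induction on the dimension: Tonelli separates the first coordinate, and each coordinate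
    contributes one factor 1/|a|. *)
Lemma ge0_integral_tuple_affine n (a : R) (b : 'rV[R]_n) (G : n.-tuple RT -> \bar R) :
  a != 0 -> measurable_fun setT G -> (forall x, 0 <= G x)%E ->
  (\int[leb_tuple R n]_t G (tuple_affine a b t) =
   (`|a| ^- n)%:E * \int[leb_tuple R n]_t G t)%E.
Proof.
move=> a0; elim: n b G => [|n ih] b G mG G0.
  rewrite expr0 invr1 mul1e; apply: eq_integral => t _; congr G.
  by rewrite (tuple0 t) (tuple0 (tuple_affine _ _ _)).
have mGc x : measurable_fun setT (fun t => G (tuple_cons (x, t))).
  apply: measurableT_comp => //.
  by apply: measurableT_comp; [exact: measurable_uncons|exact: pair1_measurable].
rewrite ge0_integral_leb_step//; last first.
  by apply: measurableT_comp => //; exact: measurable_tuple_affine.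
under eq_integral do under eq_integral do rewrite tuple_affine_cons.
under eq_integral do rewrite (ih _ (fun t => G (tuple_cons (_, t))))//.
pose H x := (\int[leb_tuple R n]_t G (tuple_cons (x, t)))%E.
have mH : measurable_fun setT H.
  rewrite (_ : H = fubini_F (leb_tuple R n) (G \o @tuple_cons R n))//.
  apply: (measurable_fun_fubini_tonelli_F (G \o @tuple_cons R n)).
    by apply: measurableT_comp => //; exact: measurable_uncons.
  by move=> p; exact: G0.
have H0 x : (0 <= H x)%E by exact: integral_ge0.
transitivity (\int[leb]_x ((`|a| ^- n)%:E * H (a * x + b 0 0)%R))%E; first by [].
rewrite ge0_integralZl//; last first.
  by apply: measurableT_comp => //; exact: measurable_affine1.
rewrite (@ge0_integral_affine1 a (b 0 0) H)// ge0_integral_leb_step// muleA -EFinM.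
by rewrite -invfM -exprSr.
Qed.

Section euclidean_integral.
Variable n : nat.
Local Notation V := 'rV[R]_n.
Implicit Types f g : V -> R.

Definition LR f := L1 (leb_tuple R n) (fun t => f (rV_of_tuple t)).
Definition IR f := Int (leb_tuple R n) (fun t => f (rV_of_tuple t)).

Lemma LR_mR f : LR f -> mR f. Proof. exact: L1_meas. Qed.

Lemma LR_le g f : mR f -> (forall x, `|f x| <= g x) -> LR g -> LR f.
Proof. by move=> mf fg; apply: L1_le mf _ => t; exact: fg. Qed.

Lemma LRD f g : LR f -> LR g -> LR (fun x => f x + g x). Proof. exact: L1D. Qed.
Lemma LRB f g : LR f -> LR g -> LR (fun x => f x - g x). Proof. exact: L1B. Qed.
Lemma LRN f : LR f -> LR (fun x => - f x). Proof. exact: L1N. Qed.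
Lemma LRZ r f : LR f -> LR (fun x => r * f x). Proof. exact: L1Z. Qed.
Lemma LR_norm f : LR f -> LR (fun x => `|f x|). Proof. exact: L1_norm. Qed.
Lemma LR0 : LR (fun=> 0). Proof. exact: L1_0. Qed.
Lemma IRD f g : LR f -> LR g -> IR (fun x => f x + g x) = IR f + IR g.
Proof. exact: IntD. Qed.
Lemma IRB f g : LR f -> LR g -> IR (fun x => f x - g x) = IR f - IR g.
Proof. exact: IntB. Qed.
Lemma IRN f : LR f -> IR (fun x => - f x) = - IR f. Proof. exact: IntN. Qed.
Lemma IRZ r f : LR f -> IR (fun x => r * f x) = r * IR f. Proof. exact: IntZ. Qed.
Lemma IR0 : IR (fun=> 0) = 0. Proof. exact: Int0. Qed.

Lemma le_IR f g : LR f -> LR g -> (forall x, f x <= g x) -> IR f <= IR g.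
Proof. by move=> hf hg fg; apply: le_Int => // t; exact: fg. Qed.

Lemma IR_ge0 f : (forall x, 0 <= f x) -> 0 <= IR f.
Proof. by move=> f0; apply: Int_ge0 => t; exact: f0. Qed.

Lemma norm_IR_le f g : LR f -> LR g -> (forall x, `|f x| <= g x) -> `|IR f| <= IR g.
Proof. by move=> hf hg fg; apply: norm_Int_le => // t; exact: fg. Qed.

Lemma IR_lim (f_ : nat -> V -> R) f g :
  (forall k, mR (f_ k)) -> (forall x, (fun k => f_ k x) @ \oo --> f x) ->
  (forall k x, `|f_ k x| <= g x) -> LR g ->
  LR f /\ (fun k => IR (f_ k)) @ \oo --> IR f.
Proof.
move=> mf cf fg hg.
exact: (@Int_lim _ _ _ (leb_tuple R n) (fun k t => f_ k (rV_of_tuple t))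
  (fun t => f (rV_of_tuple t)) (fun t => g (rV_of_tuple t)) mf (fun t => cf _) (fun k t => fg k _) hg).
Qed.

Lemma rV_of_tuple_affine a (b : V) t :
  rV_of_tuple (tuple_affine a b t) = a *: rV_of_tuple t + b.
Proof. by apply/rowP => i; rewrite !mxE tnth_mktuple. Qed.

Lemma LR_IR_affine a (b : V) f : a != 0 -> LR f ->
  LR (fun x => f (a *: x + b)) /\ IR (fun x => f (a *: x + b)) = `|a| ^- n * IR f.
Proof.
move=> a0.
(* Nonnegative functions first, where the extended integral is always defined; a general [f] is half
   the difference of |f| + f and |f| - f. *)
have pos g : (forall x, 0 <= g x) -> LR g ->
    LR (fun x => g (a *: x + b)) /\ IR (fun x => g (a *: x + b)) = `|a| ^- n * IR g.
  move=> g0 hg.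
  pose G t := (g (rV_of_tuple t))%:E.
  have mG : measurable_fun setT G by apply/measurable_EFinP; exact: L1_meas hg.
  have E : (\int[leb_tuple R n]_t (g (a *: rV_of_tuple t + b))%:E =
      (`|a| ^- n * IR g)%:E)%E.
    rewrite EFinM /IR -Int_EFin// -(@ge0_integral_tuple_affine _ a b G) //.
      by apply: eq_integral => t _; rewrite /G rV_of_tuple_affine.
    by move=> t; rewrite lee_fin.
  have mg : measurable_fun setT (fun t => g (a *: rV_of_tuple t + b)).
    apply: mR_comp; last exact: LR_mR hg.
    apply: mcoordD; last exact: mcoord_cst.
    by apply: mcoordZ; [exact: measurable_cst|exact: mcoord_tuple].
  have [h1 _] : L1 (leb_tuple R n) (fun t => g (a *: rV_of_tuple t + b)) /\
      Int (leb_tuple R n) (fun t => g (a *: rV_of_tuple t + b)) <= `|a| ^- n * IR g.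
    by apply: L1_ge0P => //; rewrite E.
  by split=> //; apply: EFin_inj; rewrite -E Int_EFin.
move=> hf.
have hp : LR (fun x => `|f x| + f x) by apply: LRD => //; exact: LR_norm.
have hn : LR (fun x => `|f x| - f x) by apply: LRB => //; exact: LR_norm.
have p0 x : 0 <= `|f x| + f x by have := ler_norm (- f x); rewrite normrN; lra.
have n0 x : 0 <= `|f x| - f x by rewrite subr_ge0 ler_norm.
have [h1 e1] := pos _ p0 hp; have [h2 e2] := pos _ n0 hn.
have fE (y : V -> V) : (fun x => f (y x)) =
    (fun x => 2^-1 * ((`|f (y x)| + f (y x)) - (`|f (y x)| - f (y x)))).
  by apply/funext => x; lra.
have hd : LR (fun x => `|f (a *: x + b)| + f (a *: x + b) - (`|f (a *: x + b)| - f (a *: x + b))).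
  exact: LRB.
rewrite (fE (fun x => a *: x + b)); split; first exact: LRZ.
rewrite IRZ// IRB// e1 e2 -mulrBr -IRB//.
rewrite mulrCA -IRZ; last exact: LRB.
by rewrite -(fE id).
Qed.

Lemma LR_affine a (b : V) f : a != 0 -> LR f -> LR (fun x => f (a *: x + b)).
Proof. by move=> a0 /(LR_IR_affine b a0)[]. Qed.

Lemma IR_affine a (b : V) f : a != 0 -> LR f ->
  IR (fun x => f (a *: x + b)) = `|a| ^- n * IR f.
Proof. by move=> a0 /(LR_IR_affine b a0)[]. Qed.

Lemma LR_shift (b : V) f : LR f -> LR (fun x => f (x + b)).
Proof.
move=> /(@LR_affine 1 b _ (oner_neq0 _)).
by rewrite (_ : (fun x => f (1 *: x + b)) = fun x => f (x + b))//; apply/funext => x; rewrite scale1r.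
Qed.

Lemma IR_shift (b : V) f : LR f -> IR (fun x => f (x + b)) = IR f.
Proof.
move=> /(@IR_affine 1 b _ (oner_neq0 _)); rewrite normr1 expr1n invr1 mul1r => <-.
by congr IR; apply/funext => x; rewrite scale1r.
Qed.

Lemma LR_scale a f : a != 0 -> LR f -> LR (fun x => f (a *: x)).
Proof.
move=> a0 /(@LR_affine a 0 _ a0).
by rewrite (_ : (fun x => f (a *: x + 0)) = fun x => f (a *: x))//; apply/funext => x; rewrite addr0.
Qed.

Lemma IR_scale a f : a != 0 -> LR f -> IR (fun x => f (a *: x)) = `|a| ^- n * IR f.
Proof.
move=> a0 /(@IR_affine a 0 _ a0) <-.
by congr IR; apply/funext => x; rewrite addr0.
Qed.

Lemma LR_opp f : LR f -> LR (fun x => f (- x)).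
Proof.
move=> /(@LR_scale (-1)); rewrite oppr_eq0 oner_eq0 => /(_ isT).
by rewrite (_ : (fun x => f (-1 *: x)) = fun x => f (- x))//; apply/funext => x; rewrite scaleN1r.
Qed.

Lemma IR_opp f : LR f -> IR (fun x => f (- x)) = IR f.
Proof.
move=> /(@IR_scale (-1)); rewrite oppr_eq0 oner_eq0 => /(_ isT).
rewrite normrN1 expr1n invr1 mul1r => <-.
by congr IR; apply/funext => x; rewrite scaleN1r.
Qed.
End euclidean_integral.

Lemma IR_fubini n m (F : 'rV[R]_n -> 'rV[R]_m -> R) (G : 'rV[R]_m -> R) :
  measurable_fun [set: n.-tuple RT * m.-tuple RT]
    (fun p => F (rV_of_tuple p.1) (rV_of_tuple p.2)) ->
  (forall x, LR (F x)) -> (forall z, LR (F^~ z)) ->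
  (forall z, IR (fun x => `|F x z|) <= G z) -> LR G ->
  [/\ LR (fun x => IR (F x)), LR (fun z => IR (F^~ z)) &
      IR (fun x => IR (F x)) = IR (fun z => IR (F^~ z))].
Proof.
move=> mF h1 h2 FG hG.
have hF := @L1_tonelli2 _ _ _ _ _ (leb_tuple R n) (leb_tuple R m) _
  (fun t => G (rV_of_tuple t)) mF (fun t => h2 (rV_of_tuple t)) (fun t => FG (rV_of_tuple t)) hG.
have [l1 e1] := Int_prod12 hF (fun t => h1 (rV_of_tuple t)).
have [l2 e2] := Int_prod21 hF (fun t => h2 (rV_of_tuple t)).
by split=> //; rewrite /IR -e1 -e2.
Qed.

Definition consr n (x : R) (v : 'rV[R]_n) : 'rV[R]_n.+1 :=
  \row_i (if unlift ord0 i is Some j then v 0 j else x).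

Lemma consr0 n x (v : 'rV[R]_n) : consr x v 0 0 = x.
Proof. by rewrite mxE unlift_none. Qed.

Lemma consrS n x (v : 'rV[R]_n) j : consr x v 0 (lift ord0 j) = v 0 j.
Proof. by rewrite mxE liftK. Qed.

Lemma rV_of_tuple_cons n (p : RT * n.-tuple RT) :
  rV_of_tuple (tuple_cons p) = consr p.1 (rV_of_tuple p.2).
Proof.
case: p => x t; apply/rowP => i; rewrite mxE; case: (unliftP ord0 i) => [j|] ->.
  by rewrite tnth_cons_lift consrS mxE.
by rewrite consr0.
Qed.

Lemma L1_leb_step n (F : n.+1.-tuple RT -> R) :
  L1 (leb \x leb_tuple R n)%E (fun p => F (tuple_cons p)) -> measurable_fun setT F ->
  L1 (leb_tuple R n.+1) F /\
  Int (leb_tuple R n.+1) F = Int (leb \x leb_tuple R n)%E (fun p => F (tuple_cons p)).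
Proof.
move=> hF mF.
have mu := @measurable_uncons n.
have iF : (leb \x leb_tuple R n)%E.-integrable (@tuple_cons R n @^-1` setT)
    ((EFin \o F) \o @tuple_cons R n) by rewrite preimage_setT.
have mE : measurable_fun setT (EFin \o F) by exact/measurable_EFinP.
split.
  exact: (@integrable_pushforward _ _ _ _ _ _ mu (leb \x leb_tuple R n)%E _ _ mE iF measurableT).
rewrite /Int /Rintegral; congr fine.
rewrite -[LHS]/(\int[pushforward (leb \x leb_tuple R n)%E (@tuple_cons R n)]_t (F t)%:E)%E.
by rewrite (@integral_pushforward _ _ _ _ _ _ mu (leb \x leb_tuple R n)%E _ _ mE iF measurableT) preimage_setT.
Qed.

Lemma IR_prod n (g : 'I_n -> R -> R) : (forall i, L1 leb (g i)) ->
  LR (fun x : 'rV[R]_n => \prod_i g i (x 0 i)) /\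
  IR (fun x : 'rV[R]_n => \prod_i g i (x 0 i)) = \prod_i Int leb (g i).
Proof.
elim: n g => [|n ih] g hg.
  rewrite big_ord0.
  have h : L1 (leb_tuple R 0) (fun=> 1).
    apply/integrableP; split; first exact: measurable_cst.
    by rewrite /= integral_dirac//= diracT normr1 mul1e ltry.
  have E : (fun x : 'rV[R]_0 => \prod_i g i (x 0 i)) = fun=> 1.
    by apply/funext => x; rewrite big_ord0.
  rewrite E; split=> //.
  by rewrite /IR /Int /Rintegral /= integral_dirac// diracT mul1e.
have [h1 e1] := ih (fun i => g (lift ord0 i)) (fun i => hg _).
have [h2 e2] := Int_prod (hg ord0) h1.
have E : (fun p : RT * n.-tuple RT => \prod_i g i (rV_of_tuple (tuple_cons p) 0 i)) =
    fun p => g ord0 p.1 * \prod_i g (lift ord0 i) (rV_of_tuple p.2 0 i).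
  apply/funext => p; rewrite big_ord_recl rV_of_tuple_cons consr0; congr (_ * _).
  by apply: eq_bigr => i _; rewrite consrS.
have m : mR (fun x : 'rV[R]_n.+1 => \prod_i g i (x 0 i)).
  apply: measurable_prod => i _.
  apply: (@measurableT_comp _ _ _ _ _ _ (g i)); first exact: L1_meas (hg i).
  exact: mcoord_tuple.
have := L1_leb_step _ m; rewrite E => /(_ h2)[h3 e3]; split=> //.
by rewrite /IR e3 e2 big_ord_recl -e1.
Qed.

End lebesgue_affine.

(** * The Euclidean norm *)

Section elementary.
Variable R : realType.

Lemma powR_anti (a b r : R) : 0 < a -> a <= b -> 0 <= r -> b `^ (- r) <= a `^ (- r).
Proof.
move=> a0 ab r0; rewrite !powRN lef_pV2 ?posrE ?powR_gt0//; last exact: lt_le_trans ab.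
by apply: ge0_ler_powR => //; rewrite nnegrE ltW// (lt_le_trans a0).
Qed.

Lemma powR_exprn (a p : R) k : 0 < a -> (a ^+ k) `^ p = (a `^ p) ^+ k.
Proof.
by move=> a0; rewrite -(powR_mulrn k (ltW a0)) -(powR_mulrn k (powR_ge0 a p)) -!powRrM mulrC.
Qed.

Lemma powRD' (a r s : R) : 0 < a -> a `^ (r + s) = a `^ r * a `^ s.
Proof. by move=> a0; apply: powRD; apply/implyP => _; rewrite gt_eqF. Qed.

Lemma geometric_le (r : R) K : 0 <= r -> r < 1 -> \sum_(j < K) r ^+ j <= (1 - r)^-1.
Proof.
move=> r0 r1; have d0 : 0 < 1 - r by rewrite subr_gt0.
rewrite -[leRHS]mul1r ler_pdivlMr// mulrC -[X in X - r](expr1n _ K) mulrC.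
have := subrXX 1 r K; rewrite expr1n => E.
have -> : (\sum_(j < K) r ^+ j) = \sum_(i < K) 1 ^+ (K.-1 - i) * r ^+ i.
  by apply: eq_bigr => i _; rewrite expr1n mul1r.
rewrite mulrC -E; first by rewrite lerBlDr lerDl exprn_ge0.
Qed.

Lemma dyadic (t : R) : 1 <= t -> exists j, 2 ^+ j <= t < 2 ^+ j.+1.
Proof.
move=> t1; have [K tK] : exists K, t < 2 ^+ K.
  exists (Num.trunc t).+1; have /andP[_ h] := trunc_itv (le_trans ler01 t1).
  apply: (lt_le_trans h); rewrite -natrX ler_nat; apply: ltnW; exact: ltn_expl.
have ex : exists K, t < 2 ^+ K by exists K.
case: (ex_minnP ex) => -[|m] hm Hmin.
  by move: hm; rewrite expr0 ltNge t1.
exists m; rewrite hm andbT leNgt; apply/negP => /Hmin.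
by rewrite ltnn.
Qed.

Lemma expR_pow (e : R) k : 0 < e -> exists2 C, 0 < C & forall t, 0 <= t ->
  (1 + t) ^+ k <= C * expR (e * t).
Proof.
move=> e0; have [k0|k0] := posnP k.
  by exists 1 => // t t0; rewrite k0 expr0 mul1r -[leLHS]expR0 ler_expR mulr_ge0// ltW.
have kp : 0 < k%:R :> R by rewrite ltr0n.
(* Chosen so that 1 + t <= a (1 + e t / k) <= a e^(e t / k); the k-th power is the claim. *)
pose a := Num.max 1 (k%:R / e).
have a1 : 1 <= a by rewrite le_max lexx.
have a2 : k%:R / e <= a by rewrite le_max lexx orbT.
have a0 : 0 < a by rewrite (lt_le_trans ltr01).
exists (a ^+ k) => [|t t0]; first by rewrite exprn_gt0.
have h : 1 + t <= a * expR (e * t / k%:R).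
  apply: (@le_trans _ _ (a * (1 + e * t / k%:R))).
    rewrite mulrDr mulr1 lerD// mulrA ler_pdivlMr// mulrC mulrA ler_wpM2r//.
    by move: a2; rewrite ler_pdivrMr.
  by rewrite ler_wpM2l ?(ltW a0)// expR_ge1Dx.
apply: (@le_trans _ _ ((a * expR (e * t / k%:R)) ^+ k)).
  rewrite lerXn2r ?nnegrE//; first by rewrite addr_ge0.
  by rewrite mulr_ge0 ?expR_ge0 ?(ltW a0).
rewrite exprMn -expRM_natr; rewrite divfK// lt0r_neq0//.
Qed.

End elementary.

Section euclidean_norm.
Variables (R : realType) (n : nat).
Local Notation V := 'rV[R]_n.
Implicit Types x y z : V.

Definition sqn x : R := \sum_i x 0 i ^+ 2.

Lemma sqn_ge0 x : 0 <= sqn x.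
Proof. by apply: sumr_ge0 => i _; exact: sqr_ge0. Qed.

Lemma enorm_ge0 x : 0 <= enorm x. Proof. exact: sqrtr_ge0. Qed.

Lemma sqr_enorm x : enorm x ^+ 2 = sqn x.
Proof. by rewrite sqr_sqrtr// sqn_ge0. Qed.

Lemma le_coord_enorm x i : `|x 0 i| <= enorm x.
Proof.
rewrite -(@ler_pXn2r _ 2)// ?nnegrE ?enorm_ge0// sqr_enorm /sqn (bigD1 i)//= real_normK ?num_real//.
by rewrite lerDl sumr_ge0// => j _; exact: sqr_ge0.
Qed.

Lemma norm_le_enorm x : `|x| <= enorm x.
Proof.
rewrite [leLHS]/Num.norm/= mx_normrE; apply: bigmax_le => [|[i0 i] _ /=]; first exact: enorm_ge0.
by rewrite ord1 le_coord_enorm.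
Qed.

Lemma enorm_le_norm x : enorm x <= n%:R * `|x|.
Proof.
have h0 : 0 <= n%:R * `|x| by rewrite mulr_ge0.
rewrite -(@ler_pXn2r _ 2)// ?nnegrE ?enorm_ge0// sqr_enorm.
apply: (@le_trans _ _ (\sum_(i < n) `|x| ^+ 2)).
  apply: ler_sum => i _; rewrite -real_normK ?num_real// lerXn2r ?nnegrE//.
  exact: norm_coord.
rewrite sumr_const card_ord -[leLHS]mulr_natl exprMn ler_wpM2r ?sqr_ge0//.
by rewrite -natrX ler_nat; case: (n) => // m; rewrite leq_pmulr.
Qed.

Lemma enorm0 : enorm (0 : V) = 0.
Proof. by rewrite /enorm big1 ?sqrtr0// => i _; rewrite mxE expr0n. Qed.

Lemma enorm_eq0 x : (enorm x == 0) = (x == 0).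
Proof.
apply/eqP/eqP => [e0|->]; last exact: enorm0.
apply/rowP => i; rewrite mxE; apply/eqP; rewrite -normr_eq0 eq_le normr_ge0 andbT.
by rewrite -e0 le_coord_enorm.
Qed.

Lemma enorm_gt0 x : (0 < enorm x) = (x != 0).
Proof. by rewrite lt_neqAle enorm_ge0 andbT eq_sym enorm_eq0. Qed.

Lemma enormZ a x : enorm (a *: x) = `|a| * enorm x.
Proof.
rewrite /enorm -sqrtr_sqr -sqrtrM ?sqr_ge0// mulr_sumr; congr Num.sqrt.
by apply: eq_bigr => i _; rewrite mxE exprMn.
Qed.

Lemma enormN x : enorm (- x) = enorm x.
Proof. by rewrite -scaleN1r enormZ normrN1 mul1r. Qed.

Lemma enormBC x y : enorm (x - y) = enorm (y - x).
Proof. by rewrite -enormN opprB. Qed.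

Definition dotr x y : R := \sum_i x 0 i * y 0 i.

Lemma dotr_le x y : `|dotr x y| <= enorm x * enorm y.
Proof.
have key (u v : V) : dotr u v <= enorm u * enorm v.
  have [u0|u0] := eqVneq u 0.
    by rewrite u0 enorm0 mul0r /dotr big1// => i _; rewrite mxE mul0r.
  have [v0|v0] := eqVneq v 0.
    by rewrite v0 enorm0 mulr0 /dotr big1// => i _; rewrite mxE mulr0.
  rewrite -enorm_gt0 in u0; rewrite -enorm_gt0 in v0.
  set X := enorm u in u0 *; set Y := enorm v in v0 *.
  (* Young's inequality with the weights Y/X and X/Y, for which the right-hand side sums exactly to
     X Y. *)
  apply: (@le_trans _ _ (\sum_i (Y / X * u 0 i ^+ 2 + X / Y * v 0 i ^+ 2) / 2)).
    apply: ler_sum => i _; rewrite -subr_ge0.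
    have -> : (Y / X * u 0 i ^+ 2 + X / Y * v 0 i ^+ 2) / 2 - u 0 i * v 0 i =
        (Y * u 0 i - X * v 0 i) ^+ 2 / (2 * X * Y).
      by field; rewrite !gt_eqF.
    by rewrite divr_ge0 ?sqr_ge0// !mulr_ge0// ltW.
  rewrite -mulr_suml big_split/= -!mulr_sumr -!/(sqn _) -!sqr_enorm -/X -/Y.
  rewrite le_eqVlt; apply/orP; left; apply/eqP; field; rewrite !gt_eqF//.
rewrite ler_norml key andbT lerNl.
have -> : - dotr x y = dotr (- x) y.
  by rewrite /dotr -sumrN; apply: eq_bigr => i _; rewrite mxE mulNr.
by rewrite (le_trans (key _ _))// enormN.
Qed.

Lemma sqnD x y : sqn (x + y) = sqn x + 2 * dotr x y + sqn y.
Proof.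
rewrite /sqn /dotr mulr_sumr -!big_split/=; apply: eq_bigr => i _.
by rewrite mxE; ring.
Qed.

Lemma enormD x y : enorm (x + y) <= enorm x + enorm y.
Proof.
rewrite -(@ler_pXn2r _ 2)// ?nnegrE ?addr_ge0 ?enorm_ge0// sqr_enorm sqnD sqrrD !sqr_enorm.
rewrite lerD2r lerD2l -[leRHS]mulr_natl ler_wpM2l//.
exact: le_trans (ler_norm _) (dotr_le x y).
Qed.

Lemma enormB x y : enorm (x - y) <= enorm x + enorm y.
Proof. by rewrite (le_trans (enormD _ _))// enormN. Qed.

Lemma enorm_dist x y : `|enorm x - enorm y| <= enorm (x - y).
Proof.
have key (u v : V) : enorm u - enorm v <= enorm (u - v).
  by rewrite lerBlDr -{1}[u](subrK v) enormD.
by rewrite ler_norml key andbT lerNl opprB enormBC key.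
Qed.

Lemma enorm_triangle y x z : enorm (x - z) <= enorm (x - y) + enorm (y - z).
Proof. by rewrite -{1}[x](subrK y) -addrA enormD. Qed.

Lemma lip_continuous (f : V -> R) K : (forall x y, `|f x - f y| <= K * `|x - y|) -> continuous f.
Proof.
move=> fK x; apply/(@cvgrPdist_lt _ _ _ (nbhs x)) => e e0.
have K0 : 0 < `|K| + 1 by rewrite ltr_pwDr.
apply/nbhs_ballP; exists (e / (`|K| + 1)) => /=; first exact: divr_gt0.
move=> t; rewrite mx_norm_ball /ball_/= => xt.
apply: (le_lt_trans (fK _ _)).
rewrite ltr_pdivlMr// in xt; apply: le_lt_trans xt.
by rewrite mulrC ler_wpM2l// (le_trans (ler_norm K))// lerDl.
Qed.

Lemma enorm_continuous : continuous (@enorm R n).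
Proof.
apply: (@lip_continuous _ n%:R) => x y.
exact: le_trans (enorm_dist x y) (enorm_le_norm _).
Qed.

Lemma mR_enorm : mR (@enorm R n). Proof. exact: mR_cont enorm_continuous. Qed.

Lemma mR_fun_enorm (g : R -> R) : measurable_fun setT g -> mR (fun x : V => g (enorm x)).
Proof. by move=> mg; apply: measurableT_comp => //; exact: mR_enorm. Qed.

Lemma mR_powR p : mR (fun x : V => enorm x `^ p).
Proof. by apply: (@mR_fun_enorm (fun t => t `^ p)); exact: measurable_powR. Qed.

(** A product over coordinates, so that [IR_prod] computes the volume. Cubes are the test sets
    throughout: they are balls of the library norm and their volume is explicit. *)
Definition boxi (r : R) x : R := \prod_i (`|x 0 i| < r)%R%:R.

Lemma boxiE r x : boxi r x = [forall i, (`|x 0 i| < r)%R]%:R.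
Proof.
rewrite /boxi; case: forallP => [h|/forallP/forallPn[i hi]].
  by rewrite big1// => i _; rewrite h.
by rewrite (bigD1 i)//= (negbTE hi) mul0r.
Qed.

Lemma boxi_ge0 r x : 0 <= boxi r x.
Proof. by rewrite boxiE; case: [forall i, _]. Qed.

Lemma LR_boxi r : 0 <= r -> LR (boxi r) /\ IR (boxi r) = (2 * r) ^+ n.
Proof.
move=> r0.
have E : (fun t : R => (`|t| < r)%R%:R : R) = \1_(`]- r, r[%classic).
  by apply/funext => t; rewrite indicE mem_setE in_itv/= ltr_norml.
have h : L1 (@lebesgue_measure R) (fun t : R => (`|t| < r)%R%:R).
  by rewrite E; exact: integrable_indic_itv.
have e : Int (@lebesgue_measure R) (fun t : R => (`|t| < r)%R%:R) = 2 * r.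
  rewrite E /Int /Rintegral integral_indic// setIT.
  rewrite -[X in fine X]/(lebesgue_measure (`]- r, r[%classic : set R)) lebesgue_measure_itv/= lte_fin.
  case: ltP => [_|rr]; first by rewrite -EFinB/=; lra.
  have -> : r = 0 by lra.
  by rewrite mulr0.
have [h1 e1] := @IR_prod R n (fun _ t => (`|t| < r)%R%:R) (fun _ => h).
by split=> //; rewrite /boxi e1 e big_const card_ord iter_mulr_1.
Qed.

(** Pointwise [f] is below one of the functions [c j] times the indicator of a cube of half-side
    [b j], hence below a finite partial sum of them; the total mass of these pieces is bounded, and
    [L1_exhaust] concludes. *)
Lemma LR_dyadic (f : V -> R) (c b : nat -> R) C : mR f -> (forall x, 0 <= f x) ->
  (forall j, 0 <= c j) -> (forall j, 0 <= b j) ->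
  (forall x, f x = 0 \/ exists j, f x <= c j /\ enorm x < b j) ->
  (forall K, \sum_(j < K) c j * (2 * b j) ^+ n <= C) -> LR f.
Proof.
move=> mf f0 c0 b0 fc bC.
pose S K x : R := \sum_(j < K) c j * boxi (b j) x.
have hb j : LR (fun x => c j * boxi (b j) x) by apply: LRZ; exact: (LR_boxi (b0 j)).1.
have S0 K x : 0 <= S K x.
  by apply: sumr_ge0 => j _; rewrite mulr_ge0// boxi_ge0.
suff [] : LR f /\ IR f <= C by [].
apply: (@L1_exhaust _ _ _ (leb_tuple R n) (fun K t => S K (rV_of_tuple t))) => //.
- by move=> K; apply: L1_sum => j _; exact: hb.
- move=> K t; rewrite S0/= /S big_ord_recr/= lerDl mulr_ge0//; exact: boxi_ge0.
- move=> K; rewrite Int_sum; last by move=> j _; exact: hb.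
  apply: le_trans (bC K); apply: ler_sum => j _.
  by rewrite IntZ; [rewrite -[Int _ _]/(IR _) (LR_boxi (b0 j)).2|exact: (LR_boxi (b0 j)).1].
- move=> t; have [->|[j [h1 h2]]] := fc (rV_of_tuple t); first by exists 0%N; rewrite /S big_ord0.
  exists j.+1; rewrite /S big_ord_recr/= ler_wpDl//; first exact: S0.
  have -> : boxi (b j) (rV_of_tuple t) = 1.
    rewrite boxiE (_ : [forall i, _] = true)//; apply/forallP => i.
    exact: le_lt_trans (le_coord_enorm _ _) h2.
  by rewrite mulr1.
Qed.

Lemma LR_tail q : n%:R < q -> LR (fun x => (1 + enorm x) `^ (- q)).
Proof.
move=> nq; have q0 : 0 < q by rewrite (le_lt_trans _ nq).
(* The shell 2^j <= 1 + |x| < 2^(j+1) contributes 4^n r^j, a geometric series since n < q. *)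
pose r := 2 `^ (n%:R - q) : R.
have r1 : r < 1.
  rewrite /r -[ltRHS](powRr0 2) /powR !(negbTE (lt0r_neq0 _))// ltr_expR ltr_pM2r ?ln_gt0 ?ltr1n//.
  by rewrite subr_lt0.
apply: (@LR_dyadic _ (fun j => (2 ^+ j) `^ (- q)) (fun j => 2 ^+ j.+1) (4 ^+ n / (1 - r))).
- apply: (@mR_fun_enorm (fun t => (1 + t) `^ (- q))).
  by apply: (measurableT_comp (measurable_powR _)); exact: measurable_funD.
- by move=> x; exact: powR_ge0.
- by move=> j; exact: powR_ge0.
- by move=> j; exact: exprn_ge0.
- move=> x; right; have [|j /andP[j1 j2]] := @dyadic R (1 + enorm x).
    by rewrite lerDl enorm_ge0.
  exists j; split; last by rewrite (le_lt_trans _ j2)// lerDr.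
  by apply: powR_anti; rewrite ?exprn_gt0// ltW.
- move=> K; apply: (@le_trans _ _ (\sum_(j < K) 4 ^+ n * r ^+ j)); last first.
    by rewrite -mulr_sumr ler_wpM2l ?exprn_ge0// geometric_le ?powR_ge0.
  apply: ler_sum => j _; rewrite powR_exprn// /r addrC powRD'// powR_mulrn//.
  have E : (2 * 2 ^+ j.+1) ^+ n = 4 ^+ n * (2 ^+ n) ^+ j :> R.
    by rewrite exprS mulrA -natrM exprMn -!exprM mulnC.
  by rewrite E exprMn le_eqVlt; apply/orP; left; apply/eqP; ring.
Qed.

Lemma LR_pole p : 0 < p < n%:R -> LR (fun x => (enorm x < 1)%R%:R * enorm x `^ (- p)).
Proof.
move=> /andP[p0 pn].
pose r := 2 `^ (p - n%:R) : R.
have r1 : r < 1.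
  rewrite /r -[ltRHS](powRr0 2) /powR !(negbTE (lt0r_neq0 _))// ltr_expR ltr_pM2r ?ln_gt0 ?ltr1n//.
  by rewrite subr_lt0.
(* The radius carries an extra factor 2 because the shell only gives |x| <= 2^-j, while [LR_dyadic]
   asks for a strict inequality. *)
apply: (@LR_dyadic _ (fun j => (2 ^+ j.+1) `^ p) (fun j => 2 * 2 ^- j) (2 `^ p * 4 ^+ n / (1 - r))).
- apply: (@mR_fun_enorm (fun t => (t < 1)%R%:R * t `^ (- p))).
  apply: measurable_funM; last exact: measurable_powR.
  rewrite (_ : (fun t : R => _) = \1_(`]-oo, 1[%classic)).
    by apply: measurable_indic; exact: measurable_itv.
  by apply/funext => t; rewrite indicE mem_setE in_itv/=.
- by move=> x; rewrite mulr_ge0// powR_ge0.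
- by move=> j; exact: powR_ge0.
- by move=> j; rewrite mulr_ge0// invr_ge0 exprn_ge0.
- move=> x; have [x1|x1] := ltP (enorm x) 1; last by left; rewrite mul0r.
  have [x0|x0] := eqVneq (enorm x) 0.
    by left; rewrite x0 powR0 ?mulr0// oppr_eq0 gt_eqF.
  have {}x0 : 0 < enorm x by rewrite lt_neqAle eq_sym x0 enorm_ge0.
  right; have [|j /andP[j1 j2]] := @dyadic R ((enorm x)^-1).
    by rewrite invf_ge1// ltW.
  have k0 : 0 < 2 ^+ j :> R by rewrite exprn_gt0.
  have k1 : 0 < 2 ^+ j.+1 :> R by rewrite exprn_gt0.
  exists j; split.
    rewrite mul1r powRN -div1r ler_pdivrMr ?powR_gt0// -powRM ?(ltW x0) ?(ltW k1)//.
    have h1 : 1 `^ p <= (2 ^+ j.+1 * enorm x) `^ p.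
      apply: ge0_ler_powR; rewrite ?nnegrE ?(ltW p0) ?mulr_ge0 ?(ltW x0) ?(ltW k1)//.
      by rewrite -ler_pdivrMr// div1r ltW.
    by rewrite powR1 in h1.
  apply: (@le_lt_trans _ _ (2 ^- j)).
    by rewrite -[enorm x]invrK lef_pV2 ?posrE ?invr_gt0.
  by rewrite ltr_pMl ?invr_gt0// ltr1n.
- move=> K; apply: (@le_trans _ _ (\sum_(j < K) 2 `^ p * 4 ^+ n * r ^+ j)); last first.
    by rewrite -mulr_sumr ler_wpM2l ?mulr_ge0 ?exprn_ge0 ?powR_ge0// geometric_le ?powR_ge0.
  apply: ler_sum => j _; rewrite powR_exprn// /r powRD'// powRN powR_mulrn//.
  have E : (2 * (2 * 2 ^- j)) ^+ n = 4 ^+ n * (2 ^- n) ^+ j :> R.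
    by rewrite mulrA -natrM exprMn !exprVn -!exprM mulnC.
  by rewrite E exprMn exprS le_eqVlt; apply/orP; left; apply/eqP; ring.
Qed.

(* The value [enorm x `^ a] at the origin is [0] or [1]. *)
Definition wgt (a b : R) x : R :=
  if enorm x < 1 then enorm x `^ a else enorm x `^ b.

Lemma wgt_ge0 a b x : 0 <= wgt a b x.
Proof. by rewrite /wgt; case: ifP => _; exact: powR_ge0. Qed.

Lemma mR_wgt a b : mR (wgt a b).
Proof.
apply: (@mR_fun_enorm (fun t => if t < 1 then t `^ a else t `^ b)).
apply: measurable_fun_ifT; [|exact: measurable_powR|exact: measurable_powR].
exact: measurable_fun_ltr.
Qed.

Lemma LR_wgt a b : - n%:R < a -> b < - n%:R -> LR (wgt a b).
Proof.
move=> na bn.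
have b0 : 0 < - b by rewrite oppr_gt0 (lt_le_trans bn)// oppr_le0.
have ht : LR (fun x => 2 `^ (- b) * (1 + enorm x) `^ b).
  by apply: LRZ; rewrite -[b in X in LR X]opprK; apply: LR_tail; lra.
(* The exponent max(-a, n/2) stays strictly between 0 and n even for a >= 0, as [LR_pole] requires.
   In dimension 0 no such exponent exists; there the space is a point and every function is
   constant. *)
have hp : LR (fun x => boxi 1 x + (enorm x < 1)%R%:R * enorm x `^ (- Num.max (- a) (n%:R / 2))) \/ n = 0%N.
  case: (posnP n) => [|n0]; first by right.
  left; apply: LRD; first exact: (LR_boxi ler01).1.
  apply: LR_pole; apply/andP; split.
    by rewrite lt_max [X in _ || X](_ : _ = true) ?orbT// divr_gt0// ltr0n.
  rewrite gt_max; apply/andP; split; first lra.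
  by rewrite ltr_pdivrMr// ltr_pMr ?ltr0n// ltr1n.
case: hp => [hp|n0].
  apply: (LR_le _ _ (LRD hp ht)); first exact: mR_wgt.
  move=> x; rewrite ger0_norm ?wgt_ge0// /wgt; case: ltP => x1; last first.
    rewrite mul0r addr0 ler_wpDl ?boxi_ge0// powRN mulrC ler_pdivlMr ?powR_gt0//.
    have x0 : 0 < enorm x by rewrite (lt_le_trans ltr01).
    rewrite -powRM ?(ltW x0)//; rewrite -[b]opprK; apply: powR_anti.
    + by rewrite ltr_wpDr// enorm_ge0.
    + by lra.
    + exact: ltW.
  rewrite mul1r ler_wpDr ?mulr_ge0 ?powR_ge0//.
  have -> : boxi 1 x = 1.
    rewrite boxiE (_ : [forall i, _] = true)//; apply/forallP => i.
    exact: le_lt_trans (le_coord_enorm _ _) x1.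
  have [x0|x0] := eqVneq (enorm x) 0.
    rewrite ler_wpDr ?powR_ge0// x0 /powR eqxx; by case: (a == 0).
  have {}x0 : 0 < enorm x by rewrite lt_neqAle eq_sym x0 enorm_ge0.
  have [a0|a0] := leP 0 a.
    rewrite ler_wpDr ?powR_ge0//.
    have <- : 1 `^ a = 1 :> R by rewrite powR1.
    by apply: ge0_ler_powR; rewrite ?nnegrE ?(ltW x0) ?(ltW x1).
  rewrite ler_wpDl//; set p := Num.max _ _.
  have ap : - a <= p by rewrite le_max lexx.
  rewrite /powR !gt_eqF// ler_expR ler_wnM2r; [by []|by rewrite ln_le0// ltW|lra].
have E : wgt a b = fun=> wgt a b 0.
  apply/funext => x; congr wgt; apply/rowP => i; have := ltn_ord i.
  by rewrite {2}n0.
rewrite E; have -> : (fun=> wgt a b 0) = fun x : V => wgt a b 0 * boxi 1 x.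
  apply/funext => x; rewrite boxiE (_ : [forall i, _] = true) ?mulr1//.
  by apply/forallP => i; have := ltn_ord i; rewrite {2}n0.
exact: LRZ (LR_boxi ler01).1.
Qed.

Definition decay (k : nat) (C : R) (f : V -> R) := forall x, (1 + enorm x) ^+ k * `|f x| <= C.

Lemma LR_decay f C : mR f -> decay n.+1 C f -> LR f.
Proof.
move=> mf fC.
have h : LR (fun x : V => C * (1 + enorm x) `^ (- n.+1%:R)).
  by apply: LRZ; apply: LR_tail; rewrite ltr_nat.
apply: (LR_le mf _ h) => x.
have p0 : 0 < 1 + enorm x by rewrite ltr_wpDr// enorm_ge0.
rewrite powRN powR_mulrn ?(ltW p0)// ler_pdivlMr ?exprn_gt0// mulrC.
exact: fC.
Qed.

(** Weights (1 + |x|)^k in place of |x|^k make the bounds monotone in k; [expr1D_le] compares the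
    two forms. *)
Definition rschwartz (f : V -> R) := rsmooth setT f /\
  forall k s, exists C, decay k C (rpartials s f).

Lemma expr1D_le (t : R) k : 0 <= t -> (1 + t) ^+ k <= 2 ^+ k * (1 + t ^+ k).
Proof.
move=> t0; have [t1|t1] := leP t 1.
  apply: (@le_trans _ _ (2 ^+ k)).
    by rewrite lerXn2r ?nnegrE ?addr_ge0//; lra.
  by rewrite ler_peMr ?exprn_ge0// lerDl exprn_ge0.
apply: (@le_trans _ _ ((2 * t) ^+ k)).
  by rewrite lerXn2r ?nnegrE ?addr_ge0 ?mulr_ge0//; lra.
by rewrite exprMn ler_wpM2l ?exprn_ge0// lerDr.
Qed.

Lemma le_Re_normc (z : R[i]) : `|complex.Re z| <= ComplexField.Normc.normc z.
Proof.
by case: z => a b /=; rewrite -sqrtr_sqr ler_wsqrtr// lerDl sqr_ge0.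
Qed.

Lemma le_Im_normc (z : R[i]) : `|complex.Im z| <= ComplexField.Normc.normc z.
Proof.
by case: z => a b /=; rewrite -sqrtr_sqr ler_wsqrtr// lerDr sqr_ge0.
Qed.

Lemma le_normc_ReIm (z : R[i]) :
  ComplexField.Normc.normc z <= `|complex.Re z| + `|complex.Im z|.
Proof.
case: z => a b /=; rewrite -(@ler_pXn2r _ 2)// ?nnegrE ?sqrtr_ge0 ?addr_ge0//.
rewrite sqr_sqrtr ?addr_ge0 ?sqr_ge0// sqrrD !real_normK ?num_real//.
by rewrite lerD2r lerDl mulrn_wge0// mulr_ge0.
Qed.

Lemma schwartz_ReIm (f : V -> R[i]) : schwartz f ->
  rschwartz (fun x => complex.Re (f x)) /\ rschwartz (fun x => complex.Im (f x)).
Proof.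
move=> [/smooth_onE[s1 s2] df].
have H (p : R[i] -> R) : (forall z : R[i], `|p z| <= ComplexField.Normc.normc z) ->
    forall k s, exists C, decay k C (fun x => p (partials s f x)).
  move=> pn k s; have [C0 h0] := df 0%N s; have [Ck hk] := df k s.
  exists (2 ^+ k * (C0 + Ck)) => x.
  apply: (@le_trans _ _ ((2 ^+ k * (1 + enorm x ^+ k)) * ComplexField.Normc.normc (partials s f x))).
    by apply: ler_pM => //; [rewrite exprn_ge0// addr_ge0// enorm_ge0|exact: expr1D_le (enorm_ge0 x)].
  rewrite -mulrA ler_wpM2l ?exprn_ge0// mulrDl mul1r lerD//.
  by have := h0 x; rewrite expr0 mul1r.
split; split=> // k s.
  by have [C h] := H _ le_Re_normc k s; exists C => x; have := h x; rewrite partialsE.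
by have [C h] := H _ le_Im_normc k s; exists C => x; have := h x; rewrite partialsE.
Qed.
End euclidean_norm.

(** * The Poisson kernel and the extension *)

Section partial_rules.
Variables (R : realType) (n : nat).
Local Notation V := 'rV[R]_n.
Implicit Types (g k : V -> R) (z : V).

Lemma rpartial_comp (phi : R -> R) g z c : differentiable g z ->
  is_derive (g z) 1 phi c ->
  differentiable (fun w => phi (g w)) z /\
  forall i, rpartial i (fun w => phi (g w)) z = c * rpartial i g z.
Proof.
move=> dg [dphi ephi]; have dp : differentiable phi (g z) by exact/derivable1_diffP.
have dc : differentiable (phi \o g) z by exact: differentiable_comp.
split=> // i; rewrite /rpartial deriveE// (diff_comp dg dp)/= deriveE//.
by rewrite -[X in 'd phi _ X]mulr1 linearZ/= -(deriveE _ dp) ephi mulrC.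
Qed.

Lemma diff_coord (j : 'I_n) z : differentiable (fun w : V => w 0 j) z /\
  forall i, rpartial i (fun w : V => w 0 j) z = (i == j)%:R.
Proof.
apply: (@diff_quad _ _ _ _ (fun i => (i == j)%:R) 1 0 ltr01) => h _.
rewrite mul0r /lincomb (bigD1 j)//= big1 ?addr0.
  rewrite eqxx mulr1 mxE (_ : _ - _ - _ = 0) ?normr0//; ring.
by move=> i ij; rewrite (negbTE ij) mulr0.
Qed.

Lemma diff_sqn z : differentiable (@sqn R n) z /\
  forall i, rpartial i (@sqn R n) z = 2 * z 0 i.
Proof.
apply: (@diff_quad _ _ _ _ (fun i => 2 * z 0 i) 1 (n%:R ^+ 2) ltr01) => h _.
rewrite sqnD; have -> : lincomb (fun i => 2 * z 0 i) h = 2 * dotr z h.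
  by rewrite /lincomb /dotr mulr_sumr; apply: eq_bigr => i _; ring.
have -> : sqn z + 2 * dotr z h + sqn h - sqn z - 2 * dotr z h = sqn h by ring.
rewrite ger0_norm ?sqn_ge0// -sqr_enorm -exprMn lerXn2r ?nnegrE ?enorm_ge0 ?mulr_ge0//.
exact: enorm_le_norm.
Qed.

Lemma mR_sqn : mR (@sqn R n).
Proof.
rewrite (_ : @sqn R n = fun x => enorm x ^+ 2).
  by apply: (@mR_fun_enorm _ _ (fun t => t ^+ 2)); exact: measurable_funX.
by apply/funext => x; rewrite sqr_enorm.
Qed.

Lemma finite_bound (I : finType) T (P : T -> Prop) (F : I -> T -> R) :
  (forall i, exists C, forall x, P x -> `|F i x| <= C) ->
  exists2 C, 0 <= C & forall i x, P x -> `|F i x| <= C.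
Proof.
move=> /choice[Cf HC]; exists (\sum_i `|Cf i|); first exact: sumr_ge0.
move=> i x Px; rewrite (le_trans (HC i x Px))// (bigD1 i)//=.
by rewrite (le_trans (ler_norm _))// lerDl sumr_ge0.
Qed.
End partial_rules.

Section half_space_kernels.
Variables (R : realType) (d : nat).
Local Notation V := 'rV[R]_(d + 1).
Local Notation HS := (@half_space R d).
Local Notation yc := (ycoord d).
Implicit Types (k : V -> R) (z : V).

Lemma open_half_space : open HS.
Proof.
rewrite (_ : HS = (@height R d) @^-1` [set x | 0 < x])//.
apply: open_comp; last exact: open_gt.
by move=> z _; exact: coord_continuous.
Qed.

Lemma sqn_gt0 z : HS z -> 0 < sqn z.
Proof.
move=> hz; rewrite -sqr_enorm exprn_gt0// (lt_le_trans hz)//.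
exact: le_trans (ler_norm _) (le_coord_enorm z yc).
Qed.

(** Derivative formulas are asserted on the half-space only: powers of the height and of |z|^2 are
    differentiable there but not everywhere. *)
Definition hpartial i k k' := forall z, HS z -> differentiable k z /\ rpartial i k z = k' z.

Lemma hpartialD i k1 k2 k1' k2' : hpartial i k1 k1' -> hpartial i k2 k2' ->
  hpartial i (fun z => k1 z + k2 z) (fun z => k1' z + k2' z).
Proof.
move=> h1 h2 z hz; have [d1 e1] := h1 z hz; have [d2 e2] := h2 z hz.
by split; [exact: differentiableD|rewrite rpartialD// e1 e2].
Qed.

Lemma hpartialM i k1 k2 k1' k2' : hpartial i k1 k1' -> hpartial i k2 k2' ->
  hpartial i (fun z => k1 z * k2 z) (fun z => k1 z * k2' z + k2 z * k1' z).
Proof.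
move=> h1 h2 z hz; have [d1 e1] := h1 z hz; have [d2 e2] := h2 z hz.
by split; [exact: differentiableM|rewrite rpartialM// e1 e2].
Qed.

Lemma hpartial_cst i c : hpartial i (fun=> c) (fun=> 0).
Proof. by move=> z _; split; [exact: differentiable_cst|exact: rpartial_cst]. Qed.

Lemma hpartial_coord i j : hpartial i (fun z => z 0 j) (fun=> (i == j)%:R).
Proof. by move=> z _; have [h1 h2] := diff_coord j z. Qed.

Lemma hpartial_height i a : hpartial i (fun z => height z `^ a)
  (fun z => (i == yc)%:R * a * height z `^ (a - 1)).
Proof.
move=> z hz; have [h1 h2] := diff_coord yc z.
have [h3 h4] := rpartial_comp h1 (is_derive1_powR a hz); split=> //.
by rewrite h4 h2 mulrC mulrA.
Qed.

Lemma hpartial_sqn i b : hpartial i (fun z => sqn z `^ b)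
  (fun z => 2 * b * (z 0 i * sqn z `^ (b - 1))).
Proof.
move=> z hz; have [h1 h2] := diff_sqn z.
have [h3 h4] := rpartial_comp h1 (is_derive1_powR b (sqn_gt0 hz)); split=> //.
by rewrite h4 h2; ring.
Qed.

Lemma hpartial2 i j k k' k'' z : hpartial i k k' -> hpartial j k' k'' -> HS z ->
  differentiable (rpartial i k) z /\ rpartial j (rpartial i k) z = k'' z.
Proof.
move=> h1 h2 hz; have [d1 e1] := h2 z hz.
have [h3 h4] : differentiable (rpartial i k) z /\
    forall j, rpartial j (rpartial i k) z = rpartial j k' z.
  apply: diff_near => //; apply: filterS (open_nbhs_nbhs (conj open_half_space hz)).
  by move=> w hw; exact: (h1 w hw).2.
by split=> //; rewrite h4.
Qed.

(* Every generator is bounded on horizontal strips, and the algebra they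
   generate is stable under differentiation. *)
Inductive kalg : (V -> R) -> Prop :=
| kalg_cst c : kalg (fun=> c)
| kalg_height a : kalg (fun z => height z `^ a)
| kalg_xi i : kalg (fun z => z 0 i * sqn z `^ (- 1))
| kalg_sqn b : 0 <= b -> kalg (fun z => sqn z `^ (- b))
| kalgD k1 k2 : kalg k1 -> kalg k2 -> kalg (fun z => k1 z + k2 z)
| kalgM k1 k2 : kalg k1 -> kalg k2 -> kalg (fun z => k1 z * k2 z).

(** The generators are closed under differentiation because the derivative of |z|^(-2b) is a
    multiple of z_i |z|^-2 times |z|^(-2b), and z_i |z|^-2 is itself a generator, bounded away from
    the origin. *)
Lemma kalg_partial k i : kalg k -> exists2 k', kalg k' & hpartial i k k'.
Proof.
elim=> [c|a|j|b b0|k1 k2 _ [k1' a1 h1] _ [k2' a2 h2]|k1 k2 b1 [k1' a1 h1] b2 [k2' a2 h2]].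
- by exists (fun=> 0); [exact: kalg_cst|exact: hpartial_cst].
- eexists; last exact: hpartial_height.
  by apply: kalgM; [exact: kalg_cst|exact: kalg_height].
- exists (fun z => (i == j)%:R * sqn z `^ (- 1) +
    (- 2) * ((z 0 j * sqn z `^ (- 1)) * (z 0 i * sqn z `^ (- 1)))).
    apply: kalgD; first by apply: kalgM; [exact: kalg_cst|exact: kalg_sqn].
    by apply: kalgM; [exact: kalg_cst|apply: kalgM; exact: kalg_xi].
  move=> z hz; have [h1 h2] := hpartialM (hpartial_coord i j) (hpartial_sqn i (- 1)) hz.
  split=> //; rewrite h2 powRD' ?sqn_gt0//; ring.
- exists (fun z => 2 * (- b) * ((z 0 i * sqn z `^ (- 1)) * sqn z `^ (- b))).
    apply: kalgM; first exact: kalg_cst.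
    by apply: kalgM; [exact: kalg_xi|exact: kalg_sqn].
  move=> z hz; have [h1 h2] := hpartial_sqn i (- b) hz.
  split=> //; rewrite h2 powRD' ?sqn_gt0//; ring.
- by exists (fun z => k1' z + k2' z); [exact: kalgD|exact: hpartialD].
- exists (fun z => k1 z * k2' z + k2 z * k1' z); last exact: hpartialM.
  by apply: kalgD; exact: kalgM.
Qed.

Lemma kalg_bounded k y1 y2 : kalg k -> 0 < y1 ->
  exists C, forall z, y1 <= height z <= y2 -> `|k z| <= C.
Proof.
move=> hk y0; have He (z : V) : y1 <= height z <= y2 -> y1 <= enorm z.
  move=> /andP[h _]; apply: (le_trans h).
  exact: le_trans (ler_norm _) (le_coord_enorm z yc).
have Hs (z : V) : y1 <= height z <= y2 -> y1 ^+ 2 <= sqn z.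
  by move=> /He h; rewrite -sqr_enorm lerXn2r ?nnegrE ?enorm_ge0 ?(ltW y0).
elim: hk => [c|a|j|b b0|k1 k2 _ [C1 h1] _ [C2 h2]|k1 k2 b1 [C1 h1] b2 [C2 h2]].
- by exists `|c|.
- have [a0|a0] := leP 0 a.
    exists (y2 `^ a) => z /andP[h1 h2]; rewrite ger0_norm ?powR_ge0//.
    have z0 : 0 < height z by exact: lt_le_trans h1.
    by apply: ge0_ler_powR; rewrite ?nnegrE ?(ltW z0)// (le_trans (ltW z0)).
  exists (y1 `^ a) => z /andP[h1 h2]; rewrite ger0_norm ?powR_ge0//.
  by rewrite -[a]opprK; apply: powR_anti => //; rewrite oppr_ge0 ltW.
- exists y1^-1 => z hz; have e0 : 0 < enorm z by exact: lt_le_trans (He z hz).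
  rewrite normrM [X in _ * X]ger0_norm ?powR_ge0// powR_inv1 ?sqn_ge0//.
  rewrite -sqr_enorm ler_pdivrMr ?exprn_gt0//.
  apply: (le_trans (le_coord_enorm z j)).
  by rewrite expr2 mulrA ler_peMl ?(ltW e0)// mulrC ler_pdivlMr// mul1r He.
- exists ((y1 ^+ 2) `^ (- b)) => z hz; rewrite ger0_norm ?powR_ge0//.
  by apply: powR_anti; rewrite ?exprn_gt0// Hs.
- by exists (C1 + C2) => z hz; rewrite (le_trans (ler_normD _ _))// lerD ?h1 ?h2.
- by exists (C1 * C2) => z hz; rewrite normrM ler_pM ?h1 ?h2.
Qed.

Lemma mR_kalg k : kalg k -> mR k.
Proof.
elim=> [c|a|j|b b0|k1 k2 _ h1 _ h2|k1 k2 _ h1 _ h2].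
- exact: measurable_cst.
- by apply: (measurableT_comp (measurable_powR _)); exact: mR_coord.
- apply: measurable_funM; first exact: mR_coord.
  by apply: (measurableT_comp (measurable_powR _)); exact: mR_sqn.
- by apply: (measurableT_comp (measurable_powR _)); exact: mR_sqn.
- exact: measurable_funD.
- exact: measurable_funM.
Qed.

Definition emb (w : 'rV[R]_d) : V := row_mx w 0.

Lemma height_emb w : height (emb w) = 0.
Proof. by rewrite /height /emb /ycoord row_mxEr mxE. Qed.

Lemma heightD z w : height (z + w) = height z + height w.
Proof. by rewrite /height mxE. Qed.

Lemma heightB_emb z w : height (z - emb w) = height z.
Proof. by have := height_emb w; rewrite /height !mxE => ->; rewrite subr0. Qed.

Lemma heightZ a z : height (a *: z) = a * height z.
Proof. by rewrite /height mxE. Qed.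

Lemma norm_height z : `|height z| <= `|z|.
Proof. exact: norm_coord. Qed.

Lemma mcoord_emb dd (TT : measurableType dd) (g : TT -> 'rV[R]_d) : mcoord g ->
  mcoord (fun t => emb (g t)).
Proof.
move=> mg i; rewrite /emb; case: (split_ordP i) => j ->.
  by under eq_fun do rewrite row_mxEl; exact: mg.
by under eq_fun do rewrite row_mxEr; under eq_fun do rewrite mxE; exact: measurable_cst.
Qed.

Section convolution.
Variable f : 'rV[R]_d -> R.
Hypothesis hf : LR f.

Definition hconv k z := IR (fun w => k (z - emb w) * f w).

Lemma LR_hconv k z : kalg k -> HS z -> LR (fun w => k (z - emb w) * f w).
Proof.
move=> hk hz; have [C HC] := @kalg_bounded k (height z) (height z) hk hz.
have h : LR (fun w => C * `|f w|) by apply: LRZ; exact: LR_norm.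
apply: (LR_le _ _ h).
- apply: measurable_funM; last exact: LR_mR.
  apply: mR_comp; last exact: mR_kalg.
  apply: mcoordD; first exact: mcoord_cst.
  by apply: mcoordN; apply: mcoord_emb => //; exact: mcoord_tuple.
- by move=> w; rewrite normrM ler_wpM2r// HC// heightB_emb lexx.
Qed.

Lemma hconv_diff k (k' : 'I_(d + 1) -> V -> R) z : kalg k -> (forall i, kalg (k' i)) ->
  (forall i, hpartial i k (k' i)) -> HS z ->
  differentiable (hconv k) z /\ forall i, rpartial i (hconv k) z = hconv (k' i) z.
Proof.
move=> hk hk' kk' hz.
have /choice[k2 Hk2] : forall ij : 'I_(d + 1) * 'I_(d + 1), exists k2 : V -> R,
    kalg k2 /\ hpartial ij.2 (k' ij.1) k2.
  by move=> ij; have [k2 a2 h2] := kalg_partial ij.2 (hk' ij.1); exists k2.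
(* For increments below half the height, all segments stay in one horizontal strip, the same for
   every [w]; the second derivatives of the kernel are bounded there, which makes the Taylor bound
   uniform in [w]. *)
set del := height z / 2; have del0 : 0 < del by rewrite divr_gt0.
have [C C0 HC] : exists2 C, 0 <= C & forall ij w, del <= height w <= height z + del ->
    `|k2 ij w| <= C.
  by apply: finite_bound => ij; apply: kalg_bounded => //; exact: (Hk2 ij).1.
pose K := (d + 1)%:R ^+ 2 * C.
have hh (h : V) (t : R) : `|h| < del -> 0 <= t <= 1 -> - del <= t * height h <= del.
  move=> hd /andP[t0 t1]; rewrite -ler_norml normrM ger0_norm//.
  rewrite (@le_trans _ _ `|height h|)//; first by rewrite ler_piMl.
  by rewrite (le_trans (norm_height h))// ltW.
have hH (h : V) w (t : R) : `|h| < del -> 0 <= t <= 1 ->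
    del <= height (z - emb w + t *: h) <= height z + del.
  move=> hd t01; have /andP[a1 a2] := hh h t hd t01.
  rewrite heightD heightB_emb heightZ lerD2l a2 andbT.
  by rewrite /del in a1 *; lra.
have hHS (h : V) w (t : R) : `|h| < del -> 0 <= t <= 1 -> HS (z - emb w + t *: h).
  move=> hd t01; have /andP[a1 _] := hH h w t hd t01.
  exact: lt_le_trans a1.
apply: (@diff_under_Int _ _ _ _ (leb_tuple R d) (fun t z => k (z - emb (rV_of_tuple t)) * f (rV_of_tuple t))
  (fun t i => k' i (z - emb (rV_of_tuple t)) * f (rV_of_tuple t))
  (fun t => K * `|f (rV_of_tuple t)|) z del del0).
- move=> h hd; apply: (@LR_hconv k (z + h)) => //.
  have := hHS h 0 1 hd; rewrite scale1r ler01 lexx => /(_ isT).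
  by rewrite /half_space/= heightD heightB_emb heightD.
- by move=> i; apply: (@LR_hconv (k' i) z).
- by apply: L1Z; apply: L1_norm.
- move=> t h hd; set w := rV_of_tuple t; set fw := f w.
  have -> : k (z + h - emb w) * fw - k (z - emb w) * fw - lincomb (fun i => k' i (z - emb w) * fw) h =
      (k (z - emb w + h) - k (z - emb w) - lincomb (fun i => rpartial i k (z - emb w)) h) * fw.
    have -> : lincomb (fun i => k' i (z - emb w) * fw) h =
        lincomb (fun i => rpartial i k (z - emb w)) h * fw.
      rewrite /lincomb mulr_suml; apply: eq_bigr => i _.
      by rewrite (kk' i _ _).2 ?mulrA// /half_space/= heightB_emb.
    by rewrite [z + h - _]addrAC !mulrBl.
  rewrite normrM mulrA ler_wpM2r// mulrC; apply: taylor2.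
  + by move=> u u01; have [] := kk' (ycoord d) _ (hHS h w u hd u01).
  + by move=> i u u01; have [] := hpartial2 (kk' i) (Hk2 (i, ycoord d)).2 (hHS h w u hd u01).
  + move=> i j u u01; have [_ ->] := hpartial2 (kk' i) (Hk2 (i, j)).2 (hHS h w u hd u01).
    exact/HC/hH.
Qed.

Lemma kalg_partials k : kalg k -> exists k' : 'I_(d + 1) -> V -> R, (forall i, kalg (k' i)) /\ forall i, hpartial i k (k' i).
Proof.
move=> hk; have /choice[k' H] : forall i : 'I_(d + 1), exists k' : V -> R, kalg k' /\ hpartial i k k'.
  by move=> i; have [k' a h] := kalg_partial i hk; exists k'.
by exists k'; split=> i; have [] := H i.
Qed.

Lemma hconv_smooth k : kalg k -> rsmooth HS (hconv k).
Proof.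
move=> hk; pose P (g : V -> R) := exists2 k, kalg k & g = hconv k.
apply: (@rsmooth_closed _ _ HS P open_half_space) => [g [k1 h1 ->] z hz|g i [k1 h1 ->]|].
- have [k' [a' p']] := kalg_partials h1.
  exact: (hconv_diff h1 a' p' hz).1.
- have [k' [a' p']] := kalg_partials h1.
  exists (hconv (k' i)); first by exists (k' i).
  by move=> z hz; exact: (hconv_diff h1 a' p' hz).2.
- by exists k.
Qed.
End convolution.
End half_space_kernels.

(** * The Poisson kernel and its equation *)

Section poisson.
Variables (R : realType) (d : nat) (s : R).
Hypothesis hs : 0 < s < 1.
Local Notation V := 'rV[R]_(d + 1).
Local Notation HS := (@half_space R d).
Local Notation yc := (ycoord d).

(** Half of d + 2s, the exponent both of the denominator of the Poisson kernel and of the kernel of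
    the fractional Laplacian. *)
Definition nu : R := (d%:R + 2 * s) / 2.

Lemma nu2 : 2 * nu = d%:R + 2 * s. Proof. by rewrite /nu; field. Qed.

Lemma nu_gt0 : 0 < nu.
Proof. by case/andP: hs => s0 _; rewrite /nu divr_gt0// ltr_wpDl// mulr_gt0. Qed.

Definition pk (v : 'rV[R]_d) : R := (1 + sqn v) `^ (- nu).

Lemma one_sqn_gt0 (v : 'rV[R]_d) : 0 < 1 + sqn v.
Proof. by rewrite ltr_wpDr// sqn_ge0. Qed.

Lemma mR_pk : mR pk.
Proof.
apply: (measurableT_comp (measurable_powR _)).
by apply: measurable_funD; [exact: measurable_cst|exact: mR_sqn].
Qed.

Lemma pk_le v : pk v <= 2 `^ nu * (1 + enorm v) `^ (- (2 * nu)).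
Proof.
have e0 := enorm_ge0 v; have p0 : 0 < 1 + enorm v by rewrite ltr_wpDr.
have h : ((2 * (1 + sqn v)) `^ (- nu)) <= ((1 + enorm v) ^+ 2) `^ (- nu).
  apply: powR_anti; [by rewrite exprn_gt0| |exact: ltW nu_gt0].
  rewrite -sqr_enorm; have := sqr_ge0 (1 - enorm v); rewrite sqrrB sqrrD; lra.
rewrite powRM ?(ltW (one_sqn_gt0 v))// in h.
rewrite -powR_mulrn ?(ltW p0)// -powRrM mulrN in h.
rewrite /pk mulrC -ler_pdivrMr ?powR_gt0// mulrC -powRN; exact: h.
Qed.

Lemma LR_pk : LR pk.
Proof.
have h : LR (fun v : 'rV[R]_d => 2 `^ nu * (1 + enorm v) `^ (- (2 * nu))).
  apply: LRZ; apply: LR_tail; rewrite nu2 ltrDl mulr_gt0//; by case/andP: hs.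
apply: (LR_le mR_pk _ h) => v; rewrite ger0_norm ?powR_ge0//; exact: pk_le.
Qed.

Lemma IR_pk_gt0 : 0 < IR pk.
Proof.
have [h1 h2] := @LR_boxi R d 1 ler01.
apply: (@lt_le_trans _ _ (IR (fun v : 'rV[R]_d => (1 + d%:R) `^ (- nu) * boxi 1 v))).
  by rewrite IRZ// h2 mulr_gt0 ?powR_gt0 ?exprn_gt0 ?mulr1// ltr_wpDr.
apply: le_IR; [exact: LRZ|exact: LR_pk|move=> v].
rewrite boxiE; case: forallP => [h|_]; last by rewrite mulr0 powR_ge0.
rewrite mulr1; apply: powR_anti; [exact: one_sqn_gt0| |exact: ltW nu_gt0].
rewrite lerD2l /sqn -[d in d%:R]card_ord -sum1_card natr_sum; apply: ler_sum => i _.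
by rewrite -real_normK ?num_real// expr_le1// ltW.
Qed.

Definition pc : R := (IR pk)^-1.

Lemma pc_gt0 : 0 < pc. Proof. by rewrite invr_gt0 IR_pk_gt0. Qed.

Definition PK v : R := pc * pk v.

Lemma PK_ge0 v : 0 <= PK v. Proof. by rewrite mulr_ge0 ?powR_ge0 ?(ltW pc_gt0). Qed.
Lemma LR_PK : LR PK. Proof. exact: LRZ LR_pk. Qed.
Lemma IR_PK : IR PK = 1.
Proof. by rewrite IRZ; [rewrite mulVf// gt_eqF// IR_pk_gt0|exact: LR_pk]. Qed.

Local Notation hh a := (fun z : V => height z `^ a).
Local Notation nn := (fun z : V => sqn z `^ (- nu)).
Local Notation xi i := (fun z : V => z 0 i * sqn z `^ (- 1)).

(** The Poisson kernel as a function of z = (x, y). At height 1 it is [PK], a probability density;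
    other heights follow by scaling ([PQ_scaled]). *)
Definition PQ (z : V) : R := pc * (height z `^ (2 * s) * sqn z `^ (- nu)).

Lemma kalg_PQ : kalg PQ.
Proof.
apply: kalgM; first exact: kalg_cst.
by apply: kalgM; [exact: kalg_height|apply: kalg_sqn; exact: ltW nu_gt0].
Qed.

Let dl i : R := (i == yc)%:R.

Definition PQ1 i (z : V) : R := pc * (dl i * (2 * s) * (height z `^ (2 * s - 1) * sqn z `^ (- nu))
  + (- (2 * nu)) * (height z `^ (2 * s) * (sqn z `^ (- nu) * (z 0 i * sqn z `^ (- 1))))).

Lemma kalg_PQ1 i : kalg (PQ1 i).
Proof.
have kn : kalg nn by apply: kalg_sqn; exact: ltW nu_gt0.
have kc c : kalg (fun _ : V => c) by exact: kalg_cst.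
have kh a : kalg (hh a) by exact: kalg_height.
by repeat (first [exact: kn | exact: kc | exact: kh | exact: kalg_xi | apply: kalgD | apply: kalgM]).
Qed.

Lemma hpartial_nn i : hpartial i nn (fun z => (- (2 * nu)) * (sqn z `^ (- nu) * (z 0 i * sqn z `^ (- 1)))).
Proof.
move=> z hz; have [h1 h2] := hpartial_sqn i (- nu) hz.
by split=> //; rewrite h2 powRD' ?sqn_gt0//; ring.
Qed.

Lemma hpartial_xi i j : hpartial i (xi j) (fun z => (i == j)%:R * sqn z `^ (- 1) -
  2 * ((z 0 i * sqn z `^ (- 1)) * (z 0 j * sqn z `^ (- 1)))).
Proof.
move=> z hz; have [h1 h2] := hpartialM (hpartial_coord i j) (hpartial_sqn i (- 1)) hz.
by split=> //; rewrite h2 powRD' ?sqn_gt0//; ring.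
Qed.

Lemma hpartial_PQ i : hpartial i PQ (PQ1 i).
Proof.
move=> z hz; have [h1 h2] := hpartialM (@hpartial_cst _ _ i pc)
  (hpartialM (hpartial_height i (2 * s)) (hpartial_nn i)) hz.
by split=> //; rewrite h2 /PQ1 /dl; ring.
Qed.

(** Every power of the height is written as y^(2s-2) times an integer power, so that the identities
    below become polynomial in a few atoms and [ring] or [field] decides them. *)
Definition PQ2 i (z : V) : R :=
  let a := height z `^ (2 * s - 2) in let h := height z in
  let n := sqn z `^ (- nu) in let q := sqn z `^ (- 1) in
  pc * n * (dl i * (2 * s * (2 * s - 1) * a - 8 * s * nu * (a * h ^+ 2 * q)) +
    (- (2 * nu)) * (a * h ^+ 2 * q) + 4 * nu * (nu + 1) * a * h ^+ 2 * (z 0 i * q) ^+ 2).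

Lemma hpartial_PQ1 i : hpartial i (PQ1 i) (PQ2 i).
Proof.
move=> z hz; have [h1 h2] := hpartialM (@hpartial_cst _ _ i pc)
  (hpartialD (hpartialM (@hpartial_cst _ _ i (dl i * (2 * s)))
     (hpartialM (hpartial_height i (2 * s - 1)) (hpartial_nn i)))
   (hpartialM (@hpartial_cst _ _ i (- (2 * nu)))
     (hpartialM (hpartial_height i (2 * s)) (hpartialM (hpartial_nn i) (hpartial_xi i i))))) hz.
split=> //; rewrite h2 /PQ2 /dl eqxx.
have z0 : 0 < height z by [].
have -> : 2 * s - 1 - 1 = 2 * s - 2 by ring.
have e1 : height z `^ (2 * s - 1) = height z `^ (2 * s - 2) * height z.
  transitivity (height z `^ (2 * s - 2 + 1)); first by congr (_ `^ _); ring.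
  by rewrite powRD'// powRr1// ltW.
have e2 : height z `^ (2 * s) = height z `^ (2 * s - 2) * height z ^+ 2.
  transitivity (height z `^ (2 * s - 2 + 2%:R)); first by congr (_ `^ _); ring.
  by rewrite powRD'// powR_mulrn// ltW.
rewrite e1 e2 (_ : (true : nat)%:R = 1)//.
have [iy|iy] := eqVneq i yc.
  have zh : z 0 i = height z by rewrite iy.
  by rewrite zh (_ : (true : nat)%:R = 1)//; ring.
by rewrite (_ : (false : nat)%:R = 0)//; ring.
Qed.

Lemma PQ_harmonic (z : V) : HS z -> \sum_i PQ2 i z + (1 - 2 * s) / height z * PQ1 yc z = 0.
Proof.
move=> hz; have z0 : 0 < height z by [].
have S0 := sqn_gt0 hz.
set a := height z `^ (2 * s - 2); set h := height z; set n := sqn z `^ (- nu).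
set q := sqn z `^ (- 1).
have e1 : height z `^ (2 * s - 1) = a * h.
  transitivity (height z `^ (2 * s - 2 + 1)); first by congr (_ `^ _); ring.
  by rewrite powRD'// powRr1// ltW.
have e2 : height z `^ (2 * s) = a * h ^+ 2.
  transitivity (height z `^ (2 * s - 2 + 2%:R)); first by congr (_ `^ _); ring.
  by rewrite powRD'// powR_mulrn// ltW.
have sx : \sum_i (z 0 i * q) ^+ 2 = q.
  rewrite (eq_bigr (fun i => q ^+ 2 * z 0 i ^+ 2)); last by move=> i _; ring.
  by rewrite -mulr_sumr -/(sqn z) /q powR_inv1 ?(ltW S0)// expr2 -mulrA mulVf ?mulr1// gt_eqF.
have sd : \sum_i dl i = 1.
  rewrite /dl (bigD1 yc)//= eqxx big1 ?addr0// => i /negbTE ->//.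
have -> : \sum_i PQ2 i z = pc * n * ((2 * s * (2 * s - 1) * a - 8 * s * nu * (a * h ^+ 2 * q)) +
    (d%:R + 1) * ((- (2 * nu)) * (a * h ^+ 2 * q)) + 4 * nu * (nu + 1) * a * h ^+ 2 * q).
  pose A := 2 * s * (2 * s - 1) * a - 8 * s * nu * (a * h ^+ 2 * q).
  pose B := (- (2 * nu)) * (a * h ^+ 2 * q).
  rewrite (eq_bigr (fun i => pc * n * (dl i * A + B + (4 * nu * (nu + 1) * a * h ^+ 2) * (z 0 i * q) ^+ 2)))//.
  have S1 : \sum_i dl i * A = A by rewrite -mulr_suml sd mul1r.
  have S2 : \sum_i (4 * nu * (nu + 1) * a * h ^+ 2) * (z 0 i * q) ^+ 2 =
      (4 * nu * (nu + 1) * a * h ^+ 2) * q by rewrite -mulr_sumr sx.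
  have S3 : \sum_(i < d + 1) B = (d%:R + 1) * B.
    by rewrite sumr_const card_ord -[B *+ _]mulr_natl natrD.
  by rewrite -mulr_sumr !big_split/= S1 S2 S3.
rewrite /PQ1 -/n -/q e1 e2 /dl eqxx mul1r -/(height z) -/h.
(* The only relation between the exponent and the dimension; with it all terms cancel. *)
have -> : d%:R = 2 * nu - 2 * s :> R by rewrite nu2; ring.
by field; rewrite gt_eqF.
Qed.

Section extension_of.
Variable f : 'rV[R]_d -> R.
Hypothesis hf : LR f.

Definition ext := hconv f PQ.

Lemma ext_smooth : rsmooth HS ext. Proof. exact: hconv_smooth hf _ kalg_PQ. Qed.

Lemma rpartial_ext i z : HS z -> rpartial i ext z = hconv f (PQ1 i) z.
Proof. by move=> hz; have [_ ->] := hconv_diff hf kalg_PQ kalg_PQ1 hpartial_PQ hz. Qed.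

Lemma rpartial2_ext i z : HS z ->
  rpartial i (rpartial i ext) z = IR (fun w => PQ2 i (z - emb w) * f w) /\
  LR (fun w => PQ2 i (z - emb w) * f w).
Proof.
move=> hz; have [k' [a' p']] := kalg_partials (kalg_PQ1 i).
have e : forall z, HS z -> k' i z = PQ2 i z.
  by move=> w hw; rewrite -(p' i w hw).2 (hpartial_PQ1 i hw).2.
have -> : (fun w => PQ2 i (z - emb w) * f w) = (fun w => k' i (z - emb w) * f w).
  by apply/funext => w; rewrite e// /half_space/= heightB_emb.
split; last exact: LR_hconv.
have -> : rpartial i (rpartial i ext) z = rpartial i (hconv f (PQ1 i)) z.
  apply: near_eq_derive; apply: filterS (open_nbhs_nbhs (conj (@open_half_space R d) hz)).
  by move=> w hw; exact: rpartial_ext.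
by have [_ ->] := hconv_diff hf (kalg_PQ1 i) a' p' hz.
Qed.

Lemma ext_harmonic z : HS z -> \sum_i rpartial i (rpartial i ext) z +
  (1 - 2 * s) / height z * rpartial yc ext z = 0.
Proof.
move=> hz; rewrite (eq_bigr _ (fun i _ => (rpartial2_ext i hz).1)) rpartial_ext//.
rewrite /IR -Int_sum; last by move=> i _; exact: (rpartial2_ext i hz).2.
have h1 := LR_hconv hf (kalg_PQ1 yc) hz.
rewrite -[X in _ + _ * X]/(Int _ _) -IntZ// -IntD; last 2 first.
- by apply: L1_sum => i _; exact: (rpartial2_ext i hz).2.
- exact: L1Z.
rewrite -[RHS](@Int0 _ _ _ (leb_tuple R d)); congr Int; apply/funext => t.
rewrite -mulr_suml mulrA -mulrDl -[X in _ / X](heightB_emb z (rV_of_tuple t)).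
by rewrite PQ_harmonic ?mul0r// /half_space/= heightB_emb.
Qed.

Lemma height_half (x : 'rV[R]_d) y : height (half_point x y) = y.
Proof. by rewrite /height /half_point /ycoord row_mxEr mxE. Qed.

Lemma sqn_half (x : 'rV[R]_d) y : sqn (half_point x y) = sqn x + y ^+ 2.
Proof.
rewrite /sqn big_split_ord/= big_ord1 /half_point row_mxEr mxE; congr (_ + _).
by apply: eq_bigr => i _; rewrite row_mxEl.
Qed.

Lemma half_pointB_emb (x w : 'rV[R]_d) y : half_point x y - emb w = half_point (x - w) y.
Proof. by rewrite /half_point /emb opp_row_mx add_row_mx oppr0 addr0. Qed.

Lemma PQ_scaled (v : 'rV[R]_d) y : 0 < y -> PQ (half_point (y *: v) y) = y ^- d * PK v.
Proof.
move=> y0; rewrite /PQ /PK height_half sqn_half -sqr_enorm enormZ exprMn real_normK ?num_real// sqr_enorm.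
rewrite -[X in _ + X]mulr1 -mulrDr [sqn v + 1]addrC powRM ?sqr_ge0 ?(ltW (one_sqn_gt0 v))//.
have e : y `^ (2 * s) * (y ^+ 2) `^ (- nu) = y ^- d.
  rewrite -powR_mulrn ?(ltW y0)// -powRrM -powRD'// -[RHS](powR_invn _ (ltW y0)).
  by congr (_ `^ _); rewrite mulrN nu2; ring.
by rewrite -/(pk v) [y `^ _ * (_ * _)]mulrA e; ring.
Qed.

(** The substitution w = x + y v turns the kernel at height y into the fixed density [PK]; the
    dependence on y moves into the argument of [f], where regularity of [f] can be used. *)
Lemma extE x y : 0 < y -> LR (fun v => PK v * f (x + y *: v)) /\
  ext (half_point x y) = IR (fun v => PK v * f (x + y *: v)).
Proof.
move=> y0; have hz : HS (half_point x y) by rewrite /half_space/= height_half.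
have h := LR_hconv hf kalg_PQ hz.
have yn : y != 0 by rewrite gt_eqF.
have e : (fun v => PK v * f (x + y *: v)) =
    (fun v => y ^+ d * (fun w => PQ (half_point x y - emb w) * f w) (y *: v + x)).
  apply/funext => v /=; rewrite half_pointB_emb [y *: v + x]addrC opprD addNKr.
  rewrite -scalerN PQ_scaled// -[PK (- v)]/(pc * ((1 + sqn (- v)) `^ (- nu))).
  rewrite -sqr_enorm enormN sqr_enorm -/(pk v) -/(PK v) !mulrA mulfV ?mul1r//.
  by rewrite expf_neq0.
rewrite e; split; first by apply: LRZ; exact: (LR_affine x yn h).
rewrite IRZ; last exact: (LR_affine x yn h).
rewrite (IR_affine x yn h) mulrA gtr0_norm// mulfV ?mul1r//.
by rewrite expf_neq0.
Qed.
End extension_of.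
End poisson.

Section poisson_integral.
Variables (R : realType) (d : nat) (s : R).
Hypothesis hs : 0 < s < 1.
Local Notation HS := (@half_space R d).
Variable f : 'rV[R]_d -> R.
Hypothesis hf : LR f.
Local Notation PK := (PK s).

Definition pint (y : R) (x : 'rV[R]_d) : R := IR (fun v => PK v * f (x + y *: v)).

Lemma ext_pint x y : 0 < y -> ext s f (half_point x y) = pint y x.
Proof. by move=> y0; have [_ ->] := extE hs hf x y0. Qed.

Lemma LR_pint_arg x y : 0 < y -> LR (fun v => PK v * f (x + y *: v)).
Proof. by move=> y0; have [] := extE hs hf x y0. Qed.

Lemma pint0 x : pint 0 x = f x.
Proof.
rewrite /pint (_ : (fun v => _) = fun v => f x * PK v).
  by rewrite IRZ; [rewrite IR_PK// mulr1|exact: LR_PK].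
by apply/funext => v; rewrite scale0r addr0 mulrC.
Qed.

(** Fubini: [PK] is a probability density and translations preserve the L^1 norm, so this norm does
    not grow with the height. The identity [key] serves once for [f] and once for |f|. *)
Lemma LR_pint y : 0 < y -> LR (pint y) /\ IR (fun x => `|pint y x|) <= IR (fun x => `|f x|).
Proof.
move=> y0.
have key (g : 'rV[R]_d -> R) : LR g -> [/\ LR (fun x => IR (fun v => PK v * g (x + y *: v))) &
    IR (fun x => IR (fun v => PK v * g (x + y *: v))) = IR g].
  move=> hg; pose F x v := PK v * g (x + y *: v).
  have [] := @IR_fubini R d d F (fun v => IR (fun x => `|g x|) * PK v).
  - apply: measurable_funM.
      apply: (mR_comp (@mcoord_snd R d d)); apply: LR_mR; exact: LR_PK.
    apply: mR_comp; last exact: LR_mR hg.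
    apply: mcoordD; first exact: mcoord_fst.
    by apply: mcoordZ; [exact: measurable_cst|exact: mcoord_snd].
  - by move=> x; have [] := extE hs hg x y0.
  - by move=> v; apply: LRZ; exact: LR_shift.
  - move=> v; rewrite (_ : (fun x => _) = fun x => PK v * `|g (x + y *: v)|).
      rewrite IRZ; last exact: (LR_shift _ (LR_norm hg)).
      by rewrite (IR_shift _ (LR_norm hg)) mulrC.
    by apply/funext => x; rewrite normrM ger0_norm// PK_ge0.
  - by apply: LRZ; exact: LR_PK.
  move=> h1 h2 h3; split; first exact: h1.
  apply: (etrans h3); clear h1 h2 h3.
  have -> : (fun v => IR (F^~ v)) = (fun v => IR g * PK v).
    apply/funext => v; rewrite /F IRZ; last exact: LR_shift.
    by rewrite IR_shift// mulrC.
  by apply: (etrans (IRZ _ (LR_PK d hs))); rewrite (IR_PK d hs) mulr1.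
have [h1 e1] := key f hf; split=> //.
have [h2 e2] := key _ (LR_norm hf); rewrite -e2; apply: le_IR => //; first exact: LR_norm.
move=> x; apply: norm_IR_le.
- exact: LR_pint_arg.
- by have [] := extE hs (LR_norm hf) x y0.
- by move=> v; rewrite normrM ger0_norm// PK_ge0.
Qed.

Lemma pint_decay x y : 0 < y -> `|pint y x| <= pc d s * IR (fun x => `|f x|) * y ^- d.
Proof.
move=> y0; rewrite -ext_pint// /ext /hconv.
have hz : HS (half_point x y) by rewrite /half_space/= height_half.
have h := LR_hconv hf (kalg_PQ d hs) hz.
have -> : pc d s * IR (fun x => `|f x|) * y ^- d = IR (fun w => (pc d s * y ^- d) * `|f w|).
  by rewrite IRZ; [ring|exact: LR_norm].
apply: (norm_IR_le h); first by apply: LRZ; exact: LR_norm.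
move=> w; rewrite half_pointB_emb normrM ler_wpM2r//.
have -> : x - w = y *: (y^-1 *: (x - w)) by rewrite scalerA mulfV ?scale1r// gt_eqF.
have y1 : 0 < y ^- d by rewrite invr_gt0 exprn_gt0.
rewrite PQ_scaled// normrM gtr0_norm// mulrC ler_wpM2r ?(ltW y1)//.
have -> : PK (y^-1 *: (x - w)) = pc d s * pk s (y^-1 *: (x - w)) by [].
rewrite ger0_norm ?mulr_ge0 ?powR_ge0 ?(ltW (pc_gt0 d hs))// ler_piMr ?(ltW (pc_gt0 d hs))//.
rewrite /pk; rewrite [leRHS](_ : 1 = 1 `^ (- nu d s)); last by rewrite powR1.
by apply: powR_anti => //; [rewrite lerDl sqn_ge0|exact: ltW (nu_gt0 d hs)].
Qed.

Section lipschitz.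
Variables (B K : R).
Hypothesis fB : forall x, `|f x| <= B.
Hypothesis fK : forall x y, `|f x - f y| <= K * enorm (x - y).

Lemma lip_B0 : 0 <= B. Proof. exact: le_trans (fB 0). Qed.

Lemma pint_bounded x y : 0 < y -> `|pint y x| <= B.
Proof.
move=> y0; have -> : B = IR (fun v : 'rV[R]_d => B * PK v).
  by rewrite IRZ; [rewrite IR_PK// mulr1|exact: LR_PK].
apply: norm_IR_le; [exact: LR_pint_arg|by apply: LRZ; exact: LR_PK|move=> v].
rewrite normrM (ger0_norm (PK_ge0 hs v)) mulrC.
by apply: ler_wpM2r => //; exact: PK_ge0.
Qed.

(** A bounded Lipschitz function is Hoelder of exponent [s]. This exponent is chosen because |v|^s
    [PK] v is always integrable, whereas |v| [PK] v is not when 2s <= 1. *)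
Lemma holder_of_lip x y : `|f x - f y| <= (2 * B + `|K|) * enorm (x - y) `^ s.
Proof.
case/andP: hs => s0 s1; have B0 := lip_B0; set e := enorm (x - y).
have [e1|e1] := leP 1 e.
  apply: (@le_trans _ _ (2 * B * 1)).
    by rewrite mulr1 (le_trans (ler_normB _ _))//; have := fB x; have := fB y; lra.
  apply: ler_pM => //; [by rewrite mulr_ge0|by rewrite lerDl|].
  have <- : 1 `^ s = 1 :> R by rewrite powR1.
  by apply: ge0_ler_powR; rewrite ?nnegrE// ?(ltW s0) ?enorm_ge0.
have e0 : 0 <= e by exact: enorm_ge0.
apply: (le_trans (fK x y)); rewrite -/e; apply: (@le_trans _ _ (`|K| * e)).
  by rewrite ler_wpM2r// ler_norm.
apply: ler_pM => //; first by rewrite lerDr mulr_ge0.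
have [->|en] := eqVneq e 0; first exact: powR_ge0.
rewrite -[leLHS](powRr1 e0) /powR (negbTE en) ler_expR ler_wnM2r ?(ltW s1)//.
by rewrite ln_le0// ltW.
Qed.

Definition PKs : R := IR (fun v : 'rV[R]_d => PK v * enorm v `^ s).

Lemma LR_PKs : LR (fun v : 'rV[R]_d => PK v * enorm v `^ s).
Proof.
case/andP: (hs) => s0 s1.
have h : LR (fun v : 'rV[R]_d => pc d s * 2 `^ nu d s * (1 + enorm v) `^ (- (d%:R + s))).
  by apply: LRZ; apply: LR_tail; rewrite ltrDl.
apply: (LR_le _ _ h).
  by apply: measurable_funM; [apply: LR_mR; exact: LR_PK|exact: mR_powR].
move=> v; have e0 := enorm_ge0 v; have p0 : 0 < 1 + enorm v by rewrite ltr_wpDr.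
rewrite ger0_norm ?mulr_ge0 ?powR_ge0 ?PK_ge0 ?(ltW (pc_gt0 d hs))//.
have -> : PK v = pc d s * pk s v by [].
rewrite -[leLHS]mulrA -[leRHS]mulrA; apply: ler_wpM2l; first exact: ltW (pc_gt0 d hs).
apply: (@le_trans _ _ (2 `^ nu d s * (1 + enorm v) `^ (- (2 * nu d s)) * (1 + enorm v) `^ s)).
  apply: ler_pM; rewrite ?powR_ge0 ?(pk_le hs)//.
  by apply: ge0_ler_powR; rewrite ?nnegrE ?(ltW s0) ?(ltW p0)// lerDr.
rewrite -mulrA ler_wpM2l ?powR_ge0// -powRD'// nu2.
by rewrite (_ : - (d%:R + 2 * s) + s = - (d%:R + s))//; ring.
Qed.

Lemma pint_holder x y y0 : 0 < y -> 0 <= y0 ->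
  `|pint y x - pint y0 x| <= (2 * B + `|K|) * PKs * `|y - y0| `^ s.
Proof.
move=> yp y0p; set t := `|y - y0|.
have h0 : LR (fun v => PK v * f (x + y0 *: v)).
  move: y0p; rewrite le_eqVlt => /orP[/eqP<-|h]; last exact: LR_pint_arg.
  rewrite (_ : (fun v => _) = fun v => f x * PK v); first exact: LRZ (LR_PK _ hs).
  by apply/funext => v; rewrite scale0r addr0 mulrC.
have h1 := LR_pint_arg x yp.
have -> : (2 * B + `|K|) * PKs * t `^ s =
    IR (fun v : 'rV[R]_d => ((2 * B + `|K|) * t `^ s) * (PK v * enorm v `^ s)).
  by rewrite IRZ; [rewrite /PKs; ring|exact: LR_PKs].
rewrite /pint -IRB//.
apply: norm_IR_le; [exact: LRB|by apply: LRZ; exact: LR_PKs|move=> v].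
rewrite -mulrBr normrM ger0_norm ?PK_ge0// mulrCA ler_wpM2l ?PK_ge0//.
apply: (le_trans (holder_of_lip _ _)).
rewrite opprD addrACA subrr add0r -scalerBl enormZ -/t powRM ?enorm_ge0 ?normr_ge0//.
rewrite mulrA.
exact: lexx.
Qed.
End lipschitz.
End poisson_integral.

Lemma powR_small (R : realType) (C r e : R) : 0 < r -> 0 < e ->
  exists2 del, 0 < del & forall t, 0 <= t -> t < del -> C * t `^ r < e.
Proof.
move=> r0 e0; have C0 : 0 < `|C| + 1 by rewrite ltr_pwDr.
pose q := e / (`|C| + 1); have q0 : 0 < q by exact: divr_gt0.
exists (q `^ r^-1) => [|t t0 td]; first by rewrite powR_gt0.
have E : (q `^ r^-1) `^ r = q by rewrite -powRrM mulVf ?gt_eqF// powRr1// ltW.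
have h : t `^ r < e / (`|C| + 1).
  by rewrite -/q -E; apply: gt0_ltr_powR => //; rewrite ?nnegrE ?powR_ge0.
rewrite ltr_pdivlMr// mulrC in h; apply: le_lt_trans h.
by rewrite ler_wpM2r ?powR_ge0// (le_trans (ler_norm C))// lerDl.
Qed.

(** * The equation in non-divergence form *)

Section weighted_divergence.
Variables (R : realType) (d : nat) (s : R).
Local Notation V := 'rV[R]_(d + 1).
Local Notation HS := (@half_space R d).
Local Notation yc := (ycoord d).

(** The weighted divergence divided by the positive weight y^(1-2s) ([rdivE]). In this form the
    second-derivative test applies at a maximum. *)
Definition lap (g : V -> R) z : R := \sum_i rpartial i (rpartial i g) z +
  (1 - 2 * s) / height z * rpartial yc g z.

Lemma rdivE (g : V -> R) z : rsmooth HS g -> HS z ->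
  \sum_i rpartial i (fun w => height w `^ (1 - 2 * s) * rpartial i g w) z =
  height z `^ (1 - 2 * s) * lap g z.
Proof.
move=> sg hz; have z0 : 0 < height z by [].
have E i : rpartial i (fun w => height w `^ (1 - 2 * s) * rpartial i g w) z =
    height z `^ (1 - 2 * s) * rpartial i (rpartial i g) z +
    (i == yc)%:R * ((1 - 2 * s) * height z `^ (1 - 2 * s - 1) * rpartial yc g z).
  have [h1 h2] := @hpartial_height R d i (1 - 2 * s) z hz.
  rewrite rpartialM//; last exact: (sg [:: i]).
  rewrite h2; congr (_ + _); case: eqVneq => [->|_]; rewrite ?mul1r ?mul0r ?mulr0//.
  by rewrite mulrC.
rewrite (eq_bigr _ (fun i _ => E i)) big_split/= -mulr_sumr /lap mulrDr; congr (_ + _).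
rewrite (bigD1 yc)//= eqxx mul1r big1 ?addr0; last by move=> i /negbTE ->; rewrite mul0r.
have e : height z `^ (1 - 2 * s - 1) = height z `^ (1 - 2 * s) / height z.
  by rewrite powRD'// powR_inv1// ltW.
by rewrite e; field; rewrite gt_eqF.
Qed.

Lemma sum_Complex (I : finType) (F G : I -> R) :
  \sum_i (Complex (F i) (G i) : R[i]) = Complex (\sum_i F i) (\sum_i G i).
Proof. by elim/big_rec3 : _ => [//|i x y z' _ ->]. Qed.

Lemma weighted_div_gradE (u : V -> R[i]) z : weighted_div_grad s u z =
  Complex (\sum_i rpartial i (fun w => height w `^ (1 - 2 * s) * rpartial i (fun w => complex.Re (u w)) w) z)
          (\sum_i rpartial i (fun w => height w `^ (1 - 2 * s) * rpartial i (fun w => complex.Im (u w)) w) z).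
Proof.
rewrite /weighted_div_grad.
have E i : partial i (fun w => (height w `^ (1 - 2 * s))%:C%C * partial i u w) z =
   Complex (rpartial i (fun w => height w `^ (1 - 2 * s) * rpartial i (fun w => complex.Re (u w)) w) z)
   (rpartial i (fun w => height w `^ (1 - 2 * s) * rpartial i (fun w => complex.Im (u w)) w) z).
  have e1 : (fun w => complex.Re ((height w `^ (1 - 2 * s))%:C%C * partial i u w)) =
    (fun w => height w `^ (1 - 2 * s) * rpartial i (fun w => complex.Re (u w)) w).
    by apply/funext => w /=; rewrite mul0r subr0.
  have e2 : (fun w => complex.Im ((height w `^ (1 - 2 * s))%:C%C * partial i u w)) =
    (fun w => height w `^ (1 - 2 * s) * rpartial i (fun w => complex.Im (u w)) w).
    by apply/funext => w /=; rewrite mul0r addr0.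
  by rewrite {1}/partial e1 e2.
rewrite (eq_bigr _ (fun i _ => E i)).
exact: sum_Complex.
Qed.

Lemma lap_ReIm (u : V -> R[i]) z : smooth_on HS u -> HS z ->
  weighted_div_grad s u z = 0 <->
  lap (fun w => complex.Re (u w)) z = 0 /\ lap (fun w => complex.Im (u w)) z = 0.
Proof.
move=> /smooth_onE[s1 s2] hz.
have e1 := rdivE s1 hz; have e2 := rdivE s2 hz.
have E : weighted_div_grad s u z = Complex (height z `^ (1 - 2 * s) * lap (fun w => complex.Re (u w)) z)
  (height z `^ (1 - 2 * s) * lap (fun w => complex.Im (u w)) z).
  by apply: (etrans (weighted_div_gradE _ _)); rewrite -e1 -e2.
rewrite E; clear E e1 e2 s1 s2.

have p : height z `^ (1 - 2 * s) != 0 by rewrite gt_eqF// powR_gt0.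
split=> [[/eqP e1 /eqP e2]|[-> ->]]; last by rewrite mulr0.
by move: e1 e2; rewrite !mulf_eq0 (negbTE p)/= => /eqP-> /eqP->.
Qed.
End weighted_divergence.

Section L2_facts.
Variables (R : realType) (n : nat).
Implicit Types g : 'rV[R]_n -> R[i].
Local Notation sq g := (fun x => complex.Re (g x) ^+ 2 + complex.Im (g x) ^+ 2).

Lemma sqr_normc (z : R[i]) :
  ComplexField.Normc.normc z ^+ 2 = complex.Re z ^+ 2 + complex.Im z ^+ 2.
Proof. by case: z => a b /=; rewrite sqr_sqrtr// addr_ge0 ?sqr_ge0. Qed.

Lemma L2normE g : L2norm g = (poweR (\int[leb_tuple R n]_t (sq g (rV_of_tuple t))%:E) 2^-1)%E.
Proof.
rewrite /L2norm unlock; congr poweR; apply: eq_integral => t _ /=.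
rewrite powR_mulrn// real_normK ?num_real//.
by rewrite sqr_normc.
Qed.

Lemma L2norm_LR g : LR (sq g) -> L2norm g = (Num.sqrt (IR (sq g)))%:E.
Proof.
move=> h; rewrite L2normE Int_EFin// poweR_EFin powR12_sqrt//.
by apply: Int_ge0 => t; rewrite addr_ge0 ?sqr_ge0.
Qed.

Lemma L2_LR g : L2 g -> LR (sq g).
Proof.
move=> [m1 m2 fin]; apply/integrableP; split.
  by apply/measurable_EFinP; apply: measurable_funD; apply: measurable_funX.
move: fin; rewrite L2normE.
rewrite (_ : (fun x => `|_|%E) = fun t => (sq g (rV_of_tuple t))%:E); last first.
  by apply/funext => t /=; rewrite ger0_norm// addr_ge0 ?sqr_ge0.
rewrite ltey; case: (ltP (\int[leb_tuple R n]_t (sq g (rV_of_tuple t))%:E)%E +oo%E) => //.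
by rewrite leye_eq => /eqP ->; rewrite poweRyr// invr_neq0.
Qed.

Lemma cvge0_squeeze T (F : set_system T) (FF : Filter F) (h : T -> \bar R) (b : T -> R) :
  (\forall t \near F, exists2 r, h t = r%:E & 0 <= r <= b t) ->
  b @ F --> 0 -> h @ F --> 0%E.
Proof.
move=> H b0; apply/fine_cvgP; split.
  by apply: filterS H => t [r -> _].
apply/cvgrPdist_lt => e e0; move/cvgrPdist_lt : b0 => /(_ e e0) b0.
apply: filterS2 H b0 => t [r hr /andP[r0 rb]]; rewrite sub0r normrN => be.
by rewrite /= hr sub0r normrN ger0_norm// (le_lt_trans rb)// (le_lt_trans (ler_norm _)).
Qed.
End L2_facts.

Lemma normc_rc (R : realType) (a : R) : ComplexField.Normc.normc (a%:C%C : R[i]) = `|a|.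
Proof. by rewrite /= expr0n/= addr0 sqrtr_sqr. Qed.

Lemma LR_sqM (R : realType) n (p g : 'rV[R]_n -> R) : mR p -> mR g ->
  LR (fun x => p x ^+ 2) -> LR (fun x => g x ^+ 2) -> LR (fun x => p x * g x).
Proof.
move=> mp mg hp hg; apply: (LR_le _ _ (LRD hp hg)); first exact: measurable_funM.
move=> x; rewrite normrM -(real_normK (num_real (p x))) -(real_normK (num_real (g x))).
have := sqr_ge0 (`|p x| - `|g x|); rewrite sqrrB.
have := sqr_ge0 `|p x|; have := sqr_ge0 `|g x|; lra.
Qed.

(** * The Poisson integral belongs to the extension class *)

Section extension_of_lipschitz.
Variables (R : realType) (d : nat) (s : R).
Hypothesis d0 : (0 < d)%N.
Hypothesis hs : 0 < s < 1.
Local Notation HS := (@half_space R d).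
Variable f : 'rV[R]_d -> R.
Hypothesis hf : LR f.
Variables (B K : R).
Hypothesis fB : forall x, `|f x| <= B.
Hypothesis fK : forall x y, `|f x - f y| <= K * enorm (x - y).
Let N := IR (fun x => `|f x|).
Let fC := fun x => ((f x)%:C%C : R[i]).
Let u := fun z : 'rV[R]_(d + 1) => ((ext s f z)%:C%C : R[i]).
Let pint := pint s f.

Lemma norm_lsub (w : 'rV[R]_(d + 1)) : `|lsubmx w| <= `|w|.
Proof.
rewrite [leLHS]/Num.norm/= mx_normrE; apply: bigmax_le => [|[i0 i] _ /=]; first exact: normr_ge0.
by rewrite ord1 mxE; exact: norm_coord.
Qed.

Lemma half_pointE (z : 'rV[R]_(d + 1)) : z = half_point (lsubmx z) (height z).
Proof.
rewrite -[LHS]hsubmxK /half_point; congr row_mx.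
by apply/matrixP => i j; rewrite !mxE ord1; congr (z _ _); rewrite ?ord1 // /ycoord; congr rshift; rewrite ord1.
Qed.

Lemma slice_ext y : 0 < y -> slice u y = fun x => ((pint y x)%:C%C : R[i]).
Proof. by move=> y0; apply/funext => x; rewrite /slice /u ext_pint. Qed.

Lemma hold_y0 e : 0 < e -> exists2 del, 0 < del & forall y y0 x, 0 < y -> 0 <= y0 ->
  `|y - y0| < del -> `|pint y x - pint y0 x| < e.
Proof.
case/andP: (hs) => s0 _ e0.
have [del del0 h] := powR_small ((2 * B + `|K|) * PKs d s) s0 e0.
exists del => // y y0 x yp y0p yd; apply: le_lt_trans (pint_holder hs hf fB fK x yp y0p) _.
exact: h.
Qed.

Lemma lip_cont_ext x0 : ccvg (within HS (nbhs (half_point x0 0))) u (fC x0).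
Proof.
have Bb := lip_B0 fB.
apply/cvgrPdist_lt => e e0.
have e2 : 0 < e / 2 by exact: divr_gt0.
have [del del0 hdel] := hold_y0 e2.
pose D := `|K| * d%:R + 1; have D0 : 0 < D by rewrite ltr_wpDl// mulr_ge0.
have r0 : 0 < Num.min del (e / 2 / D) by rewrite lt_min del0 divr_gt0.
apply/nbhs_ballP; exists (Num.min del (e / 2 / D)) => // z.
rewrite mx_norm_ball /ball_/= lt_min => /andP[z1 z2] hz.
have hz' : 0 < height z by [].
rewrite subrr expr0n/= addr0 sqrtr_sqr sub0r normrN normr_id.
rewrite {1}(half_pointE z) ext_pint//.
have a1 : `|pint (height z) (lsubmx z) - pint 0 (lsubmx z)| < e / 2.
  apply: hdel => //; rewrite subr0 ger0_norm ?(ltW hz')//; apply: le_lt_trans z1.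
  have := norm_height (half_point x0 0 - z).
  have -> : height (half_point x0 0 - z) = - height z.
    by have := height_half x0 0; rewrite /height !mxE => ->; rewrite sub0r.
  rewrite normrN.
  by rewrite gtr0_norm.
have a2 : `|f (lsubmx z) - f x0| < e / 2.
  apply: (le_lt_trans (fK _ _)).
  apply: (@le_lt_trans _ _ (`|K| * d%:R * `|half_point x0 0 - z|)).
    apply: (@le_trans _ _ (`|K| * enorm (lsubmx z - x0))).
      by rewrite ler_wpM2r ?enorm_ge0// ler_norm.
    rewrite -mulrA ler_wpM2l// (le_trans (enorm_le_norm _))// ler_wpM2l// distrC.
    have -> : x0 - lsubmx z = lsubmx (half_point x0 0 - z).
      by rewrite linearB/= /half_point row_mxKl.
    exact: norm_lsub.
  rewrite ltr_pdivlMr// in z2; apply: le_lt_trans z2.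
  by rewrite mulrC ler_wpM2l// lerDl.
have p0 : pint 0 (lsubmx z) = f (lsubmx z) by exact: pint0.
rewrite p0 in a1; rewrite -/(pint (height z) (lsubmx z)).
apply: (@le_lt_trans _ _ (`|pint (height z) (lsubmx z) - f (lsubmx z)| + `|f (lsubmx z) - f x0|)).
  exact: ler_distD.
lra.
Qed.

Lemma rpartial_sub_smooth : smooth_on HS u.
Proof.
apply/smooth_onE; split; first exact: (ext_smooth hs hf).
by apply: rsmooth_cst; exact: open_half_space.
Qed.

Lemma ext_div z : HS z -> weighted_div_grad s u z = 0.
Proof.
move=> hz; apply/(lap_ReIm s rpartial_sub_smooth hz); split; first exact: (ext_harmonic hs hf).
have e i : rpartial i (fun _ : 'rV[R]_(d + 1) => 0 : R) = (fun=> 0).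
  by apply/funext => w; exact: rpartial_cst.
have -> : (fun w => complex.Im (u w)) = (fun=> 0) by [].
rewrite /lap big1; first by rewrite add0r rpartial_cst mulr0.
by move=> i _; rewrite e rpartial_cst.
Qed.

Lemma LR_sq_of (g : 'rV[R]_d -> R) C : LR g -> (forall x, `|g x| <= C) ->
  LR (fun x => g x ^+ 2) /\ IR (fun x => g x ^+ 2) <= C * IR (fun x => `|g x|).
Proof.
move=> hg gC; have hn := LR_norm hg.
have b x : `|g x ^+ 2| <= C * `|g x|.
  by rewrite normrX expr2 ler_wpM2r.
have h : LR (fun x => g x ^+ 2).
  by apply: (LR_le _ b); [exact: measurable_funX (LR_mR hg)|exact: LRZ].
split=> //; rewrite -IRZ//; apply: le_IR => //; first exact: LRZ.
by move=> x; apply: le_trans (b x); exact: ler_norm.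
Qed.

Lemma L2norm_rc (g : 'rV[R]_d -> R) : LR (fun x => g x ^+ 2) ->
  L2norm (fun x => (g x)%:C%C : R[i]) = (Num.sqrt (IR (fun x => g x ^+ 2)))%:E.
Proof.
have e : (fun x => complex.Re ((g x)%:C%C : R[i]) ^+ 2 + complex.Im ((g x)%:C%C : R[i]) ^+ 2) = fun x => g x ^+ 2.
  by apply/funext => x /=; rewrite expr0n/= addr0.
by move=> h; rewrite L2norm_LR e.
Qed.

Lemma L2_slice y : 0 < y -> L2 (slice u y).
Proof.
move=> y0; rewrite slice_ext//; have [h1 h2] := LR_pint hs hf y0.
have [h3 h4] := LR_sq_of h1 (fun x => pint_bounded hs hf fB x y0).
split; [exact: LR_mR h1|exact: measurable_cst|].
by rewrite L2norm_rc// ltry.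
Qed.

(* Both the continuity in y > 0 and the limit at 0: the difference is small in sup norm and bounded in L^1. *)
Lemma L2_diff (F : set_system R) (FF : Filter F) (g : 'rV[R]_d -> R) y0 : 0 <= y0 ->
  g = pint y0 -> LR g -> IR (fun x => `|g x|) <= N ->
  (forall del, 0 < del -> \forall y \near F, 0 < y /\ `|y - y0| < del) ->
  L2norm (fun x => slice u y x - (g x)%:C%C) @[y --> F] --> 0%E.
Proof.
move=> y00 ge hg gN hF.
have s0 : 0 < s by case/andP: hs.
pose C := (2 * B + `|K|) * PKs d s.
have key y : 0 < y -> exists2 r, L2norm (fun x => slice u y x - (g x)%:C%C) = r%:E &
   0 <= r <= Num.sqrt (C * `|y - y0| `^ s * (2 * N)).
  move=> yp; have [h1 h2] := LR_pint hs hf yp.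
  have hd : LR (fun x => pint y x - g x) by exact: LRB.
  have bd x : `|pint y x - g x| <= C * `|y - y0| `^ s by rewrite ge; exact: pint_holder.
  have [h3 h4] := LR_sq_of hd bd.
  have e : (fun x => slice u y x - (g x)%:C%C) = fun x => ((pint y x - g x)%:C%C : R[i]).
    by apply/funext => x; rewrite slice_ext// rmorphB.
  rewrite e L2norm_rc//; exists (Num.sqrt (IR (fun x => (pint y x - g x) ^+ 2))) => //.
  rewrite sqrtr_ge0/=; apply: ler_wsqrtr; apply: (le_trans h4).
  apply: ler_wpM2l; first exact: le_trans (bd 0).
  apply: (@le_trans _ _ (IR (fun x => `|pint y x| + `|g x|))).
    apply: le_IR; [exact: LR_norm|by apply: LRD; exact: LR_norm|by move=> x; exact: ler_normB].
  rewrite IRD; [|exact: LR_norm|exact: LR_norm].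
  by rewrite mulr_natl mulr2n; apply: lerD.
apply: (@cvge0_squeeze _ _ F FF _ (fun y => Num.sqrt (C * `|y - y0| `^ s * (2 * N)))).
  by apply: filterS (hF 1 ltr01) => y [yp _]; exact: key.
apply/cvgrPdist_lt => e e0.
have e20 : 0 < e ^+ 2 by exact: exprn_gt0.
have [del del0 h] := powR_small (C * (2 * N)) s0 e20.
apply: filterS (hF del del0) => y [yp yd].
rewrite sub0r normrN [ltLHS]ger0_norm ?sqrtr_ge0//.
rewrite -[ltRHS](ger0_norm (ltW e0)) -(sqrtr_sqr e) ltr_sqrt//.
by rewrite mulrAC; apply: h.
Qed.

(** The square integral of a slice is at most its sup norm, of order y^-d, times its L^1 norm, which
    stays bounded; as d > 0 it tends to 0, so the convergence is even strong in L^2. *)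
Lemma weak_vanish (g : 'rV[R]_d -> R) e : LR (fun x => g x ^+ 2) -> mR g -> 0 < e ->
  \forall y \near +oo, `|IR (fun x => pint y x * g x)| < e.
Proof.
move=> hg mg e0; set G := IR (fun x => g x ^+ 2).
have G0 : 0 <= G by apply: IR_ge0 => x; exact: sqr_ge0.
(* Weight in |p g| <= (p^2 / eta + eta g^2) / 2: it is fixed first, to make the part of [g] small,
   and then [Y] below makes the part of the slice small. *)
pose eta := e / (G + 1); have G1 : 0 < G + 1 by rewrite ltr_wpDl.
have eta0 : 0 < eta by exact: divr_gt0.
pose P := pc d s * N; have N0 : 0 <= N by exact: IR_ge0.
have P0 : 0 <= P by rewrite mulr_ge0// ltW// pc_gt0.
pose Y := 1 + P * N / (eta * e).
have Y1 : 1 <= Y by rewrite /Y lerDl; apply: divr_ge0; apply: mulr_ge0 => //; exact: ltW.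
near=> y.
have yY : Y < y by near: y; apply: nbhs_pinfty_gt; rewrite num_real.
have y0 : 0 < y by apply: lt_trans yY; apply: lt_le_trans Y1.
have [h1 h2] := LR_pint hs hf y0.
have [h3 h4] := LR_sq_of h1 (fun x => pint_decay hs hf x y0).
have b x : `|pint y x * g x| <= 2^-1 * (eta^-1 * pint y x ^+ 2 + eta * g x ^+ 2).
  rewrite normrM -(ler_pM2l (mulr_gt0 (ltr0n R 2) eta0)).
  have -> : 2 * eta * (2^-1 * (eta^-1 * pint y x ^+ 2 + eta * g x ^+ 2)) =
     pint y x ^+ 2 + eta ^+ 2 * g x ^+ 2 by field; rewrite gt_eqF.
  rewrite -(real_normK (num_real (pint y x))) -(real_normK (num_real (g x))).
  have := sqr_ge0 (`|pint y x| - eta * `|g x|); rewrite sqrrB exprMn; lra.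
have hb : LR (fun x => 2^-1 * (eta^-1 * pint y x ^+ 2 + eta * g x ^+ 2)).
  by apply: LRZ; apply: LRD; exact: LRZ.
have hp : LR (fun x => pint y x * g x).
  by apply: (LR_le _ b hb); apply: measurable_funM mg; exact: LR_mR h1.
apply: (le_lt_trans (norm_IR_le hp hb b)).
rewrite IRZ; last by apply: LRD; exact: LRZ.
rewrite IRD; [|exact: LRZ|exact: LRZ]; rewrite !IRZ// -/G.
have t1 : eta * G < e by rewrite /eta mulrAC ltr_pdivrMr// ltr_pM2l// ltrDl.
have t2 : eta^-1 * IR (fun x => pint y x ^+ 2) < e.
  rewrite ltr_pdivrMl//; apply: (le_lt_trans h4).
  apply: (@le_lt_trans _ _ (P * y ^- d * N)).
    by apply: ler_wpM2l h2; rewrite mulr_ge0// invr_ge0 exprn_ge0// ltW.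
  have yd : Y < y ^+ d.
    apply: (lt_le_trans yY); rewrite -[leLHS]expr1; apply: ler_weXn2l d0.
    by apply: ltW; apply: le_lt_trans yY.
  have yd0 : 0 < y ^+ d by exact: exprn_gt0.
  rewrite mulrAC ltr_pdivrMr//.
  have : P * N / (eta * e) < y ^+ d by apply: lt_trans yd; rewrite ltrDr.
  by move=> h5; rewrite [ltRHS]mulrC -ltr_pdivrMr// mulr_gt0.
lra.
Unshelve. all: by end_near.
Qed.

Theorem cs_extension_ext : cs_extension s fC u.
Proof.
have s0 : 0 < s by case/andP: hs.
split; [exact: rpartial_sub_smooth|exact: ext_div|exact: lip_cont_ext| |].
- split; first exact: L2_slice.
  + move=> y0 y00; have [h1 h2] := LR_pint hs hf y00.
    have e : (fun y => L2norm (fun x => slice u y x - slice u y0 x)) =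
        fun y => L2norm (fun x => slice u y x - (pint y0 x)%:C%C).
      by apply/funext => y; rewrite [slice u y0]slice_ext.
    rewrite e; apply: (L2_diff _ (ltW y00) erefl h1 h2) => del del0.
    near=> y; split; first by near: y; exact: lt_nbhsr.
    by rewrite distrC; near: y; apply: (@cvgr_dist_lt _ _ _ (nbhs y0) _ id y0).
  + apply: (L2_diff _ (lexx 0) _ hf (lexx _)) => [|del del0].
      by apply/funext => x; rewrite /pint pint0.
    near=> y; split; first by near: y; exact: nbhs_right_gt.
    have y0 : 0 < y by near: y; exact: nbhs_right_gt.
    by rewrite subr0 gtr0_norm//; near: y; exact: nbhs_right_lt.
- move=> g hg; have hg2 := L2_LR hg; case: hg => m1 m2 _.
  have hsub (p : 'rV[R]_d -> R) : mR p -> (forall x, p x ^+ 2 <= complex.Re (g x) ^+ 2 + complex.Im (g x) ^+ 2) ->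
      LR (fun x => p x ^+ 2).
    move=> mp pg; apply: (LR_le _ _ hg2); first exact: measurable_funX.
    by move=> x; rewrite ger0_norm ?sqr_ge0.
  have hr : LR (fun x => complex.Re (g x) ^+ 2).
    by apply: hsub m1 _ => x; rewrite lerDl sqr_ge0.
  have hi : LR (fun x => complex.Im (g x) ^+ 2).
    by apply: hsub m2 _ => x; rewrite lerDr sqr_ge0.
  apply/cvgrPdist_lt => e e0.
  have e2 : 0 < e / 2 by exact: divr_gt0.
  near=> y.
  have y0 : 0 < y by near: y; exact: nbhs_pinfty_gt.
  have r1 : `|IR (fun x => pint y x * complex.Re (g x))| < e / 2.
    by near: y; exact: weak_vanish.
  have r2 : `|IR (fun x => pint y x * complex.Im (g x))| < e / 2.
    by near: y; exact: weak_vanish.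
  have -> : cintegral (fun x => slice u y x * (g x)^*%C) =
     Complex (IR (fun x => pint y x * complex.Re (g x))) (IR (fun x => - 1 * (pint y x * complex.Im (g x)))).
    rewrite slice_ext// /cintegral; congr Complex; congr (Rintegral _ _ _); apply/funext => t /=;
      case: (g (rV_of_tuple t)) => a b /=; ring.
  rewrite sub0r normrN ger0_norm ?sqrtr_ge0//.
  set c : R[i] := Complex _ _.
  have -> : c - 0 = c by rewrite subr0.
  apply: (le_lt_trans (le_normc_ReIm c)) => /=.
  have -> : IR (fun x => - 1 * (pint y x * complex.Im (g x))) = - IR (fun x => pint y x * complex.Im (g x)).
    rewrite -[RHS]mulN1r; apply: IRZ; have [h1 _] := LR_pint hs hf y0.
    have [h3 _] := LR_sq_of h1 (fun x => pint_bounded hs hf fB x y0).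
    exact: LR_sqM (LR_mR h1) m2 h3 hi.
  by rewrite normrN (splitr e) ltrD.
Unshelve. all: by end_near.
Qed.
End extension_of_lipschitz.

(** * The fractional Laplacian and the normal derivative *)

Lemma cvg_powR (R : realType) T (F : set_system T) (FF : Filter F) (u : T -> R) (l p : R) :
  0 < l -> u @ F --> l -> (fun t => u t `^ p) @ F --> l `^ p.
Proof.
move=> l0 ul; apply: (@continuous_cvg _ _ _ F FF u (fun a : R => a `^ p) l) => //.
apply: differentiable_continuous; apply/derivable1_diffP.
by have [] := is_derive1_powR p l0.
Qed.

Section fractional_operator.
Variables (R : realType) (d : nat) (s : R).
Hypothesis hs : 0 < s < 1.
Local Notation V := 'rV[R]_d.
Local Notation HS := (@half_space R d).
Local Notation yc := (ycoord d).
Local Notation nu := (nu d s).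

Definition D2 (f : V -> R) (x z : V) : R := f (x + z) + f (x - z) - 2 * f x.

(* Up to a negative constant this is the fractional Laplacian. *)
Definition Lop (f : V -> R) (x : V) : R := IR (fun z => D2 f x z * enorm z `^ (- (2 * nu))).

(** Majorant of the kernel once the second difference has gained |z|^2 near the origin. It is
    integrable at 0 because s < 1 and at infinity because s > 0. *)
Definition swgt : V -> R := wgt (2 - 2 * nu) (- (2 * nu)).

Lemma LR_swgt : LR swgt.
Proof. by case/andP: hs => s0 s1; apply: LR_wgt; rewrite nu2; lra. Qed.

Lemma D2_0 f x : D2 f x 0 = 0.
Proof. by rewrite /D2 subr0 addr0; ring. Qed.

Section bounded.
Variables (f : V -> R) (B K : R) (x : V).
Hypothesis fB : forall x, `|f x| <= B.
Hypothesis fK : forall z, `|D2 f x z| <= K * enorm z ^+ 2.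

Lemma D2_le z : `|D2 f x z| <= 4 * B.
Proof.
have h1 := fB (x + z); have h2 := fB (x - z); have h3 := fB x.
rewrite /D2; apply: (le_trans (ler_normB _ _)).
apply: (@le_trans _ _ ((`|f (x + z)| + `|f (x - z)|) + `|2 * f x|)).
  by rewrite lerD2r ler_normD.
by rewrite normrM ger0_norm//; lra.
Qed.

Lemma D2_wgt_le z : `|D2 f x z * enorm z `^ (- (2 * nu))| <= (`|K| + 4 * B) * swgt z.
Proof.
have B0 : 0 <= B by exact: le_trans (fB 0).
have e0 := enorm_ge0 z; rewrite normrM (ger0_norm (powR_ge0 _ _)) /swgt /wgt.
have [->|z0] := eqVneq z 0.
  by rewrite D2_0 normr0 mul0r; case: ifP => _; rewrite mulr_ge0 ?powR_ge0 ?addr_ge0 ?mulr_ge0.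
have ep : 0 < enorm z by rewrite enorm_gt0.
case: ifP => z1.
  apply: (@le_trans _ _ (`|K| * enorm z ^+ 2 * enorm z `^ (- (2 * nu)))).
    apply: ler_wpM2r; first exact: powR_ge0.
    by apply: (le_trans (fK z)); rewrite ler_wpM2r ?exprn_ge0 ?ler_norm.
  rewrite -mulrA -powR_mulrn// -powRD'//; apply: ler_wpM2r; first exact: powR_ge0.
  by rewrite lerDl mulr_ge0.
apply: ler_wpM2r; first exact: powR_ge0.
by apply: (le_trans (D2_le z)); rewrite lerDr.
Qed.

Lemma mR_D2 : mR f -> mR (D2 f x).
Proof.
move=> mf; have mx : mcoord (fun t : d.-tuple (measurableTypeR R) => x + rV_of_tuple t).
  by apply: mcoordD; [exact: mcoord_cst|exact: mcoord_tuple].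
have mx' : mcoord (fun t : d.-tuple (measurableTypeR R) => x - rV_of_tuple t).
  by apply: mcoordD; [exact: mcoord_cst|apply: mcoordN; exact: mcoord_tuple].
apply: measurable_funB; last exact: measurable_cst.
by apply: measurable_funD; [exact: mR_comp mx mf|exact: mR_comp mx' mf].
Qed.

Lemma LR_Lop : mR f -> LR (fun z => D2 f x z * enorm z `^ (- (2 * nu))).
Proof.
move=> mf; apply: (LR_le _ D2_wgt_le); last by apply: LRZ; exact: LR_swgt.
by apply: measurable_funM; [exact: mR_D2|exact: mR_powR].
Qed.

Lemma Lop_le : mR f -> `|Lop f x| <= (`|K| + 4 * B) * IR swgt.
Proof.
move=> mf; rewrite -IRZ; last exact: LR_swgt.
by apply: norm_IR_le D2_wgt_le; [exact: LR_Lop|by apply: LRZ; exact: LR_swgt].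
Qed.
End bounded.

(** Up to the factor [pc d s], the weighted vertical derivative y^(1-2s) d/dy of the Poisson kernel
    ([kqE]). As y -> 0 it tends to 2s |z|^(-2 nu), the kernel of [Lop] times 2s. *)
Definition nker (y : R) (z : V) : R := 2 * s * (sqn z + y ^+ 2) `^ (- nu) -
  2 * nu * y ^+ 2 * (sqn z + y ^+ 2) `^ (- nu - 1).

Let sqy_gt0 (z : V) y : 0 < y -> 0 < sqn z + y ^+ 2.
Proof. by move=> y0; rewrite ltr_wpDl ?sqn_ge0// exprn_gt0. Qed.

Let kqE y z : 0 < y -> y `^ (1 - 2 * s) * PQ1 s yc (half_point z y) = pc d s * nker y z.
Proof.
move=> y0; have S0 := sqy_gt0 z y0; rewrite /PQ1 eqxx height_half sqn_half /nker.
have -> : half_point z y 0 yc = y by have := height_half z y.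
have -> : true%:R = 1 :> R by [].
have -> : y `^ (2 * s - 1) = y `^ (2 * s) / y by rewrite powRD'// powR_inv1// ltW.
have -> : y `^ (1 - 2 * s) = y / y `^ (2 * s) by rewrite powRD'// powRr1 ?(ltW y0)// powRN.
rewrite [_ `^ (- nu - 1)]powRD'// powR_inv1 ?(ltW S0)//.
have yn : y `^ (2 * s) != 0 by rewrite gt_eqF// powR_gt0.
by field; rewrite yn !gt_eqF.
Qed.

Let kq_mR y : mR (nker y).
Proof.
have ms p : mR (fun z : V => (sqn z + y ^+ 2) `^ p).
  apply: (measurableT_comp (measurable_powR _)).
  by apply: measurable_funD; [exact: mR_sqn|exact: measurable_cst].
by apply: measurable_funB; apply: measurable_funM; (exact: ms || exact: measurable_cst).
Qed.

Let kq_le y z : 0 < y -> `|nker y z| <= (2 * s + 2 * nu) * (sqn z + y ^+ 2) `^ (- nu).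
Proof.
move=> y0; have S0 := sqy_gt0 z y0; have n0 := nu_gt0 d hs; case/andP: (hs) => s0 _.
have p0 := powR_ge0 (sqn z + y ^+ 2) (- nu).
rewrite /nker powRD'// powR_inv1 ?(ltW S0)//; set a := _ `^ _ in p0 *.
have q : 0 <= y ^+ 2 / (sqn z + y ^+ 2) <= 1.
  by rewrite divr_ge0 ?sqr_ge0 ?(ltW S0)//= ler_pdivrMr// mul1r lerDr sqn_ge0.
rewrite (_ : _ - _ = (2 * s - 2 * nu * (y ^+ 2 / (sqn z + y ^+ 2))) * a); last by ring.
rewrite normrM (ger0_norm p0) ler_wpM2r//.
case/andP: q; set b := _ / _ => b0 b1; apply: (le_trans (ler_normB _ _)).
have n2 : 0 <= 2 * nu by rewrite mulr_ge0// ltW.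
have s2 : 0 <= 2 * s by rewrite mulr_ge0// ltW.
by rewrite (ger0_norm s2) (ger0_norm (mulr_ge0 n2 b0)) lerD2l ler_piMr.
Qed.

Let kq_scale y v : 0 < y -> nker y (y *: v) = y `^ (- (2 * nu)) * nker 1 v.
Proof.
move=> y0; have o := one_sqn_gt0 v.
have y2 : 0 < y ^+ 2 by exact: exprn_gt0.
have e : sqn (y *: v) + y ^+ 2 = y ^+ 2 * (1 + sqn v).
  by rewrite -!sqr_enorm enormZ exprMn real_normK ?num_real//; ring.
have e2 : (y ^+ 2) `^ (- nu) = y `^ (- (2 * nu)).
  by rewrite -powR_mulrn ?(ltW y0)// -powRrM; congr (_ `^ _); ring.
have E p : (y ^+ 2 * (1 + sqn v)) `^ p = (y ^+ 2) `^ p * (1 + sqn v) `^ p.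
  by rewrite powRM// ltW.
rewrite /nker e expr1n [sqn v + 1]addrC !E e2.
rewrite [(y ^+ 2) `^ (- nu - 1)]powRD'// e2 powR_inv1 ?(ltW y2)//.
by field; rewrite gt_eqF.
Qed.

Let kq1_LR : LR (nker 1).
Proof.
have h : LR (fun z : V => (2 * s + 2 * nu) * pk s z) by apply: LRZ; exact: LR_pk.
apply: (LR_le (kq_mR 1) _ h) => z.
by have := kq_le z ltr01; rewrite expr1n [sqn z + 1]addrC.
Qed.

Let kq_LR y : 0 < y -> LR (nker y).
Proof.
move=> y0; have yi : y^-1 != 0 by rewrite invr_eq0 gt_eqF.
have h := LRZ (y `^ (- (2 * nu))) (LR_scale yi kq1_LR).
rewrite (_ : nker y = fun x => y `^ (- (2 * nu)) * nker 1 (y^-1 *: x))//.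
by apply/funext => z; rewrite -kq_scale// scalerA mulfV ?scale1r// gt_eqF.
Qed.

Section derivative.
Variable f : V -> R.
Hypothesis hf : LR f.

Let nder y x : R := y `^ (1 - 2 * s) * rpartial yc (ext s f) (half_point x y).

Let hs_half (x : V) y : 0 < y -> HS (half_point x y).
Proof. by move=> y0; rewrite /half_space/= height_half. Qed.

Let kq_even y z : nker y (- z) = nker y z.
Proof. by rewrite /nker -sqr_enorm enormN sqr_enorm. Qed.

Lemma nder_repr y x : 0 < y -> LR (fun z => nker y z * f (x + z)) /\
  nder y x = pc d s * IR (fun z => nker y z * f (x + z)).
Proof.
move=> y0; have hz := hs_half x y0.
have h := LR_hconv hf (kalg_PQ1 hs yc) hz.
have e : (fun z => nker y z * f (x + z)) = fun z =>
    (pc d s)^-1 * (y `^ (1 - 2 * s) * (PQ1 s yc (half_point x y - emb (1 *: z + x)) * f (1 *: z + x))).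
  apply/funext => z; rewrite scale1r half_pointB_emb opprD addrCA subrr addr0 mulrA mulrA.
  rewrite -[(_^-1 * _) * _]mulrA kqE// kq_even [z + x]addrC.
  by rewrite -mulrA mulrA mulVf ?mul1r// gt_eqF// pc_gt0.
have h2 := LR_affine x (oner_neq0 R) h.
have h3 := IR_affine x (oner_neq0 R) h.
split; first by rewrite e; do 2!apply: LRZ; exact: h2.
rewrite e IRZ; last by apply: LRZ; exact: h2.
rewrite IRZ; last exact: h2.
rewrite mulrA mulfV ?gt_eqF ?pc_gt0// mul1r h3 normr1 expr1n invr1 mul1r.
by rewrite /nder rpartial_ext.
Qed.

Lemma nder_sym y x : 0 < y -> nder y x = pc d s / 2 * IR (fun z => nker y z * (f (x + z) + f (x - z))) /\
  LR (fun z => nker y z * (f (x + z) + f (x - z))).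
Proof.
move=> y0; have [h1 h2] := nder_repr x y0.
have h3 := LR_opp h1; have e3 := IR_opp h1.
have e : (fun z => nker y z * (f (x + z) + f (x - z))) =
   fun z => nker y z * f (x + z) + nker y (- z) * f (x + - z).
  by apply/funext => z; rewrite kq_even mulrDr.
rewrite e; split; last exact: LRD.
by rewrite IRD// e3 h2; field.
Qed.

End derivative.

(* Test the derivative formula against growing boxes: the extension of 1 is constant. *)
Lemma IR_kq1 : IR (nker 1) = 0.
Proof.
have p0 := pc_gt0 d hs.
pose F k : V -> R := boxi k.+1%:R.
have hF k : LR (F k) by have [] := @LR_boxi R d k.+1%:R (ler0n _ _).
have F01 k x : 0 <= F k x <= 1 by rewrite /F boxiE; case: [forall i, _]; rewrite ?lexx ?ler01.
have boxLR k (g : V -> R) (y : R) : LR g -> LR (fun v => g v * F k (y *: v)).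
  move=> hg; apply: (LR_le _ _ (LR_norm hg)).
    apply: measurable_funM; first exact: LR_mR hg.
    apply: mR_comp; last exact: LR_mR (hF k).
    by apply: mcoordZ; [exact: measurable_cst|exact: mcoord_tuple].
  move=> v; rewrite normrM ler_piMr//; have /andP[f0 f1] := F01 k (y *: v).
  by rewrite ger0_norm.
have boxlim (g : V -> R) (y : nat -> R) : LR g -> (forall k, 1 <= y k <= 2) ->
    (fun k => IR (fun v => g v * F k (y k *: v))) @ \oo --> IR g.
  move=> hg y12; apply: (IR_lim _ _ _ (LR_norm hg)).2.
  - by move=> k; apply: LR_mR; exact: boxLR.
  - move=> v; apply: cvg_near_cst; near=> k.
    suff -> : F k (y k *: v) = 1 by rewrite mulr1.
    rewrite /F boxiE; case: forallP => // -[] i.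
    have /andP[y1 y2] := y12 k; rewrite mxE normrM ger0_norm; last lra.
    have kv : 2 * enorm v < k%:R by near: k; exact: nbhs_infty_gtr.
    have k1 : k%:R < k.+1%:R :> R by rewrite ltr_nat.
    have vi := le_coord_enorm v i; have v0 := normr_ge0 (v 0 i); nra.
  - move=> k v; rewrite normrM ler_piMr//; have /andP[f0 f1] := F01 k (y k *: v).
    by rewrite ger0_norm.
have hpD (x : V) (y t : R) : half_point x y + t *: delta_mx 0 yc = half_point x (y + t).
  have -> : delta_mx 0 yc = half_point 0 1 :> 'rV[R]_(d + 1).
    apply/rowP => i; rewrite /half_point /ycoord; case: (split_ordP i) => j ->.
      by rewrite row_mxEl !mxE eq_lrshift andbF.
    by rewrite row_mxEr !mxE ord1 !eqxx.
  rewrite /half_point scale_row_mx add_row_mx scaler0 addr0.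
  by congr row_mx; apply/matrixP => i j; rewrite !mxE mulr1.
(* Mean value theorem in the vertical direction between heights 1 and 2 above the origin: the
   increment, which tends to 1 - 1 = 0, is the normal derivative at a height [y k] in [1, 2]. By
   scaling that derivative is [a k / y k] up to a constant, so [a k] tends both to 0 and to the
   integral sought. *)
have /choice[t Ht] k : exists t : R, 0 <= t <= 1 /\ ext s (F k) (half_point 0 2) - ext s (F k) (half_point 0 1) =
    rpartial yc (ext s (F k)) (half_point 0 (1 + t)).
  have [t' t01|t' t01] := @MVT_line R _ (ext s (F k)) (half_point 0 1) (delta_mx 0 yc).
    rewrite hpD; apply: (@ext_smooth R d s hs _ (hF k) [::]).
    by rewrite /half_space/= height_half; case/andP: t01 => t0 _; rewrite ltr_wpDr.
  have h1 := hpD 0 1 1; rewrite scale1r in h1; rewrite h1 hpD => e; exists t'; split=> //.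
  rewrite -[2]/(1 + 1 : R) e /lincomb (bigD1 yc)//= mxE !eqxx mul1r big1 ?addr0// => i iy.
  by rewrite mxE (negbTE iy) mul0r.
pose y k := 1 + t k.
have y12 k : 1 <= y k <= 2 by have [/andP[t0 t1] _] := Ht k; rewrite /y; apply/andP; split; lra.
pose a k := IR (fun v => nker 1 v * F k (y k *: v)).
have al : a @ \oo --> IR (nker 1) by exact: boxlim kq1_LR y12.
pose D k := ext s (F k) (half_point 0 2) - ext s (F k) (half_point 0 1).
have extl (r : R) : 1 <= r <= 2 -> (fun k => ext s (F k) (half_point 0 r)) @ \oo --> (1 : R).
  move=> r12; have r0 : 0 < r by case/andP: r12 => r1 _; lra.
  rewrite -(IR_PK d hs); have := boxlim _ (fun=> r) (LR_PK d hs) (fun=> r12).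
  have -> // : (fun k => IR (fun v : V => PK s v * F k (r *: v))) = fun k => ext s (F k) (half_point 0 r).
  apply/funext => k; rewrite (ext_pint hs (hF k))// /pint.
  by congr IR; apply/funext => v; rewrite add0r.
have Dl : D @ \oo --> (0 : R).
  rewrite -(subrr (1 : R)); apply: cvgB; apply: extl; apply/andP; split; lra.
have aD k : pc d s * a k = y k * D k.
  have [t01 e] := Ht k; have /andP[y1 y2] := y12 k.
  have y0 : 0 < y k by exact: lt_le_trans ltr01 y1.
  have [l1 l2] := nder_repr (hF k) 0 y0.
  have l3 := IR_scale (lt0r_neq0 y0) l1.
  have l4 : IR (fun v : V => nker (y k) (y k *: v) * F k (0 + y k *: v)) = y k `^ (- (2 * nu)) * a k.
    rewrite -IRZ; last exact: boxLR kq1_LR.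
    by congr IR; apply/funext => v; rewrite kq_scale// add0r mulrA.
  rewrite l4 (gtr0_norm y0) in l3.
  have l5 : IR (fun z : V => nker (y k) z * F k (0 + z)) = y k ^+ d * (y k `^ (- (2 * nu)) * a k).
    by rewrite l3 mulrA mulfV ?mul1r// expf_neq0// gt_eqF.
  rewrite l5 -powR_mulrn ?(ltW y0)// in l2.
  rewrite /D e -/(y k).
  have l6 : y k `^ (1 - 2 * s) * (y k * rpartial yc (ext s (F k)) (half_point 0 (y k))) =
      y k `^ (1 - 2 * s) * (pc d s * a k).
    rewrite mulrCA l2; transitivity (pc d s * a k * (y k * (y k `^ d%:R * y k `^ (- (2 * nu))))); first by ring.
    rewrite [RHS]mulrC; congr (_ * _); rewrite -{1}[y k](powRr1 (ltW y0)) -!powRD'//.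
    by congr (_ `^ _); rewrite nu2; ring.
  by move: l6 => /mulfI -> //; rewrite gt_eqF// powR_gt0.
have a0 : a @ \oo --> (0 : R).
  apply/cvgrPdist_lt => e e0.
  have e1 : 0 < e * pc d s / 2 by rewrite divr_gt0// mulr_gt0.
  move/cvgrPdist_lt : Dl => /(_ _ e1); apply: filterS => k.
  rewrite !sub0r !normrN => Dk; rewrite -(ltr_pM2l p0) -{1}(gtr0_norm p0) -normrM aD normrM.
  have /andP[y1 y2] := y12 k; rewrite ger0_norm ?(le_trans _ y1)//.
  apply: (@le_lt_trans _ _ (2 * `|D k|)); first by rewrite ler_wpM2r.
  by rewrite -ltr_pdivlMl// mulrC [pc d s * e]mulrC.
exact: (cvg_unique _ al a0).
Unshelve. all: by end_near.
Qed.

Let IR_kq y : 0 < y -> IR (nker y) = 0.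
Proof.
move=> y0; have yi : y^-1 != 0 by rewrite invr_eq0 gt_eqF.
rewrite (_ : nker y = fun x => y `^ (- (2 * nu)) * nker 1 (y^-1 *: x)).
  by rewrite IRZ; [rewrite IR_scale ?IR_kq1 ?mulr0//; exact: kq1_LR|exact: LR_scale yi kq1_LR].
by apply/funext => z; rewrite -kq_scale// scalerA mulfV ?scale1r// gt_eqF.
Qed.

Lemma D2_local f C x z : rsmooth setT f ->
  (forall i j (t : R), `|t| <= 1 -> `|rpartial j (rpartial i f) (x + t *: z)| <= C) ->
  `|D2 f x z| <= 2 * d%:R ^+ 2 * C * enorm z ^+ 2.
Proof.
move=> sf fC.
(* In dimension 0 there is no second partial derivative to force C >= 0; there both sides of the
   claim vanish. *)
have C0 : (0 < d)%N -> 0 <= C by case: d f x z sf fC => // d' f' x' z' _ fC _; apply: le_trans (fC ord0 ord0 0 _) => //; rewrite normr0.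
have t2 h : h = z \/ h = - z -> `|f (x + h) - f x - lincomb (fun i => rpartial i f x) h| <= d%:R ^+ 2 * C * `|h| ^+ 2.
  move=> hz; apply: taylor2 => [? _|i ? _|i j t /andP[t0 t1]]; [exact: (sf [::])|exact: (sf [:: _])|].
  case: hz => ->; first by apply: fC; rewrite ger0_norm.
  by rewrite scalerN -scaleNr; apply: fC; rewrite normrN ger0_norm.
have t3 h : h = z \/ h = - z -> `|f (x + h) - f x - lincomb (fun i => rpartial i f x) h| <= d%:R ^+ 2 * C * enorm h ^+ 2.
  move=> hz; apply: le_trans (t2 h hz) _; case: (posnP d) => [d0|d0].
    by rewrite (_ : d%:R = 0) ?d0// expr0n/= !mul0r.
  by rewrite ler_wpM2l ?mulr_ge0 ?C0// lerXn2r ?nnegrE ?enorm_ge0 ?norm_le_enorm.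
have h1 := t3 z (or_introl erefl); have h2 := t3 (- z) (or_intror erefl); rewrite enormN in h2.
have e : lincomb (fun i => rpartial i f x) (- z) = - lincomb (fun i => rpartial i f x) z.
  by rewrite /lincomb -sumrN; apply: eq_bigr => i _; rewrite mxE mulNr.
rewrite e opprK in h2.
rewrite (_ : D2 f x z = (f (x + z) - f x - lincomb (fun i => rpartial i f x) z) +
   (f (x - z) - f x + lincomb (fun i => rpartial i f x) z)); last by rewrite /D2; ring.
apply: (le_trans (ler_normD _ _)); lra.
Qed.

Lemma D2_smooth f C x z : rsmooth setT f ->
  (forall i j x, `|rpartial j (rpartial i f) x| <= C) ->
  `|D2 f x z| <= 2 * d%:R ^+ 2 * C * enorm z ^+ 2.
Proof. by move=> sf fC; apply: D2_local => // i j t _; exact: fC. Qed.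

(* D2 (f(. + h) - f) is controlled by third derivatives times |h|. *)
Lemma Lop_lipschitz f B C : rsmooth setT f -> (forall x, `|f x| <= B) ->
  (forall s x, (size s <= 3)%N -> `|rpartials s f x| <= C) ->
  exists K', forall x y, `|Lop f x - Lop f y| <= K' * enorm (x - y).
Proof.
move=> sf fB fC; exists ((2 * d%:R ^+ 3 * C + 4 * (d%:R * C)) * IR swgt) => x y.
pose h := x - y; pose g w := f (w + h) - f w.
have sg : rsmooth setT g.
  rewrite (_ : g = fun w => f (1 *: w + h) + (-1) * f w).
    apply: rsmoothD; [exact: openT|exact: rsmooth_affine|apply: rsmoothZ; [exact: openT|exact: sf]].
  by apply/funext => w; rewrite /g scale1r mulN1r.
have C0 : 0 <= C by exact: le_trans (fC [::] 0 isT).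
have lip t w : (size t <= 2)%N -> `|rpartials t f (w + h) - rpartials t f w| <= d%:R * C * enorm h.
  move=> t2; apply: (@le_trans _ _ (d%:R * C * `|h|)).
    by apply: lip_line => *; [exact: sf|exact: (fC (_ :: t))].
  by rewrite ler_wpM2l ?mulr_ge0// norm_le_enorm.
have gp t w : rpartials t g w = rpartials t f (w + h) - rpartials t f w.
  rewrite (_ : g = fun w => f (1 *: w + h) + (-1) * f w); last first.
    by apply/funext => v; rewrite /g scale1r mulN1r.
  rewrite rpartialsD; [|exact: rsmooth_affine|by apply: rsmoothZ => //; exact: openT].
  by rewrite rpartials_affine// rpartialsZ// expr1n mul1r scale1r mulN1r.
have gB w : `|g w| <= d%:R * C * enorm h by have := lip [::] w isT.
have gK z : `|D2 g y z| <= 2 * d%:R ^+ 2 * (d%:R * C * enorm h) * enorm z ^+ 2.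
  apply: D2_smooth => // i j w; have := gp [:: j; i] w; rewrite /= => ->.
  exact: (lip [:: j; i]).
have mf : mR f by apply: mR_cont => w; apply: differentiable_continuous; exact: (sf [::]).
have mg : mR g by apply: mR_cont => w; apply: differentiable_continuous; exact: (sg [::]).
have fK w z : `|D2 f w z| <= 2 * d%:R ^+ 2 * C * enorm z ^+ 2.
  by apply: D2_smooth => // i j v; exact: (fC [:: j; i]).
have -> : Lop f x - Lop f y = Lop g y.
  rewrite /Lop -IRB; [|exact: LR_Lop fB (fK x) mf|exact: LR_Lop fB (fK y) mf].
  congr IR; apply/funext => z; rewrite -mulrBl; congr (_ * _).
  have e1 : x = y + h by rewrite /h addrC subrK.
  rewrite /D2 /g e1 [y + z + h]addrAC [y - z + h]addrAC; ring.
apply: (le_trans (Lop_le gB gK mg)).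
rewrite ger0_norm ?mulr_ge0 ?enorm_ge0//.
rewrite le_eqVlt; apply/orP; left; apply/eqP; rewrite -/h; ring.
Qed.

Variables (f : V -> R) (B K : R) (x : V).
Hypothesis hf : LR f.
Hypothesis fB : forall x, `|f x| <= B.
Hypothesis fK : forall z, `|D2 f x z| <= K * enorm z ^+ 2.

(** As [nker y] has integral 0, the term 2 f(x) can be subtracted freely. This produces the second
    difference, without which the limit y -> 0 would meet a non-integrable singularity. *)
Lemma normal_derivativeE y : 0 < y ->
  y `^ (1 - 2 * s) * rpartial yc (ext s f) (half_point x y) =
    pc d s / 2 * IR (fun z => nker y z * D2 f x z).
Proof.
move=> y0; have [-> h2] := nder_sym hf x y0.
have h3 := kq_LR y0; congr (_ * _).
rewrite (_ : (fun z => nker y z * D2 f x z) =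
   fun z => nker y z * (f (x + z) + f (x - z)) - 2 * f x * nker y z).
  by rewrite IRB// ?IRZ// ?IR_kq// ?mulr0 ?subr0//; exact: LRZ.
by apply/funext => z; rewrite /D2; ring.
Qed.

(** Dominated convergence: |nker y z| is at most a constant times |z|^(-2 nu) uniformly in y, and
    multiplied by the second difference this is below a multiple of [swgt]. The factor [s] is the
    half from symmetrisation times the limit 2s of the kernel. *)
Lemma normal_derivative_limit :
  y `^ (1 - 2 * s) * rpartial yc (ext s f) (half_point x y) @[y --> 0^'+] --> pc d s * s * Lop f x.
Proof.
have [s0 _] := andP hs; have n0 := nu_gt0 d hs; have mf := LR_mR hf.
have C0 : 0 <= 2 * s + 2 * nu by rewrite addr_ge0// mulr_ge0// ltW.
apply/cvg_at_rightP => u [u0 ul].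
have e : (fun k => u k `^ (1 - 2 * s) * rpartial yc (ext s f) (half_point x (u k))) =
   fun k => pc d s / 2 * IR (fun z => nker (u k) z * D2 f x z).
  by apply/funext => k; exact: normal_derivativeE.
rewrite e (_ : pc d s * s * Lop f x = pc d s / 2 * (2 * s * Lop f x)); last by field.
apply: cvgMl_tmp; rewrite -IRZ; last exact: LR_Lop.
have u2 : (fun k => u k ^+ 2) @ \oo --> 0.
  by have h := cvgM ul ul; rewrite mulr0 in h; exact: (h _).
apply: (IR_lim _ _ _ (LRZ ((2 * s + 2 * nu) * (`|K| + 4 * B)) LR_swgt)).2.
- by move=> k; apply: measurable_funM; [exact: kq_mR|exact: mR_D2].
- move=> z; have [->|zn] := eqVneq z 0.
    by rewrite D2_0 mul0r mulr0; under eq_fun do rewrite mulr0; exact: cvg_cst.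
  have z0 : 0 < sqn z by rewrite -sqr_enorm exprn_gt0 ?enorm_gt0.
  rewrite mulrCA mulrC; apply: cvgMr_tmp.
  have S : (fun k => sqn z + u k ^+ 2) @ \oo --> sqn z.
    by rewrite -[X in _ --> X]addr0; apply: cvgD u2; exact: cvg_cst.
  rewrite (_ : 2 * s * enorm z `^ (- (2 * nu)) =
     2 * s * sqn z `^ (- nu) - 2 * nu * 0 * sqn z `^ (- nu - 1)); last first.
    rewrite mulr0 mul0r subr0 -sqr_enorm -powR_mulrn ?enorm_ge0// -powRrM.
    by congr (_ * _ `^ _); ring.
  apply: cvgB; first by apply: cvgMl_tmp; exact: cvg_powR.
  by apply: cvgM; [apply: cvgMl_tmp|exact: cvg_powR].
- move=> k z; rewrite normrM -mulrA.
  apply: (@le_trans _ _ ((2 * s + 2 * nu) * enorm z `^ (- (2 * nu)) * `|D2 f x z|)).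
    have [->|zn] := eqVneq z 0; first by rewrite D2_0 normr0 !mulr0.
    have z0 : 0 < sqn z by rewrite -sqr_enorm exprn_gt0 ?enorm_gt0.
    apply: ler_wpM2r => //; apply: (le_trans (kq_le z (u0 k))).
    apply: ler_wpM2l; first exact: C0.
    rewrite (_ : enorm z `^ (- (2 * nu)) = sqn z `^ (- nu)); last first.
      by rewrite -sqr_enorm -powR_mulrn ?enorm_ge0// -powRrM; congr (_ `^ _); ring.
    by apply: powR_anti (ltW n0) => //; rewrite lerDl sqr_ge0.
  rewrite -mulrA; apply: ler_wpM2l; first exact: C0.
  have := D2_wgt_le fB fK z; rewrite normrM (ger0_norm (powR_ge0 _ _)).
  by rewrite [X in X <= _]mulrC.
Qed.

End fractional_operator.

(** * Uniqueness of the extension *)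

Section boxes.
Variables (R : realType) (n : nat).
Local Notation V := 'rV[R]_n.
Implicit Types (a b : 'I_n -> R) (g : V -> R).

Lemma box_max a b g : (forall i, a i <= b i) ->
  (forall w : V, (forall i, a i <= w 0 i <= b i) -> {for w, continuous g}) ->
  exists2 w : V, (forall i, a i <= w 0 i <= b i) &
    forall t : V, (forall i, a i <= t 0 i <= b i) -> g t <= g w.
Proof.
move=> ab cg; pose A := [set w : V | forall i, `[a i, b i]%classic (w ord0 i)].
have AP w : A w <-> forall i, a i <= w 0 i <= b i.
  by split=> h i; have := h i; rewrite /= in_itv.
have A0 : A !=set0 by exists (\row_i a i); apply/AP => i; rewrite mxE lexx ab.
have cA : compact A.
  by apply: (@rV_compact R n (fun i => `[a i, b i]%classic)) => i; exact: segment_compact.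
have [|w wA wm] := EVT_max_rV A0 cA (f := g).
  by apply: continuous_in_subspaceT => w /set_mem/AP; exact: cg.
exists w; first by apply/AP; apply: set_mem wA.
by move=> t /AP ht; apply: wm; exact: mem_set.
Qed.

Lemma box_bounded a b g : (forall i, a i <= b i) ->
  (forall w : V, (forall i, a i <= w 0 i <= b i) -> {for w, continuous g}) ->
  exists C, forall w : V, (forall i, a i <= w 0 i <= b i) -> `|g w| <= C.
Proof.
move=> ab cg; have [w _ wm] : exists2 w : V, (forall i, a i <= w 0 i <= b i) &
    forall t : V, (forall i, a i <= t 0 i <= b i) -> `|g t| <= `|g w|.
  apply: (box_max (g := fun w => `|g w|)) ab _ => w hw.
  apply: (@continuous_comp _ _ _ g (fun r : R => `|r|)); first exact: cg.
  exact: norm_continuous.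
by exists `|g w|.
Qed.

Lemma derive_gt0_increasing (f : R -> R) D : is_derive (0 : R) (1 : R) f D -> 0 < D -> f 0 = 0 ->
  exists2 e, 0 < e & forall t, 0 < t < e -> 0 < f t.
Proof.
move=> [df eD] D0 f0.
have : \forall h \near 0^', 0 < h^-1 *: (f (h *: (1 : R) + 0) - f 0).
  by apply: (@cvgr_gt R R _ _ _ D _ 0 D0); rewrite -eD; exact: df.
rewrite near_withinE => /nbhs_ballP[e /= e0 he]; exists e => // t /andP[t0 te].
have := he t; rewrite /ball/= sub0r normrN gtr0_norm// => /(_ te (lt0r_neq0 t0)).
rewrite f0 subr0 addr0 [t *: 1]mulr1 /GRing.scale/= pmulr_rgt0// invr_gt0//.
Qed.

(** A positive second derivative would make the first derivative, zero at the maximum, positive just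
    to its right; the mean value theorem then gives a larger value of [g]. *)
Lemma second_derivative_test g i (z : V) e : 0 < e ->
  (forall t : R, `|t| < e -> differentiable g (z + t *: delta_mx 0 i)) ->
  differentiable (rpartial i g) z ->
  (forall t : R, `|t| < e -> g (z + t *: delta_mx 0 i) <= g z) ->
  rpartial i g z = 0 /\ rpartial i (rpartial i g) z <= 0.
Proof.
move=> e0 dg dp gm; pose f (t : R) := g (z + t *: delta_mx 0 i).
have z0 : z + (0 : R) *: delta_mx 0 i = z by rewrite scale0r addr0.
have df (t : R) : `|t| < e -> is_derive t 1 f (rpartial i g (z + t *: delta_mx 0 i)).
  by move=> te; apply: is_derive_line; exact: dg.
have inE' t : (t \in `]-e, e[%R) = (`|t| < e) by rewrite in_itv/= ltr_norml.
have p0 : rpartial i g z = 0.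
  have e00 : `|0 : R| < e by rewrite normr0.
  have [_ h1] : is_derive (0 : R) 1 f 0.
    apply: (@derive1_at_max _ f (- e) e) => [|t|| t].
    - by rewrite lerNl (le_trans _ (ltW e0))// oppr_le0 ltW.
    - by rewrite inE' => /df [].
    - by rewrite inE'.
    - by rewrite inE' => te; rewrite /f z0; exact: gm.
  by have [_ h2] := df 0 e00; rewrite h1 z0 in h2.
split=> //; rewrite leNgt; apply/negP => D0.
have dl : is_derive (0 : R) 1 (fun t : R => rpartial i g (z + t *: delta_mx 0 i)) (rpartial i (rpartial i g) z).
  have := @is_derive_line R n (rpartial i g) z (delta_mx 0 i) 0.
  by rewrite z0; apply.
have [|e' e'0 he'] := derive_gt0_increasing dl D0; first by rewrite z0.
pose t := Num.min e e' / 2.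
have m0 : 0 < Num.min e e' by rewrite lt_min e0.
have t0 : 0 < t by rewrite divr_gt0.
have tm : t < Num.min e e' by rewrite ltr_pdivrMr// ltr_pMr// ltr1n.
have [te te'] : t < e /\ t < e' by move: tm; rewrite lt_min => /andP.
have fd (x : R) : 0 <= x <= t -> is_derive x 1 f (rpartial i g (z + x *: delta_mx 0 i)).
  by move=> /andP[x0 xt]; apply: df; rewrite ger0_norm// (le_lt_trans xt).
have [|| c] := @MVT R f (fun x => rpartial i g (z + x *: delta_mx 0 i)) 0 t t0.
- by move=> x; rewrite in_itv/= => /andP[x0 xt]; apply: fd; rewrite !ltW.
- apply: continuous_in_subspaceT => x /set_mem/=; rewrite in_itv/= => /fd[dx _].
  by apply: differentiable_continuous; exact/derivable1_diffP.
rewrite in_itv/= => /andP[c0 ct]; rewrite subr0 => E.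
have := gm t; rewrite gtr0_norm// => /(_ te); rewrite -subr_le0.
have -> : g (z + t *: delta_mx 0 i) - g z = f t - f 0 by rewrite /f z0.
by rewrite E pmulr_lle0// leNgt he'// c0 (lt_trans ct).
Qed.
End boxes.

(** * A maximum principle on the half-space *)

Section maximum_principle.
Variables (R : realType) (d : nat) (s : R).
Hypothesis hs : 0 < s < 1.
Local Notation V := 'rV[R]_(d + 1).
Local Notation HS := (@half_space R d).
Local Notation yc := (ycoord d).
(** The value for which |x|^2 - k y^2 has weighted Laplacian -2, while y^(2s) has weighted Laplacian
    0 ([lap_psi]). Note that [psi] sums over all coordinates, including y, so it subtracts (1 + k)
    y^2. *)
Let k : R := (d%:R + 1) / (2 * (1 - s)).

Let k0 : 0 < k.
Proof. by case/andP: hs => _ s1; rewrite divr_gt0 ?ltr_wpDl// mulr_gt0// subr_gt0. Qed.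

Let psi c1 del (w : V) := c1 * height w `^ (2 * s) +
  del * (\sum_i w 0 i ^+ 2 - (1 + k) * (w 0 yc * w 0 yc)).

Let psi1 c1 del i (w : V) := c1 * ((i == yc)%:R * (2 * s) * height w `^ (2 * s - 1)) +
  del * (2 * w 0 i - 2 * (1 + k) * ((i == yc)%:R * w 0 yc)).

Let psi2 c1 del i (w : V) :=
  c1 * ((i == yc)%:R * (2 * s) * ((i == yc)%:R * (2 * s - 1) * height w `^ (2 * s - 1 - 1))) +
  del * (2 - 2 * (1 + k) * (i == yc)%:R).

Let hpsi c1 del i : hpartial i (psi c1 del) (psi1 c1 del i).
Proof.
have hsq : hpartial i (fun w : V => \sum_i w 0 i ^+ 2) (fun w => 2 * w 0 i).
  by move=> z _; have [h1 h2] := @diff_sqn R (d + 1) z; split=> //; exact: h2.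
have hc a := @hpartial_cst R d i a.
move=> z hz; have [h1 h2] := hpartialD (hpartialM (hc c1) (hpartial_height i (2 * s)))
  (hpartialM (hc del) (hpartialD hsq (hpartialM (hc (- (1 + k)))
     (hpartialM (hpartial_coord i yc) (hpartial_coord i yc))))) hz.
have e : psi c1 del = (fun z => c1 * height z `^ (2 * s) +
  del * (\sum_i z 0 i ^+ 2 + - (1 + k) * (z 0 yc * z 0 yc))).
  by apply/funext => w; rewrite /psi mulNr.
by rewrite e; split=> //; rewrite h2 /psi1; ring.
Qed.

Let hpsi1 c1 del i : hpartial i (psi1 c1 del i) (psi2 c1 del i).
Proof.
have hc a := @hpartial_cst R d i a.
move=> z hz; have [h1 h2] := hpartialD (hpartialM (hc c1) (hpartialM (hc ((i == yc)%:R * (2 * s))) (hpartial_height i (2 * s - 1))))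
  (hpartialM (hc del) (hpartialD (hpartialM (hc 2) (hpartial_coord i i)) (hpartialM (hc (- (2 * (1 + k))))
     (hpartialM (hc (i == yc)%:R) (hpartial_coord i yc))))) hz.
have e : psi1 c1 del i = (fun z => c1 * ((i == yc)%:R * (2 * s) * height z `^ (2 * s - 1)) +
  del * (2 * z 0 i + - (2 * (1 + k)) * ((i == yc)%:R * z 0 yc))).
  by apply/funext => w; rewrite /psi1 mulNr.
rewrite e; split=> //; rewrite h2 /psi2 eqxx.
by case: (i == yc) => /=; ring.
Qed.

Let lap_psi c1 del z : HS z -> \sum_i psi2 c1 del i z + (1 - 2 * s) / height z * psi1 c1 del yc z = - (2 * del).
Proof.
move=> hz; have z0 : 0 < height z by [].
have s1 : 1 - s != 0 by case/andP: hs => _ s1; rewrite gt_eqF// subr_gt0.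
rewrite big_split/= -mulr_sumr -mulr_sumr sumrB -mulr_sumr.
rewrite sumr_const card_ord (bigD1 yc)//= eqxx big1 ?addr0; last by move=> i /negbTE ->; rewrite !mul0r.
rewrite (bigD1 yc)//= eqxx big1 ?addr0; last by move=> i /negbTE ->.
rewrite /psi1 eqxx -/(height z) powRD'// powR_inv1 ?(ltW z0)//.
have -> : true%:R = 1 :> R by [].
rewrite -(mulr_natr 2 (d + 1)) natrD /k; field; rewrite s1 gt_eqF//.
Qed.

Variables (v : V -> R) (B : R).
Hypothesis sv : rsmooth HS v.
Hypothesis lv : forall z, HS z -> lap s v z = 0.
Hypothesis vB : forall z, HS z -> v z <= B.
Hypothesis v0 : forall e, 0 < e -> exists2 eta, 0 < eta & forall z, 0 < height z < eta -> v z <= e.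

(** Subtract the barrier from [v] and maximise over a large box. The value at [z] is positive,
    whereas each face forces a nonpositive value: the bottom by smallness of [v], the sides by the
    quadratic term, the top by the power y^(2s). The maximum is therefore interior, where the
    weighted Laplacian must be at most 0; but it equals 2 [del]. *)
Lemma maximum_principle z : HS z -> v z <= 0.
Proof.
move=> hz0; have z00 : 0 < height z by []. have [s0 s1] := andP hs.
have s2 : 0 < 2 * s by rewrite mulr_gt0.
rewrite leNgt; apply/negP => vz0; set y0 := height z in z00.
pose B' := `|B| + 1; have B'0 : 0 < B' by rewrite ltr_wpDl.
have vB' w : HS w -> v w <= B' by move=> hw; have := vB hw; have := ler_norm B; rewrite /B'; lra.
(* Three terms of the barrier, each at most [e] at [z], leave a positive value there. *)
pose e := v z / 4; have e0 : 0 < e by rewrite divr_gt0.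
(* Y is chosen with B' (y0 / Y)^{2s} = e, or larger *)
have [Y y0Y HY] : exists2 Y, y0 < Y & B' * (y0 / Y) `^ (2 * s) <= e.
  have [del del0 hdel] := powR_small B' s2 e0.
  exists (y0 * (1 + 2 / del)).
    by rewrite ltr_pMr// ltrDl divr_gt0.
  apply: ltW; apply: hdel.
    by rewrite divr_ge0 ?(ltW z00)// mulr_ge0 ?(ltW z00)// addr_ge0// divr_ge0// ltW.
  rewrite invfM mulrA mulfV ?gt_eqF// mul1r.
  have p : 0 < 1 + 2 / del by rewrite ltr_wpDr// divr_ge0// ltW.
  have i0 : 0 < del^-1 by rewrite invr_gt0.
  rewrite -[ltRHS](invrK del) ltf_pV2 ?posrE//; lra.
have Y0 : 0 < Y by exact: lt_trans y0Y.
have [eta0 eta00 Heta] := v0 e0.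
pose eta := Num.min eta0 y0 / 2.
have m0 : 0 < Num.min eta0 y0 by rewrite lt_min eta00.
have eta_gt0 : 0 < eta by rewrite divr_gt0.
have etam : eta < Num.min eta0 y0 by rewrite ltr_pdivrMr// ltr_pMr// ltr1n.
have [eta1 eta2] : eta < eta0 /\ eta < y0 by move: etam; rewrite lt_min => /andP.
(* Makes the quadratic part of the barrier at [z] at most [e] after multiplication by [del]. *)
pose D := sqn z + k * Y ^+ 2 + 1.
have D0 : 0 < D by rewrite ltr_wpDl// addr_ge0 ?sqn_ge0// mulr_ge0 ?sqr_ge0// ltW.
pose del := e / D; have del0 : 0 < del by rewrite divr_gt0.
(* The box contains [z], and on its lateral faces the quadratic term alone reaches the bound [B'] of
   [v]. *)
pose rho := enorm z + B' / del + 1.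
have rho0 : 1 <= rho by rewrite /rho lerDr addr_ge0 ?enorm_ge0// divr_ge0// ltW.
have rhoB : B' <= del * rho ^+ 2.
  rewrite mulrC -ler_pdivrMr//; apply: (@le_trans _ _ rho).
    by rewrite /rho -addrA addrC -addrA lerDl addr_ge0// enorm_ge0.
  by rewrite expr2 ler_peMl// (le_trans ler01).
(* On the top face the term c1 y^(2s) equals [B']. *)
pose c1 := B' * Y `^ (- (2 * s)).
have c10 : 0 < c1 by rewrite mulr_gt0 ?powR_gt0.
pose h w := v w + (-1) * (psi c1 del w + (e + del * (k * Y ^+ 2))).
pose a i : R := if i == yc then eta else - rho.
pose b i : R := if i == yc then Y else rho.
have ab i : a i <= b i.
  rewrite /a /b; case: ifP => _; first by rewrite ltW// (lt_trans eta2).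
  by rewrite (@le_trans _ _ 0) ?oppr_le0 ?(le_trans ler01).
have inHS (w : V) : (forall i, a i <= w 0 i <= b i) -> HS w.
  by move=> /(_ yc); rewrite /a /b eqxx => /andP[h1 _]; rewrite /half_space/= (lt_le_trans eta_gt0).
have dpsi w : HS w -> differentiable (psi c1 del) w by move=> hw; have [] := hpsi c1 del yc hw.
have dh w : HS w -> differentiable h w.
  move=> hw; apply: differentiableD; first exact: rsmooth_diff sv _ hw.
  apply: differentiableM; first exact: differentiable_cst.
  by apply: differentiableD; [exact: dpsi|exact: differentiable_cst].
have [w hw wm] := box_max ab (fun w hw => differentiable_continuous (dh w (inHS w hw))).
have HSw := inHS w hw.
have hwz : h z <= h w.
  apply: wm => i; rewrite /a /b; case: eqVneq => [->|_].
    by apply/andP; split; apply: ltW.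
  by rewrite -ler_norml (le_trans (le_coord_enorm z i))// /rho -addrA lerDl addr_ge0// divr_ge0// ltW.
have hz : 0 < h z.
  have a1 : c1 * y0 `^ (2 * s) <= e.
    apply: le_trans HY; rewrite /c1 -mulrA powRM ?invr_ge0 ?(ltW z00) ?(ltW Y0)//.
    by rewrite [Y `^ _ * _]mulrC -powR_inv1 ?(ltW Y0)// -powRrM mulN1r.
  have a2 : del * (sqn z + k * Y ^+ 2) <= e.
    rewrite /del mulrAC ler_pdivrMr// ler_pM2l// /D; lra.
  have a3 : 0 <= del * ((1 + k) * (z 0 yc * z 0 yc)).
    by rewrite mulr_ge0 ?(ltW del0)// mulr_ge0 ?addr_ge0 ?(ltW k0)// -expr2 sqr_ge0.
  have a4 : v z = 4 * e by rewrite /e; field.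
  rewrite /h /psi -/(sqn z) -/y0 a4; lra.
have hw0 := lt_le_trans hz hwz.
have sqx : sqn w = \sum_(i | i != yc) w 0 i ^+ 2 + height w ^+ 2.
  by rewrite /sqn (bigD1 yc)//= addrC.
have sqx0 : 0 <= \sum_(i | i != yc) w 0 i ^+ 2 by apply: sumr_ge0 => i _; exact: sqr_ge0.
have hwE : h w = v w - c1 * height w `^ (2 * s) - e -
    del * (\sum_(i | i != yc) w 0 i ^+ 2 + k * (Y ^+ 2 - height w ^+ 2)).
  by rewrite /h /psi -/(sqn w) sqx -/(height w); ring.
have hwy : eta <= height w <= Y by have := hw yc; rewrite /a /b eqxx.
have yY : 0 <= k * (Y ^+ 2 - height w ^+ 2).
  have /andP[h1 h2] := hwy; rewrite mulr_ge0 ?(ltW k0)// subr_ge0 lerXn2r ?nnegrE ?(ltW Y0)//.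
  by rewrite (le_trans (ltW eta_gt0)).
have pw0 : 0 <= c1 * height w `^ (2 * s) by rewrite mulr_ge0 ?powR_ge0 ?(ltW c10).
have dd0 : 0 <= del * (\sum_(i | i != yc) w 0 i ^+ 2 + k * (Y ^+ 2 - height w ^+ 2)).
  by rewrite mulr_ge0 ?addr_ge0 ?(ltW del0).
have Hrho i : i != yc -> w 0 i ^+ 2 = rho ^+ 2 -> False.
  move=> iy E.
  have q : rho ^+ 2 <= \sum_(i | i != yc) w 0 i ^+ 2.
    by rewrite -E (bigD1 i)//= lerDl sumr_ge0// => j _; exact: sqr_ge0.
  have q2 : del * rho ^+ 2 <= del * (\sum_(i | i != yc) w 0 i ^+ 2 + k * (Y ^+ 2 - height w ^+ 2)).
    by rewrite ler_pM2l// (le_trans q)// lerDl.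
  by have := vB' w HSw; move: hw0; rewrite hwE; lra.
have Hint i : a i < w 0 i < b i.
  have /andP[h1 h2] := hw i.
  have ne1 : a i != w 0 i.
    apply/eqP; rewrite /a; case: eqVneq => [->|iy] E.
      have := Heta w; rewrite /height -E eta_gt0 eta1 => /(_ isT) ve.
      by move: hw0; rewrite hwE; lra.
    by apply: (Hrho i iy); rewrite -E sqrrN.
  have ne2 : w 0 i != b i.
    apply/eqP; rewrite /b; case: eqVneq => [->|iy] E.
      have : c1 * height w `^ (2 * s) = B'.
        rewrite /height E /c1 -mulrA -powRD ?addNr ?powRr0 ?mulr1//.
        by rewrite (gt_eqF Y0) implybT.
      have := vB' w HSw; move: hw0; rewrite hwE; lra.
    by apply: (Hrho i iy); rewrite E.
  by rewrite !lt_neqAle ne1 ne2 h1 h2.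
have dh2 i : differentiable (rpartial i h) w /\ rpartial i (rpartial i h) w =
    rpartial i (rpartial i v) w - psi2 c1 del i w.
  have hh : hpartial i h (fun w => rpartial i v w + (-1) * psi1 c1 del i w).
    move=> w' hw'; split; first exact: dh.
    have [p1 p2] := hpsi c1 del i hw'.
    rewrite /h rpartialD; last 2 first.
    - exact: rsmooth_diff sv _ hw'.
    - apply: differentiableM; first exact: differentiable_cst.
      by apply: differentiableD => //; exact: differentiable_cst.
    rewrite rpartialZ; last by apply: differentiableD => //; exact: differentiable_cst.
    by rewrite rpartialD ?rpartial_cst ?addr0 ?p2//; exact: differentiable_cst.
  have hh2 : hpartial i (fun w => rpartial i v w + (-1) * psi1 c1 del i w)
      (fun w => rpartial i (rpartial i v) w + (-1) * psi2 c1 del i w).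
    move=> w' hw'; have [p1 p2] := hpsi1 c1 del i hw'.
    have d1 : differentiable (rpartial i v) w' by exact: rsmooth_diff (rsmooth_rpartial i sv) _ hw'.
    have d2 : differentiable (fun w => (-1) * psi1 c1 del i w) w'.
      by apply: differentiableM => //; exact: differentiable_cst.
    split; first exact: differentiableD.
    by rewrite rpartialD// rpartialZ// p2.
  have [p1 p2] := hpartial2 hh hh2 HSw.
  by split=> //; rewrite p2 mulN1r.
have dh1 : rpartial yc h w = rpartial yc v w - psi1 c1 del yc w.
  have [p1 p2] := hpsi c1 del yc HSw.
  rewrite /h rpartialD; last 2 first.
  - exact: rsmooth_diff sv _ HSw.
  - apply: differentiableM; first exact: differentiable_cst.
    by apply: differentiableD => //; exact: differentiable_cst.
  rewrite rpartialZ; last by apply: differentiableD => //; exact: differentiable_cst.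
  by rewrite rpartialD ?rpartial_cst ?addr0 ?p2 ?mulN1r//; exact: differentiable_cst.
have test i : rpartial i h w = 0 /\ rpartial i (rpartial i h) w <= 0.
  have /andP[h1 h2] := Hint i.
  pose r := Num.min (w 0 i - a i) (b i - w 0 i).
  have r0 : 0 < r by rewrite lt_min !subr_gt0 h1.
  have inb (t : R) : `|t| < r -> forall j, a j <= (w + t *: delta_mx 0 i) 0 j <= b j.
    rewrite lt_min => /andP[t1 t2] j; rewrite !mxE.
    have := ler_norm t; have := ler_norm (- t); rewrite normrN => n1 n2.
    case: (eqVneq j i) => [->|ji]; last by rewrite mulr0 addr0; exact: hw.
    by rewrite eqxx mulr1; apply/andP; split; lra.
  apply: (second_derivative_test r0).
  - by move=> t tr; apply: dh; apply: inHS; exact: inb.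
  - exact: (dh2 i).1.
  - by move=> t tr; apply: wm; exact: inb.
have L1 : lap s h w <= 0.
  rewrite /lap (test yc).1 mulr0 addr0; apply: sumr_le0 => i _; exact: (test i).2.
have L2 : lap s h w = 2 * del.
  rewrite /lap (eq_bigr _ (fun i _ => (dh2 i).2)) sumrB dh1 mulrBr.
  have := lv HSw; rewrite /lap; have := lap_psi c1 del HSw.
  set A1 := \sum_i psi2 _ _ _ _; set A2 := (_ * psi1 _ _ _ _); set A3 := \sum_i rpartial _ _ _; set A4 := (_ * rpartial _ _ _).
  by move=> e1 e2; lra.
by rewrite L2 in L1; lra.
Qed.
End maximum_principle.

(** * Averages over cubes in the horizontal variable *)

Section averages.
Variables (R : realType) (d : nat) (r : R).
Hypothesis r0 : 0 < r.
Local Notation V := 'rV[R]_(d + 1).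
Local Notation HS := (@half_space R d).
Local Notation yc := (ycoord d).
Implicit Types (g : V -> R) (z : V).

(** Trades the L^2 control of slices for pointwise control. The equation is preserved because its
    coefficients depend on the height only, and horizontal translations commute with it. The average
    is not divided by the volume. *)
Definition avg g z : R := IR (fun q : 'rV[R]_d => boxi r q * g (z + emb q)).

Lemma heightD_emb z (q : 'rV[R]_d) : height (z + emb q) = height z.
Proof. by rewrite heightD height_emb addr0. Qed.

Lemma boxi_cases (q : 'rV[R]_d) : boxi r q = 0 \/ boxi r q = 1 /\ forall i, `|q 0 i| < r.
Proof. by rewrite boxiE; case: forallP => h; [right|left]. Qed.

Lemma avg_bounded g z : (forall w, HS w -> {for w, continuous g}) -> HS z ->
  exists C, forall (h : V) q, `|h| <= height z / 2 -> boxi r q = 1 -> `|g (z + h + emb q)| <= C.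
Proof.
move=> cg hz; have z0 : 0 < height z by [].
pose h2 := height z / 2; have h20 : 0 < h2 by rewrite divr_gt0.
pose a i : R := if i == yc then z 0 i - h2 else z 0 i - h2 - r.
pose b i : R := if i == yc then z 0 i + h2 else z 0 i + h2 + r.
have [| |C HC] := @box_bounded R _ a b g.
- by move=> i; rewrite /a /b; case: ifP => _; have := r0; lra.
- move=> w hw; apply: cg; have := hw yc; rewrite /a eqxx -/(height z) -/(height w) => /andP[h1 _].
  by rewrite /half_space/=; apply: lt_le_trans h1; rewrite /h2; lra.
exists C => h q hh bq; apply: HC => i; rewrite 2!mxE.
have hi : `|h 0 i| <= h2 by apply: le_trans (norm_coord _ _) hh.
move: hi; rewrite ler_norml => /andP[hi1 hi2].
rewrite /a /b; case: eqVneq => [->|iy].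
  have -> : emb q 0 yc = 0 by exact: height_emb.
  by rewrite -?iy; apply/andP; split; move: (le_trans (norm_coord h yc) hh); rewrite ler_norml -/h2 => /andP[]; rewrite ?addr0; lra.
have [|[_ hq]] := boxi_cases q; first by rewrite bq => /eqP; rewrite oner_eq0.
have : `|emb q 0 i| < r.
  rewrite /emb; case: (split_ordP i) iy => j -> iy; first by rewrite row_mxEl.
  by move: iy; rewrite /ycoord ord1 eqxx.
by rewrite ltr_norml => /andP[q1 q2]; apply/andP; split; lra.
Qed.

Lemma continuous_translate g z (q0 : 'rV[R]_d) : {for z + emb q0, continuous g} ->
  {for q0, continuous (fun q : 'rV[R]_d => g (z + emb q))}.
Proof.
move=> cg; apply: (@continuous_comp _ _ _ (fun q : 'rV[R]_d => z + emb q) g) => //.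
apply/(@cvgrPdist_lt _ _ _ (nbhs q0)) => e e0; apply/nbhs_ballP; exists e => // q.
rewrite mx_norm_ball /ball_/= => h; rewrite opprD addrACA subrr add0r.
apply: le_lt_trans h; rewrite [leLHS]/Num.norm/= mx_normrE; apply: bigmax_le => [|[i0 i] _ /=].
  exact: normr_ge0.
rewrite ord1 2!mxE /emb; case: (split_ordP i) => j E; rewrite E.
  rewrite -[X in `|_ + X|]/((- row_mx q 0 : V) 0 (lshift 1 j)) opp_row_mx !row_mxEl.
  by have := norm_coord (q0 - q) j; rewrite !mxE.
by rewrite opp_row_mx !row_mxEr !mxE subrr normr0 normr_ge0.
Qed.

Lemma mR_translate g z : (forall w, HS w -> {for w, continuous g}) -> HS z ->
  mR (fun q : 'rV[R]_d => g (z + emb q)).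
Proof.
move=> cg hz; apply: mR_cont => q; apply: continuous_translate; apply: cg.
by rewrite /half_space/= heightD_emb.
Qed.

Lemma LR_avg g z : (forall w, HS w -> {for w, continuous g}) -> HS z ->
  LR (fun q : 'rV[R]_d => boxi r q * g (z + emb q)).
Proof.
move=> cg hz; have [C HC] := avg_bounded cg hz.
have [hb _] := @LR_boxi R d r (ltW r0).
apply: (LR_le _ _ (LRZ `|C| hb)).
  by apply: measurable_funM; [exact: LR_mR hb|exact: mR_translate].
move=> q; have [->|[q1 _]] := boxi_cases q; first by rewrite mul0r normr0 mulr0.
rewrite q1 mul1r mulr1; apply: le_trans (ler_norm C).
have := HC 0 q; rewrite normr0 addr0; apply=> //.
by rewrite divr_ge0// ltW.
Qed.

Lemma rsmooth_cont g : rsmooth HS g -> forall w, HS w -> {for w, continuous g}.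
Proof. by move=> sg w hw; apply: differentiable_continuous; exact: (sg [::]). Qed.

Lemma avg_diff g z : rsmooth HS g -> HS z ->
  differentiable (avg g) z /\ forall i, rpartial i (avg g) z = avg (rpartial i g) z.
Proof.
move=> sg hz; have z0 : 0 < height z by [].
have h20 : 0 < height z / 2 by rewrite divr_gt0.
have cg := rsmooth_cont sg.
have cp i : forall w, HS w -> {for w, continuous (rpartial i g)}.
  exact: rsmooth_cont (rsmooth_rpartial i sg).
have [C C0 HC] : exists2 C, 0 <= C & forall (ij : 'I_(d + 1) * 'I_(d + 1)) (p : V * 'rV[R]_d),
    `|p.1| <= height z / 2 /\ boxi r p.2 = 1 ->
    `|rpartial ij.2 (rpartial ij.1 g) (z + p.1 + emb p.2)| <= C.
  apply: finite_bound => -[i j].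
  have [C HC] := avg_bounded (rsmooth_cont (rsmooth_rpartial j (rsmooth_rpartial i sg))) hz.
  by exists C => -[h q] /= [h1 h2]; exact: HC.
have [hb _] := @LR_boxi R d r (ltW r0).
apply: (@diff_under_Int _ _ _ _ (leb_tuple R d) (fun t z => boxi r (rV_of_tuple t) * g (z + emb (rV_of_tuple t)))
  (fun t i => boxi r (rV_of_tuple t) * rpartial i g (z + emb (rV_of_tuple t)))
  (fun t => (d + 1)%:R ^+ 2 * C * boxi r (rV_of_tuple t)) z _ h20).
- move=> h hh; apply: LR_avg => //; rewrite /half_space/= heightD.
  by have := norm_height h; rewrite ler_norml => /andP[]; lra.
- by move=> i; exact: LR_avg (cp i) hz.
- by apply: (@LRZ R d); exact: hb.
move=> t h hh; set q := rV_of_tuple t.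
have [->|[q1 _]] := boxi_cases q.
  rewrite !mul0r subrr sub0r /lincomb big1 ?oppr0 ?normr0 ?mulr0//.
  by move=> i _; rewrite mul0r mulr0.
rewrite !q1 !mul1r mulr1.
have -> : lincomb (fun i => 1 * rpartial i g (z + emb q)) h = lincomb (fun i => rpartial i g (z + emb q)) h.
  by apply: eq_bigr => i _; rewrite mul1r.
have inn (t' : R) : 0 <= t' <= 1 -> `|t' *: h| <= height z / 2 /\ HS (z + emb q + t' *: h).
  move=> /andP[t0 t1]; have th : `|t' *: h| <= `|h| by rewrite normrZ ger0_norm// ler_piMl.
  split; first by apply: le_trans th (ltW hh).
  rewrite /half_space/= heightD heightD_emb.
  by have := norm_height (t' *: h); rewrite ler_norml => /andP[]; lra.
rewrite [z + h + _]addrAC mulrC; apply: taylor2.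
- by move=> t' /inn[_ h']; exact: (sg [::]).
- by move=> i t' /inn[_ h']; exact: (sg [:: i]).
- move=> i j t' /inn[h' _]; rewrite addrAC; exact: (HC (i, j) (t' *: h, q)).
Qed.

Lemma avg_smooth g : rsmooth HS g -> rsmooth HS (avg g).
Proof.
move=> sg; pose P (f : V -> R) := exists2 g', rsmooth HS g' & f = avg g'.
apply: (@rsmooth_closed _ _ HS P (@open_half_space R d)) => [f [g' sg' ->] z hz|f i [g' sg' ->]|].
- exact: (avg_diff sg' hz).1.
- exists (avg (rpartial i g')); first by exists (rpartial i g') => //; exact: rsmooth_rpartial.
  by move=> z hz; exact: (avg_diff sg' hz).2.
- by exists g.
Qed.

Lemma lap_avg s g z : rsmooth HS g -> HS z -> (forall w, HS w -> lap s g w = 0) -> lap s (avg g) z = 0.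
Proof.
move=> sg hz lg.
have d2 i : rpartial i (rpartial i (avg g)) z = avg (rpartial i (rpartial i g)) z.
  have h1 : hpartial i (avg g) (avg (rpartial i g)).
    by move=> w hw; have [p1 p2] := avg_diff sg hw.
  have h2 : hpartial i (avg (rpartial i g)) (avg (rpartial i (rpartial i g))).
    by move=> w hw; have [p1 p2] := avg_diff (rsmooth_rpartial i sg) hw.
  exact: (hpartial2 h1 h2 hz).2.
have h2 i : LR (fun q : 'rV[R]_d => boxi r q * rpartial i (rpartial i g) (z + emb q)).
  by apply: LR_avg => //; apply: rsmooth_cont; do 2!apply: rsmooth_rpartial.
have h1 : LR (fun q : 'rV[R]_d => boxi r q * rpartial yc g (z + emb q)).
  by apply: LR_avg => //; apply: rsmooth_cont; exact: rsmooth_rpartial.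
rewrite /lap (eq_bigr _ (fun i _ => d2 i)) (avg_diff sg hz).2 /avg /IR.
rewrite -Int_sum; last by move=> i _; exact: h2.
rewrite -[X in _ + _ * X]/(Int _ _) -IntZ// -IntD; last 2 first.
- by apply: L1_sum => i _; exact: h2.
- exact: L1Z.
rewrite -[RHS](Int0 (leb_tuple R d)); congr Int; apply/funext => t.
set q := rV_of_tuple t; have := lg (z + emb q); rewrite /half_space/= heightD_emb => /(_ hz).
rewrite /lap heightD_emb => E; rewrite -mulr_sumr mulrCA -mulrDr E mulr0//.
Qed.
End averages.

(** * Uniform bounds from weak convergence *)

Section gliding_hump.
Variable R : realType.

(* Sokal's choice of signs: each new term is added with the sign that does not
   cancel the partial sum that it is tested on. *)
Lemma hump_signs (A : nat -> nat -> R) : exists sg : nat -> R, (forall j, `|sg j| <= 1) /\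
  forall k, 3 ^- k * `|A k k| <= `|\sum_(j < k.+1) sg j * 3 ^- j * A k j|.
Proof.
pose sgn (a b : R) : R := if 0 <= a * b then 1 else -1.
(* [st n] holds the first [n] signs: the sign of index n' is decided at stage n'+1 from the partial
   sum tested on row n', and by [stS] later stages leave it alone. *)
pose st := fix st n : nat -> R := match n with
  | 0 => fun=> 0
  | n'.+1 => fun j => if j == n' then sgn (\sum_(i < n') st n' i * 3 ^- i * A n' i) (A n' n') else st n' j
  end.
have stS n j : (j < n)%N -> st n j = st j.+1 j.
  elim: n => // n ih; rewrite ltnS leq_eqVlt => /orP[/eqP -> //|jn].
  by rewrite [LHS]/= (ltn_eqF jn) ih.
exists (fun j => st j.+1 j); split.
  by move=> j; rewrite /= eqxx /sgn; case: ifP; rewrite ?normrN normr1.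
move=> k; rewrite big_ord_recr/= eqxx.
have -> : \sum_(i < k) (if val i == i :> nat then sgn (\sum_(i0 < i) st i i0 * 3 ^- i0 * A i i0) (A i i) else st i i) * 3 ^- i * A k i =
    \sum_(i < k) st k i * 3 ^- i * A k i.
  by apply: eq_bigr => i _; rewrite (stS k i (ltn_ord i)) /=.
set a := \sum_(i < k) _; set b := A k k.
have p0 : 0 < 3 ^- k :> R by rewrite invr_gt0 exprn_gt0.
rewrite /sgn; case: ifP => ab.
  rewrite mul1r; have [a0|a0] := leP 0 a.
    have [b0|b0] := leP 0 b.
      by rewrite !ger0_norm ?addr_ge0 ?mulr_ge0 ?(ltW p0)// lerDr.
    have a00 : a = 0 by apply/eqP; rewrite eq_le a0 andbT; move: ab; rewrite nmulr_lge0.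
    by rewrite a00 add0r normrM (gtr0_norm p0).
  have b0 : b <= 0 by move: ab; rewrite nmulr_rge0.
  have q : 3 ^- k * b <= 0 by rewrite pmulr_rle0.
  by rewrite (ler0_norm b0) ler0_norm; lra.
have ab0 : a * b < 0 by rewrite ltNge ab.
rewrite mulN1r mulNr; have [a0|a0] := leP 0 a.
  have b0 : b <= 0 by rewrite leNgt; apply/negP => b0; move: ab0; rewrite ltNge mulr_ge0// ltW.
  have q : 3 ^- k * b <= 0 by rewrite pmulr_rle0.
  by rewrite (ler0_norm b0) ger0_norm; lra.
have b0 : 0 <= b by rewrite leNgt; apply/negP => b0; move: ab0; rewrite ltNge ltW// nmulr_lgt0.
have q : 0 <= 3 ^- k * b by rewrite mulr_ge0// ltW.
by rewrite (ger0_norm b0) ler0_norm; lra.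
Qed.

(** The terms after index k weigh at most 3^-k S_k / 2 because the sum of 3^-j over j > k is 3^-k /
    2; the diagonal keeps at least 2/3, and 2/3 - 1/2 = 1/6. *)
Lemma hump_matrix (A : nat -> nat -> R) (S : nat -> R) : (forall k j, `|A k j| <= S k) ->
  (forall k, 2 / 3 * S k <= `|A k k|) ->
  exists sg : nat -> R, (forall j, `|sg j| <= 1) /\
    forall k n, (k < n)%N -> 3 ^- k * S k / 6 <= `|\sum_(j < n) sg j * 3 ^- j * A k j|.
Proof.
move=> AS Akk; have [sg [sg1 Hsg]] := hump_signs A.
exists sg; split=> // k n kn.
have S0 : 0 <= S k by exact: le_trans (AS k 0%N).
have p0 : 0 < 3 ^- k :> R by rewrite invr_gt0 exprn_gt0.
have tail m : `|\sum_(k.+1 <= j < k.+1 + m) sg j * 3 ^- j * A k j| <= S k * (3 ^- k - 3 ^- (k + m)) / 2.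
  elim: m => [|m ih]; first by rewrite !addn0 big_geq// normr0 subrr mulr0 mul0r.
  rewrite addnS big_nat_recr/=; last by rewrite leq_addr.
  apply: (le_trans (ler_normD _ _)).
  have e : `|sg (k.+1 + m)%N * 3 ^- (k.+1 + m) * A k (k.+1 + m)%N| <= 3 ^- (k.+1 + m) * S k.
    rewrite !normrM -[leRHS]mul1r -mulrA; apply: ler_pM => //; apply: ler_pM => //.
    by rewrite ger0_norm// invr_ge0 exprn_ge0.
  apply: (le_trans (lerD ih e)); rewrite addSn addnS.
  have -> : 3 ^- (k + m).+1 = 3 ^- (k + m) / 3 :> R by rewrite exprSr invfM.
  set a := 3 ^- k; set b := 3 ^- (k + m).
  by rewrite le_eqVlt; apply/orP; left; apply/eqP; field.
have -> : \sum_(j < n) sg j * 3 ^- j * A k j =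
   \sum_(j < k.+1) sg j * 3 ^- j * A k j + \sum_(k.+1 <= j < n) sg j * 3 ^- j * A k j.
  rewrite -(big_mkord xpredT (fun j => sg j * 3 ^- j * A k j)) (big_cat_nat (n := k.+1))//=.
  by rewrite big_mkord.
have t := tail (n - k.+1)%N; rewrite subnKC// in t.
have h := Hsg k; have a := Akk k.
set x := \sum_(j < k.+1) _ in h *; set y := \sum_(k.+1 <= j < n) _ in t *.
have tri : `|x| <= `|x + y| + `|y| by rewrite -{1}(addrK y x) ler_normB.
have q0 : 0 <= 3 ^- (k + (n - k.+1)) :> R by rewrite invr_ge0 exprn_ge0.
have t2 : S k * (3 ^- k - 3 ^- (k + (n - k.+1))) / 2 <= 3 ^- k * S k / 2.
  by rewrite ler_pM2r ?invr_gt0// mulrC ler_wpM2r// lerBlDr lerDl.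
have h2 : 3 ^- k * (2 / 3 * S k) <= 3 ^- k * `|A k k| by rewrite ler_pM2l.
have e6 : 3 ^- k * S k / 6 = 3 ^- k * (2 / 3 * S k) - 3 ^- k * S k / 2 by field.
rewrite e6; lra.
Qed.

Variables (n : nat) (r : R) (v : R -> 'rV[R]_n -> R).
Hypothesis r0 : 0 < r.
Hypothesis mv : forall y, 0 < y -> mR (v y).
Hypothesis hv : forall y, 0 < y -> LR (fun x => v y x ^+ 2).
Hypothesis weak : forall g, mR g -> LR (fun x => g x ^+ 2) ->
  (fun y => IR (fun x => v y x * g x)) @ +oo --> (0 : R).
Let Q (x q : 'rV[R]_n) : R := boxi r (q - x).

Let Q01 x q : 0 <= Q x q <= 1.
Proof. by rewrite /Q boxiE; case: [forall i, _]; rewrite ?lexx ?ler01. Qed.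

Let LRQ x : LR (Q x) /\ IR (Q x) = (2 * r) ^+ n.
Proof. by have [h1 h2] := @LR_boxi R n r (ltW r0); split; [exact: LR_shift|rewrite IR_shift]. Qed.

Let Qsq x q : Q x q ^+ 2 = Q x q.
Proof. by rewrite /Q boxiE; case: [forall i, _]; rewrite ?expr1n ?expr0n. Qed.

Lemma box_pairing x y eta : 0 < y -> 0 < eta -> LR (fun q => v y q * Q x q) /\
  `|IR (fun q => v y q * Q x q)| <= (eta^-1 * IR (fun q => v y q ^+ 2) + eta * (2 * r) ^+ n) / 2.
Proof.
move=> y0 e0; have [q1 q2] := LRQ x.
have q3 : LR (fun q => Q x q ^+ 2) by under eq_fun do rewrite Qsq.
have h := LR_sqM (mv y0) (LR_mR q1) (hv y0) q3; split=> //.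
rewrite -q2 -!IRZ//; last exact: hv.
rewrite -IRD; [|by apply: LRZ; exact: hv|exact: LRZ].
rewrite mulrC -IRZ; last by apply: LRD; apply: LRZ => //; exact: hv.
apply: norm_IR_le => //; first by apply: LRZ; apply: LRD; apply: LRZ => //; exact: hv.
move=> q; rewrite -{2}Qsq normrM -(ler_pM2l (mulr_gt0 (ltr0n R 2) e0)).
have -> : 2 * eta * (2^-1 * (eta^-1 * v y q ^+ 2 + eta * Q x q ^+ 2)) =
   v y q ^+ 2 + (eta * Q x q) ^+ 2 by field; rewrite gt_eqF.
have /andP[Q0 _] := Q01 x q; rewrite (ger0_norm Q0) -(real_normK (num_real (v y q))).
have := sqr_ge0 (`|v y q| - eta * Q x q); rewrite sqrrB; lra.
Qed.

(** If the cube averages were unbounded at arbitrarily large heights, cubes could be chosen whose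
    signed series with weights 3^-j is a single L^2 function [g], and the pairings of the slices
    with [g] would stay at least 1, against weak convergence to 0. The bound is uniform in the
    position [x] of the cube. *)
Lemma gliding_hump : exists Y M : R, 0 < Y /\
  forall y x, Y <= y -> `|IR (fun q => v y q * Q x q)| <= M.
Proof.
apply: contrapT => no.
pose T y x := IR (fun q => v y q * Q x q).
(* Growth 6 * 4^k survives division by 6 * 3^k: the pairing of slice k with [g] is then at least
   1. *)
have /choice[yx Hyx] k : exists yx : R * 'rV[R]_n, k.+1%:R <= yx.1 /\ 6 * 4 ^+ k < `|T yx.1 yx.2|.
  apply: contrapT => nk; apply: no; exists k.+1%:R, (6 * 4 ^+ k); split; first by rewrite ltr0n.
  by move=> y x ky; rewrite leNgt; apply/negP => h; apply: nk; exists (y, x).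
pose y k := (yx k).1; have yk k : k.+1%:R <= y k by case: (Hyx k).
have y0 k : 0 < y k by apply: lt_le_trans (yk k); rewrite ltr0n.
pose E k := [set `|T (y k) x| | x in [set: 'rV[R]_n]].
have Esup k : has_sup (E k).
  split; first by exists `|T (y k) 0|; exists 0.
  exists ((1^-1 * IR (fun q => v (y k) q ^+ 2) + 1 * (2 * r) ^+ n) / 2) => _ [x _ <-].
  exact: (box_pairing x (y0 k) ltr01).2.
pose S k := sup (E k).
have TS k x : `|T (y k) x| <= S k by apply: sup_upper_bound => //; exists x.
have S4 k : 6 * 4 ^+ k < S k by apply: lt_le_trans (TS k (yx k).2); case: (Hyx k).
have S0 k : 0 < S k by apply: lt_trans (S4 k); rewrite mulr_gt0// exprn_gt0.
(* The supremum over all cubes is finite by [box_pairing] but may not be attained; the ratio 2/3 is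
   the one [hump_matrix] is calibrated for. *)
have /choice[xk Hxk] k : exists x, 2 / 3 * S k <= `|T (y k) x|.
  have e : 0 < S k / 3 by rewrite divr_gt0.
  have [_ [x _ <-] hx] := sup_adherent e (Esup k).
  by exists x; rewrite -/(S k) in hx; lra.
have [sg [sg1 Hsg]] := @hump_matrix (fun k j => T (y k) (xk j)) S (fun k j => TS k _) Hxk.
pose u q (j : nat) := sg j * 3 ^- j * Q (xk j) q.
pose w q (j : nat) := 3 ^- j * Q (xk j) q : R.
have sum3 k : \sum_(j < k) 3 ^- j <= 3 / 2 :> R.
  under eq_bigr do rewrite -exprVn.
  apply: (le_trans (geometric_le _ _ _)) => //; first by rewrite invf_lt1// ltr1n.
  by rewrite le_eqVlt; apply/orP; left; apply/eqP; field.
have w0 q j : 0 <= w q j by rewrite mulr_ge0 ?invr_ge0 ?exprn_ge0//; case/andP: (Q01 (xk j) q).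
have uw q j : `|u q j| <= w q j.
  rewrite /u -mulrA normrM (ger0_norm (w0 q j)) ler_piMl//.
have w3 q j : w q j <= geometric 1 (3^-1) j.
  rewrite /geometric/= mul1r exprVn ler_piMr ?invr_ge0 ?exprn_ge0//.
  by case/andP: (Q01 (xk j) q).
have cw q : cvgn (series (w q)).
  apply: (series_le_cvg (w0 q) _ (w3 q)).
    by move=> j; apply: le_trans (w3 q j).
  by apply: is_cvg_geometric_series; rewrite ger0_norm// invf_lt1// ltr1n.
have cu q : cvgn (series (u q)).
  apply: normed_cvg; apply: (series_le_cvg _ (w0 q) (uw q) (cw q)) => j; exact: normr_ge0.
pose G q := limn (series (w q)); pose g q := limn (series (u q)).
have Gw q k : series (w q) k <= G q.
  by apply: nondecreasing_cvgn_le; [apply: nondecreasing_series => j _ _; exact: w0|exact: cw].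
have ug q k : `|series (u q) k| <= G q.
  apply: le_trans (Gw q k); rewrite !seriesEnat/=; apply: (le_trans (ler_norm_sum _ _ _)).
  by apply: ler_sum => j _; exact: uw.
have G2 q : 0 <= G q <= 3 / 2.
  apply/andP; split; first by have := Gw q 0%N; rewrite seriesEnat/= big_geq.
  apply: limr_le; first exact: cw.
  apply: nearW => k; rewrite seriesEnat/=; apply: (@le_trans _ _ (\sum_(j < k) 3 ^- j)) => //.
  rewrite big_mkord; apply: ler_sum => j _.
  by have := w3 q j; rewrite /geometric/= mul1r exprVn.
have LRw k : LR (fun q => series (w q) k).
  have -> : (fun q => series (w q) k) = fun q => \sum_(0 <= j < k) w q j by apply/funext => q; rewrite seriesEnat.
  by apply: L1_sum => j _; apply: LRZ; case: (LRQ (xk j)).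
have LRu k : LR (fun q => series (u q) k).
  have -> : (fun q => series (u q) k) = fun q => \sum_(0 <= j < k) u q j by apply/funext => q; rewrite seriesEnat.
  by apply: L1_sum => j _; apply: LRZ; case: (LRQ (xk j)).
have mG : mR G.
  by apply: (measurable_fun_cvg (fun k => LR_mR (LRw k))) => t _; exact: cw.
have mg : mR g.
  by apply: (measurable_fun_cvg (fun k => LR_mR (LRu k))) => t _; exact: cu.
have LRG : LR G.
  (* Half of [G]: being strictly below the limit where [G] is positive, it is reached by finite
     partial sums, as [L1_exhaust] requires. *)
  have h : LR (fun q => 2^-1 * G q).
    have [] // := @L1_exhaust _ _ _ (leb_tuple R n) (fun k t => series (w (rV_of_tuple t)) k)
      (fun t => 2^-1 * G (rV_of_tuple t)) (3 / 2 * (2 * r) ^+ n).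
    - by apply: measurable_funM => //; exact: measurable_cst.
    - by move=> t; rewrite mulr_ge0//; case/andP: (G2 (rV_of_tuple t)).
    - move=> k t; rewrite !seriesEnat/= big_nat_recr//= lerDl w0 andbT.
      by apply: sumr_ge0.
    - move=> k; have -> : Int (leb_tuple R n) (fun t => series (w (rV_of_tuple t)) k) =
          \sum_(0 <= j < k) 3 ^- j * (2 * r) ^+ n.
        have -> : (fun t => series (w (rV_of_tuple t)) k) = fun t => \sum_(0 <= j < k) w (rV_of_tuple t) j.
          by apply/funext => t; rewrite seriesEnat.
        rewrite Int_sum; last by move=> j _; apply: (LRZ (3 ^- j) (LRQ (xk j)).1).
        apply: eq_bigr => j _; rewrite -(LRQ (xk j)).2.
        exact: (IRZ (3 ^- j) (LRQ (xk j)).1).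
      rewrite -mulr_suml ler_wpM2r ?exprn_ge0 ?mulr_ge0 ?(ltW r0)// big_mkord.
      exact: sum3.
    - move=> t; set q := rV_of_tuple t; have [G0|G0] := leP (G q) 0.
        by exists 0%N; rewrite seriesEnat/= big_geq// pmulr_rle0.
      have : \forall k \near \oo, 2^-1 * G q < series (w q) k.
        apply: (cvgr_gt (G q)); first exact: cw.
        by rewrite gtr_pMl// invf_lt1// ltr1n.
      by move=> h; have [k hk] := filter_ex h; exists k; exact: ltW.
  have := LRZ 2 h; congr LR; apply/funext => q; by rewrite mulrA mulfV// mul1r.
have gG q : `|g q| <= G q by apply: cvg_norm_le (ug q); exact: cu.
have LRG2 : LR (fun q => G q ^+ 2).
  apply: (LR_le _ _ (LRZ (3 / 2) LRG)); first exact: measurable_funX.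
  by move=> q; have /andP[h1 h2] := G2 q; rewrite ger0_norm ?sqr_ge0// expr2 ler_wpM2r.
have LRg2 : LR (fun q => g q ^+ 2).
  apply: (LR_le _ _ LRG2); first exact: measurable_funX.
  by move=> q; rewrite normrX lerXn2r ?nnegrE//; case/andP: (G2 q).
have Tg k : 3 ^- k * S k / 6 <= `|IR (fun q => v (y k) q * g q)|.
  have lim : (fun m => IR (fun q => v (y k) q * series (u q) m)) @ \oo --> IR (fun q => v (y k) q * g q).
    have LRvG : LR (fun q => `|v (y k) q| * G q).
      apply: LR_sqM => //; first exact: measurableT_comp (mv (y0 k)).
      by under eq_fun do rewrite real_normK ?num_real//; exact: hv.
    apply: (IR_lim _ _ _ LRvG).2.
    - by move=> m; apply: measurable_funM; [exact: mv|exact: LR_mR (LRu m)].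
    - by move=> q; apply: cvgMl_tmp; exact: cu.
    - by move=> m q; rewrite normrM ler_wpM2l.
  have nlim : (fun m => `|IR (fun q => v (y k) q * series (u q) m)|) @ \oo --> `|IR (fun q => v (y k) q * g q)|.
    exact: cvg_norm lim.
  rewrite -(cvg_lim (@Rhausdorff R) nlim); apply: limr_ge; first by apply: cvgP nlim.
  near=> m; have km : (k < m)%N by near: m; exact: nbhs_infty_gt.
  apply: (le_trans (Hsg k m km)).
  have -> // : IR (fun q => v (y k) q * series (u q) m) = \sum_(j < m) sg j * 3 ^- j * T (y k) (xk j).
  have h j : LR (fun q => v (y k) q * Q (xk j) q) by exact: (box_pairing (xk j) (y0 k) ltr01).1.
  rewrite -(big_mkord xpredT (fun j => sg j * 3 ^- j * T (y k) (xk j))).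
  have -> : (fun q => v (y k) q * series (u q) m) =
      fun q => \sum_(0 <= j < m) (sg j * 3 ^- j) * (v (y k) q * Q (xk j) q).
    by apply/funext => q; rewrite seriesEnat/= mulr_sumr; apply: eq_bigr => j _; rewrite /u mulrCA.
  rewrite {1}/IR Int_sum; last by move=> j _; exact: (LRZ (sg j * 3 ^- j) (h j)).
  by apply: eq_bigr => j _; exact: (IRZ (sg j * 3 ^- j) (h j)).
have /cvgrPdist_lt/(_ 1 ltr01) := weak mg LRg2.
move=> -[N [_ HN]].
have [k Nk] := filter_ex (nbhs_infty_gtr N).
have yN : N < y k by apply: (lt_le_trans Nk); apply: le_trans (yk k); rewrite ler_nat.
have := HN (y k) yN; rewrite sub0r normrN; apply/negP; rewrite -leNgt.
apply: le_trans (Tg k).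
have p3 : 0 < 3 ^+ k :> R by exact: exprn_gt0.
have p4 : 3 ^+ k <= 4 ^+ k :> R by rewrite lerXn2r ?nnegrE// ler_nat.
rewrite ler_pdivlMr// mul1r mulrC ler_pdivlMr//.
by apply: le_trans (ltW (S4 k)); rewrite ler_pM2l.
Unshelve. all: by end_near.
Qed.
End gliding_hump.

(** * Two extensions of the same function coincide *)

Section uniqueness.
Variables (R : realType) (d : nat) (s : R).
Hypothesis hs : 0 < s < 1.
Local Notation V := 'rV[R]_(d + 1).
Local Notation W := 'rV[R]_d.
Local Notation HS := (@half_space R d).
Implicit Types (f : W -> R) (U : V -> R).

(** What the real and imaginary parts of an extension inherit, with L^2 norms replaced by real
    square integrals. *)
Definition real_extension f U : Prop :=
  [/\ rsmooth HS U, forall z, HS z -> lap s U z = 0,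
      forall y, 0 < y -> LR (fun x => U (half_point x y) ^+ 2),
      (fun y => IR (fun x => (U (half_point x y) - f x) ^+ 2)) @ 0^'+ --> (0 : R) /\
      forall y0, 0 < y0 -> (fun y => IR (fun x => (U (half_point x y) - U (half_point x y0)) ^+ 2)) @ y0 --> (0 : R)
    & forall g, mR g -> LR (fun x => g x ^+ 2) ->
        (fun y => IR (fun x => U (half_point x y) * g x)) @ +oo --> (0 : R)].

Lemma mR_slice U y : rsmooth HS U -> 0 < y -> mR (fun x : W => U (half_point x y)).
Proof.
move=> sU y0; have hz : HS (half_point 0 y) by rewrite /half_space/= height_half.
have := mR_translate (rsmooth_cont sU) hz; congr mR; apply/funext => x.
by rewrite /half_point /emb add_row_mx add0r addr0.
Qed.

Lemma IR_sq_le_L2 n (p : 'rV[R]_n -> R) (g : 'rV[R]_n -> R[i]) :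
  L2 g -> mR p -> (forall x, `|p x| <= Normc.normc (g x)) ->
  LR (fun x => p x ^+ 2) /\ IR (fun x => p x ^+ 2) <= fine (L2norm g) ^+ 2.
Proof.
move=> hg mp pg; have h := L2_LR hg.
have b x : p x ^+ 2 <= complex.Re (g x) ^+ 2 + complex.Im (g x) ^+ 2.
  by rewrite -sqr_normc -(real_normK (num_real (p x))) lerXn2r ?nnegrE// (le_trans _ (pg x)).
have hp : LR (fun x => p x ^+ 2).
  by apply: (LR_le _ _ h); [exact: measurable_funX|move=> x; rewrite ger0_norm ?sqr_ge0].
split=> //; rewrite L2norm_LR//= sqr_sqrtr; last by apply: IR_ge0 => x; rewrite addr_ge0 ?sqr_ge0.
exact: le_IR.
Qed.

Lemma real_extension_part (b : bool) (p : R[i] -> R) (F : W -> R[i]) (u : V -> R[i]) :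
  p = (fun z => if b then complex.Re z else complex.Im z) ->
  mR (fun x => complex.Re (F x)) -> mR (fun x => complex.Im (F x)) ->
  cs_extension s F u -> real_extension (fun x => p (F x)) (fun z => p (u z)).
Proof.
move=> pE mr mi [su du _ [L2u cu c0] wu].
have [s1 s2] : rsmooth HS (fun w => complex.Re (u w)) /\ rsmooth HS (fun w => complex.Im (u w)).
  exact/smooth_onE.
have pB z w : p (z - w) = p z - p w by rewrite pE; case: b {pE}; case: z => ? ?; case: w => ? ?.
have pn z : `|p z| <= Normc.normc z.
  by rewrite pE; case: b {pE}; [exact: le_Re_normc|exact: le_Im_normc].
have sp : rsmooth HS (fun z => p (u z)) by rewrite pE; case: b {pE}.
have mF : mR (fun x => p (F x)) by rewrite pE; case: b {pE}.
have msl y : 0 < y -> mR (fun x => p (u (half_point x y))) by move=> y0; exact: (mR_slice sp y0).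
have mre y : 0 < y -> mR (fun x => complex.Re (u (half_point x y))) by move=> y0; exact: (mR_slice s1 y0).
have mim y : 0 < y -> mR (fun x => complex.Im (u (half_point x y))) by move=> y0; exact: (mR_slice s2 y0).
have key (Fl : set_system R) (FF : ProperFilter Fl) (G : W -> R[i]) :
    mR (fun x => complex.Re (G x)) -> mR (fun x => complex.Im (G x)) ->
    (\forall y \near Fl, 0 < y) ->
    L2norm (fun x => slice u y x - G x) @[y --> Fl] --> 0%E ->
    (fun y => IR (fun x => (p (u (half_point x y)) - p (G x)) ^+ 2)) @ Fl --> (0 : R).
  move=> mG1 mG2 Fp /fine_cvgP[fin lim].
  have mG : mR (fun x => p (G x)) by rewrite pE; case: b {pE}.
  have sqlim : (fun y => fine (L2norm (fun x => slice u y x - G x)) ^+ 2) @ Fl --> (0 : R).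
    by have h := cvgM lim lim; rewrite mulr0 in h; exact: h.
  apply/cvgrPdist_lt => e e0; move/cvgrPdist_lt : sqlim => /(_ e e0) sq.
  apply: filterS3 Fp fin sq => y y0 finy sqy.
  have hL : L2 (fun x => slice u y x - G x).
    have e1 : (fun x => complex.Re (slice u y x - G x)) = fun x => complex.Re (u (half_point x y)) - complex.Re (G x).
      by apply/funext => x; rewrite /slice; case: (u _) => ? ?; case: (G x).
    have e2 : (fun x => complex.Im (slice u y x - G x)) = fun x => complex.Im (u (half_point x y)) - complex.Im (G x).
      by apply/funext => x; rewrite /slice; case: (u _) => ? ?; case: (G x).
    split.
    - have := measurable_funB (mre y y0) mG1; congr measurable_fun; apply/funext => t.
      by move/(congr1 (@^~ (rV_of_tuple t))): e1 => ->.
    - have := measurable_funB (mim y y0) mG2; congr measurable_fun; apply/funext => t.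
      by move/(congr1 (@^~ (rV_of_tuple t))): e2 => ->.
    - by rewrite ltey_eq finy.
  have pG x : `|p (u (half_point x y)) - p (G x)| <= Normc.normc (slice u y x - G x).
    by rewrite -pB; exact: pn.
  have [h1 h2] := @IR_sq_le_L2 d (fun x => p (u (half_point x y)) - p (G x)) _ hL
    (measurable_funB (msl y y0) mG) pG.
  rewrite sub0r normrN ger0_norm; last by apply: IR_ge0 => x; exact: sqr_ge0.
  apply: (le_lt_trans h2); apply: le_lt_trans (ler_norm _) _.
  by rewrite sub0r normrN in sqy.
split => //.
- move=> z hz; have [] := (lap_ReIm s su hz).1 (du z hz).
  by rewrite pE; case: b {pE}.
- move=> y y0; have [] // := @IR_sq_le_L2 d (fun x => p (u (half_point x y))) _ (L2u y y0) (msl y y0).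
- split; first exact: (key _ _ F mr mi (nbhs_right_gt 0) c0).
  move=> y0 y00; apply: (key _ _ (slice u y0) (mre y0 y00) (mim y0 y00) _ (cu y0 y00)).
  exact: lt_nbhsr.
- move=> g mg hg.
  have hG : L2 (fun x => ((g x)%:C%C : R[i])).
    by split; [exact: mg|exact: measurable_cst|rewrite L2norm_rc// ltry].
  have /cvgrPdist_lt H := wu _ hG; apply/cvgrPdist_lt => e e0.
  apply: filterS (H e e0) => y; rewrite !sub0r !normrN ger0_norm ?sqrtr_ge0// => h.
  have E : `|IR (fun x => p (u (half_point x y)) * g x)| <=
     Normc.normc (cintegral (fun x => slice u y x * ((g x)%:C%C)^*%C) - 0).
    rewrite subr0; apply: le_trans (pn _); rewrite pE /cintegral; case: b {pE} => /=.
      rewrite le_eqVlt; apply/orP; left; apply/eqP; congr `|_|; congr Rintegral; apply/funext => t.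
      by rewrite /slice; case: (u _) => a b' /=; ring.
    rewrite le_eqVlt; apply/orP; left; apply/eqP; congr `|_|; congr Rintegral; apply/funext => t.
    by rewrite /slice; case: (u _) => a b' /=; ring.
  by apply: (le_lt_trans E).
Qed.
Lemma sqB_le n (a b : 'rV[R]_n -> R) : mR a -> mR b ->
  LR (fun x => a x ^+ 2) -> LR (fun x => b x ^+ 2) ->
  LR (fun x => (a x - b x) ^+ 2) /\
  IR (fun x => (a x - b x) ^+ 2) <= 2 * IR (fun x => a x ^+ 2) + 2 * IR (fun x => b x ^+ 2).
Proof.
move=> ma mb ha hb.
have h : LR (fun x => 2 * a x ^+ 2 + 2 * b x ^+ 2) by apply: LRD; exact: LRZ.
have p x : (a x - b x) ^+ 2 <= 2 * a x ^+ 2 + 2 * b x ^+ 2.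
  by have := sqr_ge0 (a x + b x); rewrite sqrrB sqrrD; lra.
have hd : LR (fun x => (a x - b x) ^+ 2).
  apply: (LR_le _ _ h); first by apply: measurable_funX; exact: measurable_funB.
  by move=> x; rewrite ger0_norm ?sqr_ge0.
split=> //; rewrite -!IRZ// -IRD; [exact: le_IR|exact: LRZ|exact: LRZ].
Qed.

Lemma sum_sub_id (I : finType) (a b : I -> R) c x y :
  \sum_i (a i + -1 * b i) + c * (x + -1 * y) = (\sum_i a i + c * x) - (\sum_i b i + c * y).
Proof. by rewrite big_split/= -mulr_sumr; ring. Qed.

Lemma lap_sub U U' z : rsmooth HS U -> rsmooth HS U' -> HS z ->
  lap s (fun w => U w + (-1) * U' w) z = lap s U z - lap s U' z.
Proof.
move=> sU sU' hz.
have hp i (g : V -> R) : rsmooth HS g -> hpartial i g (rpartial i g).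
  by move=> sg w hw; split=> //; exact: rsmooth_diff sg _ hw.
have h1 i : hpartial i (fun w => U w + (-1) * U' w) (fun w => rpartial i U w + (-1) * rpartial i U' w).
  move=> w hw; have [p1 p2] := hpartialD (hp i _ sU) (hpartialM (@hpartial_cst R d i (-1)) (hp i _ sU')) hw.
  by split=> //; rewrite p2 mulr0 addr0.
have h2 i : hpartial i (fun w => rpartial i U w + (-1) * rpartial i U' w)
   (fun w => rpartial i (rpartial i U) w + (-1) * rpartial i (rpartial i U') w).
  move=> w hw; have [p1 p2] := hpartialD (hp i _ (rsmooth_rpartial i sU))
    (hpartialM (@hpartial_cst R d i (-1)) (hp i _ (rsmooth_rpartial i sU'))) hw.
  by split=> //; rewrite p2 mulr0 addr0.
have e1 := (h1 (ycoord d) z hz).2.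
have e2 i := (hpartial2 (h1 i) (h2 i) hz).2.
clear h1 h2 hp.
have e3 : \sum_i rpartial i (rpartial i (fun w => U w + -1 * U' w)) z =
    \sum_i (rpartial i (rpartial i U) z + -1 * rpartial i (rpartial i U') z).
  by apply: eq_bigr => i _; exact: e2.
apply: (etrans (f_equal2 (fun a b => a + (1 - 2 * s) / height z * b) e3 e1)).
exact: sum_sub_id.
Qed.

(** If the difference [v] were positive at [z], so would be its average over a small cube. That
    average is bounded above on the half-space: at low heights by the limit at 0 in L^2, at middle
    heights by compactness, at large heights by [gliding_hump]. It also tends to 0 at the boundary
    uniformly in [x], so the maximum principle makes it nonpositive. *)
Lemma real_extension_le f U U' : mR f -> LR (fun x => f x ^+ 2) ->
  real_extension f U -> real_extension f U' -> forall z, HS z -> U z <= U' z.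
Proof.
move=> mf hf [sU lU hU [oU cU] wU] [sU' lU' hU' [oU' cU'] wU'].
pose v w := U w + (-1) * U' w.
have sv : rsmooth HS v.
  by apply: rsmoothD; [exact: open_half_space|exact: sU|apply: rsmoothZ => //; exact: open_half_space].
have lv w : HS w -> lap s v w = 0 by move=> hw; rewrite lap_sub// lU// lU'// subr0.
pose vs y x := v (half_point x y).
have vsE y x : vs y x = U (half_point x y) - U' (half_point x y) by rewrite /vs /v mulN1r.
have mU y : 0 < y -> mR (fun x => U (half_point x y)) by exact: mR_slice.
have mU' y : 0 < y -> mR (fun x => U' (half_point x y)) by exact: mR_slice.
have mv y : 0 < y -> mR (vs y) by exact: mR_slice.
have hv y : 0 < y -> LR (fun x => vs y x ^+ 2).
  move=> y0; have [h _] := sqB_le (mU y y0) (mU' y y0) (hU y y0) (hU' y y0).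
  by under eq_fun do rewrite vsE.
pose N y := IR (fun x => vs y x ^+ 2).
have wv g : mR g -> LR (fun x => g x ^+ 2) -> (fun y => IR (fun x => vs y x * g x)) @ +oo --> (0 : R).
  move=> mg hg; have h : (fun y => IR (fun x => U (half_point x y) * g x) - IR (fun x => U' (half_point x y) * g x)) @ +oo --> (0 : R).
    by rewrite -(subrr (0 : R)); apply: cvgB; [exact: wU|exact: wU'].
  apply: cvg_trans h.
  apply: near_eq_cvg; near=> y; have y0 : 0 < y by near: y; exact: nbhs_pinfty_gt.
  rewrite /= -[LHS](IRB (LR_sqM (mU y y0) mg (hU y y0) hg) (LR_sqM (mU' y y0) mg (hU' y y0) hg)).
  by congr IR; apply/funext => x; rewrite vsE mulrBl.
have N0 e : 0 < e -> exists2 eta, 0 < eta & forall y, 0 < y < eta -> N y <= e.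
  move=> e0; have e4 : 0 < e / 4 by rewrite divr_gt0.
  move/cvgrPdist_lt : oU => /(_ _ e4) o1; move/cvgrPdist_lt : oU' => /(_ _ e4) o2.
  have : \forall y \near 0^'+, N y <= e.
    near=> y; have y0 : 0 < y by near: y; exact: nbhs_right_gt.
    have a1 : `|0 - IR (fun x => (U (half_point x y) - f x) ^+ 2)| < e / 4 by near: y.
    have a2 : `|0 - IR (fun x => (U' (half_point x y) - f x) ^+ 2)| < e / 4 by near: y.
    have [h1 _] := sqB_le (mU y y0) mf (hU y y0) hf.
    have [h2 _] := sqB_le (mU' y y0) mf (hU' y y0) hf.
    have [_ h3] := sqB_le (measurable_funB (mU y y0) mf) (measurable_funB (mU' y y0) mf) h1 h2.
    have -> : N y = IR (fun x => (U (half_point x y) - f x - (U' (half_point x y) - f x)) ^+ 2).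
      by congr IR; apply/funext => x; rewrite vsE; congr (_ ^+ 2); ring.
    apply: (le_trans h3); move: a1 a2; rewrite !sub0r !normrN.
    by move=> /ltr_normlW a1 /ltr_normlW a2; lra.
  rewrite near_withinE => /nbhs_ballP[eta /= eta0 he]; exists eta => // y /andP[y0 ye].
  by apply: he => //; rewrite /ball/= sub0r normrN gtr0_norm.
(* The constant is 2 (2 + 2) = 8: two uses of (a - b)^2 <= 2 a^2 + 2 b^2 on terms whose square
   integrals are below 1. *)
have Nloc (y0 : R) : 0 < y0 -> \forall y \near y0, 0 < y /\ N y <= 2 * N y0 + 8.
  move=> y00.
  move/cvgrPdist_lt : (cU y0 y00) => /(_ _ ltr01) o1; move/cvgrPdist_lt : (cU' y0 y00) => /(_ _ ltr01) o2.
  near=> y; have yp : 0 < y by near: y; exact: lt_nbhsr.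
  split=> //.
  have a1 : `|0 - IR (fun x => (U (half_point x y) - U (half_point x y0)) ^+ 2)| < 1 by near: y.
  have a2 : `|0 - IR (fun x => (U' (half_point x y) - U' (half_point x y0)) ^+ 2)| < 1 by near: y.
  have [h1 _] := sqB_le (mU y yp) (mU y0 y00) (hU y yp) (hU y0 y00).
  have [h2 _] := sqB_le (mU' y yp) (mU' y0 y00) (hU' y yp) (hU' y0 y00).
  have [h3 h4] := sqB_le (measurable_funB (mU y yp) (mU y0 y00)) (measurable_funB (mU' y yp) (mU' y0 y00)) h1 h2.
  have mN : mR (fun x => - vs y0 x) by apply: measurableT_comp (mv y0 y00).
  have hN : LR (fun x => (- vs y0 x) ^+ 2) by under eq_fun do rewrite sqrrN; exact: hv.
  have [_ h5] := sqB_le (measurable_funB (measurable_funB (mU y yp) (mU y0 y00)) (measurable_funB (mU' y yp) (mU' y0 y00))) mN h3 hN.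
  have -> : N y = IR (fun x => (U (half_point x y) - U (half_point x y0) -
     (U' (half_point x y) - U' (half_point x y0)) - (- vs y0 x)) ^+ 2).
    by congr IR; apply/funext => x; rewrite !vsE; congr (_ ^+ 2); ring.
  apply: (le_trans h5).
  have -> : IR (fun x => (- vs y0 x) ^+ 2) = N y0 by congr IR; apply/funext => x; rewrite sqrrN.
  move: a1 a2; rewrite !sub0r !normrN => /ltr_normlW a1 /ltr_normlW a2; lra.
(* Local boundedness of the L^2 norm in the height becomes boundedness on a compact interval, by
   compactness in covering form with M -> +oo as the second filter. *)
have Ncompact a b : 0 < a -> exists M, forall y, a <= y <= b -> N y <= M.
  move=> a0.
  have /compact_near_coveringP/(_ R (+oo : set_system R) (fun M y => N y <= M)) := @segment_compact R a b.
  case=> [y|]; last first.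
    by move=> M [_ HM]; exists (M + 1) => y hy; apply: (HM (M + 1)) => //=; rewrite ?ltrDl// in_itv.
  rewrite /= in_itv/= => /andP[ay yb]; have y0 : 0 < y by exact: lt_le_trans ay.
  exists ([set y' | 0 < y' /\ N y' <= 2 * N y + 8], [set M | 2 * N y + 8 < M]); first split => /=.
  - exact: Nloc.
  - by apply: nbhs_pinfty_gt; rewrite num_real.
  - by move=> [y' M] /= [[_ h1] h2]; exact: le_trans h1 (ltW h2).
move=> z hz; rewrite -subr_le0 -[X in X <= _](_ : v z = _); last by rewrite /v mulN1r.
rewrite leNgt; apply/negP => vz.
have cv : {for z, continuous v} by exact: (rsmooth_cont sv).
have v2 : 0 < v z / 2 by rewrite divr_gt0.
have /nbhs_ballP[r /= r0 hr] : \forall w \near z, v z / 2 < v w.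
  by apply: (@cvgr_gt R V (nbhs z) _ v (v z) cv); rewrite ltr_pdivrMr// ltr_pMr// ltr1n.
have avgE x y : 0 < y -> avg r v (half_point x y) = IR (fun q => vs y q * boxi r (q - x)).
  move=> y0; have [h _] := box_pairing r0 mv hv x y0 ltr01.
  rewrite -(IR_shift x h) /avg; congr IR; apply/funext => q.
  rewrite addrK mulrC; congr (v _ * _).
  by rewrite /half_point /emb add_row_mx addr0 addrC.
have avg_le x y eta : 0 < y -> 0 < eta -> avg r v (half_point x y) <= (eta^-1 * N y + eta * (2 * r) ^+ d) / 2.
  move=> y0 e0; rewrite avgE//; have [_ h] := box_pairing r0 mv hv x y0 e0.
  by apply: le_trans h; exact: ler_norm.
have D0 : 0 < (2 * r) ^+ d by rewrite exprn_gt0// mulr_gt0.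
have [Y [M1 [Y0 HM1]]] := gliding_hump r0 mv hv wv.
have [eta eta0 Heta] := N0 1 ltr01.
have [M2 HM2] := Ncompact eta Y eta0.
pose B := `|M1| + (1 + `|M2| + (2 * r) ^+ d).
have aB w : HS w -> avg r v w <= B.
  move=> hw; have w0 : 0 < height w by []. rewrite (half_pointE w) /B.
  have n1 := normr_ge0 M1; have n2 := normr_ge0 M2.
  have [Yw|wY] := leP Y (height w).
    have := HM1 _ (lsubmx w) Yw; rewrite -avgE// => h.
    have := le_trans (ler_norm _) h; have := ler_norm M1; lra.
  have := avg_le (lsubmx w) (height w) 1 w0 ltr01; rewrite invr1 !mul1r.
  have [ew|we] := leP eta (height w).
    have := HM2 (height w); rewrite ew (ltW wY) => /(_ isT); have := ler_norm M2; lra.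
  have := Heta (height w); rewrite w0 we => /(_ isT); lra.
have a0 e : 0 < e -> exists2 eta, 0 < eta & forall w, 0 < height w < eta -> avg r v w <= e.
  (* The weight in Young's inequality for which the cube contributes exactly [e]; the slice
     contributes at most [e] once its square integral is below k e, and the average of the two is
     [e]. *)
  move=> e0; pose k := e / (2 * r) ^+ d; have k0 : 0 < k by rewrite divr_gt0.
  have [eta' eta'0 H'] := N0 (k * e) (mulr_gt0 k0 e0); exists eta' => // w hw.
  have w0 : 0 < height w by case/andP: hw.
  rewrite (half_pointE w); apply: (le_trans (avg_le (lsubmx w) _ k w0 k0)).
  have := H' _ hw => h; have : k^-1 * N (height w) <= e by rewrite ler_pdivrMl.
  have -> : k * (2 * r) ^+ d = e by rewrite /k mulfVK ?gt_eqF.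
  lra.
have := @maximum_principle R d s hs _ B (avg_smooth r0 sv)
  (fun w hw => lap_avg r0 sv hw lv) aB a0 z hz.
apply/negP; rewrite -ltNge.
have [b1 b2] := @LR_boxi R d r (ltW r0).
apply: (@lt_le_trans _ _ (v z / 2 * (2 * r) ^+ d)); first exact: mulr_gt0.
rewrite -b2 -IRZ//; apply: le_IR; [exact: LRZ|exact: LR_avg (rsmooth_cont sv) hz|move=> q].
have [->|[q1 qr]] := boxi_cases r q; first by rewrite mulr0 mul0r.
rewrite q1 mulr1 mul1r; apply: ltW; apply: hr.
rewrite mx_norm_ball /ball_/= opprD addrA subrr add0r normrN.
rewrite [ltLHS]/Num.norm/= mx_normrE; apply: bigmax_lt => [//|[i0 i] _ /=].
rewrite ord1 /emb; case: (split_ordP i) => j ->; first by rewrite row_mxEl.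
by rewrite row_mxEr mxE normr0.
Unshelve. all: by end_near.
Qed.

Lemma real_extension_unique f U U' : mR f -> LR (fun x => f x ^+ 2) ->
  real_extension f U -> real_extension f U' -> forall z, HS z -> U z = U' z.
Proof.
move=> mf hf e1 e2 z hz; apply/eqP; rewrite eq_le.
by rewrite (real_extension_le mf hf e1 e2)// (real_extension_le mf hf e2 e1).
Qed.
End uniqueness.

(** * Moments and the symbol *)

Section trigonometric_series.
Variable R : realType.
Implicit Types (b : bool) (y : R).

(* [trg false] is the cosine and [trg true] the sine; [b] is also the parity of the power series. *)
Definition trg b y : R := if b then sin y else cos y.
(** Taylor coefficients of both functions at once; they vanish when the parity of the order differs
    from [b]. *)
Definition trgc b n : R := (odd n == b)%:R * (-1) ^+ n./2 / n`!%:R.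
Definition trgs b N y : R := \sum_(k < N) trgc b k * y ^+ k.

Lemma trg_le1 b y : `|trg b y| <= 1.
Proof. by case: b; [exact: sin_max|exact: cos_max]. Qed.

Lemma continuous_trg b : continuous (trg b).
Proof. by case: b; [exact: continuous_sin|exact: continuous_cos]. Qed.

Lemma trgs_cvg b y : (fun N => trgs b N y) @ \oo --> trg b y.
Proof.
case: b; rewrite /trg ?sin.unlock ?cos.unlock.
  rewrite (_ : (fun N => _) = series (sin_coeff y)); first exact: is_cvg_series_sin_coeff.
  apply/funext => N; rewrite seriesEnat /trgs /= big_mkord; apply: eq_bigr => -[k /= _] _.
  rewrite /sin_coeff /trgc /=; case ok : (odd k) => /=; last by rewrite !mul0r.
  have -> : k./2 = k.-1./2 by case: k ok => //= k; rewrite uphalf_half => /negbTE ->.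
  rewrite !mul1r.
  by ring.
rewrite (_ : (fun N => _) = series (cos_coeff y)); first exact: is_cvg_series_cos_coeff.
apply/funext => N; rewrite seriesEnat /trgs /= big_mkord; apply: eq_bigr => -[k /= _] _.
rewrite /cos_coeff /trgc /=; case: (odd k) => /=; first by rewrite !mul0r.
by rewrite -exprnP !mul1r; ring.
Qed.

Lemma trgc_le b n : `|trgc b n| <= n`!%:R^-1.
Proof.
rewrite /trgc !normrM normrX normrN normr1 expr1n mulr1 [X in _ * X]ger0_norm ?invr_ge0//.
by rewrite ler_piMl ?invr_ge0//; case: (odd n == b); rewrite ?normr0 ?normr1.
Qed.

Lemma trgc_neq0 n : trgc (odd n) n != 0.
Proof.
by rewrite /trgc eqxx mul1r mulf_neq0 ?invr_eq0 ?pnatr_eq0 -?lt0n ?fact_gt0 ?signr_eq0//.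
Qed.

Lemma trgc_parity b n : odd n != b -> trgc b n = 0.
Proof. by move=> /negbTE h; rewrite /trgc h !mul0r. Qed.

Lemma exp_sum_le y N : 0 <= y -> \sum_(k < N) y ^+ k / k`!%:R <= expR y.
Proof.
move=> y0; rewrite -(big_mkord xpredT (fun k => y ^+ k / k`!%:R)) expRE /pseries.
have -> : (fun n : nat => (n`!%:R)^-1 * y ^+ n) = exp_coeff y by rewrite exp_coeffE.
have -> : \sum_(0 <= i < N) y ^+ i / i`!%:R = series (exp_coeff y) N by rewrite seriesEnat.
apply: nondecreasing_cvgn_le; last exact: is_cvg_series_exp_coeff.
by apply: nondecreasing_series => k _ _; exact: exp_coeff_ge0.
Qed.

Lemma trgs_le b N y : `|trgs b N y| <= expR `|y|.
Proof.
apply: (le_trans (ler_norm_sum _ _ _)); apply: le_trans (exp_sum_le N (normr_ge0 y)).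
by apply: ler_sum => k _; rewrite normrM normrX mulrC ler_wpM2l ?exprn_ge0 ?trgc_le.
Qed.

(** One bound for all real [y]: beyond 1 the partial sum itself is at most e |y|^N, below 1 the tail
    of the series is. *)
Lemma trg_remainder b N y : `|trg b y - trgs b N y| <= (1 + expR 1) * `|y| ^+ N.
Proof.
have e1 := expR_gt0 (1 : R); have yN : 0 <= `|y| ^+ N by rewrite exprn_ge0.
have [y1|y1] := leP `|y| 1; last first.
  have a1 : 1 <= `|y| ^+ N by rewrite exprn_ege1// ltW.
  apply: (le_trans (ler_normB _ _)).
  have h : `|trgs b N y| <= `|y| ^+ N * expR 1.
    apply: (@le_trans _ _ (\sum_(k < N) `|y| ^+ N * (1 ^+ k / k`!%:R))); last first.
      by rewrite -mulr_sumr ler_wpM2l ?exp_sum_le.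
    apply: (le_trans (ler_norm_sum _ _ _)); apply: ler_sum => k _.
    rewrite normrM normrX mulrC; apply: ler_pM; rewrite ?exprn_ge0 ?normr_ge0//.
      by apply: ler_weXn2l; [exact: ltW|exact: ltnW].
    by rewrite expr1n mul1r trgc_le.
  have := trg_le1 b y; rewrite mulrDl mul1r [expR 1 * _]mulrC; lra.
have lim : (fun M => trgs b (N + M) y - trgs b N y) @ \oo --> trg b y - trgs b N y.
  apply: cvgB; last exact: cvg_cst.
  have := @trgs_cvg b y; rewrite -(cvg_shiftn N); apply: cvg_trans.
  by apply: near_eq_cvg; apply: nearW => M; rewrite addnC.
apply: (cvg_norm_le lim) => M; rewrite /trgs big_split_ord/= addrAC subrr add0r.
apply: (le_trans (ler_norm_sum _ _ _)).
apply: (@le_trans _ _ (\sum_(k < M) `|y| ^+ N * (1 ^+ k / k`!%:R))).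
  apply: ler_sum => k _; rewrite normrM normrX mulrC exprD expr1n mul1r.
  apply: ler_pM; rewrite ?mulr_ge0 ?exprn_ge0 ?normr_ge0//.
    by rewrite ler_piMr ?exprn_ge0// exprn_ile1.
  apply: (le_trans (trgc_le _ _)); rewrite lef_pV2 ?posrE ?ltr0n ?fact_gt0//.
  by rewrite ler_nat leq_fact// leq_addl.
rewrite -mulr_sumr mulrDl mul1r mulrC; apply: (@le_trans _ _ (expR 1 * `|y| ^+ N)).
  by rewrite ler_wpM2r// exp_sum_le.
by rewrite lerDr.
Qed.

Lemma norm_exprB (a b : R) m : `|a| <= 1 -> `|b| <= 1 -> `|a ^+ m - b ^+ m| <= m%:R * `|a - b|.
Proof.
move=> a1 b1; elim: m => [|m ih]; first by rewrite !expr0 subrr normr0 mul0r.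
rewrite !exprS (_ : a * a ^+ m - b * b ^+ m = a * (a ^+ m - b ^+ m) + (a - b) * b ^+ m); last by ring.
apply: (le_trans (ler_normD _ _)); rewrite !normrM -[m.+1]addn1 natrD mulrDl mul1r.
apply: lerD; first by apply: le_trans ih; rewrite ler_piMl.
by rewrite ler_piMr// normrX exprn_ile1.
Qed.

(* Both sides agree with 1 - y^2/2 up to O(y^4). *)
Lemma cos_gauss_le : exists C, forall y, `|cos y - expR (- (y ^+ 2 / 2))| <= C * y ^+ 4.
Proof.
exists (1 + expR 1 + 1) => y.
have t4 : trgs false 4 y = 1 - y ^+ 2 / 2.
  by rewrite /trgs !big_ord_recr big_ord0 /trgc /= !factS fact0; field.
have h := trg_remainder false 4 y; rewrite t4 /= in h.
have y4 : `|y| ^+ 4 = y ^+ 4 by rewrite -normrX ger0_norm// (_ : y ^+ 4 = (y ^+ 2) ^+ 2) ?sqr_ge0//; ring.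
rewrite y4 in h; set w := y ^+ 2 / 2; have w0 : 0 <= w by rewrite divr_ge0 ?sqr_ge0.
have e1 : 1 - w <= expR (- w) by exact: expR_ge1Dx.
have e2 : expR (- w) <= 1 - w + w ^+ 2.
  have p : 0 < 1 + w by rewrite ltr_wpDr.
  rewrite expRN; apply: (@le_trans _ _ (1 + w)^-1).
    by rewrite lef_pV2 ?posrE ?expR_gt0 ?expR_ge1Dx.
  rewrite -[leLHS]mul1r ler_pdivrMr//; have -> : (1 - w + w ^+ 2) * (1 + w) = 1 + w ^+ 3 by ring.
  by rewrite lerDl exprn_ge0.
have ew : w ^+ 2 = y ^+ 4 / 4 by rewrite /w; field.
have y40 : 0 <= y ^+ 4 by rewrite -y4 exprn_ge0.
rewrite -/w in h; rewrite mulrDl mul1r.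
apply: (@le_trans _ _ (`|cos y - (1 - w)| + `|(1 - w) - expR (- w)|)); first exact: ler_distD.
by apply: lerD => //; rewrite ler_norml; apply/andP; split; lra.
Qed.

(** The central limit theorem for coin tosses: each factor differs from e^(-(y/K)^2 / 2) by order
    (y/K)^4, and 2 K^2 factors make a total error of order K^-2. It exhibits Gaussians as limits of
    trigonometric polynomials bounded by 1. *)
Lemma cos_pow_gauss (y : R) : (fun k => cos (y / k.+1%:R) ^+ (2 * k.+1 ^ 2)) @ \oo --> expR (- y ^+ 2).
Proof.
have [C HC] := cos_gauss_le.
have lim0 : (fun k => 2 * C * y ^+ 4 * k.+1%:R^-1 : R) @ \oo --> (0 : R).
  by rewrite -(mulr0 (2 * C * y ^+ 4)); apply: cvgMl_tmp; exact: cvg_harmonic.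
apply/cvgrPdist_lt => e e0; move/cvgrPdist_lt : lim0 => /(_ e e0); apply: filterS => k.
rewrite sub0r normrN => h; apply: le_lt_trans h.
have k0 : 0 < k.+1%:R :> R by rewrite ltr0n.
have -> : expR (- y ^+ 2) = expR (- ((y / k.+1%:R) ^+ 2 / 2)) ^+ (2 * k.+1 ^ 2).
  by rewrite -expRM_natr natrM natrX; congr expR; field; rewrite gt_eqF.
rewrite distrC; apply: (le_trans (norm_exprB _ _ _)); first exact: cos_max.
  rewrite ger0_norm ?expR_ge0// -(expR0 R) ler_expR oppr_le0 divr_ge0 ?sqr_ge0//.
apply: (le_trans (ler_wpM2l _ (HC _))) => //.
have -> : (2 * k.+1 ^ 2)%:R * (C * (y / k.+1%:R) ^+ 4) = 2 * C * y ^+ 4 * k.+1%:R^-1 * k.+1%:R^-1.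
  by rewrite natrM natrX; field; rewrite gt_eqF.
apply: (le_trans (ler_norm _)); rewrite normrM ler_piMr//.
by rewrite ger0_norm ?invr_ge0// invf_le1// ler1n.
Qed.
End trigonometric_series.

(** * A function with vanishing Fourier transform is zero *)

Section fourier.
Variables (R : realType) (n : nat).
Local Notation V := 'rV[R]_n.
Implicit Types (f : V -> R) (x z : V).

Lemma dotrDl x y z : dotr (x + y) z = dotr x z + dotr y z.
Proof. by rewrite /dotr -big_split; apply: eq_bigr => i _; rewrite mxE mulrDl. Qed.
Lemma dotrZl a x z : dotr (a *: x) z = a * dotr x z.
Proof. by rewrite /dotr mulr_sumr; apply: eq_bigr => i _; rewrite mxE mulrA. Qed.
Lemma dotrC x y : dotr x y = dotr y x.
Proof. by apply: eq_bigr => i _; rewrite mulrC. Qed.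
Lemma dotrDr x y z : dotr z (x + y) = dotr z x + dotr z y.
Proof. by rewrite !(dotrC z) dotrDl. Qed.
Lemma dotrZr a x z : dotr z (a *: x) = a * dotr z x.
Proof. by rewrite !(dotrC z) dotrZl. Qed.
Lemma dotrNr x z : dotr z (- x) = - dotr z x.
Proof. by rewrite -scaleN1r dotrZr mulN1r. Qed.
Lemma dotrBr x y z : dotr z (x - y) = dotr z x - dotr z y.
Proof. by rewrite dotrDr dotrNr. Qed.

Lemma continuous_dotr x : continuous (dotr x).
Proof.
apply: (@lip_continuous _ _ _ (enorm x * n%:R)) => y z.
rewrite -dotrBr (le_trans (dotr_le _ _))// -mulrA ler_wpM2l ?enorm_ge0// enorm_le_norm//.
Qed.

Lemma mR_phase (g : R -> R) x c : continuous g -> mR (fun z => g (dotr x z + c)).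
Proof.
move=> cg; apply: mR_cont => z.
apply: (@continuous_comp _ _ _ (fun z => dotr x z + c) g); last exact: cg.
apply: (@cvgD _ _ _ (nbhs z) _ (dotr x) (fun=> c)); last exact: cvg_cst.
exact: continuous_dotr.
Qed.

Lemma LR_mul1 f g : LR f -> mR g -> (forall x, `|g x| <= 1) -> LR (fun x => f x * g x).
Proof.
move=> hf mg g1; apply: (LR_le _ _ (LR_norm hf)); first by apply: measurable_funM => //; exact: LR_mR.
by move=> x; rewrite normrM ler_piMr.
Qed.

(** Vanishing of the Fourier transform in real form. The phase [c] covers sine and cosine together
    and makes the class stable under multiplication by cosines. *)
Definition spectrum_free f := LR f /\ forall xi c, IR (fun x => f x * cos (dotr xi x + c)) = 0.

Lemma spectrum_free_cos f eta c : spectrum_free f -> spectrum_free (fun x => f x * cos (dotr eta x + c)).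
Proof.
have mc xi a : mR (fun x => cos (dotr xi x + a)) by apply: mR_phase; exact: continuous_cos.
move=> [hf f0]; have h xi a : LR (fun x => f x * cos (dotr xi x + a)).
  by apply: LR_mul1 => // x; exact: cos_max.
split=> // xi a.
have -> : (fun x => f x * cos (dotr eta x + c) * cos (dotr xi x + a)) =
   fun x => 2^-1 * (f x * cos (dotr (eta + xi) x + (c + a)) + f x * cos (dotr (eta - xi) x + (c - a))).
  apply/funext => x; rewrite !dotrDl -scaleN1r dotrZl mulN1r.
  have -> : dotr eta x + dotr xi x + (c + a) = (dotr eta x + c) + (dotr xi x + a) by ring.
  have -> : dotr eta x - dotr xi x + (c - a) = (dotr eta x + c) + - (dotr xi x + a) by ring.
  move: (dotr eta x + c) (dotr xi x + a) => u v.
  by rewrite !cosD sinN cosN; field.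
by rewrite IRZ ?IRD ?f0 ?addr0 ?mulr0//; exact: LRD.
Qed.

Lemma spectrum_free_IR f : spectrum_free f -> IR f = 0.
Proof.
move=> [_ /(_ 0 0)]; have -> // : (fun x => f x * cos (dotr 0 x + 0)) = f.
apply/funext => x; rewrite (_ : dotr 0 x = 0) ?addr0 ?cos0 ?mulr1//.
by rewrite -(scale0r 0) dotrZl mul0r.
Qed.

Definition gs x : R := expR (- sqn x).

Lemma gs_prod x : gs x = \prod_i gauss_fun (x 0 i).
Proof. by rewrite /gs /sqn -sumrN expR_sum. Qed.

Lemma LR_gs : LR gs /\ 0 < IR gs.
Proof.
have [h1 h2] := @IR_prod R n (fun=> @gauss_fun R) (fun=> @integrableT_gauss R).
have e : gs = fun x => \prod_i gauss_fun (x 0 i) by apply/funext => x; exact: gs_prod.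
rewrite e h2; split=> //; apply: prodr_gt0 => i _.
by rewrite /Int /Rintegral integralT_gauss/= sqrtr_gt0 pi_gt0.
Qed.

Lemma gs_le1 x : 0 <= gs x <= 1.
Proof. by rewrite expR_ge0 -(expR0 R) ler_expR oppr_le0 sqn_ge0. Qed.

Lemma cvg_prodr (F : 'I_n -> nat -> R) (l : 'I_n -> R) :
  (forall i, F i @ \oo --> l i) -> (fun k => \prod_i F i k) @ \oo --> \prod_i l i.
Proof.
move=> Fl; have key (r : seq 'I_n) : (fun k => \prod_(i <- r) F i k) @ \oo --> \prod_(i <- r) l i.
  elim: r => [|i r ih]; first by under eq_fun do rewrite big_nil; rewrite big_nil; exact: cvg_cst.
  by under eq_fun do rewrite big_cons; rewrite big_cons; exact: cvgM.
exact: key.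
Qed.

(** Multiplying by powers of cosines stays in the class, and products over coordinates of such
    powers converge boundedly to any dilated and translated Gaussian. *)
Lemma spectrum_free_gauss f lam z : spectrum_free f -> IR (fun x => f x * gs (lam *: (x - z))) = 0.
Proof.
move=> hf; pose F k x := \prod_i cos (lam * (x - z) 0 i / k.+1%:R) ^+ (2 * k.+1 ^ 2).
have step k i m g : spectrum_free g ->
    spectrum_free (fun x => g x * cos (lam * (x - z) 0 i / k.+1%:R) ^+ m).
  move=> hg; elim: m => [|m ih]; first by under eq_fun do rewrite expr0 mulr1.
  have := spectrum_free_cos ((lam / k.+1%:R) *: delta_mx 0 i) (- (lam * z 0 i / k.+1%:R)) ih.
  congr spectrum_free; apply/funext => x; rewrite -mulrA exprSr; congr (_ * (_ * cos _)).
  rewrite dotrZl /dotr (bigD1 i)//= big1 ?addr0; last first.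
    by move=> j ji; rewrite !mxE (negbTE ji) andbF mul0r.
  by rewrite !mxE !eqxx mul1r; ring.
have qF k : spectrum_free (fun x => f x * F k x).
  rewrite /F; elim: (index_enum _) => [|i r ih].
    by under eq_fun do rewrite big_nil mulr1.
  under eq_fun do rewrite big_cons mulrCA mulrC; exact: step.
have [hfL _] := hf.
have lim : (fun k => IR (fun x => f x * F k x)) @ \oo --> IR (fun x => f x * gs (lam *: (x - z))).
  apply: (IR_lim _ _ _ (LR_norm hfL)).2.
  - by move=> k; apply: LR_mR; case: (qF k).
  - move=> x; apply: cvgMl_tmp; rewrite gs_prod /F.
    have c i : (fun k => cos (lam * (x - z) 0 i / k.+1%:R) ^+ (2 * k.+1 ^ 2)) @ \oo --> gauss_fun ((lam *: (x - z)) 0 i).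
      have -> : (lam *: (x - z)) 0 i = lam * (x - z) 0 i by rewrite mxE.
      exact: cos_pow_gauss.
    exact: (cvg_prodr c).
  - move=> k x; rewrite normrM ler_piMr// /F; elim/big_ind : _ => [|a b a1 b1|i _].
    + by rewrite normr1.
    + by rewrite normrM mulr_ile1.
    + by rewrite normrX exprn_ile1// cos_max.
have e : (fun k => IR (fun x => f x * F k x)) = fun=> 0.
  by apply/funext => k; exact: spectrum_free_IR.
rewrite e in lim; exact: (cvg_unique _ lim (cvg_cst _)).
Qed.

(** Gaussians of width 1/(k+1) around [z] concentrate at [z]: rescaled, the vanishing integrals
    converge to f(z) times a positive constant. *)
Lemma spectrum_free_eq0 f B : continuous f -> (forall x, `|f x| <= B) -> spectrum_free f ->
  forall z, f z = 0.
Proof.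
move=> cf fB hf z; have [hg g0] := LR_gs.
have E (k : nat) : IR (fun w => f (k.+1%:R^-1 *: w + z) * gs w) = 0.
  have k0 : k.+1%:R != 0 :> R by rewrite pnatr_eq0.
  have ki : k.+1%:R^-1 != 0 :> R by rewrite invr_eq0.
  have h := spectrum_free_gauss k.+1%:R z hf.
  have L : LR (fun x => f x * gs (k.+1%:R *: (x - z))).
    apply: LR_mul1; first by case: hf.
      apply: (mR_comp _ (LR_mR hg)).
      apply: mcoordZ; first exact: measurable_cst.
      by apply: mcoordD; [exact: mcoord_tuple|exact: mcoord_cst].
    by move=> x; have /andP[a b] := gs_le1 (k.+1%:R *: (x - z)); rewrite ger0_norm.
  have := IR_affine z ki L; rewrite h mulr0 => <-; congr IR; apply/funext => w.
  by rewrite addrK scalerA mulfV// scale1r.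
have lim : (fun k : nat => IR (fun w => f (k.+1%:R^-1 *: w + z) * gs w)) @ \oo --> IR (fun w => f z * gs w).
  apply: (IR_lim _ _ _ (LRZ B hg)).2.
  - move=> k; apply: measurable_funM; last exact: LR_mR hg.
    apply: mR_comp; last exact: mR_cont.
    by apply: mcoordD; [apply: mcoordZ; [exact: measurable_cst|exact: mcoord_tuple]|exact: mcoord_cst].
  - move=> w; apply: cvgMr_tmp; apply: (@continuous_cvg _ _ _ \oo _ _ f z); first exact: cf.
    rewrite -[X in _ --> X]add0r; apply: cvgD; last exact: cvg_cst.
    rewrite -(scale0r w); apply: cvgZr_tmp; exact: cvg_harmonic.
  - move=> k w; have /andP[a b] := gs_le1 w.
    by rewrite normrM (ger0_norm a) ler_wpM2r.
have e : (fun k : nat => IR (fun w => f (k.+1%:R^-1 *: w + z) * gs w)) = fun=> 0 by apply/funext.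
rewrite e IRZ// in lim.
have E0 : f z * IR gs = 0 by exact: (cvg_unique _ lim (cvg_cst (0 : R))).
by move/eqP : E0; rewrite mulf_eq0 (gt_eqF g0) orbF => /eqP.
Qed.
End fourier.

(** * The Fourier symbol of the fractional operator *)

Section symbol.
Variables (R : realType) (d : nat) (s : R).
Hypothesis d0 : (0 < d)%N.
Hypothesis hs : 0 < s < 1.
Local Notation V := 'rV[R]_d.
Local Notation nu := (nu d s).
Implicit Types (xi x z : V).

Lemma D2_cos xi z : D2 (fun x => cos (dotr xi x)) 0 z = 2 * cos (dotr xi z) - 2.
Proof.
have h0 : dotr xi 0 = 0 by rewrite -(scale0r 0) dotrZr mul0r.
by rewrite /D2 add0r sub0r dotrNr cosN h0 cos0; ring.
Qed.

(** A constant multiple of |xi|^(2s), defined through the action on a plane wave. Two properties are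
    extracted: homogeneity of degree 2s and positivity away from 0. *)
Definition symbol xi : R := - Lop s (fun x => cos (dotr xi x)) 0.

Let D2_cos_le xi z : `|D2 (fun x => cos (dotr xi x)) 0 z| <= 2 * (1 + expR 1) * enorm xi ^+ 2 * enorm z ^+ 2.
Proof.
rewrite D2_cos; have := trg_remainder false 2 (dotr xi z).
have -> : trgs false 2 (dotr xi z) = 1.
  by rewrite /trgs !big_ord_recr big_ord0 /trgc /= !factS fact0; field.
move=> h; rewrite (_ : 2 * _ - 2 = 2 * (cos (dotr xi z) - 1)); last by ring.
rewrite normrM ger0_norm// (_ : _ * enorm z ^+ 2 = 2 * ((1 + expR 1) * (enorm xi * enorm z) ^+ 2)); last by ring.
rewrite ler_wpM2l//; apply: (le_trans h).
rewrite ler_wpM2l ?addr_ge0 ?expR_ge0// lerXn2r ?nnegrE ?mulr_ge0 ?enorm_ge0//.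
exact: dotr_le.
Qed.

Let mcos xi : mR (fun x => cos (dotr xi x)).
Proof.
by have := mR_phase xi 0 (@continuous_cos R); congr mR; apply/funext => x; rewrite addr0.
Qed.

Let cos1 xi x : `|cos (dotr xi x)| <= 1. Proof. exact: cos_max. Qed.

Lemma LR_symbol xi : LR (fun z => (2 - 2 * cos (dotr xi z)) * enorm z `^ (- (2 * nu))) /\
  symbol xi = IR (fun z => (2 - 2 * cos (dotr xi z)) * enorm z `^ (- (2 * nu))).
Proof.
have h := LR_Lop hs (cos1 xi) (D2_cos_le xi) (mcos xi).
have e : (fun z => (2 - 2 * cos (dotr xi z)) * enorm z `^ (- (2 * nu))) =
   fun z => - (D2 (fun x => cos (dotr xi x)) 0 z * enorm z `^ (- (2 * nu))).
  by apply/funext => z; rewrite D2_cos; ring.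
by rewrite e; split; [exact: LRN|rewrite IRN].
Qed.

Lemma symbol_scale k xi : 0 < k -> symbol (k *: xi) = k `^ (2 * s) * symbol xi.
Proof.
move=> k0; have [h1 e1] := LR_symbol xi; have [h2 e2] := LR_symbol (k *: xi).
have h3 := IR_scale (lt0r_neq0 k0) h1; rewrite (gtr0_norm k0) in h3.
rewrite e1 e2 (_ : (fun z => _ * _) = fun z : V => k `^ (2 * nu) *
   ((2 - 2 * cos (dotr xi (k *: z))) * enorm (k *: z) `^ (- (2 * nu)))); last first.
  apply/funext => z; rewrite enormZ (gtr0_norm k0) powRM ?enorm_ge0 ?(ltW k0)// dotrZl dotrZr.
  have kk : k `^ (2 * nu) * k `^ (- (2 * nu)) = 1 by rewrite -powRD'// subrr powRr0.
  by rewrite [RHS]mulrCA; congr (_ * _); rewrite [RHS]mulrA kk mul1r.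
rewrite IRZ; last exact: LR_scale (lt0r_neq0 k0) h1.
rewrite h3 mulrA -powR_invn ?(ltW k0)// -powRD'//; congr (_ `^ _ * _).
by rewrite nu2; ring.
Qed.

Lemma one_sub_cos_ge : exists2 r : R, 0 < r & forall y, 0 <= y <= r -> y ^+ 2 / 4 <= 1 - cos y.
Proof.
pose C : R := 1 + expR 1; have C0 : 0 < C by rewrite addr_gt0 ?expR_gt0.
have C1 : 1 <= C by rewrite lerDl expR_ge0.
exists (4 * C)^-1 => [|y /andP[y0 yr]]; first by rewrite invr_gt0 mulr_gt0.
have h := trg_remainder false 4 y.
have t4 : trgs false 4 y = 1 - y ^+ 2 / 2.
  by rewrite /trgs !big_ord_recr big_ord0 /trgc /= !factS fact0; field.
rewrite t4 /= -/C (ger0_norm y0) in h.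
have Cy : C * y <= 1 / 4.
  by rewrite mulrC -ler_pdivlMr// (le_trans yr)// invfM mul1r.
have y1 : y <= 1 / 4 by apply: le_trans Cy; rewrite ler_peMl.
have h2 : C * y ^+ 4 <= y ^+ 2 / 4.
  have -> : C * y ^+ 4 = y ^+ 2 * (C * y * y) by ring.
  rewrite ler_wpM2l ?sqr_ge0//; apply: (@le_trans _ _ (1 / 4 * 1)); last by rewrite mulr1 mul1r.
  by apply: ler_pM => //; [rewrite mulr_ge0// ltW|lra].
move: h; rewrite ler_norml => /andP[_ h]; lra.
Qed.

Lemma symbol_gt0 xi : xi != 0 -> 0 < symbol xi.
Proof.
move=> xn; have [h ->] := LR_symbol xi; have E0 : 0 < enorm xi by rewrite enorm_gt0.
have [r0 r00 Hr] := one_sub_cos_ge; pose r := r0 / 2; have rp : 0 < r by rewrite divr_gt0.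
(* A point with xi . z0 = r; on a small cube around it the phase stays between r/2 and 3r/2, inside
   the range where 1 - cos has a quadratic lower bound. *)
pose z0 := (r / enorm xi ^+ 2) *: xi; have dz0 : dotr xi z0 = r.
  have e : dotr xi xi = enorm xi ^+ 2 by rewrite sqr_enorm /dotr /sqn; apply: eq_bigr => i _; rewrite expr2.
  by rewrite dotrZr e mulfVK// expf_neq0// gt_eqF.
have dn : 0 < d%:R :> R by rewrite ltr0n.
pose rho := r / (2 * enorm xi * d%:R); have rho0 : 0 < rho by rewrite divr_gt0 ?mulr_gt0.
have [b1 b2] := @LR_boxi R d rho (ltW rho0).
pose D := enorm z0 + d%:R * rho; have D0 : 0 < D by rewrite ltr_wpDl ?enorm_ge0// mulr_gt0.
pose c := 2 * ((r / 2) ^+ 2 / 4) * D `^ (- (2 * nu)).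
have c0 : 0 < c by rewrite mulr_gt0 ?powR_gt0// mulr_gt0// divr_gt0// exprn_gt0// divr_gt0.
apply: (@lt_le_trans _ _ (c * (2 * rho) ^+ d)); first by rewrite mulr_gt0// exprn_gt0// mulr_gt0.
rewrite -b2 -(IR_shift (- z0) b1) -IRZ; last exact: LR_shift.
apply: le_IR => //; first by apply: LRZ; exact: LR_shift.
move=> z; have cp : 0 <= 2 - 2 * cos (dotr xi z) by have := cos_le1 (dotr xi z); lra.
have [->|[-> hb]] := boxi_cases rho (z - z0); first by rewrite mulr0 mulr_ge0 ?powR_ge0.
have n1 : `|z - z0| <= rho.
  rewrite [leLHS]/Num.norm/= mx_normrE; apply: bigmax_le => [|[i0 i] _ /=]; first exact: ltW.
  by rewrite ord1 ltW.
have n2 : enorm (z - z0) <= d%:R * rho by apply: (le_trans (enorm_le_norm _)); rewrite ler_pM2l.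
have zD : enorm z <= D.
  by rewrite -(subrK z0 z) addrC (le_trans (enormD _ _))// lerD2l.
have dz : `|dotr xi z - r| <= r / 2.
  rewrite -{1}dz0 -dotrBr (le_trans (dotr_le _ _))//.
  apply: (@le_trans _ _ (enorm xi * (d%:R * rho))); first by rewrite ler_pM2l.
  by rewrite /rho le_eqVlt; apply/orP; left; apply/eqP; field; rewrite !gt_eqF.
move: dz; rewrite ler_norml => /andP[dz1 dz2].
have zn : z != 0.
  by apply/eqP => z00; move: dz1; rewrite z00 -(scale0r 0) dotrZr mul0r; lra.
rewrite mulr1 /c; apply: ler_pM; rewrite ?powR_ge0//.
- by rewrite mulr_ge0// divr_ge0// sqr_ge0.
- have y1 : r / 2 <= dotr xi z by lra.
  have y2 : (r / 2) ^+ 2 / 4 <= 1 - cos (dotr xi z).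
    apply: (@le_trans _ _ (dotr xi z ^+ 2 / 4)).
      by rewrite ler_pM2r ?invr_gt0// lerXn2r ?nnegrE//; lra.
    by apply: Hr; rewrite /r in y1 dz2 *; apply/andP; split; lra.
  lra.
- by apply: powR_anti => //; [rewrite enorm_gt0|rewrite mulr_ge0// ltW// nu_gt0].
Qed.

Variable f : V -> R.
Hypothesis hf : rschwartz f.

Let cf : continuous f.
Proof. by move=> x; apply: differentiable_continuous; exact: (hf.1 [::]). Qed.

Let mf : mR f. Proof. exact: mR_cont. Qed.

Lemma LR_schwartz : LR f.
Proof. by have [C hC] := hf.2 d.+1 [::]; exact: LR_decay hC. Qed.

(** Decay in [x] is kept along with the gain |z|^2, as needed to integrate the second difference in
    [x] first. It holds for |z| < 1 because a shift by less than 1 changes 1 + |x| by at most a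
    factor 2. *)
Lemma D2_schwartz_le : exists2 C, 0 <= C & forall x z, enorm z < 1 ->
  `|D2 f x z| <= C * (1 + enorm x) ^- d.+1 * enorm z ^+ 2.
Proof.
have [C C0 HC] : exists2 C, 0 <= C & forall (ij : 'I_d * 'I_d) (x : V), True ->
    `|(1 + enorm x) ^+ d.+1 * rpartial ij.2 (rpartial ij.1 f) x| <= C.
  apply: finite_bound => -[i j]; have [C hC] := hf.2 d.+1 [:: j; i]; exists C => x _ /=.
  by rewrite normrM ger0_norm ?exprn_ge0 ?addr_ge0 ?enorm_ge0//; exact: hC.
exists (2 * d%:R ^+ 2 * (C * 2 ^+ d.+1)).
  by rewrite !mulr_ge0 ?exprn_ge0.
move=> x z z1; have x0 := enorm_ge0 x.
have -> : 2 * d%:R ^+ 2 * (C * 2 ^+ d.+1) * (1 + enorm x) ^- d.+1 =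
  2 * d%:R ^+ 2 * (C * (2 ^+ d.+1 * (1 + enorm x) ^- d.+1)) by rewrite !mulrA.
apply: (D2_local hf.1) => i j t t1; set w := x + t *: z.
have w0 := enorm_ge0 w.
have := HC (i, j) w I; rewrite normrM ger0_norm ?exprn_ge0 ?addr_ge0//= => h.
have xw : 1 + enorm x <= 2 * (1 + enorm w).
  have : enorm x <= enorm w + enorm (t *: z).
    by rewrite -[x in leLHS](addrK (t *: z) x) enormB.
  have : enorm (t *: z) <= 1 by rewrite enormZ; apply: mulr_ile1 => //; [exact: enorm_ge0|exact: ltW].
  lra.
have p : (1 + enorm x) ^+ d.+1 <= 2 ^+ d.+1 * (1 + enorm w) ^+ d.+1.
  by rewrite -exprMn lerXn2r ?nnegrE ?mulr_ge0 ?addr_ge0.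
have q : 0 < (1 + enorm x) ^+ d.+1 by rewrite exprn_gt0// ltr_wpDr.
rewrite mulrA ler_pdivlMr// mulrC; apply: (le_trans (ler_wpM2r (normr_ge0 _) p)).
by rewrite -mulrA [C * _]mulrC ler_wpM2l ?exprn_ge0.
Qed.

Lemma trg_sum b (u v : R) : trg b (u - v) + trg b (u + v) = 2 * cos v * trg b u.
Proof.
by case: b; rewrite /trg ?sinD ?cosD sinN cosN; ring.
Qed.

Lemma mtrg b xi : mR (fun x => trg b (dotr xi x)).
Proof.
by have := mR_phase xi 0 (@continuous_trg R b); congr mR; apply/funext => x; rewrite addr0.
Qed.

(** Fubini in [x] and [z]: integrated in [x], the second difference is of order |z|^2 near 0 and
    bounded elsewhere, so [swgt] dominates. Translating [x] turns f(x + z) and f(x - z) into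
    opposite phase shifts, whose sum is the factor 2 cos(xi . z). *)
Lemma Lop_transform b xi :
  LR (fun x => Lop s f x * trg b (dotr xi x)) /\
  IR (fun x => Lop s f x * trg b (dotr xi x)) = - symbol xi * IR (fun x => f x * trg b (dotr xi x)).
Proof.
have [C C0 HC] := D2_schwartz_le; have hL := LR_schwartz.
have [B fB] := hf.2 0%N [::].
have fB' x : `|f x| <= B by have := fB x; rewrite expr0 mul1r.
pose w z := enorm z `^ (- (2 * nu)).
have fK x z : `|D2 f x z| <= (C + 4 * `|B|) * enorm z ^+ 2.
  have B0 : 0 <= `|B| by [].
  have [z1|z1] := ltP (enorm z) 1.
    apply: (le_trans (HC x z z1)); rewrite ler_wpM2r ?exprn_ge0 ?enorm_ge0//.
    apply: (@le_trans _ _ (C * 1)); last by rewrite mulr1; lra.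
    by rewrite ler_wpM2l// invf_le1 ?exprn_ege1 ?exprn_gt0 ?lerDl ?enorm_ge0// ltr_wpDr ?enorm_ge0.
  apply: (le_trans (D2_le x fB' z)).
  apply: (@le_trans _ _ ((C + 4 * `|B|) * 1)); first by have := ler_norm B; rewrite mulr1; lra.
  by rewrite ler_wpM2l ?exprn_ege1//; lra.
have hD z : LR (fun x => D2 f x z).
  by rewrite /D2; apply: LRB; [apply: LRD; exact: LR_shift|exact: LRZ].
have hlin : LR (fun x : V => (1 + enorm x) `^ (- d.+1%:R)) by apply: LR_tail; rewrite ltr_nat.
pose A := IR (fun x : V => (1 + enorm x) `^ (- d.+1%:R)).
have A0 : 0 <= A by apply: IR_ge0 => x; exact: powR_ge0.
pose M := IR (fun x => `|f x|); have M0 : 0 <= M by exact: IR_ge0.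
have iD z : IR (fun x => `|D2 f x z|) * w z <= (C * A + 4 * M) * swgt s z.
  rewrite /swgt /wgt /w; case: ifP => z1.
    apply: (@le_trans _ _ (C * A * enorm z ^+ 2 * enorm z `^ (- (2 * nu)))).
      apply: ler_wpM2r; first exact: powR_ge0.
      rewrite (_ : C * A * enorm z ^+ 2 = IR (fun x => (C * enorm z ^+ 2) * (1 + enorm x) `^ (- d.+1%:R))).
        apply: le_IR; [exact: LR_norm|exact: LRZ|move=> x].
        apply: (le_trans (HC x z z1)); rewrite powR_invn ?addr_ge0 ?enorm_ge0//.
        by rewrite mulrAC.
      by rewrite IRZ// -/A; ring.
    have [->|zn] := eqVneq z 0.
      by rewrite enorm0 expr0n/= mulr0 mul0r mulr_ge0 ?powR_ge0 ?addr_ge0 ?mulr_ge0.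
    have z0 : 0 < enorm z by rewrite enorm_gt0.
    rewrite -mulrA -powR_mulrn ?(ltW z0)// -powRD'//; apply: ler_wpM2r; first exact: powR_ge0.
    by rewrite lerDl mulr_ge0.
  apply: ler_wpM2r; first exact: powR_ge0.
  apply: (@le_trans _ _ (4 * M)); last by rewrite lerDr mulr_ge0.
  have e : 4 * M = IR (fun x => `|f (x + z)| + `|f (x - z)| + 2 * `|f x|).
    rewrite IRD ?IRD ?IRZ ?(IR_shift _ (LR_norm hL)) -/M; [ring|..].
    all: try (by exact: LR_norm).
    - exact: (LR_shift z (LR_norm hL)).
    - exact: (LR_shift (- z) (LR_norm hL)).
    - by apply: LRD; [exact: (LR_shift z (LR_norm hL))|exact: (LR_shift (- z) (LR_norm hL))].
    - by apply: LRZ; exact: LR_norm.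
  rewrite e; apply: le_IR; [exact: LR_norm| |move=> x].
    apply: LRD; last by apply: LRZ; exact: LR_norm.
    by apply: LRD; [exact: (LR_shift z (LR_norm hL))|exact: (LR_shift (- z) (LR_norm hL))].
  rewrite /D2; apply: (le_trans (ler_normB _ _)); rewrite normrM ger0_norm// lerD2r.
  exact: ler_normD.
pose F x z := D2 f x z * w z * trg b (dotr xi x).
have [] := @IR_fubini R d d F (fun z => (C * A + 4 * M) * swgt s z).
- apply: measurable_funM; first apply: measurable_funM.
  + have m1 := @mcoord_fst R d d; have m2 := @mcoord_snd R d d.
    apply: measurable_funB; last first.
      by apply: measurable_funM; [exact: measurable_cst|exact: mR_comp m1 mf].
    apply: measurable_funD; first exact: (mR_comp (mcoordD m1 m2) mf).
    exact: (mR_comp (mcoordD m1 (mcoordN m2)) mf).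
  + exact: (mR_comp (@mcoord_snd R d d) (@mR_powR R d (- (2 * nu)))).
  + exact: (mR_comp (@mcoord_fst R d d) (mtrg b xi)).
- move=> x; have h := LR_Lop hs fB' (fK x) mf.
  have := LRZ (trg b (dotr xi x)) h; congr LR; apply/funext => z; by rewrite /F mulrC.
- move=> z; have := LRZ (w z) (LR_mul1 (hD z) (mtrg b xi) (fun x => trg_le1 b _)).
  by congr LR; apply/funext => x; rewrite /F mulrA [w z * _]mulrC.
- move=> z; apply: le_trans (iD z); rewrite mulrC -IRZ; last by apply: LR_norm.
  apply: le_IR.
  + apply: LR_norm; have := LRZ (w z) (LR_mul1 (hD z) (mtrg b xi) (fun x => trg_le1 b _)).
    by congr LR; apply/funext => x; rewrite /F mulrA [w z * _]mulrC.
  + by apply: LRZ; exact: LR_norm.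
  + move=> x; rewrite /F !normrM (ger0_norm (powR_ge0 _ _)) [X in X * _ <= _]mulrC.
    by rewrite ler_piMr ?mulr_ge0 ?powR_ge0 ?trg_le1.
- by apply: LRZ; exact: LR_swgt.
move=> h1 h2 h3.
have e1 : (fun x => IR (F x)) = fun x => Lop s f x * trg b (dotr xi x).
  apply/funext => x; rewrite [RHS]mulrC /Lop -IRZ; last exact: (LR_Lop hs fB' (fK x) mf).
  by congr IR; apply/funext => z; rewrite /F mulrC.
rewrite e1 in h1 h3; split; first exact: h1.
rewrite h3; have [s1 s2] := LR_symbol xi.
have -> : - symbol xi * IR (fun x => f x * trg b (dotr xi x)) =
   IR (fun z => - IR (fun x => f x * trg b (dotr xi x)) * ((2 - 2 * cos (dotr xi z)) * enorm z `^ (- (2 * nu)))).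
  by rewrite IRZ// s2; ring.
congr IR; apply/funext => z.
have hm c : LR (fun x => f (x + c) * trg b (dotr xi x)).
  by apply: LR_mul1; [exact: LR_shift|exact: mtrg|move=> x; exact: trg_le1].
have hm0 : LR (fun x => f x * trg b (dotr xi x)).
  by have := hm 0; under eq_fun do rewrite addr0.
have sh c : IR (fun x => f (x + c) * trg b (dotr xi x)) = IR (fun x => f x * trg b (dotr xi x - dotr xi c)).
  have hh : LR (fun x => f x * trg b (dotr xi x - dotr xi c)).
    by apply: LR_mul1 => // [|x]; [exact: (mR_phase xi (- dotr xi c) (@continuous_trg R b))|exact: trg_le1].
  rewrite -(IR_shift c hh); congr IR; apply/funext => x.
  by rewrite dotrDr addrK.
have e2 : F^~ z = fun x => w z * (f (x + z) * trg b (dotr xi x) + f (x - z) * trg b (dotr xi x) - 2 * (f x * trg b (dotr xi x))).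
  by apply/funext => x; rewrite /F /D2; ring.
rewrite e2 IRZ; last by apply: LRB; [exact: LRD|exact: LRZ].
rewrite IRB; [|exact: LRD|exact: LRZ]; rewrite IRD// IRZ// !sh dotrNr opprK.
have hh c : LR (fun x => f x * trg b (dotr xi x + c)).
  by apply: LR_mul1 => // [|x]; [exact: (mR_phase xi c (@continuous_trg R b))|exact: trg_le1].
rewrite -IRD//.
have -> : (fun x => f x * trg b (dotr xi x - dotr xi z) + f x * trg b (dotr xi x + dotr xi z)) =
   fun x => 2 * cos (dotr xi z) * (f x * trg b (dotr xi x)).
  by apply/funext => x; rewrite -mulrDr trg_sum; ring.
by rewrite IRZ// /w; ring.
Qed.
End symbol.

Lemma small_zero (R : realType) (a C p : R) : 0 < p ->
  (forall k, 0 < k <= 1 -> `|a| <= C * k `^ p) -> a = 0.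
Proof.
move=> p0 H; apply/eqP; rewrite -normr_eq0 eq_le normr_ge0 andbT leNgt; apply/negP => a0.
have [del del0 hdel] := powR_small C p0 a0.
pose k := Num.min 1 (del / 2); have d2 : 0 < del / 2 by rewrite divr_gt0.
have k0 : 0 < k by rewrite lt_min ltr01.
have k1 : k <= 1 by rewrite ge_min lexx.
have kd : k < del.
  by rewrite (@le_lt_trans _ _ (del / 2)) ?ge_min ?lexx ?orbT// ltr_pdivrMr// ltr_pMr// ltr1n.
have := H k; rewrite k0 k1 => /(_ isT); apply/negP; rewrite -ltNge.
by apply: hdel => //; exact: ltW.
Qed.

Lemma powR_le1 (R : realType) (k p q : R) : 0 < k <= 1 -> p <= q -> k `^ q <= k `^ p.
Proof.
move=> /andP[k0 k1] pq; rewrite /powR (gt_eqF k0) ler_expR.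
by apply: ler_wnM2r => //; exact: ln_le0.
Qed.

(* A non-integer power of k is not a polynomial up to a smaller error. *)
Lemma power_independence (R : realType) n (c : nat -> R) (a C r p : R) : 0 < r -> 0 < p ->
  (forall k, 0 < k <= 1 -> `|\sum_(j < n.+1) c j * k ^+ j + a * k `^ (n%:R + r)| <= C * k `^ (n%:R + r + p)) ->
  a = 0.
Proof.
move=> r0 p0 H.
have c0 j : (j <= n)%N -> c j = 0.
  elim/ltn_ind: j => j ih jn.
  pose D := \sum_(i < n.+1) `|c i| + `|a| + `|C|.
  have S0 : 0 <= \sum_(i < n.+1) `|c i| by apply: sumr_ge0.
  (* A lower bound for the gap between exponent j and every larger exponent that occurs; dividing by
     k^j leaves the constant term [c j] against k^e. *)
  pose e := Num.min 1 r; have e0 : 0 < e by rewrite lt_min ltr01.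
  apply: (@small_zero _ _ D e) => // k hk; have /andP[k0 k1] := hk.
  have kj : 0 < k ^+ j by rewrite exprn_gt0.
  rewrite -(ler_pM2r kj) -[X in _ * X](gtr0_norm kj) -normrM.
  have jn1 : (j < n.+1)%N by [].
  have E : \sum_(i < n.+1) c i * k ^+ i = c j * k ^+ j + \sum_(i < n.+1 | i != Ordinal jn1) c i * k ^+ i.
    by rewrite (bigD1 (Ordinal jn1)).
  have Q : D * k `^ e * k ^+ j = D * k `^ (j%:R + e).
    by rewrite -powR_mulrn ?(ltW k0)// -mulrA -powRD'// addrC.
  have pj : 0 <= k `^ (j%:R + e) by exact: powR_ge0.
  have b1 : `|\sum_(i < n.+1 | i != Ordinal jn1) c i * k ^+ i| <= (\sum_(i < n.+1) `|c i|) * k `^ (j%:R + e).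
    apply: (le_trans (ler_norm_sum _ _ _)); rewrite mulr_suml [leRHS](bigD1 (Ordinal jn1))//= -[leLHS]add0r.
    apply: lerD; first by rewrite mulr_ge0.
    apply: ler_sum => i ij; rewrite normrM; have [ij'|ji] := ltnP i j.
      by rewrite (ih _ ij') ?normr0 ?mul0r// ltnW// (leq_trans ij').
    rewrite ler_wpM2l// ger0_norm ?exprn_ge0 ?(ltW k0)// -powR_mulrn ?(ltW k0)//.
    apply: powR_le1 => //.
    have ji' : (j < i)%N by rewrite ltn_neqAle ji andbT; apply: contra ij => /eqP h; apply/eqP; apply: val_inj.
    apply: (@le_trans _ _ j.+1%:R); last by rewrite ler_nat.
    by rewrite -addn1 natrD lerD2l ge_min lexx.
  have b2 : `|a * k `^ (n%:R + r)| <= `|a| * k `^ (j%:R + e).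
    rewrite normrM ler_wpM2l// ger0_norm ?powR_ge0//; apply: powR_le1 => //.
    by rewrite lerD ?ler_nat// ge_min lexx orbT.
  have b3 : C * k `^ (n%:R + r + p) <= `|C| * k `^ (j%:R + e).
    apply: (@le_trans _ _ (`|C| * k `^ (n%:R + r + p))).
      by rewrite ler_wpM2r ?powR_ge0 ?ler_norm.
    rewrite ler_wpM2l//; apply: powR_le1 => //; rewrite -addrA lerD ?ler_nat//.
    by rewrite ge_min (_ : r <= r + p) ?orbT// lerDl ltW.
  have := H k hk; rewrite E => h.
  have -> : c j * k ^+ j = (c j * k ^+ j + \sum_(i < n.+1 | i != Ordinal jn1) c i * k ^+ i + a * k `^ (n%:R + r)) -
     \sum_(i < n.+1 | i != Ordinal jn1) c i * k ^+ i - a * k `^ (n%:R + r) by ring.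
  rewrite Q /D !mulrDl; apply: (le_trans (ler_normB _ _)).
  apply: (le_trans (lerD (ler_normB _ _) (lexx _))).
  move: (le_trans h b3) b1 b2; lra.
apply: (@small_zero _ _ C p) => // k hk; have /andP[k0 k1] := hk.
have := H k hk; rewrite big1 ?add0r; last by move=> i _; rewrite c0 ?mul0r// -ltnS.
rewrite normrM (ger0_norm (powR_ge0 _ _)) [k `^ (n%:R + r + p)]powRD'// => h.
have X0 : 0 < k `^ (n%:R + r) by rewrite powR_gt0.
by rewrite -(ler_pM2r X0) (le_trans h)// mulrCA mulrC.
Qed.

(** * All moments of [f] along a line vanish *)

Section moments.
Variables (R : realType) (d : nat) (s : R).
Hypothesis d0 : (0 < d)%N.
Hypothesis hs : 0 < s < 1.
Local Notation V := 'rV[R]_d.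
Implicit Types (g : V -> R) (xi x : V).

Definition rapid g := mR g /\ forall k, exists C, decay k C g.

Lemma rapid_moment g xi j : rapid g -> LR (fun x => g x * dotr xi x ^+ j).
Proof.
move=> [mg hg]; have [C hC] := hg (d.+1 + j)%N.
have e0 := enorm_ge0 xi.
apply: (@LR_decay R d _ (C * enorm xi ^+ j)).
  apply: measurable_funM => //; apply: measurable_funX.
  exact: mR_cont (@continuous_dotr R d xi).
move=> x; rewrite normrM normrX mulrA.
have x1 : 0 <= enorm x := enorm_ge0 x.
have := hC x; rewrite exprD => h.
apply: (@le_trans _ _ ((1 + enorm x) ^+ d.+1 * `|g x| * ((1 + enorm x) ^+ j * enorm xi ^+ j))).
  rewrite ler_wpM2l ?mulr_ge0 ?exprn_ge0 ?addr_ge0// -exprMn lerXn2r ?nnegrE ?mulr_ge0 ?addr_ge0//.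
  by apply: (le_trans (dotr_le _ _)); rewrite mulrC ler_wpM2r// lerDr.
rewrite mulrA ler_wpM2r ?exprn_ge0//; apply: le_trans h.
by rewrite mulrAC.
Qed.

(** Taylor expansion at k = 0 of the transform along the ray through [xi]; order N uses only
    finitely many moments, so rapid decay suffices. *)
Lemma moment_expansion g xi b N : rapid g -> exists C, forall k, 0 <= k ->
  `|IR (fun x => g x * trg b (dotr (k *: xi) x)) - \sum_(j < N) trgc R b j * IR (fun x => g x * dotr xi x ^+ j) * k ^+ j| <= C * k ^+ N.
Proof.
move=> hg; have hm j := rapid_moment xi j hg.
have hLR : LR g by have := hm 0%N; under eq_fun do rewrite expr0 mulr1.
exists ((1 + expR 1) * IR (fun x => `|g x * dotr xi x ^+ N|)) => k k0.
have ht : LR (fun x => g x * trg b (dotr (k *: xi) x)).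
  by apply: LR_mul1 => // [|x]; [exact: mtrg|exact: trg_le1].
have hs' j : LR (fun x => (trgc R b j * k ^+ j) * (g x * dotr xi x ^+ j)) by exact: LRZ.
have -> : \sum_(j < N) trgc R b j * IR (fun x => g x * dotr xi x ^+ j) * k ^+ j =
    IR (fun x => \sum_(j < N) (trgc R b j * k ^+ j) * (g x * dotr xi x ^+ j)).
  rewrite /IR Int_sum; last by move=> j _; exact: hs'.
  apply: eq_bigr => j _; apply/esym; apply: (etrans (IRZ _ (hm j))).
  by rewrite /IR; move: (Int _ _) => I; ring.
rewrite -IRB//; last by apply: L1_sum => j _; exact: hs'.
rewrite mulrAC -IRZ; last exact: LR_norm.
apply: norm_IR_le.
- by apply: LRB => //; apply: L1_sum => j _; exact: hs'.
- by apply: LRZ; exact: LR_norm.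
move=> x; have -> : \sum_(j < N) (trgc R b j * k ^+ j) * (g x * dotr xi x ^+ j) = g x * trgs b N (dotr (k *: xi) x).
  by rewrite /trgs mulr_sumr; apply: eq_bigr => j _; rewrite dotrZl exprMn; ring.
rewrite -mulrBr normrM; apply: (le_trans (ler_wpM2l (normr_ge0 _) (trg_remainder b N _))).
rewrite dotrZl normrM exprMn (ger0_norm k0) normrM normrX.
by rewrite le_eqVlt; apply/orP; left; apply/eqP; ring.
Qed.

Variable f : V -> R.
Hypothesis hf : rschwartz f.
Hypothesis hL : rapid (Lop s f).

Lemma rapid_schwartz : rapid f.
Proof.
split; last by move=> k; exact: (hf.2 k [::]).
by apply: mR_cont => x; apply: differentiable_continuous; exact: (hf.1 [::]).
Qed.

(** Once the lower moments vanish, the transform of [f] of parity n is a multiple of mu k^n up to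
    k^(n+1), and the symbol turns it into k^(n+2s). The transform of [Lop s f] of the same parity is
    a polynomial of degree at most n up to k^(n+2), because order n+1 has the wrong parity. Since 0
    < 2s < 2, the power n + 2s lies strictly between, also when 2s = 1, and its coefficient must
    vanish. *)
Lemma moments_zero xi n : xi != 0 -> IR (fun x => f x * dotr xi x ^+ n) = 0.
Proof.
move=> xn; have [s0 s1] := andP hs; elim/ltn_ind: n => n ih.
pose b := odd n.
have [C1 H1] := moment_expansion xi b n.+1 rapid_schwartz.
have [C2 H2] := moment_expansion xi b n.+2 hL.
set mu := IR _; pose m := symbol s xi; have m0 : 0 < m by exact: symbol_gt0.
(* The smaller of the two margins by which the errors k^(n+1+2s) and k^(n+2) beat k^(n+2s). *)
pose p := Num.min 1 (2 - 2 * s); have p0 : 0 < p by rewrite lt_min ltr01; lra.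
have p1 : p <= 1 by rewrite ge_min lexx.
have p2 : p <= 2 - 2 * s by rewrite ge_min lexx orbT.
have : m * trgc R b n * mu = 0.
  apply: (@power_independence _ n (fun j => trgc R b j * IR (fun x => Lop s f x * dotr xi x ^+ j)) _
    (`|C2| + m * `|C1|) (2 * s) p _ p0); first by rewrite mulr_gt0.
  move=> k hk; have /andP[k0 k1] := hk; have k0' := ltW k0.
  have := H1 k k0'; rewrite big_ord_recr/= big1 ?add0r; last first.
    by move=> j _; rewrite ih ?mulr0 ?mul0r.
  rewrite -/mu; set F := IR (fun x => f x * trg b (dotr (k *: xi) x)) => h1.
  have := H2 k k0'; rewrite big_ord_recr/= trgc_parity; last by rewrite /b/=; case: (odd n).
  rewrite !mul0r addr0; have [_ ->] := Lop_transform hs hf b (k *: xi).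
  rewrite symbol_scale// -/m -/F => h2.
  set S := \sum_(j < n.+1) _ in h2 *.
  have e : S + m * trgc R b n * mu * k `^ (n%:R + 2 * s) =
     - (- (k `^ (2 * s) * m) * F - S) - k `^ (2 * s) * m * (F - trgc R b n * mu * k ^+ n).
    by rewrite powRD'// powR_mulrn//; ring.
  rewrite e; apply: (le_trans (ler_normB _ _)); rewrite normrN [leRHS]mulrDl; apply: lerD.
    apply: (le_trans h2); apply: (@le_trans _ _ (`|C2| * k ^+ n.+2)).
      by rewrite ler_wpM2r ?exprn_ge0 ?ler_norm.
    rewrite ler_wpM2l// -powR_mulrn//; apply: powR_le1 => //.
    by rewrite -addn2 natrD; lra.
  rewrite normrM ger0_norm ?mulr_ge0 ?powR_ge0 ?(ltW m0)//.
  set X := `|F - _|; have -> : k `^ (2 * s) * m * X = m * (k `^ (2 * s) * X) by ring.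
  rewrite -mulrA ler_pM2l//.
  apply: (@le_trans _ _ (k `^ (2 * s) * (`|C1| * k ^+ n.+1))).
    apply: ler_wpM2l; first exact: powR_ge0.
    by apply: (le_trans h1); rewrite ler_wpM2r ?exprn_ge0 ?ler_norm.
  rewrite mulrCA ler_wpM2l// -powR_mulrn// -powRD'//; apply: powR_le1 => //.
  by rewrite -addn1 natrD; lra.
have tn : trgc R b n != 0 by exact: trgc_neq0.
by move=> e; apply: (mulfI (mulf_neq0 (lt0r_neq0 m0) tn)); rewrite e mulr0.
Qed.
End moments.

(** * From vanishing moments to all frequencies *)

Section continuation.
Variables (R : realType) (d : nat) (C e : R) (xi : 'rV[R]_d).
Hypothesis e0 : 0 < e.
Local Notation V := 'rV[R]_d.
Implicit Types (g : V -> R) (x : V).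

Definition exp_decaying g := mR g /\ forall x, `|g x| <= C * expR (- (e * enorm x)).
Definition moment_free g := exp_decaying g /\ forall j, IR (fun x => g x * dotr xi x ^+ j) = 0.

Lemma LR_exp_poly j c : 0 < c -> LR (fun x : V => enorm x ^+ j * expR (- (c * enorm x))).
Proof.
move=> c0; have [K K0 HK] := @expR_pow R c (d.+1 + j) c0.
apply: (@LR_decay R d _ K).
  apply: measurable_funM; first by apply: measurable_funX; exact: mR_enorm.
  apply: (mR_fun_enorm (g := fun t => expR (- (c * t)))).
  apply: continuous_measurable_fun => t; apply: (@continuous_comp _ _ _ (fun t => - (c * t)) expR).
    by apply: cvgN; apply: cvgMl_tmp; exact: cvg_id.
  exact: continuous_expR.
move=> x; have x0 := enorm_ge0 x; rewrite ger0_norm ?mulr_ge0 ?exprn_ge0 ?expR_ge0//.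
rewrite mulrA expRN ler_pdivrMr ?expR_gt0//; apply: le_trans (HK _ x0).
rewrite exprD ler_wpM2l ?exprn_ge0 ?addr_ge0// lerXn2r ?nnegrE ?addr_ge0// lerDr//.
Qed.

Lemma LR_exp_moment g j : exp_decaying g -> LR (fun x => g x * dotr xi x ^+ j).
Proof.
move=> [mg gC]; apply: (LR_le _ _ (LRZ (C * enorm xi ^+ j) (LR_exp_poly j e0))).
  apply: measurable_funM => //; apply: measurable_funX.
  exact: mR_cont (@continuous_dotr R d xi).
move=> x; rewrite normrM normrX.
rewrite (_ : C * _ * _ = C * expR (- (e * enorm x)) * (enorm xi * enorm x) ^+ j); last first.
  by rewrite exprMn; ring.
apply: ler_pM => //; rewrite ?exprn_ge0// lerXn2r ?nnegrE ?mulr_ge0 ?enorm_ge0//.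
exact: dotr_le.
Qed.

Lemma exp_decaying_trg b h g : exp_decaying g -> exp_decaying (fun x => g x * trg b (h * dotr xi x)).
Proof.
move=> [mg gC]; split.
  have mt : mR (fun x => trg b (h * dotr xi x)).
    by have := mtrg b (h *: xi); congr mR; apply/funext => x; rewrite dotrZl.
  exact: measurable_funM mg mt.
by move=> x; apply: le_trans (gC x); rewrite normrM ler_piMr ?trg_le1.
Qed.

(** The Taylor series of the modulation may be integrated term by term, since it is at most e^(|h|
    |xi| |x|) and this costs only half of the decay of [g]. Each term is a moment, hence 0. As |trg|
    <= 1 the modulated function keeps the same [C] and [e], so steps of the same length can be
    repeated forever. *)
Lemma moment_free_trg b h g : `|h| * enorm xi <= e / 2 -> moment_free g ->
  moment_free (fun x => g x * trg b (h * dotr xi x)).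
Proof.
move=> hh [hg g0]; split; first exact: exp_decaying_trg.
move=> j; have LRj i := LR_exp_moment i hg; have [mg gC] := hg.
have C0 : 0 <= C by have := le_trans (normr_ge0 _) (gC 0); rewrite pmulr_lge0// expR_gt0.
have E N : (fun x => g x * dotr xi x ^+ j * trgs b N (h * dotr xi x)) =
    fun x => \sum_(k < N) (trgc R b k * h ^+ k) * (g x * dotr xi x ^+ (j + k)).
  apply/funext => x; rewrite /trgs mulr_sumr; apply: eq_bigr => k _; rewrite exprD exprMn; ring.
have lim : (fun N => IR (fun x => g x * dotr xi x ^+ j * trgs b N (h * dotr xi x))) @ \oo -->
    IR (fun x => g x * trg b (h * dotr xi x) * dotr xi x ^+ j).
  have e2 : 0 < e / 2 by rewrite divr_gt0.
  apply: (IR_lim _ _ _ (LRZ (C * enorm xi ^+ j) (LR_exp_poly j e2))).2.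
  - move=> N; rewrite E; apply: LR_mR; apply: L1_sum => k _; exact: (LRZ _ (LRj (j + k)%N)).
  - move=> x; rewrite mulrAC; apply: cvgMl_tmp; exact: trgs_cvg.
  - move=> N x; rewrite !normrM normrX.
    apply: (@le_trans _ _ (C * expR (- (e * enorm x)) * (enorm xi * enorm x) ^+ j * expR (e / 2 * enorm x))).
      apply: ler_pM; rewrite ?mulr_ge0 ?exprn_ge0//.
        apply: ler_pM; rewrite ?exprn_ge0// lerXn2r ?nnegrE ?mulr_ge0 ?enorm_ge0//.
        exact: dotr_le.
      apply: (le_trans (trgs_le _ _ _)); rewrite ler_expR normrM.
      apply: (@le_trans _ _ (`|h| * enorm xi * enorm x)).
        by rewrite -mulrA ler_wpM2l// dotr_le.
      by rewrite ler_wpM2r ?enorm_ge0.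
    have -> : expR (- (e / 2 * enorm x)) = expR (- (e * enorm x)) * expR (e / 2 * enorm x).
      by rewrite -expRD; congr expR; field.
    by rewrite exprMn le_eqVlt; apply/orP; left; apply/eqP; ring.
have e1 : (fun N => IR (fun x => g x * dotr xi x ^+ j * trgs b N (h * dotr xi x))) = fun=> 0.
  apply/funext => N; rewrite E /IR Int_sum; last by move=> k _; exact: (LRZ _ (LRj (j + k)%N)).
  by apply: big1 => k _; rewrite [LHS](IRZ _ (LRj (j + k)%N)) g0 mulr0.
by rewrite e1 in lim; exact: (cvg_unique _ lim (cvg_cst _)).
Qed.

(* Frequencies are reached in small steps by the addition theorems. *)
Lemma moment_free_all b k g : moment_free g -> IR (fun x => g x * trg b (k * dotr xi x)) = 0.
Proof.
move=> hg; have e2 : 0 < e / 2 by rewrite divr_gt0.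
have [N hN] := filter_ex (nbhs_infty_gtr (`|k| * enorm xi / (e / 2))).
have X0 : 0 <= `|k| * enorm xi / (e / 2) by apply: divr_ge0 (ltW e2); rewrite mulr_ge0 ?enorm_ge0.
have N0 : 0 < N%:R :> R by exact: le_lt_trans hN.
pose h := k / N%:R; have hh : `|h| * enorm xi <= e / 2.
  rewrite /h normrM normfV (gtr0_norm N0) mulrAC ler_pdivrMr// -ler_pdivrMl// mulrC.
  exact: ltW.
have P n : moment_free (fun x => g x * trg false (n%:R * h * dotr xi x)) /\
           moment_free (fun x => g x * trg true (n%:R * h * dotr xi x)).
  elim: n => [|n [ic is_]].
    by split; apply: moment_free_trg => //; rewrite mul0r normr0 mul0r ltW.
  have hA b1 b2 : moment_free (fun x => g x * trg b1 (n%:R * h * dotr xi x) * trg b2 (h * dotr xi x)).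
    by apply: moment_free_trg => //; case: b1.
  have eA x : n.+1%:R * h * dotr xi x = n%:R * h * dotr xi x + h * dotr xi x.
    by rewrite -addn1 natrD; ring.
  split; (split; first exact: exp_decaying_trg hg.1) => j.
    have [h1 z1] := hA false false; have [h2 z2] := hA true true.
    rewrite -[RHS](subrr (0 : R)) -{1}(z1 j) -(z2 j) -IRB; [|exact: LR_exp_moment..].
    by congr IR; apply/funext => x; rewrite eA /trg cosD; ring.
  have [h1 z1] := hA true false; have [h2 z2] := hA false true.
  rewrite -[RHS](addr0 (0 : R)) -{1}(z1 j) -(z2 j) -IRD; [|exact: LR_exp_moment..].
  by congr IR; apply/funext => x; rewrite eA /trg sinD; ring.
have [_ z] : moment_free (fun x => g x * trg b (N%:R * h * dotr xi x)).
  by case: b; case: (P N).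
have := z 0%N; have -> // : (fun x => g x * trg b (N%:R * h * dotr xi x) * dotr xi x ^+ 0) =
  fun x => g x * trg b (k * dotr xi x).
by apply/funext => x; rewrite expr0 mulr1 /h [N%:R * _]mulrC mulfVK// gt_eqF.
Qed.
End continuation.

(** * Densities *)

Section density.
Variables (R : realType) (d : nat).
Local Notation V := 'rV[R]_d.
Implicit Types (x z : V) (G : set V).

Lemma LR_ball : LR (fun x : V => (enorm x < 1)%R%:R) /\ 0 < IR (fun x : V => (enorm x < 1)%R%:R).
Proof.
have m : mR (fun x : V => (enorm x < 1)%R%:R).
  apply: (@mR_fun_enorm R d (fun t => (t < 1)%R%:R)).
  rewrite (_ : (fun t : R => _) = \1_(`]-oo, 1[%classic)).
    by apply: measurable_indic; exact: measurable_itv.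
  by apply/funext => t; rewrite indicE mem_setE in_itv/=.
have [h1 _] := @LR_boxi R d 1 ler01.
have hb : LR (fun x : V => (enorm x < 1)%R%:R).
  apply: (LR_le m _ h1) => x; rewrite ger0_norm// boxiE.
  case: ltP => // x1; case: forallP => // h; exfalso; apply: h => i.
  exact: le_lt_trans (le_coord_enorm _ _) x1.
split=> //; pose r : R := (1 + d%:R)^-1.
have d0 : 0 < 1 + d%:R :> R by rewrite ltr_wpDr.
have r0 : 0 < r by rewrite invr_gt0.
have [h2 e2] := @LR_boxi R d r (ltW r0).
apply: (@lt_le_trans _ _ (IR (boxi r : V -> R))).
  by rewrite e2 exprn_gt0// mulr_gt0.
apply: le_IR => // x; rewrite boxiE; case: forallP => // h.
suff -> : enorm x < 1 by [].
rewrite -(@ltr_pXn2r _ 2) ?nnegrE ?enorm_ge0// sqr_enorm expr1n.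
apply: (@le_lt_trans _ _ (\sum_(i < d) r ^+ 2)).
  apply: ler_sum => i _; rewrite -[x 0 i ^+ 2]real_normK ?num_real//.
  by rewrite lerXn2r ?nnegrE ?(ltW r0)// ltW.
rewrite sumr_const card_ord -[_ *+ d]mulr_natr /r exprVn mulrC ltr_pdivrMr ?exprn_gt0//.
rewrite mul1r expr2 mulrDl mul1r mulrDr mulr1.
have h0 : 0 <= d%:R :> R by [].
by have := mulr_ge0 h0 h0; lra.
Qed.

Lemma volume_eball z (t : R) : 0 < t ->
  volume (eball z t) = (t ^+ d * IR (fun x : V => (enorm x < 1)%R%:R))%:E.
Proof.
move=> t0; have [h _] := LR_ball.
pose g x : R := (enorm (t^-1 *: x + - (t^-1 *: z)) < 1)%R%:R.
have tn : t^-1 != 0 by rewrite invr_eq0 gt_eqF.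
have hg : LR g := LR_affine (- (t^-1 *: z)) tn h.
have eg : IR g = t ^+ d * IR (fun x : V => (enorm x < 1)%R%:R).
  by rewrite /g (IR_affine (- (t^-1 *: z)) tn h) gtr0_norm ?invr_gt0// exprVn invrK.
have gE x : g x = \1_(eball z t) x.
  rewrite /g -scalerBr enormZ gtr0_norm ?invr_gt0// mulrC ltr_pdivrMr// mul1r.
  have e : (x \in eball z t) = (enorm (x - z) < t) by apply/idP/idP; rewrite inE.
  by rewrite indicE e.
have mE : measurable (@rV_of_tuple R d @^-1` eball z t).
  have := LR_mR hg; rewrite /mR (_ : (fun t0 => g _) = \1_(@rV_of_tuple R d @^-1` eball z t)).
    by move/measurable_indicP.
  by apply/funext => u; rewrite gE !indicE.
have := Int_EFin hg; rewrite -/(IR g) eg => <-.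
rewrite /volume -[X in leb_tuple R d X]setIT -integral_indic//.
by apply: eq_integral => u _; rewrite /= gE !indicE.
Qed.

(** A positive limit inferior yields one volume [r] at which the infimum is positive, so every ball
    of that volume in the range of [Phi] contains an image of a point of [G]. *)
Lemma lower_density_ball a c G : (0 < d)%N -> (0 < lower_density a c G)%E ->
  exists2 t : R, 0 < t & forall z, eball z t `<=` range (Phi a c) ->
    exists2 g, G g & enorm (Phi a c g - z) < t.
Proof.
move=> d0; rewrite /lower_density limf_einfE => /ereal_sup_gt[_ [A hA <-] h0].
have [r [Ar r0]] : exists r, A r /\ 0 < r.
  have /filter_ex[r []] : \forall r \near (+oo : set_system R), A r /\ 0 < r.
    by apply: filterI => //; exact: nbhs_pinfty_gt.
  by move=> *; exists r.
have [hb b0] := LR_ball; set v := IR _ in b0.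
pose t := (r / v) `^ (d%:R^-1); have rv : 0 < r / v by rewrite divr_gt0.
have t0 : 0 < t by exact: powR_gt0.
have td : t ^+ d * v = r.
  rewrite -powR_mulrn ?powR_ge0// -powRrM mulVf ?pnatr_eq0 -?lt0n// powRr1 ?(ltW rv)//.
  by rewrite divfK// gt_eqF.
exists t => // z hz.
have vol : volume (eball z t) = r%:E by rewrite volume_eball// td.
pose q := (counting ((Phi a c @` G) `&` eball z t) / volume (eball z t))%E : \bar R.
have q0 : (0 < q)%E.
  apply: (lt_le_trans h0); apply: (le_trans (ereal_inf_lbound _)); first by exists r => //.
  by apply: ereal_inf_lbound; exists z, t; split.
have [E|/set0P[w [[g Gg gw] hw]]] := eqVneq ((Phi a c @` G) `&` eball z t) set0.
  by move: q0; rewrite /q E /counting asboolT// fset_set0 finmap.cardfs0 mul0e ltxx.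
by exists g => //; rewrite gw.
Qed.

Lemma range_Phi a c (w : V) : 0 < a -> 0 < c -> 1 < enorm w -> range (Phi a c) w.
Proof.
move=> a0 c0 w1; have w0 : 0 < enorm w := lt_trans ltr01 w1.
have l0 : 0 < ln (enorm w) by rewrite ln_gt0.
pose m := c * ln (enorm w) `^ a; have m0 : 0 < m by rewrite mulr_gt0 ?powR_gt0.
pose x := (m / enorm w) *: w.
have ex : enorm x = m by rewrite enormZ ger0_norm ?divr_ge0 ?(ltW m0) ?(ltW w0)// divfK// gt_eqF.
exists x => //; rewrite /Phi -enorm_eq0 ex gt_eqF// /m mulrAC mulfV ?gt_eqF// !mul1r.
rewrite -powRrM mulfV ?gt_eqF// powRr1 ?(ltW l0)// lnK ?posrE// -/m.
rewrite /x !scalerA (_ : _ * _ * _ = 1) ?scale1r//; field.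
by rewrite !gt_eqF.
Qed.

Lemma enorm_Phi a c x : x != 0 -> enorm (Phi a c x) = expR ((enorm x / c) `^ (1 / a)).
Proof.
move=> x0; rewrite /Phi (negbTE x0) !enormZ (gtr0_norm (expR_gt0 _)) normfV.
by rewrite ger0_norm ?enorm_ge0// mulVf ?mulr1// enorm_eq0.
Qed.

Lemma expR_sub (u v : R) : `|expR u - expR v| <= `|u - v| * expR (Num.max u v).
Proof.
wlog uv : u v / v <= u.
  move=> h; have /orP[vu|vu] := le_total v u; first exact: h.
  rewrite distrC [`|u - v|]distrC maxC; exact: h.
rewrite (max_idPl uv) !ger0_norm ?subr_ge0 ?ler_expR//.
have := expR_ge1Dx (v - u); rewrite expRB ler_pdivlMr ?expR_gt0//; nra.
Qed.

Lemma ln_sub (m u v : R) : 0 < m -> m <= u -> m <= v -> `|ln u - ln v| <= `|u - v| / m.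
Proof.
move=> m0; wlog uv : u v / v <= u.
  by move=> h mu mv; have [/h->//|/ltW/h] := leP v u; rewrite distrC [`|v - u|]distrC => ->.
move=> mu mv; have v0 := lt_le_trans m0 mv; have u0 := lt_le_trans m0 mu.
rewrite !ger0_norm ?subr_ge0 ?ler_ln ?posrE//.
rewrite ler_pdivlMr//; apply: (@le_trans _ _ ((ln u - ln v) * v)).
  by rewrite ler_wpM2l// subr_ge0 ler_ln ?posrE.
have := expR_ge1Dx (ln u - ln v); rewrite expRB !lnK ?posrE// ler_pdivlMr//; lra.
Qed.

Lemma powR_sub (a u v : R) : 0 <= a -> 1 <= u -> 1 <= v -> u <= v + 1 ->
  `|u `^ a - v `^ a| <= a * `|u - v| * (v + 1) `^ a.
Proof.
move=> a0 u1 v1 uv; have u0 : 0 < u by lra. have v0 : 0 < v by lra.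
have v2 : 0 < v + 1 by lra.
rewrite /powR !gt_eqF//; apply: (le_trans (expR_sub _ _)); apply: ler_pM => //; rewrite ?expR_ge0//.
  rewrite -mulrBr normrM ger0_norm// ler_wpM2l//.
  by apply: (le_trans (ln_sub ltr01 u1 v1)); rewrite divr1.
rewrite ler_expR ge_max !ler_wpM2l ?ler_ln ?posrE//; lra.
Qed.

(** With L = (|x|/c)^(1/a), the point Phi(x) has norm e^L and some image of [g] lies within [t] of
    it. Taking logarithms, the exponents differ by order e^-L; the power [a] brings this back to
    radii at the cost of a factor (L+1)^a, and the directions differ by order e^-L as well. Half of
    the exponential absorbs the polynomial factor. *)
Lemma density_dist a c G : (0 < d)%N -> 0 < a -> 0 < c -> (0 < lower_density a c G)%E ->
  exists L0 C : R, 0 <= C /\ forall x, L0 <= (enorm x / c) `^ (1 / a) ->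
    exists2 g, G g & enorm (x - g) <= C * expR (- ((enorm x / c) `^ (1 / a) / 2)).
Proof.
move=> d0 a0 c0 /(lower_density_ball d0)[t t0 Ht].
pose k := Num.truncn a; have ka : a < k.+1%:R.
  by rewrite /k truncnS_gt.
have h2 : 0 < (2^-1 : R) by [].
have [K K0 HK] := @expR_pow R 2^-1 k.+1 h2.
(* From here on e^L >= 3 + 2t, so the ball of radius [t] around Phi(x) avoids the unit ball, lies in
   the range of [Phi], and perturbs e^L by at most a half. *)
exists (2 + 2 * t), (c * (2 * a + 2) * t * K); split.
  by rewrite !mulr_ge0 ?addr_ge0 ?mulr_ge0// ltW.
have back y : 0 <= y -> c * ((y / c) `^ (1 / a)) `^ a = y.
  move=> y0; rewrite -powRrM mul1r mulVf ?gt_eqF// powRr1 ?divr_ge0 ?(ltW c0)// mulrC divfK//.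
  by rewrite gt_eqF.
move=> x; have [L LE] : {L | L = (enorm x / c) `^ (1 / a)} by exists ((enorm x / c) `^ (1 / a)).
rewrite -LE => hL; have L1 : 1 <= L by lra.
have x0 : x != 0.
  apply: contraTneq L1 => x0; rewrite LE x0 enorm0 mul0r powR0; first by rewrite -ltNge ltr01.
  by rewrite mulf_neq0 ?oner_neq0 ?invr_neq0 ?gt_eqF.
have EL : 1 + L <= expR L by exact: expR_ge1Dx.
have nx : enorm (Phi a c x) = expR L by rewrite LE; exact: enorm_Phi.
have [|g Gg] := Ht (Phi a c x).
  move=> w; rewrite /eball/= => hw; apply: range_Phi => //.
  by have := enorm_dist w (Phi a c x); rewrite nx ler_norml => /andP[]; lra.
have [w wE] : {w | w = Phi a c g} by exists (Phi a c g).
rewrite -wE => hg; exists g => //; have hw : expR L - t < enorm w.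
  by have := enorm_dist w (Phi a c x); rewrite nx ler_norml => /andP[]; lra.
have g0 : g != 0.
  apply: contraTneq hw => g0; rewrite wE g0 /Phi eqxx enorm0 -leNgt.
  by clear -EL hL t0; lra.
have [M ME] : {M | M = (enorm g / c) `^ (1 / a)} by exists ((enorm g / c) `^ (1 / a)).
have nw : enorm w = expR M by rewrite ME wE; exact: enorm_Phi.
have eM : `|expR M - expR L| <= t by rewrite -nw -nx; apply: le_trans (enorm_dist _ _) (ltW hg).
(* Bound for the difference of the logarithms: [t] divided by e^L / 2, a lower bound of both
   norms. *)
pose D := 2 * t * expR (- L).
have D0 : 0 <= D by rewrite !mulr_ge0 ?expR_ge0// ltW.
have LM : `|M - L| <= D.
  rewrite -(expRK M) -(expRK L).
  have m0 : 0 < expR L / 2 by rewrite divr_gt0 ?expR_gt0.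
  have m1 : expR L / 2 <= expR M by rewrite -nw; clear -EL hL hw t0; lra.
  have m2 : expR L / 2 <= expR L by have := expR_gt0 L; lra.
  apply: (le_trans (@ln_sub _ _ _ m0 m1 m2)).
  rewrite /D expRN ler_pdivrMr// mulrA mulfVK ?gt_eqF ?expR_gt0//.
  by rewrite mulrAC mulfV// mul1r.
have D1 : D <= 1 by rewrite /D expRN ler_pdivrMr ?expR_gt0// mul1r; lra.
have M1 : 1 <= M by move: LM; rewrite ler_norml => /andP[]; lra.
have M2 : M <= L + 1 by move: LM; rewrite ler_norml => /andP[]; lra.
have eg := back _ (enorm_ge0 g); have ex := back _ (enorm_ge0 x); rewrite -ME in eg; rewrite -LE in ex.
(* Polar form: radius times the unit vector obtained by normalising the image under [Phi]. The
   difference x - g then splits into a radial and an angular part. *)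
have xE : x = enorm x *: (expR (- L) *: Phi a c x).
  rewrite /Phi (negbTE x0) -LE !scalerA -[_ * expR (- L) * expR L]mulrA -expRD addNr expR0 mulr1.
  by rewrite mulfV ?scale1r// enorm_eq0.
have gE : g = enorm g *: (expR (- M) *: w).
  rewrite wE /Phi (negbTE g0) -ME !scalerA -[_ * expR (- M) * expR M]mulrA -expRD addNr expR0 mulr1.
  by rewrite mulfV ?scale1r// enorm_eq0.
pose P := (L + 1) `^ a; have P0 : 0 <= P by exact: powR_ge0.
have dn : enorm x - enorm g = - (c * (M `^ a - L `^ a)) by rewrite -eg -ex; ring.
have b1 : `|enorm x - enorm g| <= c * (a * D * P).
  rewrite dn normrN normrM (gtr0_norm c0) ler_wpM2l ?(ltW c0)//.
  apply: (le_trans (powR_sub (ltW a0) M1 L1 M2)); by rewrite ler_wpM2r// ler_wpM2l// ltW.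
have b2 : enorm g <= c * P.
  rewrite -eg ler_wpM2l ?(ltW c0)// ge0_ler_powR ?nnegrE ?(ltW a0)//; lra.
have b3 : enorm (expR (- L) *: Phi a c x - expR (- M) *: w) <= D.
  have -> : expR (- L) *: Phi a c x - expR (- M) *: w =
     - (expR (- L) *: (w - Phi a c x)) + (expR (- L) - expR (- M)) *: w.
    by rewrite scalerBl scalerBr; rewrite opprB addrA subrK.
  apply: (le_trans (enormD _ _)); rewrite enormN !enormZ nw (gtr0_norm (expR_gt0 _)).
  have -> : expR (- L) - expR (- M) = expR (- L) * (expR (- M) * (expR M - expR L)).
    by rewrite !expRN; field; rewrite !gt_eqF ?expR_gt0.
  rewrite !normrM !(gtr0_norm (expR_gt0 _)) /D.
  have -> : expR (- L) * (expR (- M) * `|expR M - expR L|) * expR M = expR (- L) * `|expR M - expR L|.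
    by rewrite [expR (- M)]expRN; field; rewrite gt_eqF ?expR_gt0.
  rewrite -mulrDr mulrC ler_wpM2r ?expR_ge0//; lra.
rewrite {1}xE {1}gE.
set u := expR (- L) *: _ in b3 *; set u' := expR (- M) *: _ in b3 *.
have nu' : enorm u = 1 by rewrite /u enormZ nx gtr0_norm ?expR_gt0// expRN mulVf// gt_eqF ?expR_gt0.
have -> : enorm x *: u - enorm g *: u' = (enorm x - enorm g) *: u + enorm g *: (u - u').
  by rewrite scalerBl scalerBr addrA subrK.
apply: (le_trans (enormD _ _)); rewrite (enormZ _ u) (enormZ _ (u - u')) nu' mulr1 (ger0_norm (enorm_ge0 g)).
have PK : P <= K * expR (2^-1 * L).
  apply: le_trans (HK L _); last lra.
  rewrite /P [L + 1]addrC -powR_mulrn; last lra.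
  by apply: ler_powR; [lra|exact: ltW].
have eE : expR (- L) * expR (2^-1 * L) = expR (- (L / 2)) by rewrite -expRD; congr expR; field.
apply: (@le_trans _ _ (c * (a * D * P) + c * P * D)).
  by apply: lerD => //; apply: ler_pM; rewrite ?enorm_ge0.
rewrite (_ : _ + _ = c * (2 * a + 2) * t * (expR (- L) * P)); last by rewrite /D; ring.
rewrite -[leRHS]mulrA ler_wpM2l ?mulr_ge0 ?addr_ge0 ?mulr_ge0 ?(ltW c0) ?(ltW a0) ?(ltW t0)//.
by rewrite -eE mulrCA ler_wpM2l ?expR_ge0.
Qed.

(** Compare with a zero of [g] at exponentially small distance, by the Lipschitz bound; where x is
    too close to the origin for [density_dist], boundedness and the factor e^(L0/2) suffice. *)
Lemma lip_density_decay a c G (g : V -> R) (B K : R) :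
  (0 < d)%N -> 0 < a -> 0 < c -> (0 < lower_density a c G)%E ->
  (forall x, G x -> g x = 0) -> (forall x y, `|g x - g y| <= K * enorm (x - y)) ->
  (forall x, `|g x| <= B) ->
  exists C, forall x, `|g x| <= C * expR (- ((enorm x / c) `^ (1 / a) / 2)).
Proof.
move=> d0 a0 c0 /(density_dist d0 a0 c0)[L0 [C [C0 H]]] gG gK gB.
have B0 : 0 <= B := le_trans (normr_ge0 _) (gB 0).
exists (`|K| * C + B * expR (L0 / 2)) => x; set L := (_ / _) `^ _.
have [/H[y Gy hy]|L1] := leP L0 L.
  rewrite -[g x]subr0 -(gG y Gy); apply: (le_trans (gK _ _)).
  apply: (@le_trans _ _ (`|K| * (C * expR (- (L / 2))))).
    by apply: (@le_trans _ _ (`|K| * enorm (x - y))); rewrite ?ler_wpM2r ?enorm_ge0 ?ler_norm// ler_wpM2l.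
  by rewrite mulrA ler_wpM2r ?expR_ge0// lerDl mulr_ge0 ?expR_ge0.
apply: (le_trans (gB x)); rewrite mulrDl -[leLHS]add0r; apply: lerD.
  by rewrite !mulr_ge0 ?expR_ge0.
rewrite -mulrA -expRD ler_peMr// -[leLHS]expR0 ler_expR; lra.
Qed.
End density.

(** * Uniform bounds for Schwartz functions and stretched exponentials *)

Section schwartz_bounds.
Variables (R : realType) (d : nat).
Local Notation V := 'rV[R]_d.
Implicit Types (f g : V -> R).

Lemma rschwartz_bounded n f : rschwartz f ->
  exists2 C, 0 <= C & forall s x, (size s <= n)%N -> `|rpartials s f x| <= C.
Proof.
elim: n f => [|n ih] f hf.
  have [C hC] := hf.2 0%N [::]; exists `|C| => // -[|//] x _.
  by have := hC x; rewrite expr0 mul1r => h; apply: le_trans h (ler_norm _).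
have hi (i : 'I_d) : rschwartz (rpartial i f).
  split; first by move=> s; rewrite -rpartials_rcons; exact: hf.1.
  by move=> k s; have [C hC] := hf.2 k (rcons s i); exists C; rewrite -rpartials_rcons.
have [C0 C00 H0] := ih f hf.
have [C1 H1] : exists C, forall i s x, (size s <= n)%N -> `|rpartials s (rpartial i f) x| <= C.
  have hc i := cid2 (ih _ (hi i)); exists (\sum_i s2val (hc i)) => i s x sn.
  apply: (le_trans (s2valP' (hc i) s x sn)).
  by rewrite (bigD1 i)//= lerDl; apply: sumr_ge0 => j _; exact: (s2valP (hc j)).
exists (C0 + `|C1|); first by rewrite addr_ge0.
move=> s x; case: (lastP s) => [_|{}s i].
  by apply: (le_trans (H0 [::] x _)) => //; rewrite lerDl.
rewrite size_rcons ltnS => sn; rewrite rpartials_rcons; apply: (le_trans (H1 _ _ _ sn)).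
by apply: (le_trans (ler_norm _)); rewrite lerDr.
Qed.

Lemma rschwartz_lip f : rschwartz f -> exists K, forall x y, `|f x - f y| <= K * enorm (x - y).
Proof.
move=> hf; have [C C0 HC] := rschwartz_bounded 1 hf; exists (d%:R * C) => x y.
have h : `|f (y + (x - y)) - f y| <= d%:R * C * `|x - y|.
  by apply: lip_line => *; [exact: (hf.1 [::])|exact: (HC [:: _])].
rewrite [y + _]addrC subrK in h; apply: (le_trans h).
by rewrite ler_wpM2l ?mulr_ge0// norm_le_enorm.
Qed.

Lemma rschwartz_D2 f : rschwartz f -> exists K, forall x z, `|D2 f x z| <= K * enorm z ^+ 2.
Proof.
move=> hf; have [C C0 HC] := rschwartz_bounded 2 hf; exists (2 * d%:R ^+ 2 * C) => x z.
by apply: D2_local => [|i j t _]; [exact: hf.1|exact: (HC [:: j; i])].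
Qed.

Lemma rschwartz_cont f : rschwartz f -> continuous f.
Proof. by move=> hf x; apply: differentiable_continuous; exact: (hf.1 [::]). Qed.

Lemma lip_enorm_cont f K : (forall x y, `|f x - f y| <= K * enorm (x - y)) -> continuous f.
Proof.
move=> fK; apply: (@lip_continuous R d f (`|K| * d%:R)) => x y; apply: (le_trans (fK x y)).
apply: (@le_trans _ _ (`|K| * enorm (x - y))); first by rewrite ler_wpM2r ?enorm_ge0 ?ler_norm.
by rewrite -mulrA ler_wpM2l// enorm_le_norm.
Qed.

(** With T = (t/c)^alpha, t is c times a power of T, so a power of 1 + t is at most a power of 1 +
    T, and e^(T/2) beats it. *)
Lemma stretched_exp_decay (c alpha : R) k : 0 < c -> 0 < alpha ->
  exists2 C, 0 <= C & forall t, 0 <= t -> (1 + t) ^+ k * expR (- ((t / c) `^ alpha / 2)) <= C.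
Proof.
move=> c0 a0; pose N := (Num.truncn alpha^-1).+1.
have Na : alpha^-1 <= N%:R by rewrite ltW// truncnS_gt.
have h2 : 0 < (2^-1 : R) by [].
have [K K0 HK] := @expR_pow R 2^-1 (N * k) h2.
exists ((1 + c) ^+ k * K); first by rewrite mulr_ge0 ?exprn_ge0 ?addr_ge0 ?(ltW c0) ?(ltW K0).
move=> t t0; set T := (t / c) `^ alpha; have T0 : 0 <= T by exact: powR_ge0.
have tE : t = c * T `^ alpha^-1.
  by rewrite /T -powRrM mulfV ?gt_eqF// powRr1 ?divr_ge0 ?(ltW c0)// mulrC divfK// gt_eqF.
have T1 : 1 <= 1 + T by rewrite lerDl.
have h1 : 1 + t <= (1 + c) * (1 + T) ^+ N.
  rewrite mulrDl mul1r; apply: lerD; first exact: exprn_ege1.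
  rewrite {1}tE ler_wpM2l ?(ltW c0)//; apply: (@le_trans _ _ ((1 + T) `^ alpha^-1)).
    by apply: ge0_ler_powR; rewrite ?nnegrE ?invr_ge0 ?(ltW a0) ?lerDr// addr_ge0.
  by rewrite -powR_mulrn ?addr_ge0//; exact: ler_powR.
rewrite expRN ler_pdivrMr ?expR_gt0//.
apply: (@le_trans _ _ (((1 + c) * (1 + T) ^+ N) ^+ k)).
  by rewrite lerXn2r ?nnegrE ?addr_ge0 ?mulr_ge0 ?exprn_ge0 ?addr_ge0 ?(ltW c0).
rewrite exprMn -exprM -mulrA ler_wpM2l ?exprn_ge0 ?addr_ge0 ?(ltW c0)//.
by have := HK T T0; rewrite mulrC [2^-1 * _]mulrC; congr (_ <= _); rewrite ?mulrA//; rewrite mulrC.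
Qed.
End schwartz_bounds.

Section schwartz_extension.
Variables (R : realType) (d : nat) (s : R).
Hypothesis d0 : (0 < d)%N.
Hypothesis hs : 0 < s < 1.
Variable f : 'rV[R]_d -> R.
Hypothesis hf : rschwartz f.
Local Notation yc := (ycoord d).

Lemma cs_extension_schwartz :
  cs_extension s (fun x => (f x)%:C%C) (fun z => (ext s f z)%:C%C).
Proof.
have [B B0 HB] := rschwartz_bounded 0 hf; have [K fK] := rschwartz_lip hf.
by apply: (cs_extension_ext d0 hs (LR_schwartz hf) (fun x => HB [::] x isT) fK).
Qed.

Lemma ext_trace x : ext s f (half_point x y) @[y --> 0^'+] --> f x.
Proof.
have [B B0 HB] := rschwartz_bounded 0 hf; have [K fK] := rschwartz_lip hf.
have hL := LR_schwartz hf; have fB y := HB [::] y isT; have [s0 s1] := andP hs.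
apply/cvgrPdist_lt => e e0.
set D := (2 * B + `|K|) * @PKs R d s.
have [del del0 hdel] := @powR_small R D s e s0 e0.
near=> y; have y0 : 0 < y by near: y; exact: nbhs_right_gt.
rewrite (ext_pint hs hL)// -(pint0 hs f x) distrC.
apply: (le_lt_trans (pint_holder hs hL fB fK x y0 (lexx 0))).
rewrite subr0 (gtr0_norm y0); apply: hdel; first exact: ltW.
by near: y; exact: nbhs_right_lt.
Unshelve. all: by end_near. Qed.

Lemma ext_normal_derivative x :
  y `^ (1 - 2 * s) * rpartial yc (ext s f) (half_point x y) @[y --> 0^'+] --> pc d s * s * Lop s f x.
Proof.
have [B B0 HB] := rschwartz_bounded 0 hf; have [K fK] := rschwartz_D2 hf.
exact: (normal_derivative_limit hs (LR_schwartz hf) (fun x => HB [::] x isT) (fK x)).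
Qed.

Lemma Lop_schwartz : (exists B, forall x, `|Lop s f x| <= B) /\
  exists K, forall x y, `|Lop s f x - Lop s f y| <= K * enorm (x - y).
Proof.
have [C C0 HC] := rschwartz_bounded 3 hf; have [K fK] := rschwartz_D2 hf.
have fB x : `|f x| <= C by exact: (HC [::]).
split; last exact: (Lop_lipschitz hs hf.1 fB (fun s x h => HC s x h)).
eexists => x; apply: (Lop_le hs fB (fK x)); exact: mR_cont (rschwartz_cont hf).
Qed.
End schwartz_extension.

(** * Zeros of the trace and of the normal derivative force the zero function *)

Section uniqueness_from_zeros.
Variables (R : realType) (d : nat) (alpha s c : R).
Hypothesis d0 : (0 < d)%N.
Hypothesis hs : 0 < s < 1.
Hypothesis c0 : 0 < c.
Hypothesis a0 : 0 < alpha.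
Local Notation V := 'rV[R]_d.
Local Notation yc := (ycoord d).

Lemma schwartz_eq0_of_zeros (f : V -> R) (Lambda M : set V) : rschwartz f ->
  (0 < lower_density 1 c Lambda)%E -> (0 < lower_density (1 / alpha) c M)%E ->
  (forall x, Lambda x -> f x = 0) -> (forall x, M x -> Lop s f x = 0) ->
  forall x, f x = 0.
Proof.
move=> hf dL dM fL fM.
have [B B0 HB] := rschwartz_bounded 0 hf; have fB x : `|f x| <= B by exact: (HB [::]).
have [K fK] := rschwartz_lip hf.
have [[BL hBL] [KL hKL]] := Lop_schwartz hs hf.
have b0 : 0 < 1 / alpha by rewrite divr_gt0.
have [C1 H1] := lip_density_decay d0 ltr01 c0 dL fL fK fB.
have [C2 H2] := lip_density_decay d0 b0 c0 dM fM hKL hBL.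
have mf := mR_cont (rschwartz_cont hf).
have mL := mR_cont (lip_enorm_cont hKL).
(* For [Phi 1 c] the exponent in the decay is |x|/(2c), linear in |x|: a true exponential rate, as
   [moment_free] needs. For [M] only rapid decay results. *)
pose e := (2 * c)^-1; have e0 : 0 < e by rewrite invr_gt0 mulr_gt0.
have hE : exp_decaying C1 e f.
  split=> // x; have := H1 x; rewrite divr1 powRr1 ?divr_ge0 ?enorm_ge0 ?(ltW c0)//.
  by congr (_ <= _ * expR (- _)); rewrite /e; field; rewrite gt_eqF.
have hR : rapid (Lop s f).
  split=> // k; have [C C0 HC] := stretched_exp_decay k c0 a0; exists (`|C2| * C) => x.
  have := H2 x; rewrite !div1r invrK => h.
  apply: (@le_trans _ _ ((1 + enorm x) ^+ k * (`|C2| * expR (- ((enorm x / c) `^ alpha / 2))))).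
    rewrite ler_wpM2l ?exprn_ge0 ?addr_ge0 ?enorm_ge0//; apply: (le_trans h).
    by rewrite ler_wpM2r ?expR_ge0 ?ler_norm.
  by rewrite mulrCA ler_wpM2l// HC// enorm_ge0.
have mfree xi : xi != 0 -> moment_free C1 e xi f.
  by move=> x0; split=> // j; exact: (moments_zero d0 hs hf hR).
have trg0 b xi : IR (fun x => f x * trg b (dotr xi x)) = 0.
  have [->|x0] := eqVneq xi 0; last first.
    by have := moment_free_all e0 b 1 (mfree xi x0); under eq_fun do rewrite mul1r.
  (* Frequency 0 is reached as 0 times a nonzero direction, because moments are controlled along
     nonzero directions only. *)
  pose eta : V := const_mx 1; have en : eta != 0.
    apply/eqP => /matrixP/(_ 0 (Ordinal d0)); rewrite !mxE => /eqP; by rewrite oner_eq0.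
  have := moment_free_all e0 b 0 (mfree eta en).
  have -> // : (fun x => f x * trg b (0 * dotr eta x)) = fun x => f x * trg b (dotr 0 x).
  by apply/funext => x; rewrite -dotrZl scale0r.
have LRt b xi : LR (fun x => f x * trg b (dotr xi x)).
  by apply: LR_mul1; [exact: LR_schwartz|exact: mtrg|move=> x; exact: trg_le1].
apply: (@spectrum_free_eq0 R d f B (rschwartz_cont hf) fB); split; first exact: LR_schwartz.
move=> xi t; have -> : (fun x => f x * cos (dotr xi x + t)) =
   fun x => cos t * (f x * trg false (dotr xi x)) - sin t * (f x * trg true (dotr xi x)).
  by apply/funext => x; rewrite cosD /trg; ring.
by rewrite IRB ?IRZ ?trg0 ?mulr0 ?subr0//; exact: LRZ.
Qed.

Lemma extension_eq0 (Lambda M : set V) (f : V -> R[i]) (u : 'rV[R]_(d + 1) -> R[i]) :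
  (0 < lower_density 1 c Lambda)%E -> (0 < lower_density (1 / alpha) c M)%E ->
  schwartz f -> cs_extension s f u ->
  (forall x, Lambda x -> trace_vanishes_at u x) ->
  (forall x, M x -> weighted_normal_vanishes_at s u x) ->
  forall z, half_space z -> u z = 0.
Proof.
move=> dL dM sf eu tL nM.
have [fr fi] := schwartz_ReIm sf.
(* [b] selects the real or the imaginary part. By uniqueness that part of [u] is the Poisson
   integral of the same part of [f], so trace and normal derivative become statements on [F] and
   [Lop s F]. *)
have P (b : bool) z : half_space z -> (if b then complex.Re (u z) else complex.Im (u z)) = 0.
  move=> hz; pose p (z : R[i]) := if b then complex.Re z else complex.Im z.
  have pn w : `|p w| <= ComplexField.Normc.normc w.
    by rewrite /p; case: b {p}; [exact: le_Re_normc|exact: le_Im_normc].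
  have n0 w : 0 <= ComplexField.Normc.normc w := le_trans (normr_ge0 _) (pn w).
  pose F x := p (f x).
  have hF : rschwartz F by rewrite /F /p; case: b {p pn n0 F}.
  have mF := mR_cont (rschwartz_cont hF).
  have [B B0 HB] := rschwartz_bounded 0 hF; have FB x : `|F x| <= B by exact: (HB [::]).
  have [L2F _] := LR_sq_of (LR_schwartz hF) FB.
  have e1 : real_extension s F (fun z => p (u z)).
    by apply: real_extension_part => //; apply: mR_cont; exact: rschwartz_cont.
  have e2 : real_extension s F (ext s F).
    apply: (real_extension_part (b := true) (p := fun z => complex.Re z) _ _ _ (cs_extension_schwartz d0 hs hF)) => //.
    exact: measurable_cst.
  have E := real_extension_unique hs mF L2F e1 e2.
  have hp (x : V) y : 0 < y -> half_space (half_point x y) by move=> y0; rewrite /half_space/= height_half.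
  have F0 x : Lambda x -> F x = 0.
    move=> /tL h; have lim : ext s F (half_point x y) @[y --> 0^'+] --> F x by exact: ext_trace.
    apply: (cvg_unique (@norm_hausdorff _ _) lim).
    apply/cvgr0Pnorm_lt => e e0; move/cvgr0Pnorm_lt : h => /(_ e e0).
    apply: filterS2 (nbhs_right_gt _) => y y0.
    rewrite subr0 (ger0_norm (n0 _)) -E; last exact: hp.
    exact: le_lt_trans.
  have L0 x : M x -> Lop s F x = 0.
    move=> /nM h; have /eqP : pc d s * s * Lop s F x = 0.
      have lim : y `^ (1 - 2 * s) * rpartial yc (ext s F) (half_point x y) @[y --> 0^'+] -->
         pc d s * s * Lop s F x by exact: ext_normal_derivative.
      apply: (cvg_unique (@norm_hausdorff _ _) lim); apply/cvgr0Pnorm_lt => e e0; move/cvgr0Pnorm_lt : h => /(_ e e0).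
      apply: filterS2 (nbhs_right_gt _) => y y0.
      rewrite subr0 (ger0_norm (n0 _)); apply: le_lt_trans.
      have -> : rpartial yc (ext s F) (half_point x y) = rpartial yc (fun z => p (u z)) (half_point x y).
        apply: near_eq_derive; apply: filterS (open_nbhs_nbhs (conj (@open_half_space R d) (hp x y y0))) => w hw.
        by rewrite E.
      apply: le_trans (pn _); rewrite /weighted_dy /p /partial.
      by case: b {p pn n0 F hF mF FB L2F e1 e2 E F0 HB lim} => /=; rewrite ?mul0r ?subr0 ?addr0.
    have [s0 _] := andP hs.
    by rewrite mulf_eq0 gt_eqF ?mulr_gt0 ?pc_gt0//= => /eqP.
  have Fz : F = fun=> 0 by apply/funext => x; exact: (schwartz_eq0_of_zeros hF dL dM F0 L0).
  rewrite -/(p (u z)) E// Fz /ext /hconv.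
  have -> : (fun w : V => PQ s (z - emb w) * 0) = fun=> 0 by apply/funext => w; rewrite mulr0.
  by rewrite IR0.
move=> z hz; have := P true z hz; have := P false z hz.
by case: (u z) => a b /= -> ->.
Qed.
End uniqueness_from_zeros.

(** * Bumps with high frequencies *)

Section gaussian_transform.
Variables (R : realType) (n : nat).
Local Notation V := 'rV[R]_n.
Implicit Types (w xi z : V).

Lemma LR_gs_exp k (a : R) : 0 <= a -> LR (fun w : V => (1 + enorm w) ^+ k * expR (a * enorm w) * gs w).
Proof.
move=> a0; have [C C0 HC] := @expR_pow R 1 k ltr01.
have h : LR (fun w : V => C * expR ((a + 2) ^+ 2 / 4) * expR (- (1 * enorm w))).
  apply: LRZ; have := @LR_exp_poly R n 0 1 ltr01; by under eq_fun do rewrite expr0 mul1r.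
have mg := @LR_mR R n _ (@LR_gs R n).1.
apply: (LR_le _ _ h).
  apply: measurable_funM => //.
  apply: (@mR_fun_enorm R n (fun t => (1 + t) ^+ k * expR (a * t))).
  apply: measurable_funM.
    by apply: measurable_funX; apply: measurable_funD; [exact: measurable_cst|exact: measurable_id].
  apply: continuous_measurable_fun => t; apply: (@continuous_comp _ _ _ (fun t => a * t) expR).
    by apply: cvgMl_tmp; exact: cvg_id.
  exact: continuous_expR.
move=> w; have t0 := enorm_ge0 w; have := HC _ t0; set t := enorm w in t0 * => ht.
have /andP[g0 _] := gs_le1 w.
rewrite ger0_norm ?mulr_ge0 ?exprn_ge0 ?addr_ge0 ?expR_ge0//.
rewrite -!mulrA; apply: (@le_trans _ _ (C * expR (1 * t) * (expR (a * t) * gs w))).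
  by rewrite ler_wpM2r ?mulr_ge0 ?expR_ge0.
rewrite /gs -sqr_enorm -/t -!mulrA ler_wpM2l ?(ltW C0)// -!expRD ler_expR.
by have := sqr_ge0 (t - (a + 2) / 2); rewrite sqrrB; lra.
Qed.

Lemma trg_taylor (u v : R) : `|cos (u + v) - cos u + v * sin u| <= 2 * (1 + expR 1) * v ^+ 2.
Proof.
have e1 := @trg_remainder R false 2 v; have e2 := @trg_remainder R true 2 v.
have t1 : trgs false 2 v = 1 by rewrite /trgs !big_ord_recr big_ord0 /trgc /= fact0; field.
have t2 : trgs true 2 v = v by rewrite /trgs !big_ord_recr big_ord0 /trgc /= factS fact0; field.
rewrite t1 in e1; rewrite t2 in e2; rewrite /trg -normrX (ger0_norm (sqr_ge0 v)) in e1 e2.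
have -> : cos (u + v) - cos u + v * sin u = cos u * (cos v - 1) - sin u * (sin v - v) by rewrite cosD; ring.
apply: (le_trans (ler_normB _ _)); rewrite !normrM -mulrA mulr_natl mulr2n; apply: lerD.
  by apply: le_trans e1; rewrite ler_piMl ?cos_max.
by apply: le_trans e2; rewrite ler_piMl ?sin_max.
Qed.

Lemma trg_lip (u v : R) : `|cos (u + v) - cos u| <= 2 * (1 + expR 1) * `|v|.
Proof.
have e1 := @trg_remainder R false 1 v; have e2 := @trg_remainder R true 1 v.
have t1 : trgs false 1 v = 1 by rewrite /trgs !big_ord_recr big_ord0 /trgc /= fact0; field.
have t2 : trgs true 1 v = 0 by rewrite /trgs !big_ord_recr big_ord0 /trgc /= fact0; field.
rewrite t1 in e1; rewrite t2 subr0 in e2; rewrite /trg expr1 in e1 e2.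
have -> : cos (u + v) - cos u = cos u * (cos v - 1) - sin u * sin v by rewrite cosD; ring.
apply: (le_trans (ler_normB _ _)); rewrite !normrM -mulrA mulr_natl mulr2n; apply: lerD.
  by apply: le_trans e1; rewrite ler_piMl ?cos_max.
by apply: le_trans e2; rewrite ler_piMl ?sin_max.
Qed.

Lemma exp_taylor (b : R) : `|expR b - 1 - b| <= b ^+ 2 * expR `|b|.
Proof.
have e0 := expR_ge1Dx b; rewrite ger0_norm; last lra.
have e1 := expR_ge1Dx (- b).
have h : (1 - b) * expR b <= 1.
  rewrite -[leRHS](expRxMexpNx_1 b) mulrC ler_wpM2l ?expR_ge0//.
have [b0|b0] := leP 0 b; first by rewrite ger0_norm//; nra.
have e2 : 1 <= expR `|b| by rewrite -[leLHS]expR0 ler_expR.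
have e3 : expR b <= 1 by rewrite -[leRHS]expR0 ler_expR ltW.
by have b2 := sqr_ge0 b; nra.
Qed.

Definition gauss_cos c xi := IR (fun w => cos (dotr xi w + c) * gs w).

Let mcos xi c : mR (fun w => cos (dotr xi w + c)). Proof. exact: mR_phase (@continuous_cos R). Qed.

Lemma LR_gauss_cos c xi : LR (fun w => cos (dotr xi w + c) * gs w).
Proof.
have := LR_mul1 (@LR_gs R n).1 (mcos xi c) (fun w => cos_max _).
by under eq_fun do rewrite mulrC.
Qed.

Lemma LR_gauss_sin c xi i : LR (fun w => w 0 i * sin (dotr xi w + c) * gs w).
Proof.
have h := @LR_gs_exp 1 0 (lexx 0); apply: (LR_le _ _ h).
  apply: measurable_funM; last exact: LR_mR (@LR_gs R n).1.
  apply: measurable_funM; first exact: (mcoord_tuple i).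
  exact: mR_phase (@continuous_sin R).
move=> w; have /andP[g0 _] := gs_le1 w; rewrite normrM (ger0_norm g0) ler_wpM2r// mul0r expR0 mulr1 expr1.
rewrite normrM -[leRHS]mulr1; apply: ler_pM => //; last exact: sin_max.
by apply: (le_trans (le_coord_enorm _ _)); rewrite lerDr.
Qed.

Let dotr_lincomb w h : dotr h w = lincomb (fun i => w 0 i) h.
Proof. by rewrite /dotr /lincomb; apply: eq_bigr => i _; rewrite mulrC. Qed.

Lemma gauss_cos_diff c xi : differentiable (gauss_cos c) xi /\
  forall i, rpartial i (gauss_cos c) xi = - IR (fun w => w 0 i * sin (dotr xi w + c) * gs w).
Proof.
pose H w := 2 * (1 + expR 1) * n%:R ^+ 2 * ((1 + enorm w) ^+ 2 * expR (0 * enorm w) * gs w).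
have hH : LR H by apply: LRZ; exact: LR_gs_exp.
pose k (t : n.-tuple R) xi := cos (dotr xi (rV_of_tuple t) + c) * gs (rV_of_tuple t).
pose p (t : n.-tuple R) i := - (rV_of_tuple t 0 i * sin (dotr xi (rV_of_tuple t) + c) * gs (rV_of_tuple t)).
have [||||D E] := @diff_under_Int R n _ _ (leb_tuple R n) k p (fun t => H (rV_of_tuple t)) xi 1 ltr01.
- by move=> h _; exact: LR_gauss_cos.
- by move=> i; exact: LRN (LR_gauss_sin c xi i).
- exact: hH.
- move=> t h _; rewrite /k /p; set w := rV_of_tuple t; have /andP[g0 _] := gs_le1 w.
  set u := dotr xi w + c; set v := dotr h w.
  have -> : lincomb (fun i => - (w 0 i * sin u * gs w)) h = - (v * sin u * gs w).
    rewrite /v dotr_lincomb /lincomb -mulrA mulr_suml -sumrN; apply: eq_bigr => i _; ring.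
  have -> : dotr (xi + h) w + c = u + v by rewrite dotrDl /u /v; ring.
  rewrite (_ : _ - _ = (cos (u + v) - cos u + v * sin u) * gs w); last by ring.
  rewrite normrM (ger0_norm g0) /H mul0r expR0 mulr1 mulrA [leRHS]mulrA ler_wpM2r//.
  apply: (le_trans (trg_taylor _ _)).
  have -> : `|h| ^+ 2 * (2 * (1 + expR 1) * n%:R ^+ 2 * (1 + enorm w) ^+ 2) =
    2 * (1 + expR 1) * (n%:R * `|h| * (1 + enorm w)) ^+ 2 by ring.
  rewrite ler_wpM2l ?mulr_ge0 ?addr_ge0 ?expR_ge0// -[v ^+ 2]real_normK ?num_real// lerXn2r ?nnegrE ?mulr_ge0 ?addr_ge0 ?enorm_ge0//.
  apply: (le_trans (dotr_le _ _)); apply: ler_pM; rewrite ?enorm_ge0 ?lerDr//.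
  by apply: (le_trans (enorm_le_norm _)).
split=> [|i]; first exact: D.
by rewrite (E i); exact: (IRN (LR_gauss_sin c xi i)).
Qed.

(* Translation invariance, differentiated in the translation: an integration by parts. *)
Lemma gauss_cos_parts c xi i :
  2 * IR (fun w => w 0 i * sin (dotr xi w + c) * gs w) = xi 0 i * gauss_cos c xi.
Proof.
(* A quarter turn of the phase writes the sine as a cosine, so that one family of integrals serves
   for both. *)
set c' := c - pi / 2; pose E := enorm xi; have E0 : 0 <= E := enorm_ge0 _.
have cU w : cos (dotr xi w + c') = sin (dotr xi w + c).
  by rewrite /c' addrA cosB cos_pihalf sin_pihalf; ring.
have sU w : sin (dotr xi w + c') = - cos (dotr xi w + c).
  by rewrite /c' addrA sinB cos_pihalf sin_pihalf; ring.
(* The translate by [h] of the cosine times the Gaussian, multiplied by e^(|h|^2) to clear the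
   quadratic term. Its integral is e^(|h|^2) times a constant, with zero gradient at h = 0;
   differentiating the integrand instead gives the identity. *)
pose F h w := cos (dotr xi w + c' + dotr xi h) * expR (- 2 * dotr h w) * gs w.
have FE h : F h = fun w => expR (sqn h) * (cos (dotr xi (w + h) + c') * gs (w + h)).
  apply/funext => w; rewrite /F dotrDr.
  have -> : gs (w + h) = expR (- 2 * dotr h w) * gs w * expR (- sqn h).
    by rewrite /gs sqnD -!expRD dotrC; congr expR; ring.
  have -> : dotr xi w + dotr xi h + c' = dotr xi w + c' + dotr xi h by ring.
  have e : expR (sqn h) * expR (- sqn h) = 1 by rewrite -expRD subrr expR0.
  move: e (cos _) (expR (-2 * _)) (gs w) => e a b g.
  have -> : expR (sqn h) * (a * (b * g * expR (- sqn h))) = expR (sqn h) * expR (- sqn h) * (a * b * g) by ring.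
  by rewrite e mul1r.
have LRF h : LR (F h) by rewrite FE; exact: LRZ (LR_shift h (LR_gauss_cos c' xi)).
have IRF h : IR (F h) = expR (sqn h) * gauss_cos c' xi.
  by rewrite FE (IRZ _ (LR_shift h (LR_gauss_cos c' xi))) (IR_shift h (LR_gauss_cos c' xi)).
have hc := LR_gauss_cos c xi; have hi j := LR_gauss_sin c xi j.
pose k (t : n.-tuple R) h := F h (rV_of_tuple t).
pose q (w : V) j := xi 0 j * (cos (dotr xi w + c) * gs w) - 2 * (w 0 j * sin (dotr xi w + c) * gs w).
have LRq j : LR (q^~ j) by apply: LRB; apply: LRZ.
pose K : R := 2 * (1 + expR 1); have K0 : 0 <= K by rewrite mulr_ge0 ?addr_ge0 ?expR_ge0.
pose Q := n%:R ^+ 2 * (K * E ^+ 2 + 4 + 2 * K * E).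
pose H w := Q * ((1 + enorm w) ^+ 2 * expR (2 * n%:R * enorm w) * gs w).
have hH : LR H by apply: LRZ; apply: LR_gs_exp; rewrite mulr_ge0.
have [||||D D'] := @diff_under_Int R n _ _ (leb_tuple R n) k (fun t => q (rV_of_tuple t)) (fun t => H (rV_of_tuple t)) 0 1 ltr01.
- by move=> h _; exact: LRF.
- by move=> j; exact: LRq.
- exact: hH.
- move=> t h h1; rewrite /k add0r; set w := rV_of_tuple t; have /andP[g0 _] := gs_le1 w.
  set u := dotr xi w + c'; set a := dotr xi h; set b := - 2 * dotr h w.
  have F0 : F 0 w = cos u * gs w.
    have z1 (y : V) : dotr 0 y = 0 by rewrite -(scale0r y) dotrZl mul0r.
    have z2 : dotr xi 0 = 0 by rewrite dotrC.
    by rewrite /F z1 z2 mulr0 expR0 addr0 mulr1.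
  have -> : lincomb (q w) h = (b * cos u - a * sin u) * gs w.
    rewrite /u cU sU /a /b /lincomb /dotr !mulr_sumr !mulr_suml -sumrB mulr_suml.
    by apply: eq_bigr => j _; rewrite /q; ring.
  have -> : F h w = cos (u + a) * expR b * gs w by [].
  rewrite F0 (_ : _ - _ = ((cos (u + a) - cos u + a * sin u) + cos (u + a) * (expR b - 1 - b) +
    b * (cos (u + a) - cos u)) * gs w); last by ring.
  have t0 : 0 <= enorm w := enorm_ge0 w.
  have -> : `|h| ^+ 2 * H w = `|h| ^+ 2 * Q * (1 + enorm w) ^+ 2 * expR (2 * n%:R * enorm w) * gs w.
    by rewrite /H; ring.
  rewrite normrM (ger0_norm g0) ler_wpM2r//.
  have aE : `|a| <= n%:R * `|h| * E.
    by apply: (le_trans (dotr_le _ _)); rewrite mulrC ler_wpM2r// enorm_le_norm.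
  have bE : `|b| <= 2 * (n%:R * `|h| * enorm w).
    rewrite /b normrM normrN normr_nat ler_wpM2l//; apply: (le_trans (dotr_le _ _)).
    by rewrite ler_wpM2r// enorm_le_norm.
  have bX : expR `|b| <= expR (2 * n%:R * enorm w).
    rewrite ler_expR; apply: (le_trans bE); rewrite mulrA ler_wpM2r// ler_wpM2l//.
    by rewrite ler_piMr// ltW.
  have X1 : 1 <= expR (2 * n%:R * enorm w) by rewrite -[leLHS]expR0 ler_expR !mulr_ge0.
  set X := expR (2 * n%:R * enorm w) in bX X1 *; set T := 1 + enorm w; set m := n%:R * `|h| in aE bE.
  have T1 : 1 <= T by rewrite lerDl.
  have m0 : 0 <= m by rewrite mulr_ge0.
  have tT : enorm w <= T by rewrite lerDr.
  have r1 : `|cos (u + a) - cos u + a * sin u| <= K * (m * E) ^+ 2.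
    apply: (le_trans (trg_taylor _ _)); rewrite ler_wpM2l// -[a ^+ 2]real_normK ?num_real//.
    by rewrite lerXn2r ?nnegrE ?mulr_ge0.
  have b2 : `|b| <= 2 * (m * T) by apply: (le_trans bE); rewrite !ler_wpM2l.
  have r2 : `|cos (u + a) * (expR b - 1 - b)| <= (2 * (m * T)) ^+ 2 * X.
    rewrite normrM -[leRHS]mul1r; apply: ler_pM => //; first exact: cos_max.
    apply: (le_trans (exp_taylor b)); apply: ler_pM; rewrite ?sqr_ge0 ?expR_ge0//.
    by rewrite -[b ^+ 2]real_normK ?num_real// lerXn2r ?nnegrE ?mulr_ge0 ?(le_trans _ T1).
  have r3 : `|b * (cos (u + a) - cos u)| <= 2 * (m * T) * (K * (m * E)).
    rewrite normrM; apply: ler_pM => //.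
    by apply: (le_trans (trg_lip _ _)); rewrite ler_wpM2l.
  apply: (@le_trans _ _ (K * (m * E) ^+ 2 + (2 * (m * T)) ^+ 2 * X + 2 * (m * T) * (K * (m * E)))).
    by apply: (le_trans (ler_normD _ _)); apply: lerD => //; apply: (le_trans (ler_normD _ _)); apply: lerD.
  have -> : `|h| ^+ 2 * Q * T ^+ 2 * X = K * (m * E) ^+ 2 * (T ^+ 2 * X) + (2 * (m * T)) ^+ 2 * X +
     2 * (m * T) * (K * (m * E)) * (T * X) by rewrite /Q /m; ring.
  have TX : 1 <= T * X by rewrite -[leLHS]mulr1 ler_pM.
  have T2X : 1 <= T ^+ 2 * X by rewrite -[leLHS]mulr1 ler_pM// exprn_ege1.
  have T0 : 0 <= T := le_trans ler01 T1.
  by apply: lerD; [apply: lerD => //|]; rewrite ler_peMr// !mulr_ge0// ?exprn_ge0 ?mulr_ge0.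
have [dn en] := diff_sqn (0 : V).
have [de ee] := rpartial_comp dn (is_derive_expR (sqn (0 : V))).
have := D' i; have -> : (fun h => Int (leb_tuple R n) (k^~ h)) = fun h => expR (sqn h) * gauss_cos c' xi.
  by apply/funext => h; exact: IRF.
rewrite rpartialM//; rewrite ee en mxE rpartial_cst !mulr0 addr0 => e.
have : IR (q^~ i) = 0 by rewrite [RHS]e.
rewrite IRB; [|exact: LRZ|exact: LRZ].
by rewrite !IRZ// => /eqP; rewrite subr_eq0 => /eqP ->.
Qed.

(** By [gauss_cos_parts] the product with e^(|xi|^2 / 4) has zero gradient, so it equals its value
    at xi = 0. *)
Lemma gauss_transform c xi : gauss_cos c xi = expR (- (sqn xi / 4)) * (cos c * IR (@gs R n)).
Proof.
pose H z := gauss_cos c z * expR (4^-1 * sqn z).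
have dE z : differentiable (fun w : V => expR (4^-1 * sqn w)) z /\
    forall i, rpartial i (fun w : V => expR (4^-1 * sqn w)) z = expR (4^-1 * sqn z) * (z 0 i / 2).
  have [dn en] := diff_sqn z.
  have d4 : differentiable (fun w : V => 4^-1 * sqn w) z by apply: differentiableM.
  have [de ee] := rpartial_comp d4 (is_derive_expR (4^-1 * sqn z)).
  split=> // i; rewrite ee rpartialZ// en; by congr (_ * _); field.
have dH z : differentiable H z.
  by apply: differentiableM; [exact: (gauss_cos_diff c z).1|exact: (dE z).1].
have H0 i z : rpartial i H z = 0.
  rewrite rpartialM; [|exact: (gauss_cos_diff c z).1|exact: (dE z).1].
  rewrite (gauss_cos_diff c z).2 (dE z).2; have := gauss_cos_parts c z i.
  set J := IR _ => e; have -> : J = z 0 i * gauss_cos c z / 2 by rewrite -e; field.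
  by field.
have : `|H (0 + xi) - H 0| <= n%:R * 0 * `|xi|.
  by apply: lip_line => // i t _; rewrite H0 normr0.
rewrite mulr0 mul0r normr_le0 subr_eq0 add0r => /eqP e.
have s0 : sqn (0 : V) = 0 by rewrite -sqr_enorm enorm0 expr0n.
have : H 0 = cos c * IR (@gs R n).
  rewrite /H s0 mulr0 expR0 mulr1 /gauss_cos -IRZ; last exact: (@LR_gs R n).1.
  by congr IR; apply/funext => w; rewrite (_ : dotr 0 w = 0) ?add0r// /dotr big1// => j _; rewrite mxE mul0r.
rewrite -e => <-; rewrite /H mulrCA -expRD (_ : - _ + _ = 0) ?expR0 ?mulr1//; ring.
Qed.
End gaussian_transform.

(** * Trigonometric polynomials with prescribed frequencies *)

Section trigonometric_polynomials.
Variables (R : realType) (d : nat).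
Local Notation V := 'rV[R]_d.
Implicit Types (f g : V -> R) (x xi : V) (l : seq (R * V * R)).

Definition wave (p : R * V * R) x := p.1.1 * cos (dotr p.1.2 x + p.2).

(** Finite cosine sums with frequencies in [Q] and coefficients of total mass at most 1. Mass and
    frequency range are both stable under products, and every bound derived from them is independent
    of the number of terms, hence passes to limits. *)
Definition trigp (Q : V -> Prop) f := exists l,
  [/\ forall p, p \in l -> Q p.1.2, \sum_(p <- l) `|p.1.1| <= 1 &
      f = fun x => \sum_(p <- l) wave p x].

Lemma trigpM (Q1 Q2 Q : V -> Prop) f g :
  (forall xi eta, Q1 xi -> Q2 eta -> Q (xi + eta) /\ Q (xi - eta)) ->
  trigp Q1 f -> trigp Q2 g -> trigp Q (fun x => f x * g x).
Proof.
move=> QQ [l1 [q1 s1 ->]] [l2 [q2 s2 ->]].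
pose P (p q : R * V * R) := (p.1.1 * q.1.1 / 2, p.1.2 + q.1.2, p.2 + q.2).
pose M (p q : R * V * R) := (p.1.1 * q.1.1 / 2, p.1.2 - q.1.2, p.2 - q.2).
exists ([seq P p q | p <- l1, q <- l2] ++ [seq M p q | p <- l1, q <- l2]); split.
- by move=> r; rewrite mem_cat => /orP[] /allpairsP[[p q] /= [h1 h2 ->]]; have [] := QQ _ _ (q1 _ h1) (q2 _ h2).
- rewrite big_cat/= !big_allpairs_dep/= -big_split/=.
  apply: (@le_trans _ _ ((\sum_(p <- l1) `|p.1.1|) * (\sum_(q <- l2) `|q.1.1|))).
    rewrite mulr_suml; apply: ler_sum => p _; rewrite -big_split mulr_sumr; apply: ler_sum => q _.
    have h : `|p.1.1 * q.1.1 / 2| + `|p.1.1 * q.1.1 / 2| <= `|p.1.1| * `|q.1.1|.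
      by rewrite 2!normrM (ger0_norm (_ : 0 <= 2^-1)) ?invr_ge0//; lra.
    exact: h.
  by rewrite -[leRHS]mulr1; apply: ler_pM => //; apply: sumr_ge0.
- apply/funext => x; rewrite big_cat/= !big_allpairs_dep/= -big_split/= mulr_suml.
  apply: eq_bigr => p _; rewrite -big_split mulr_sumr; apply: eq_bigr => q _.
  rewrite /wave/= !dotrDl -scaleN1r dotrZl mulN1r.
  have -> : dotr p.1.2 x + dotr q.1.2 x + (p.2 + q.2) = (dotr p.1.2 x + p.2) + (dotr q.1.2 x + q.2) by ring.
  have -> : dotr p.1.2 x - dotr q.1.2 x + (p.2 - q.2) = (dotr p.1.2 x + p.2) - (dotr q.1.2 x + q.2) by ring.
  by move: (dotr _ _ + _) (dotr _ _ + _) => u v; rewrite cosD cosB; field.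
Qed.

Lemma trigp1 (Q : V -> Prop) : Q 0 -> trigp Q (fun=> 1).
Proof.
move=> Q0; exists [:: (1, 0, 0)]; split.
- by move=> p; rewrite inE => /eqP ->.
- by rewrite big_seq1/= normr1.
- apply/funext => x; rewrite big_seq1 /wave/= -(scale0r x) dotrZl mul0r addr0 cos0 mulr1//.
Qed.

Lemma trigp_cos xi : trigp (fun eta => eta = xi) (fun x => cos (dotr xi x)).
Proof.
exists [:: (1, xi, 0)]; split.
- by move=> p; rewrite inE => /eqP ->.
- by rewrite big_seq1/= normr1.
- by apply/funext => x; rewrite big_seq1 /wave/= addr0 mul1r.
Qed.

Definition band (r : R) xi := `|xi| <= r.

Lemma trigp_half (b : R) i : 0 <= b -> trigp (band b) (fun x => (1 + cos (b * x 0 i)) / 2).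
Proof.
move=> b0; exists [:: (2^-1, 0, 0); (2^-1, b *: delta_mx 0 i, 0)]; split.
- move=> p; rewrite !inE => /orP[] /eqP ->; rewrite /band/= ?normr0// normrZ ger0_norm//.
  rewrite ler_piMr// /Num.norm/= mx_normrE; apply: bigmax_le => // -[j k] _ /=.
  by rewrite mxE; case: (_ && _); rewrite ?normr1 ?normr0.
- by rewrite !big_cons big_nil/= addr0 ger0_norm ?invr_ge0//; lra.
- apply/funext => x; rewrite !big_cons big_nil /wave/= !addr0 dotrZl.
  have -> : dotr (delta_mx 0 i) x = x 0 i.
    by rewrite /dotr (bigD1 i)//= big1 ?mxE ?eqxx ?mul1r ?addr0// => j ji; rewrite mxE (negbTE ji) andbF mul0r.
  by rewrite -(scale0r x) dotrZl mul0r cos0; field.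
Qed.

Lemma trigp_prod I (s : seq I) (r : I -> R) (F : I -> V -> R) :
  (forall i, trigp (band (r i)) (F i)) -> trigp (band (\sum_(i <- s) r i)) (fun x => \prod_(i <- s) F i x).
Proof.
move=> hF; elim: s => [|i s ih].
  rewrite (_ : (fun _ => _) = fun=> 1); first by apply: trigp1; rewrite /band big_nil normr0.
  by apply/funext => x; rewrite big_nil.
rewrite big_cons (_ : (fun _ => _) = fun x => F i x * \prod_(j <- s) F j x); last first.
  by apply/funext => x; rewrite big_cons.
apply: trigpM (hF i) ih => xi eta h1 h2; rewrite /band; split.
  by apply: (le_trans (ler_normD _ _)); exact: lerD.
by apply: (le_trans (ler_normB _ _)); exact: lerD.
Qed.

Lemma wave_diff p x : differentiable (wave p) x /\
  forall i, rpartial i (wave p) x = wave (p.1.1 * p.1.2 0 i, p.1.2, p.2 + pi / 2) x.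
Proof.
pose K : R := 2 * (1 + expR 1).
have K0 : 0 <= K by rewrite mulr_ge0 ?addr_ge0 ?expR_ge0.
apply: (@diff_quad _ _ _ _ _ 1 (`|p.1.1| * (K * (enorm p.1.2 * d%:R) ^+ 2)) ltr01) => h _.
set u := dotr p.1.2 x + p.2; set v := dotr p.1.2 h.
have -> : lincomb (fun i => wave (p.1.1 * p.1.2 0 i, p.1.2, p.2 + pi / 2) x) h = - p.1.1 * (v * sin u).
  rewrite /v /lincomb /dotr mulr_suml mulr_sumr; apply: eq_bigr => i _.
  by rewrite /wave/= addrA -/u cosD cos_pihalf sin_pihalf; ring.
have -> : wave p (x + h) - wave p x - - p.1.1 * (v * sin u) = p.1.1 * (cos (u + v) - cos u + v * sin u).
  by rewrite /wave dotrDr (_ : dotr _ x + dotr _ h + _ = u + v); rewrite /u /v; ring.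
rewrite normrM -mulrA ler_wpM2l//; apply: (le_trans (trg_taylor _ _)); rewrite -/K -mulrA ler_wpM2l//.
rewrite -exprMn -[v ^+ 2]real_normK ?num_real// lerXn2r ?nnegrE ?mulr_ge0 ?enorm_ge0//.
by apply: (le_trans (dotr_le _ _)); rewrite -mulrA ler_wpM2l ?enorm_ge0// enorm_le_norm.
Qed.

Lemma wave_smooth p : rsmooth setT (wave p).
Proof.
pose P f := exists p, f = wave p.
apply: (@rsmooth_closed R d setT P openT); last by exists p.
  by move=> f [q ->] x _; exact: (wave_diff q x).1.
move=> f i [q ->]; exists (wave (q.1.1 * q.1.2 0 i, q.1.2, q.2 + pi / 2)); first by eexists.
by move=> x _; rewrite (wave_diff q x).2.
Qed.

Lemma rpartials_wave s p : exists c, rpartials s (wave p) = wave (p.1.1 * \prod_(i <- s) p.1.2 0 i, p.1.2, c).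
Proof.
elim: s => [|i s [c ih]] /=; first by exists p.2; rewrite big_nil mulr1 -!surjective_pairing.
exists (c + pi / 2); rewrite ih; apply/funext => x; rewrite (wave_diff _ x).2/= big_cons.
by rewrite -mulrA [_ * p.1.2 0 i]mulrC.
Qed.

(** The upper bound on the frequencies controls all derivatives; the lower bound, away from
    frequency 0, gives the decay of Gaussian averages. *)
Definition shell xi := forall i, 1 <= xi 0 i <= 2.

Lemma trigp_derivatives f s x : trigp shell f -> rsmooth setT f /\ `|rpartials s f x| <= 2 ^+ size s.
Proof.
move=> [l [ql sl ->]]; split; first by apply: rsmooth_sum => [|p]; [exact: openT|exact: wave_smooth].
rewrite rpartials_sum; last by move=> p; exact: wave_smooth.
apply: (le_trans (ler_norm_sum _ _ _)).
apply: (@le_trans _ _ ((\sum_(p <- l) `|p.1.1|) * 2 ^+ size s)); last by rewrite ler_piMl ?exprn_ge0.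
rewrite mulr_suml big_seq [leRHS]big_seq; apply: ler_sum => p /ql hp.
have [c ->] := rpartials_wave s p; rewrite /wave/= !normrM -mulrA ler_wpM2l//.
rewrite -[leRHS]mulr1; apply: ler_pM => //; last exact: cos_max.
elim: s => [|i s ih]; first by rewrite big_nil normr1.
rewrite big_cons normrM exprS; apply: ler_pM => //.
by have /andP[a b] := hp i; rewrite ger0_norm//; lra.
Qed.

(** Averaging against a Gaussian of width t multiplies frequency xi by e^(-t^2 |xi|^2 / 4), and |xi|
    >= 1 on the shell. *)
Lemma trigp_heat f x (t : R) : (0 < d)%N -> trigp shell f ->
  LR (fun z => f (x + t *: z) * gs z) /\
  `|IR (fun z => f (x + t *: z) * gs z)| <= expR (- (t ^+ 2 / 4)) * IR (@gs R d).
Proof.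
move=> d0 [l [ql sl ->]].
pose c (p : R * V * R) := dotr p.1.2 x + p.2.
have E : (fun z => (\sum_(p <- l) wave p (x + t *: z)) * gs z) =
    fun z => \sum_(p <- l) p.1.1 * (cos (dotr (t *: p.1.2) z + c p) * gs z).
  apply/funext => z; rewrite mulr_suml; apply: eq_bigr => p _; rewrite /wave /c dotrDr dotrZr dotrZl -mulrA.
  by congr (_ * (cos _ * _)); ring.
have h p : LR (fun z => p.1.1 * (cos (dotr (t *: p.1.2) z + c p) * gs z)).
  by apply: LRZ; exact: LR_gauss_cos.
have [hg g0] := @LR_gs R d.
rewrite E; split; first by apply: L1_sum => p _; exact: h.
rewrite /IR Int_sum; last by move=> p _; exact: h.
apply: (le_trans (ler_norm_sum _ _ _)).
apply: (@le_trans _ _ ((\sum_(p <- l) `|p.1.1|) * (expR (- (t ^+ 2 / 4)) * IR (@gs R d)))); last first.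
  by rewrite ler_piMl// mulr_ge0 ?expR_ge0// ltW.
rewrite mulr_suml big_seq [leRHS]big_seq; apply: ler_sum => p /ql hp.
have -> : Int (leb_tuple R d) (fun u => p.1.1 * (cos (dotr (t *: p.1.2) (rV_of_tuple u) + c p) * gs (rV_of_tuple u))) =
    p.1.1 * gauss_cos (c p) (t *: p.1.2) by exact: (IRZ _ (LR_gauss_cos (c p) (t *: p.1.2))).
rewrite gauss_transform normrM ler_wpM2l// normrM (ger0_norm (expR_ge0 _)); apply: ler_pM; rewrite ?expR_ge0//.
  rewrite ler_expR lerN2 ler_wpM2r// -[sqn _]sqr_enorm enormZ exprMn real_normK ?num_real//.
  rewrite ler_peMr ?sqr_ge0// sqr_enorm /sqn (bigD1 (Ordinal d0))//=.
  have /andP[a b] := hp (Ordinal d0); rewrite -[leLHS]addr0; apply: lerD; first exact: exprn_ege1.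
  by apply: sumr_ge0 => i _; exact: sqr_ge0.
by rewrite normrM (ger0_norm (ltW g0)) ler_piMl ?cos_max// ltW.
Qed.
End trigonometric_polynomials.

(** * An infinite product with stretched exponential decay *)

Section bump.
Variables (R : realType) (d : nat) (rho : R).
Hypothesis d0 : (0 < d)%N.
Hypothesis hrho : 0 < rho < 1.
Local Notation V := 'rV[R]_d.
Implicit Types (x z : V).

(** About 2^(m rho) copies of the factor of scale 2^m. For |x| of order 2^m that factor is below a
    fixed r < 1, so the product is at most r^(|x|^rho) up to constants, while the total frequency,
    the sum of 2^(m rho) 2^-m, converges because rho < 1. Here [rho] is the order of decay; the
    interpolation uses the order called [tau]. *)
Definition multiplicity m : nat := (Num.truncn ((2 ^+ m : R) `^ rho)).+1.
Definition total_freq : R := 2 / (1 - 2 `^ (rho - 1)).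
(** Normalises the total frequency of [damp] to at most 1/2; shifted by the carrier frequency 3/2 it
    lies in [1, 2] in each coordinate. *)
Definition base_freq : R := (2 * d%:R * total_freq)^-1.
Definition half_cos m x (i : 'I_d) : R := (1 + cos (base_freq / 2 ^+ m * x 0 i)) / 2.
Definition damp n x : R := \prod_(m < n) \prod_i \prod_(k < multiplicity m) half_cos m x i.
Definition carrier x := cos (dotr (const_mx (3 / 2)) x).
Definition bump x := carrier x * limn (damp^~ x).

Let q1 : 2 `^ (rho - 1) < 1 :> R.
Proof.
have [_ r1] := andP hrho; rewrite -[ltRHS](powRr0 2) /powR !(negbTE (lt0r_neq0 _))//.
by rewrite ltr_expR ltr_pM2r ?ln_gt0 ?ltr1n// subr_lt0.
Qed.

Lemma total_freq_gt0 : 0 < total_freq. Proof. by rewrite divr_gt0// subr_gt0. Qed.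
Lemma base_freq_gt0 : 0 < base_freq.
Proof. by rewrite invr_gt0 mulr_gt0 ?total_freq_gt0// mulr_gt0// ltr0n. Qed.

Lemma multiplicity_bounds m :
  (2 ^+ m : R) `^ rho <= (multiplicity m)%:R <= 2 * (2 ^+ m : R) `^ rho.
Proof.
have [r0 _] := andP hrho; set t := (2 ^+ m : R) `^ rho.
have t1 : 1 <= t.
  have p1 : 1 `^ rho = 1 :> R by rewrite powR1.
  rewrite /t -[leLHS]p1; apply: ge0_ler_powR; rewrite ?nnegrE ?exprn_ge0 ?(ltW r0)//.
  by apply: exprn_ege1; rewrite ler1n.
rewrite /multiplicity -/t ltW ?truncnS_gt//= -addn1 natrD mulr_natl mulr2n; apply: lerD => //.
by have /andP[] := truncn_itv (le_trans ler01 t1).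
Qed.

Lemma half_cos01 m x i : 0 <= half_cos m x i <= 1.
Proof.
have := cos_max (base_freq / 2 ^+ m * x 0 i); rewrite ler_norml => /andP[a b].
by rewrite /half_cos; lra.
Qed.

Let prod01 I (s : seq I) (F : I -> R) : (forall i, 0 <= F i <= 1) -> 0 <= \prod_(i <- s) F i <= 1.
Proof.
move=> h; elim: s => [|i s /andP[a b]]; first by rewrite big_nil ler01 lexx.
by have /andP[u v] := h i; rewrite big_cons mulr_ge0//= mulr_ile1.
Qed.

Lemma damp01 n x : 0 <= damp n x <= 1.
Proof. by do 3!(apply: prod01 => ?); exact: half_cos01. Qed.

Lemma damp_trigp n : trigp (band 2^-1) (damp n).
Proof.
have b0 := base_freq_gt0; have S0 := total_freq_gt0; have dn : 0 < d%:R :> R by rewrite ltr0n.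
have h m : trigp (band (\sum_(i < d) \sum_(k < multiplicity m) base_freq / 2 ^+ m))
   (fun x => \prod_i \prod_(k < multiplicity m) half_cos m x i).
  do 2!(apply: trigp_prod => ?); apply: trigp_half.
  by rewrite divr_ge0 ?(ltW b0)// exprn_ge0.
have := trigp_prod (index_enum 'I_n) (fun m : 'I_n => h m).
move=> [l [ql sl E]]; exists l; split=> // p /ql; rewrite /band => /le_trans; apply.
apply: (@le_trans _ _ (\sum_(m < n) d%:R * base_freq * 2 * (2 `^ (rho - 1)) ^+ m)).
  apply: ler_sum => m _; rewrite !sumr_const !card_ord -[leLHS]mulr_natr -[_ *+ multiplicity m]mulr_natr.
  have /andP[_ N2] := multiplicity_bounds m.
  have k0 : 0 < 2 ^+ m :> R by rewrite exprn_gt0.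
  apply: (@le_trans _ _ (base_freq / 2 ^+ m * (2 * (2 ^+ m : R) `^ rho) * d%:R)).
    by rewrite ler_wpM2r// ler_wpM2l// divr_ge0 ?(ltW b0)// ltW.
  rewrite powRD'// powRN powRr1// exprMn -powR_exprn// exprVn.
  rewrite le_eqVlt; apply/orP; left; apply/eqP; field; exact: lt0r_neq0.
rewrite -mulr_sumr; have g := @geometric_le R (2 `^ (rho - 1)) n (powR_ge0 _ _) q1.
apply: (@le_trans _ _ (d%:R * base_freq * 2 * (1 - 2 `^ (rho - 1))^-1)).
  by rewrite ler_wpM2l// !mulr_ge0 ?(ltW b0).
have q0 : 1 - 2 `^ (rho - 1) != 0 :> R by rewrite gt_eqF// subr_gt0.
rewrite /base_freq /total_freq le_eqVlt; apply/orP; left; apply/eqP; field.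
by rewrite q0 gt_eqF.
Qed.

Definition bump_approx n x := carrier x * damp n x.

Lemma bump_trigp n : trigp (@shell R d) (bump_approx n).
Proof.
apply: trigpM (trigp_cos (const_mx (3 / 2))) (damp_trigp n) => xi eta -> he.
have hi i : `|eta 0 i| <= 2^-1.
  by apply: le_trans he; rewrite [leRHS]/Num.norm/= mx_normrE; exact: (le_bigmax_cond _ (fun ij : 'I_1 * 'I_d => `|eta ij.1 ij.2|) (j := (0, i))).
by split=> i; have := hi i; rewrite ler_norml !mxE => /andP[a b]; lra.
Qed.

Lemma damp_cvg x : damp n x @[n --> \oo] --> limn (damp^~ x) /\ forall n, 0 <= limn (damp^~ x) <= damp n x.
Proof.
have dec : nonincreasing_seq (damp^~ x).
  apply/nonincreasing_seqP => n; rewrite /damp big_ord_recr/= ler_piMr//.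
    by have /andP[] := damp01 n x.
  by have /andP[] : 0 <= \prod_i \prod_(k < multiplicity n) half_cos n x i <= 1
    by do 2!(apply: prod01 => ?); exact: half_cos01.
have c : cvgn (damp^~ x).
  apply: nonincreasing_is_cvgn => //; exists 0 => _ [n _ <-].
  by have /andP[] := damp01 n x.
split=> // n; rewrite nonincreasing_cvgn_ge// andbT.
by apply: limr_ge => //; apply: nearW => k; have /andP[] := damp01 k x.
Qed.

Lemma bump_cvg x : bump_approx n x @[n --> \oo] --> bump x.
Proof. by apply: cvgMl_tmp; exact: (damp_cvg x).1. Qed.

(** All finite products lie in [trigp shell], whose derivative bounds 2^|s| do not depend on the
    number of factors; [smooth_limit] carries them over. *)
Lemma bump_smooth : rsmooth setT bump /\ forall s x, `|rpartials s bump x| <= 2 ^+ size s.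
Proof.
have hs s n x : `|rpartials s (bump_approx n) x| <= 2 ^+ size s by have [] := trigp_derivatives s x (bump_trigp n).
have [] := @smooth_limit R d bump_approx bump.
- by move=> m; have [] := trigp_derivatives [::] 0 (bump_trigp m).
- by move=> s; exists (2 ^+ size s) => m z; exact: hs.
- exact: bump_cvg.
move=> sm lim; split=> // s x; exact: (cvg_norm_le (lim s x)).
Qed.

Lemma bump0 : bump 0 = 1.
Proof.
have d1 n : damp n 0 = 1.
  rewrite /damp big1// => m _; rewrite big1// => i _; rewrite big1// => k _.
  by rewrite /half_cos mxE mulr0 cos0; lra.
rewrite /bump /carrier (_ : damp^~ 0 = fun=> 1); last by apply/funext.
by rewrite lim_cst// mulr1 dotrC -(scale0r (0 : V)) dotrZl mul0r cos0.
Qed.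

Lemma bump_le1 x : `|bump x| <= 1.
Proof. exact: (bump_smooth.2 [::] x). Qed.

Lemma bump_heat x t : LR (fun z => bump (x + t *: z) * gs z) /\
  `|IR (fun z => bump (x + t *: z) * gs z)| <= expR (- (t ^+ 2 / 4)) * IR (@gs R d).
Proof.
have h n := trigp_heat x t d0 (bump_trigp n).
have [L lim] : LR (fun z => bump (x + t *: z) * gs z) /\
    (fun n => IR (fun z => bump_approx n (x + t *: z) * gs z)) @ \oo --> IR (fun z => bump (x + t *: z) * gs z).
  apply: (IR_lim _ _ _ (@LR_gs R d).1).
  - by move=> n; exact: LR_mR (h n).1.
  - by move=> z; apply: cvgMr_tmp; exact: bump_cvg.
  - move=> n z; have /andP[g0 _] := gs_le1 z; rewrite normrM (ger0_norm g0) ler_piMl//.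
    by have [_] := trigp_derivatives [::] (x + t *: z) (bump_trigp n).
by split=> //; apply: (cvg_norm_le lim) => n; exact: (h n).2.
Qed.

(** Only one scale and one coordinate are used, all other factors being at most 1: the coordinate is
    a large one, and the scale is the dyadic [m] that brings its phase into [1, 2], where the factor
    is at most (1 + cos 1)/2. *)
Lemma bump_decay : exists C k : R, [/\ 0 <= C, 0 < k & forall x, `|bump x| <= C * expR (- (k * enorm x `^ rho))].
Proof.
have b0 := base_freq_gt0; have [r0 r1] := andP hrho; have dn : 0 < d%:R :> R by rewrite ltr0n.
pose r : R := (1 + cos 1) / 2.
have c1 : cos 1 < 1 :> R.
  rewrite -[ltRHS]cos0 ltr_cos ?in_itv/= ?lexx ?pi_ge0 ?ler01//.
  by apply: le_trans (pi_ge2 _); rewrite ler1n.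
have rp : 0 < r.
  have : cos 2 < cos 1 :> R.
    by rewrite ltr_cos ?in_itv/= ?ler01 ?ler0n ?pi_ge2 ?ltr1n//=; apply: le_trans (pi_ge2 _); rewrite ler1n.
  by have := cos_max (2 : R); rewrite ler_norml /r => /andP[]; lra.
have rl : r < 1 by rewrite /r; lra.
have l0 : 0 < - ln r by rewrite oppr_gt0 ln_lt0// rp.
pose k := - ln r * (base_freq / (4 * d%:R)) `^ rho.
have k0 : 0 < k by rewrite mulr_gt0// powR_gt0// divr_gt0// mulr_gt0.
(* The constant 1/r covers the points too close to the origin for a dyadic scale: there the
   exponential loses at most a factor [r]. *)
exists (expR (- ln r)), k; split=> [||x]; [exact: expR_ge0|exact: k0|].
(* Otherwise |x|^2 < d (|x|/(2d))^2 = |x|^2/(4d), which is absurd; the factor 2 leaves room to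
   spare. *)
have [i hi] : exists i, enorm x / (2 * d%:R) <= `|x 0 i|.
  apply: contrapT => /forallNP h; have {}h i : `|x 0 i| < enorm x / (2 * d%:R) by rewrite ltNge; exact/negP/h.
  have e0 : 0 < enorm x by have := le_lt_trans (normr_ge0 _) (h (Ordinal d0)); rewrite pmulr_lgt0// invr_gt0 mulr_gt0.
  have : enorm x ^+ 2 <= d%:R * (enorm x / (2 * d%:R)) ^+ 2.
    apply: (@le_trans _ _ (\sum_(j < d) (enorm x / (2 * d%:R)) ^+ 2)); last first.
      by rewrite sumr_const card_ord [leRHS]mulr_natl lexx.
    rewrite sqr_enorm /sqn; apply: ler_sum => j _.
    rewrite -real_normK ?num_real// lerXn2r ?nnegrE ?(ltW (h j))//.
    by rewrite divr_ge0 ?mulr_ge0 ?(ltW e0).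
  rewrite (_ : d%:R * _ = enorm x ^+ 2 / (4 * d%:R)); last by field; exact: lt0r_neq0.
  rewrite ler_pdivlMr ?mulr_gt0//; have d1 : 1 <= d%:R :> R by rewrite ler1n.
  by have := exprn_gt0 2 e0; nra.
set t := `|x 0 i| in hi.
have main n m : (m < n)%N -> `|bump x| <= half_cos m x i ^+ multiplicity m.
  move=> mn; rewrite normrM; have /andP[l00 l1] := (damp_cvg x).2 n.
  rewrite (ger0_norm l00); apply: (@le_trans _ _ (limn (damp^~ x))).
    by rewrite ler_piMl// cos_max.
  apply: (le_trans l1); rewrite /damp (bigD1 (Ordinal mn))//= (bigD1 i)//= prodr_const card_ord.
  have h0 := half_cos01 m x i; rewrite -mulrA ler_piMr ?exprn_ge0//; first by case/andP: h0.
  have p01 (P : pred 'I_n) (F : 'I_n -> R) : (forall i, 0 <= F i <= 1) -> 0 <= \prod_(i | P i) F i <= 1.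
    by move=> hF; rewrite -big_filter; exact: prod01.
  have p02 (P : pred 'I_d) (F : 'I_d -> R) : (forall i, 0 <= F i <= 1) -> 0 <= \prod_(i | P i) F i <= 1.
    by move=> hF; rewrite -big_filter; exact: prod01.
  have /andP[a1 a2] : 0 <= \prod_(i0 < d | i0 != i) \prod_(k0 < multiplicity m) half_cos m x i0 <= 1.
    by apply: p02 => ?; apply: prod01 => ?; exact: half_cos01.
  have /andP[b1 b2] : 0 <= \prod_(i0 < n | i0 != Ordinal mn) \prod_i1 \prod_(k0 < multiplicity i0) half_cos i0 x i1 <= 1.
    by apply: p01 => ?; do 2!(apply: prod01 => ?); exact: half_cos01.
  by rewrite mulr_ile1.
have le1 : (enorm x) `^ rho * (base_freq / (4 * d%:R)) `^ rho = (base_freq * (enorm x / (2 * d%:R)) / 2) `^ rho.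
  rewrite -powRM ?enorm_ge0 ?divr_ge0 ?mulr_ge0 ?(ltW b0)//; congr (_ `^ _).
  by field; exact: lt0r_neq0.
have le2 : (base_freq * (enorm x / (2 * d%:R)) / 2) `^ rho <= (base_freq * t / 2) `^ rho.
  have B0 := ltW b0; have D0 : 0 <= 2 * d%:R :> R by rewrite mulr_ge0.
  have a1 : 0 <= base_freq * (enorm x / (2 * d%:R)) / 2.
    by apply: divr_ge0 => //; apply: mulr_ge0 => //; apply: divr_ge0 => //; exact: enorm_ge0.
  have a2 : base_freq * (enorm x / (2 * d%:R)) / 2 <= base_freq * t / 2.
    by apply: ler_wpM2r => //; exact: ler_wpM2l.
  by apply: ge0_ler_powR; rewrite ?nnegrE ?(ltW r0)//; exact: le_trans a2.
have kx : k * enorm x `^ rho <= - ln r * (base_freq * t / 2) `^ rho.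
  by rewrite /k -mulrA [_ `^ rho * enorm x `^ rho]mulrC le1 ler_pM2l.
rewrite -expRD; have [bt|bt] := leP 1 (base_freq * t); last first.
  apply: (le_trans (bump_le1 x)); rewrite -[leLHS]expR0 ler_expR subr_ge0; apply: (le_trans kx).
  have p1 : 1 `^ rho = 1 :> R by rewrite powR1.
  rewrite -[leRHS]mulr1 ler_pM2l// -[leRHS]p1; apply: ge0_ler_powR; rewrite ?nnegrE ?(ltW r0)//.
    by apply: divr_ge0 => //; exact: mulr_ge0 (ltW b0) (normr_ge0 _).
  lra.
have [m /andP[m1 m2]] := dyadic bt; have p0 : 0 < 2 ^+ m :> R by rewrite exprn_gt0.
apply: (le_trans (main m.+1 m (ltnSn m))).
pose u := base_freq / 2 ^+ m * t.
have u1 : 1 <= u by rewrite /u mulrAC ler_pdivlMr// mul1r.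
have u2 : u <= 2 by rewrite /u mulrAC ler_pdivrMr// -exprS ltW.
have hu : half_cos m x i <= r.
  rewrite /half_cos -cos_norm normrM ger0_norm; last by rewrite divr_ge0 ?(ltW b0)// ltW.
  rewrite -/t -/u /r ler_pM2r ?invr_gt0// lerD2l leNgt ltr_cos -?leNgt//.
    by rewrite in_itv/= (le_trans ler01 u1)/= (le_trans u2)// pi_ge2.
  by rewrite in_itv/= ler01/=; apply: le_trans (pi_ge2 _); rewrite ler1n.
have /andP[h0 _] := half_cos01 m x i.
apply: (@le_trans _ _ (r ^+ multiplicity m)); first by rewrite lerXn2r ?nnegrE// ltW.
rewrite -[r in leLHS]lnK ?posrE// -expRM_natl ler_expR.
have /andP[N1 _] := multiplicity_bounds m.
suff : k * enorm x `^ rho <= - ln r * (multiplicity m)%:R by have := l0; nra.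
apply: (le_trans kx); rewrite ler_pM2l//; apply: le_trans N1.
apply: ge0_ler_powR; rewrite ?nnegrE ?(ltW r0) ?(ltW p0)//; first by apply: divr_ge0 => //; exact: mulr_ge0 (ltW b0) (normr_ge0 _).
by rewrite ler_pdivrMr// -exprSr ltW.
Qed.
End bump.

(* The kernel [|z| ^ (- 2 nu)] is a superposition of Gaussians of all widths [theta];
   an integral over theta > 0 is half of an integral of [enorm t] over the line 'rV_1. *)
Section subordination.
Variables (R : realType) (d : nat) (s : R).
Hypothesis d0 : (0 < d)%N.
Hypothesis hs : 0 < s < 1.
Local Notation V := 'rV[R]_d.
Local Notation L := 'rV[R]_1.
Local Notation nu := (nu d s).
Local Notation p := (1 + 2 * nu).
Implicit Types (t : L) (x z w : V) (f : V -> R).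

Lemma enorm1 t : enorm t = `|t 0 0|.
Proof. by rewrite /enorm big_ord1 sqrtr_sqr. Qed.

Let p0 : 0 < p. Proof. by rewrite addr_gt0// mulr_gt0// nu_gt0. Qed.

(** Weight of the Gaussian of width t at distance r. Integrated over t it is a constant times r^(-2
    nu) by scaling, and it vanishes rapidly as t -> 0 when r > 0, so the integral converges at both
    ends. *)
Definition width_density (r : R) t := enorm t `^ (- p) * expR (- ((enorm t)^-1 * r) ^+ 2).

Lemma mR_width_density r : mR (width_density r).
Proof.
rewrite (_ : width_density r = fun t => enorm t `^ (- p) * expR (- (enorm t `^ (- 1) * r) ^+ 2)); last first.
  by apply/funext => t; rewrite /width_density powR_inv1// enorm_ge0.
apply: (@mR_fun_enorm R 1 (fun u => u `^ (- p) * expR (- (u `^ (- 1) * r) ^+ 2))).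
apply: measurable_funM; first exact: measurable_powR.
apply: (measurableT_comp (f := expR)); first exact: measurable_expR.
apply: measurableT_comp; first exact: oppr_measurable.
by apply: measurable_funX; apply: measurable_funM; [exact: measurable_powR|exact: measurable_cst].
Qed.

Lemma width_density_ge0 r t : 0 <= width_density r t.
Proof. by rewrite mulr_ge0 ?powR_ge0 ?expR_ge0. Qed.

Lemma LR_width_density1 : LR (width_density 1).
Proof.
pose k := (Num.truncn p).+1; have pk : p <= k%:R by rewrite ltW// truncnS_gt.
have [C C0 HC] := @expR_pow R 1 k ltr01.
have p1 : 1%:R < p by have := nu_gt0 d hs; lra.
have h : LR (fun t => (1 + C * expR 1) * wgt 0 (- p) t).
  by apply: LRZ; apply: LR_wgt; lra.
apply: (LR_le (mR_width_density 1) _ h) => t; rewrite ger0_norm ?width_density_ge0// /width_density /wgt mulr1.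
have := enorm_ge0 t; set u := enorm t => u0.
have C1 : 0 <= C * expR 1 by rewrite mulr_ge0 ?expR_ge0 ?(ltW C0).
have [->|un] := eqVneq u 0.
  rewrite [in leLHS]powR0 ?oppr_eq0 ?gt_eqF// mul0r mulr_ge0 ?addr_ge0//.
  by case: ifP => _; exact: powR_ge0.
have up : 0 < u by rewrite lt_neqAle eq_sym un.
case: ltP => u1; last first.
  apply: (@le_trans _ _ (u `^ (- p) * 1)).
    by rewrite ler_wpM2l ?powR_ge0// -[leRHS]expR0 ler_expR oppr_le0 sqr_ge0.
  by rewrite mulrC ler_wpM2r ?powR_ge0// lerDl.
have v1 : 1 <= u^-1 by rewrite invf_ge1// ltW.
have v0 := le_trans ler01 v1.
have -> : u `^ (- p) = u^-1 `^ p by rewrite -(powR_inv1 u0) -powRrM mulN1r.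
rewrite powRr0 mulr1; set v := u^-1 in v1 v0 *.
have h1 : v `^ p <= C * expR (1 * v).
  apply: le_trans (HC v v0); apply: (@le_trans _ _ ((1 + v) `^ p)).
    by apply: ge0_ler_powR; rewrite ?nnegrE ?(ltW p0) ?addr_ge0// lerDr.
  by rewrite -powR_mulrn ?addr_ge0//; apply: ler_powR => //; rewrite lerDl.
apply: (@le_trans _ _ (C * expR (1 * v) * expR (- v ^+ 2))); first by rewrite ler_wpM2r ?expR_ge0.
apply: (@le_trans _ _ (C * expR 1)); last by rewrite lerDr.
by rewrite -mulrA ler_wpM2l ?(ltW C0)// -expRD ler_expR; nra.
Qed.

Lemma width_density_scale r : 0 < r -> LR (width_density r) /\
  IR (width_density r) = r `^ (- (2 * nu)) * IR (width_density 1).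
Proof.
move=> r0; have rn : r != 0 by rewrite gt_eqF.
have rin : r^-1 != 0 by rewrite invr_eq0.
have E : width_density r = fun t => r `^ (- p) * width_density 1 (r^-1 *: t).
  apply/funext => t; rewrite /width_density enormZ ger0_norm ?invr_ge0 ?(ltW r0)// mulr1.
  rewrite powRM ?invr_ge0 ?enorm_ge0 ?(ltW r0)// invfM invrK [r * _]mulrC.
  have k : r `^ (- p) * r^-1 `^ (- p) = 1.
    by rewrite -(powR_inv1 (ltW r0)) -powRrM -powRD'// mulN1r opprK addrC subrr powRr0.
  by rewrite [RHS]mulrA [_ `^ _ * (_ * _)]mulrA k mul1r.
have h := LR_width_density1.
split; first by rewrite E; apply: LRZ; exact: LR_scale.
rewrite E IRZ; last exact: LR_scale.
rewrite IR_scale// ger0_norm ?invr_ge0 ?(ltW r0)// expr1 invrK mulrA; congr (_ * _).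
by rewrite -{2}(powRr1 (ltW r0)) -powRD'//; congr (_ `^ _); ring.
Qed.

Lemma width_const_gt0 : 0 < IR (width_density 1).
Proof.
have [h1 e1] := @LR_boxi R 1 1 ler01; have [h2 e2] := @LR_boxi R 1 2 (ler0n _ 2).
pose c : R := 2 `^ (- p) * expR (- 1); have c0 : 0 < c by rewrite mulr_gt0 ?powR_gt0 ?expR_gt0.
have : IR (fun t : L => c * (boxi 2 t - boxi 1 t)) <= IR (width_density 1).
  apply: le_IR; [by apply: LRZ; exact: LRB|exact: LR_width_density1|move=> t].
  rewrite /boxi !big_ord1 -enorm1; set u := enorm t.
  have u0 : 0 <= u by exact: enorm_ge0.
  have w0 := width_density_ge0 1 t.
  case: (ltP u 2) => u2; case: (ltP u 1) => u1 /=; rewrite ?subrr ?mulr0 ?subr0 ?mulr1//; last first.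
    lra.
  rewrite /c /width_density -/u mulr1; apply: ler_pM; rewrite ?powR_ge0 ?expR_ge0//.
    by apply: powR_anti; [lra|exact: ltW|exact: ltW].
  rewrite ler_expR lerN2 expr_le1 ?invr_ge0// invf_le1//; lra.
apply: lt_le_trans; rewrite IRZ; last exact: LRB.
by rewrite IRB// e1 e2 !expr1 mulr_gt0//; lra.
Qed.

Section heat_bound.
Variables (f : V -> R) (x : V) (B K : R).
Hypothesis mf : mR f.
Hypothesis fB : forall x, `|f x| <= B.
Hypothesis K0 : 0 <= K.
Hypothesis fK : forall z, `|D2 f x z| <= K * enorm z ^+ 2.

Definition heat (u : R) := IR (fun w => D2 f x (u *: w) * gs w).

Let F t z := D2 f x z * (enorm t `^ (- p) * gs ((enorm t)^-1 *: z)).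

Let mD : mR (D2 f x). Proof. exact: mR_D2. Qed.

Let LR_heat u : LR (fun w => D2 f x (u *: w) * gs w).
Proof.
have [hg _] := @LR_gs R d.
apply: (LR_le _ _ (LRZ (4 * B) hg)).
  apply: measurable_funM; last exact: LR_mR.
  apply: (mR_comp _ mD); apply: mcoordZ; [exact: measurable_cst|exact: mcoord_tuple].
move=> w; have /andP[g0 _] := gs_le1 w.
by rewrite normrM (ger0_norm g0) ler_wpM2r//; exact: D2_le.
Qed.

Let gsE u z : gs (u *: z) = expR (- (u * enorm z) ^+ 2).
Proof. by rewrite /gs -sqr_enorm enormZ exprMn real_normK ?num_real// exprMn. Qed.

Let F0 t z : enorm t = 0 -> F t z = 0.
Proof. by move=> e; rewrite /F e powR0 ?mul0r ?mulr0// oppr_eq0 gt_eqF. Qed.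

Let F_inner t : LR (F t) /\ IR (F t) = enorm t `^ (- (1 + 2 * s)) * heat (enorm t).
Proof.
have [s0 s1] := andP hs; have := enorm_ge0 t; rewrite le_eqVlt => /orP[/eqP t0|t0].
  have -> : F t = fun=> 0 by apply/funext => z; exact: F0.
  split; first exact: LR0.
  by rewrite IR0 -t0 powR0 ?mul0r// oppr_eq0 gt_eqF//; lra.
set u := enorm t in t0 *; have un : u^-1 != 0 by rewrite invr_eq0 gt_eqF.
have h := LR_heat u.
have E : F t = fun z => u `^ (- p) * (fun w => D2 f x (u *: w) * gs w) (u^-1 *: z).
  apply/funext => z; rewrite /F -/u scalerA mulfV ?gt_eqF// scale1r; ring.
rewrite E; split; first by apply: LRZ; exact: (LR_scale un h).
rewrite IRZ; last exact: (LR_scale un h).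
rewrite (IR_scale un h) /heat mulrA; congr (_ * _).
rewrite ger0_norm ?invr_ge0 ?(ltW t0)// exprVn invrK -powR_mulrn ?(ltW t0)// -powRD'//.
by congr (_ `^ _); rewrite nu2; ring.
Qed.

Let FE t z : z != 0 -> F t z = D2 f x z * width_density (enorm z) t.
Proof. by move=> _; rewrite /F gsE. Qed.

Let F_outer z : LR (F^~ z) /\
  IR (F^~ z) = IR (width_density 1) * (D2 f x z * enorm z `^ (- (2 * nu))).
Proof.
have [->|z0] := eqVneq z 0.
  have -> : F^~ 0 = fun=> 0 by apply/funext => t; rewrite /F D2_0 mul0r.
  by split; [exact: LR0|rewrite IR0 D2_0 mul0r mulr0].
have ez : 0 < enorm z by rewrite enorm_gt0.
have [h e] := width_density_scale ez.
have -> : F^~ z = fun t => D2 f x z * width_density (enorm z) t by apply/funext => t; exact: FE.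
by split; [exact: LRZ|rewrite IRZ// e; ring].
Qed.

(** Fubini between the width [t] and the point [z]: integrating [t] first restores the kernel of
    [Lop], integrating [z] first leaves Gaussian averages of the second difference. *)
Lemma Lop_subordination : LR (fun t => enorm t `^ (- (1 + 2 * s)) * heat (enorm t)) /\
  IR (width_density 1) * Lop s f x = IR (fun t => enorm t `^ (- (1 + 2 * s)) * heat (enorm t)).
Proof.
have hL := LR_Lop hs fB fK mf; have S0 := width_const_gt0.
have [] := @IR_fubini R 1 d F (fun z => IR (width_density 1) * `|D2 f x z * enorm z `^ (- (2 * nu))|).
- have m1 := @mcoord_fst R 1 d; have m2 := @mcoord_snd R 1 d.
  apply: measurable_funM; first exact: (mR_comp m2 mD).
  apply: measurable_funM; first exact: (mR_comp m1 (mR_powR _)).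
  have mg := LR_mR (@LR_gs R d).1.
  apply: (mR_comp _ mg); apply: mcoordZ; last exact: m2.
  rewrite (_ : (fun _ => _) = fun q : 1.-tuple R * d.-tuple R => enorm (rV_of_tuple q.1) `^ (- 1)).
    exact: (mR_comp m1 (mR_powR _)).
  by apply/funext => q; rewrite powR_inv1// enorm_ge0.
- by move=> t; exact: (F_inner t).1.
- by move=> z; exact: (F_outer z).1.
- move=> z; have [h e] := F_outer z.
  have -> : (fun t => `|F t z|) = fun t => Num.sg (D2 f x z) * F t z.
    apply/funext => t; rewrite normrM normrEsg (ger0_norm (_ : 0 <= enorm t `^ (- p) * _)).
      by rewrite -mulrA.
    by rewrite mulr_ge0 ?powR_ge0//; have /andP[] := gs_le1 ((enorm t)^-1 *: z).
  rewrite IRZ// e normrM (ger0_norm (powR_ge0 _ _)) [in leRHS]normrEsg.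
  by rewrite le_eqVlt; apply/orP; left; apply/eqP; ring.
- by apply: LRZ; exact: LR_norm.
have -> : (fun t => IR (F t)) = fun t => enorm t `^ (- (1 + 2 * s)) * heat (enorm t).
  by apply/funext => t; exact: (F_inner t).2.
have -> : (fun z => IR (F^~ z)) = fun z => IR (width_density 1) * (D2 f x z * enorm z `^ (- (2 * nu))).
  by apply/funext => z; exact: (F_outer z).2.
by move=> h1 _ e; split=> //; rewrite e IRZ.
Qed.

Lemma heat_small u : `|heat u| <= K * IR (fun w : V => enorm w ^+ 2 * gs w) * u ^+ 2.
Proof.
have hg2 : LR (fun w : V => enorm w ^+ 2 * gs w).
  have h := @LR_gs_exp R d 2 0 (lexx 0); apply: (LR_le _ _ h).
    by apply: measurable_funM; [apply: measurable_funX; exact: mR_enorm|exact: LR_mR (@LR_gs R d).1].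
  move=> w; have /andP[g0 _] := gs_le1 w; have w0 := enorm_ge0 w.
  rewrite mul0r expR0 mulr1 ger0_norm ?mulr_ge0 ?exprn_ge0// ler_wpM2r//.
  by rewrite lerXn2r ?nnegrE ?addr_ge0// lerDr.
rewrite mulrAC -IRZ//; apply: norm_IR_le; [exact: LR_heat|exact: LRZ|move=> w].
have /andP[g0 _] := gs_le1 w; rewrite normrM (ger0_norm g0) mulrA ler_wpM2r//.
by apply: (le_trans (fK _)); rewrite enormZ exprMn real_normK ?num_real// mulrA.
Qed.

(** The average [heat u] is of order u^2 for small widths and at most [eps] always; integrating
    u^(-1-2s) min(u^2, eps) gives order eps^(1-s). So decay of Gaussian averages passes to
    [Lop s f], with the loss of a power 1 - s. *)
Lemma Lop_heat_le eps : 0 < eps -> (forall u, 0 < u -> `|heat u| <= eps) ->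
  `|Lop s f x| <= (K * IR (fun w : V => enorm w ^+ 2 * gs w) + 1) *
     IR (wgt (1 - 2 * s) (- (1 + 2 * s)) : L -> R) / IR (width_density 1) * eps `^ (1 - s).
Proof.
move=> e0 hE; have [s0 s1] := andP hs; have S0 := width_const_gt0.
set A := _ + 1; set W := wgt _ _.
have I0 : 0 <= IR (fun w : V => enorm w ^+ 2 * gs w).
  by apply: IR_ge0 => w; have /andP[g0 _] := gs_le1 w; rewrite mulr_ge0 ?exprn_ge0 ?enorm_ge0.
have A1 : 1 <= A by rewrite lerDr mulr_ge0.
have A0 := le_trans ler01 A1.
have hW : LR W by apply: LR_wgt; lra.
(* The width where the two bounds cross; after rescaling by it the integrand is below a multiple of
   a fixed function [wgt]. *)
pose del := eps `^ 2^-1; have del0 : 0 < del by exact: powR_gt0.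
have dn : del^-1 != 0 by rewrite invr_eq0 gt_eqF.
have d2 : del ^+ 2 = eps by rewrite -powR_mulrn ?(ltW del0)// -powRrM mulVf// powRr1// ltW.
have [h1 e1] := Lop_subordination.
have hW' := LR_scale dn hW.
have : `|IR (width_density 1) * Lop s f x| <=
    IR (fun t => A * eps * del `^ (- (1 + 2 * s)) * W (del^-1 *: t)).
  rewrite e1; apply: norm_IR_le => //; first exact: LRZ.
  move=> t; have di : 0 <= del^-1 by rewrite invr_ge0 ltW.
  rewrite normrM (ger0_norm (powR_ge0 _ _)) /W /wgt enormZ (ger0_norm di).
  have := enorm_ge0 t; set u := enorm t; rewrite le_eqVlt => /orP[/eqP <-|u0].
    rewrite powR0 ?mul0r; last by rewrite oppr_eq0 gt_eqF//; lra.
    by rewrite !mulr_ge0 ?powR_ge0 ?(ltW e0)//; case: ifP => _; exact: powR_ge0.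
  pose v := del^-1 * u; have v0 : 0 < v by rewrite mulr_gt0// invr_gt0.
  have uE : u = del * v by rewrite /v mulrA mulfV ?mul1r// gt_eqF.
  have -> : u `^ (- (1 + 2 * s)) = del `^ (- (1 + 2 * s)) * v `^ (- (1 + 2 * s)).
    by rewrite {1}uE powRM// ltW.
  rewrite -/v [A * eps]mulrC.
  have h2 := heat_small u; have h3 := hE _ u0.
  have P0 : 0 <= del `^ (- (1 + 2 * s)) by exact: powR_ge0.
  have Q0 : 0 <= v `^ (- (1 + 2 * s)) by exact: powR_ge0.
  case: ltP => v1.
    have -> : v `^ (1 - 2 * s) = v ^+ 2 * v `^ (- (1 + 2 * s)).
      by rewrite -powR_mulrn ?(ltW v0)// -powRD'//; congr (_ `^ _); ring.
    have h4 : `|heat u| <= eps * A * v ^+ 2.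
      apply: (le_trans h2); rewrite uE exprMn d2 mulrA [_ * eps]mulrC; apply: ler_wpM2r; first exact: sqr_ge0.
      by rewrite ler_wpM2l ?(ltW e0)// lerDl.
    by apply: (le_trans (ler_wpM2l (mulr_ge0 P0 Q0) h4)); rewrite le_eqVlt; apply/orP; left; apply/eqP; ring.
  have h4 : `|heat u| <= eps * A by apply: (le_trans h3); rewrite ler_peMr// ltW.
  by apply: (le_trans (ler_wpM2l (mulr_ge0 P0 Q0) h4)); rewrite le_eqVlt; apply/orP; left; apply/eqP; ring.
have di : 0 <= del^-1 by rewrite invr_ge0 ltW.
rewrite normrM (gtr0_norm S0) IRZ// (IR_scale dn hW) (ger0_norm di) expr1 invrK.
have -> : A * IR W / IR (width_density 1) * eps `^ (1 - s) =
    (A * eps * del `^ (- (1 + 2 * s)) * (del * IR W)) / IR (width_density 1).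
  have -> : eps `^ (1 - s) = eps * del `^ (- (1 + 2 * s)) * del.
    rewrite -[in RHS]d2 -[X in _ * X](powRr1 (ltW del0)) -powR_mulrn ?(ltW del0)// -!powRD'//.
    by rewrite /del -powRrM; congr (_ `^ _); field.
  by ring.
by rewrite ler_pdivlMr// mulrC.
Qed.
End heat_bound.
End subordination.

(** * The bump under the fractional operator *)

Section bump_operator.
Variables (R : realType) (d : nat) (s rho : R).
Hypothesis d0 : (0 < d)%N.
Hypothesis hs : 0 < s < 1.
Hypothesis hrho : 0 < rho < 1.
Local Notation V := 'rV[R]_d.
Local Notation bump := (@bump R d rho).
Local Notation nu := (nu d s).
Implicit Types (x z : V).

Let bump_mR : mR bump.
Proof.
apply: mR_cont => x; apply: differentiable_continuous.
by apply: (bump_smooth d0 hrho).1 [::] x I.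
Qed.

Let bB x : `|bump x| <= 1. Proof. exact: bump_le1. Qed.

Let bK x z : `|D2 bump x z| <= 2 * d%:R ^+ 2 * 4 * enorm z ^+ 2.
Proof.
have [sm hb] := bump_smooth d0 hrho; apply: D2_smooth => // i j y.
by have := hb [:: j; i] y; rewrite /= (_ : 4 = 2 ^+ 2 :> R)// expr2; lra.
Qed.

Lemma powR_le1D (t : R) : 0 <= t -> t `^ rho <= 1 + t.
Proof.
move=> t0; have [r0 r1] := andP hrho; have [t1|t1] := leP 1 t.
  apply: (@le_trans _ _ (t `^ 1)); last by rewrite powRr1// lerDr.
  by apply: ler_powR => //; exact: ltW.
apply: (@le_trans _ _ 1); last by rewrite lerDl.
have <- : 1 `^ rho = 1 :> R by rewrite powR1.
by apply: ge0_ler_powR; rewrite ?nnegrE ?(ltW r0) ?(ltW t1).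
Qed.

(* For [t ^ 2 <= |x|] the Gaussian average sees [bump] near x only; for larger [t]
   the absence of low frequencies wins. *)
Lemma bump_heat_decay : exists C k : R, [/\ 0 < C, 0 < k & forall x t,
  `|IR (fun z => bump (x + t *: z) * gs z)| <= C * expR (- (k * enorm x `^ rho))].
Proof.
have aux (a e : R) : a <= 8^-1 * (1 + e) -> - (8^-1 * e) <= 1 - a by lra.
have [r0 r1] := andP hrho; have [C [k [C0 k0 H]]] := bump_decay d0 hrho.
(* The factor 2^-rho comes from |x + t z| >= |x|/2 in the near region; the rate 1/8 is below those
   of e^(-|x|/4) for large t and e^(-3|x|/16) for the Gaussian tail. *)
pose k' := Num.min (k * 2^-1 `^ rho) 8^-1.
have k'0 : 0 < k' by rewrite lt_min; apply/andP; split; [rewrite mulr_gt0 ?powR_gt0 ?invr_gt0|rewrite invr_gt0].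
have [hg g0] := @LR_gs R d.
have h2 : (2^-1 : R) != 0 by [].
have hg' := LR_scale h2 hg; set I2 := IR (fun z : V => gs (2^-1 *: z)).
have I20 : 0 <= I2 by apply: IR_ge0 => z; have /andP[] := gs_le1 (2^-1 *: z).
have e8 x : expR (- (8^-1 * enorm x)) <= expR 1 * expR (- (k' * enorm x `^ rho)).
  have x0 := enorm_ge0 x; rewrite -expRD ler_expR.
  have h1 := powR_le1D x0; have k8 : k' <= 8^-1 by rewrite ge_min lexx orbT.
  have : k' * enorm x `^ rho <= 8^-1 * (1 + enorm x) by apply: ler_pM => //; [exact: ltW|exact: powR_ge0].
  exact: aux.
exists (expR 1 * IR (@gs R d) + (C + expR 1) * I2), k'; split=> //.
  exact: ltr_pwDl (mulr_gt0 (expR_gt0 1) g0) (mulr_ge0 (addr_ge0 C0 (expR_ge0 1)) I20).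
move=> x t; have [hL hT] := bump_heat d0 hrho x t; have x0 := enorm_ge0 x.
set E := expR (- (k' * _)); have E0 : 0 < E by exact: expR_gt0.
have [tx|tx] := leP (enorm x) (t ^+ 2).
  apply: (le_trans hT); rewrite mulrDl -[leLHS]addr0; apply: lerD; last first.
    by rewrite !mulr_ge0 ?addr_ge0 ?expR_ge0 ?(ltW E0).
  rewrite [leRHS]mulrAC ler_wpM2r ?(ltW g0)//; apply: le_trans (e8 x); rewrite ler_expR; lra.
apply: (@le_trans _ _ (IR (fun z : V => (C + expR 1) * E * gs (2^-1 *: z)))); last first.
  rewrite IRZ// -/I2 [leRHS](_ : _ = expR 1 * IR (@gs R d) * E + (C + expR 1) * E * I2); last by ring.
  rewrite -[leLHS]add0r; apply: lerD; last exact: lexx.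
  exact: mulr_ge0 (mulr_ge0 (expR_ge0 1) (ltW g0)) (ltW E0).
apply: norm_IR_le => //; first exact: LRZ.
move=> z; have /andP[gz _] := gs_le1 z; rewrite normrM (ger0_norm gz).
have z0 := enorm_ge0 z.
have gg : gs z <= gs (2^-1 *: z).
  rewrite /gs ler_expR lerN2 -!sqr_enorm enormZ ger0_norm ?invr_ge0//.
  by rewrite lerXn2r ?nnegrE ?mulr_ge0 ?invr_ge0// ler_piMl// invf_le1// ler1n.
have G0 : 0 <= gs (2^-1 *: z) by have /andP[] := gs_le1 (2^-1 *: z).
have [tz|tz] := leP (enorm (t *: z)) (enorm x / 2).
  apply: ler_pM; [exact: normr_ge0|exact: gz| |exact: gg].
  apply: (le_trans (H _)); rewrite [leRHS]mulrDl -[leLHS]addr0; apply: lerD; last first.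
    by rewrite mulr_ge0 ?expR_ge0 ?(ltW E0).
  apply: (ler_wpM2l C0); rewrite /E ler_expR lerN2.
  have xz : enorm x / 2 <= enorm (x + t *: z).
    have := enormB (x + t *: z) (t *: z); rewrite addrK; lra.
  apply: (@le_trans _ _ (k * (enorm x / 2) `^ rho)).
    rewrite powRM ?invr_ge0// [_ `^ rho * _]mulrC mulrA ler_wpM2r ?powR_ge0//.
    by rewrite ge_min lexx.
  rewrite ler_wpM2l ?(ltW k0)//; apply: ge0_ler_powR; rewrite ?nnegrE ?(ltW r0) ?enorm_ge0 ?divr_ge0//.
have zx : enorm x / 4 <= enorm z ^+ 2.
  have e0 : 0 < enorm x.
    rewrite lt_neqAle x0 andbT eq_sym; apply: contraTneq tx => ->; rewrite -leNgt sqr_ge0//.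
  have : (enorm x / 2) ^+ 2 <= t ^+ 2 * enorm z ^+ 2.
    rewrite -[t ^+ 2]real_normK ?num_real// -exprMn lerXn2r ?nnegrE ?mulr_ge0 ?divr_ge0//.
    by rewrite enormZ in tz; exact: ltW.
  move=> h; have {}h : (enorm x / 2) ^+ 2 <= enorm x * enorm z ^+ 2.
    by apply: (le_trans h); rewrite ler_wpM2r ?sqr_ge0// ltW.
  by rewrite -(ler_pM2l e0); apply: le_trans h; rewrite expr2; lra.
apply: (@le_trans _ _ (1 * gs z)); first by rewrite ler_wpM2r.
rewrite mul1r (_ : gs z = expR (- (3 / 4 * enorm z ^+ 2)) * gs (2^-1 *: z)); last first.
  by rewrite /gs -!sqr_enorm enormZ ger0_norm ?invr_ge0// -expRD; congr expR; field.
apply: ler_wpM2r => //; apply: (@le_trans _ _ (expR 1 * E)); last by rewrite mulrDl lerDr mulr_ge0// ltW.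
by apply: le_trans (e8 x); rewrite ler_expR; lra.
Qed.

(** [Lop_heat_le] with eps = D e^(-k |x|^rho): all Gaussian averages of the second difference are
    that small, and the power 1 - s only lowers the rate. *)
Lemma bump_Lop_decay : exists C k : R, [/\ 0 < C, 0 < k, forall x, `|bump x| <= C * expR (- (k * enorm x `^ rho)) &
  forall x, `|Lop s bump x| <= C * expR (- (k * enorm x `^ rho))].
Proof.
have [s0 s1] := andP hs; have [C1 [k1 [C10 k10 H1]]] := bump_decay d0 hrho.
have [C2 [k2 [C20 k20 H2]]] := bump_heat_decay.
pose k := Num.min k1 k2; have k0 : 0 < k by rewrite lt_min k10.
have [hg g0] := @LR_gs R d.
have ek x k3 : k <= k3 -> expR (- (k3 * enorm x `^ rho)) <= expR (- (k * enorm x `^ rho)).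
  by move=> kk; rewrite ler_expR lerN2 ler_wpM2r ?powR_ge0.
pose D := 2 * C2 + 2 * C1 * IR (@gs R d); have D0 : 0 < D.
  by rewrite ltr_pwDl ?mulr_gt0// !mulr_ge0// ltW.
set A := (2 * d%:R ^+ 2 * 4 * IR (fun w : V => enorm w ^+ 2 * gs w) + 1) *
     IR (wgt (1 - 2 * s) (- (1 + 2 * s)) : 'rV[R]_1 -> R) / IR (width_density d s 1).
have K0 : 0 <= 2 * d%:R ^+ 2 * 4 :> R by rewrite !mulr_ge0 ?exprn_ge0.
have main x : `|Lop s bump x| <= A * D `^ (1 - s) * expR (- ((1 - s) * k * enorm x `^ rho)).
  have p0 : 0 < D * expR (- (k * enorm x `^ rho)) by rewrite mulr_gt0// expR_gt0.
  have := Lop_heat_le hs bump_mR bB K0 (bK x) p0.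
  have -> : (D * expR (- (k * enorm x `^ rho))) `^ (1 - s) =
      D `^ (1 - s) * expR (- ((1 - s) * k * enorm x `^ rho)).
    rewrite powRM ?expR_ge0 ?(ltW D0)//; congr (_ * _).
    by rewrite /powR gt_eqF ?expR_gt0// expRK; congr expR; ring.
  rewrite -/A mulrA; apply=> u u0.
  have [l1 h1] := bump_heat d0 hrho x u; have [l2 h2] := bump_heat d0 hrho x (- u).
  have -> : heat bump x u = IR (fun z => bump (x + u *: z) * gs z) + IR (fun z => bump (x + - u *: z) * gs z)
      - 2 * bump x * IR (@gs R d).
    rewrite -IRD// -(IRZ _ hg) -IRB; [|exact: LRD|exact: LRZ].
    by rewrite /heat; congr IR; apply/funext => z; rewrite /D2 scaleNr; ring.
  have b1 := le_trans (H2 x u) (ler_wpM2l (ltW C20) (ek x k2 _)).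
  have b2 := le_trans (H2 x (- u)) (ler_wpM2l (ltW C20) (ek x k2 _)).
  have b3 := le_trans (H1 x) (ler_wpM2l C10 (ek x k1 _)).
  have kk1 : k <= k1 by rewrite ge_min lexx.
  have kk2 : k <= k2 by rewrite ge_min lexx orbT.
  move: (b1 kk2) (b2 kk2) (b3 kk1); set E := expR _ => c1 c2 c3.
  apply: (le_trans (ler_normB _ _)); rewrite /D [leRHS]mulrDl; apply: lerD.
    apply: (le_trans (ler_normD _ _)); rewrite (_ : 2 * C2 * E = C2 * E + C2 * E); last by ring.
    exact: (lerD c1 c2).
  rewrite normrM (normrM 2 (bump x)) (gtr0_norm g0) normr_nat [leRHS]mulrAC; apply: (ler_wpM2r (ltW g0)).
  by rewrite -[leRHS]mulrA; exact: (ler_wpM2l (ler0n _ 2) c3).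
exists (`|C1| + `|A * D `^ (1 - s)| + 1), ((1 - s) * k); split.
- by rewrite ltr_wpDl// addr_ge0.
- by rewrite mulr_gt0// subr_gt0.
- move=> x; apply: (le_trans (H1 x)); apply: ler_pM; rewrite ?expR_ge0//.
    by have := ler_norm C1; have := normr_ge0 (A * D `^ (1 - s)); lra.
  rewrite ler_expR lerN2 ler_wpM2r ?powR_ge0//.
  have kk1 : k <= k1 by rewrite ge_min lexx.
  nra.
- move=> x; apply: (le_trans (main x)); rewrite ler_wpM2r ?expR_ge0//.
  by have := ler_norm (A * D `^ (1 - s)); have := normr_ge0 C1; lra.
Qed.

(** The bump is largest at 0, so its second difference there is nonpositive, and it is at most -1
    once |z| exceeds [m]. Nonvanishing is what allows the conditions on [Lop] to be normalised. *)
Lemma Lop_bump0 : Lop s bump 0 < 0.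
Proof.
have [r0 r1] := andP hrho; have [C [k [C0 k0 H]]] := bump_decay d0 hrho.
have [m m0 Hm] : exists2 m : R, 0 < m & forall z, m <= enorm z -> `|bump z| <= 2^-1.
  pose X := (2 * C + 1); have X0 : 0 < X by rewrite ltr_wpDl ?mulr_ge0.
  exists ((X / k) `^ rho^-1) => [|z hz]; first by rewrite powR_gt0// divr_gt0.
  apply: (le_trans (H z)); have : X / k <= enorm z `^ rho.
    rewrite -[leLHS](powRr1 (ltW (divr_gt0 X0 k0))) -[1](mulVf (lt0r_neq0 r0)) powRrM.
    by apply: ge0_ler_powR; rewrite ?nnegrE ?(ltW r0) ?powR_ge0 ?enorm_ge0.
  rewrite ler_pdivrMr// mulrC => h.
  rewrite expRN ler_pdivrMr ?expR_gt0//.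
  have := expR_ge1Dx (k * enorm z `^ rho); rewrite /X in h; lra.
have hL := LR_Lop hs bB (bK 0) bump_mR.
have dn : 0 < d%:R :> R by rewrite ltr0n.
have [b1 e1] := @LR_boxi R d m (ltW m0).
have m20 : 0 <= 2 * m by rewrite mulr_ge0// ltW.
have [b2 e2] := @LR_boxi R d (2 * m) m20.
pose c := (d%:R * (2 * m)) `^ (- (2 * nu)); have c0 : 0 < c by rewrite powR_gt0// !mulr_gt0.
rewrite -oppr_gt0 -IRN//; apply: (@lt_le_trans _ _ (IR (fun z : V => c * (boxi (2 * m) z - boxi m z)))).
  rewrite IRZ; last exact: LRB.
  rewrite IRB// e1 e2 mulr_gt0// subr_gt0 ltr_pXn2r ?nnegrE ?mulr_ge0//; lra.
apply: le_IR; [by apply: LRZ; exact: LRB|exact: LRN|move=> z].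
have n2 : 0 <= - (D2 bump 0 z * enorm z `^ (- (2 * nu))).
  rewrite -mulNr mulr_ge0 ?powR_ge0// /D2 bump0// add0r sub0r.
  have := bB z; have := bB (- z); rewrite !ler_norml => /andP[_ u1] /andP[_ u2]; lra.
rewrite !boxiE; case: (forallP (P := fun i => `|z 0 i| < 2 * m)) => [z2|z2]; last first.
  case: forallP => [z1|_]; last by rewrite subr0 mulr0.
  by rewrite sub0r mulrN1; apply: le_trans n2; rewrite oppr_le0 ltW.
case: forallP => z1; first by rewrite subrr mulr0.
rewrite subr0 mulr1 -mulNr.
have zm : m <= enorm z.
  have [i hi] : exists i, m <= `|z 0 i|.
    apply: contrapT => /forallNP h; apply: z1 => i; rewrite ltNge; apply/negP; exact: h.
  exact: le_trans hi (le_coord_enorm _ _).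
have D1 : 1 <= - D2 bump 0 z.
  rewrite /D2 bump0// add0r sub0r; have := Hm z zm; have := Hm (- z); rewrite enormN => /(_ zm).
  by rewrite !ler_norml => /andP[_ u1] /andP[_ u2]; lra.
rewrite -[leLHS]mul1r; apply: ler_pM => //; first exact: ltW.
apply: powR_anti; [exact: lt_le_trans zm| |by rewrite mulr_ge0// ltW// nu_gt0].
apply: (le_trans (enorm_le_norm _)); rewrite ler_pM2l// [leLHS]/Num.norm/= mx_normrE.
by apply: bigmax_le => [|[i0 i] _ /=]; [by []|rewrite ord1 ltW].
Qed.
End bump_operator.

(** * Interpolation *)

Section summation.
Variable R : realType.
Implicit Types (g w : nat -> R).

(** A series as an integral for counting measure, so that linearity and dominated convergence come
    from the integral. *)
Definition csum g : R := Int (@counting nat R) g.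
Definition summable_by C w := (forall j, 0 <= w j) /\ forall N, \sum_(j < N) w j <= C.

Let mnat (g : nat -> R) : measurable_fun setT g. Proof. by move=> _ A _. Qed.

Lemma L1_count C w : summable_by C w -> L1 (@counting nat R) w /\ csum w <= C.
Proof.
move=> [w0 wC]; apply: L1_ge0P => //.
rewrite ge0_integral_count; last by move=> k; rewrite lee_fin.
apply: lime_le; first by apply: is_cvg_nneseries => k _; rewrite lee_fin.
by apply: nearW => N; rewrite big_mkord sumEFin lee_fin.
Qed.

Lemma csum_le g C w : summable_by C w -> (forall j, `|g j| <= w j) ->
  [/\ L1 (@counting nat R) g, `|csum g| <= C & (fun N => \sum_(j < N) g j) @ \oo --> csum g].
Proof.
move=> hw gw; have [w1 wC] := L1_count hw; have hg : L1 (@counting nat R) g by apply: L1_le w1 => //; exact: mnat.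
split=> //; first by apply: le_trans wC; exact: norm_Int_le.
pose G N j := if (j < N)%N then g j else 0.
pose D N (j : nat) : R := (j == N)%:R.
have hD N : L1 (@counting nat R) (D N) /\ csum (D N) = 1.
  have E : D N = \1_[set N].
    apply/funext => j; have e : (j \in [set N]) = (j == N) by apply/idP/eqP; rewrite inE.
    by rewrite indicE e.
  split; last first.
    rewrite /csum /Int /Rintegral E integral_indic// setIT -[X in fine X]/(counting [set N]).
    by rewrite /counting asboolT// fset_set1 finmap.cardfs1.
  have [] := @L1_count 1 (D N); last by [].
  split=> [j|M]; first by rewrite /D; case: eqP.
  have [NM|MN] := ltnP N M.
    by rewrite (bigD1 (Ordinal NM))//= /D eqxx big1 ?addr0// => i; rewrite -val_eqE /= => /negbTE ->.
  by rewrite big1// => i _; rewrite /D ltn_eqF// (leq_trans (ltn_ord i)).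
have hG N : L1 (@counting nat R) (G N) /\ csum (G N) = \sum_(j < N) g j.
  elim: N => [|N [ih e]].
    rewrite big_ord0 (_ : G 0%N = fun=> 0); first by split; [exact: L1_0|exact: Int0].
    by apply/funext => j; rewrite /G ltn0.
  have E : G N.+1 = fun j => G N j + g N * D N j.
    apply/funext => j; rewrite /G /D ltnS leq_eqVlt; case: eqP => [->|_] /=.
      by rewrite ltnn add0r mulr1.
    by rewrite mulr0 addr0.
  have [h1 h2] := hD N.
  split; first by rewrite E; apply: L1D => //; exact: L1Z.
  by rewrite E big_ord_recr/= /csum IntD//; [rewrite IntZ// -/(csum (G N)) -/(csum (D N)) e h2 mulr1|exact: L1Z].
have -> : (fun N => \sum_(j < N) g j) = fun N => csum (G N) by apply/funext => N; rewrite (hG N).2.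
apply: (Int_lim _ _ _ w1).2.
- by move=> N; exact: mnat.
- move=> j; apply: cvg_near_cst; near=> N; rewrite /G.
  suff -> : (j < N)%N by []. by near: N; exact: nbhs_infty_gt.
- by move=> N j; rewrite /G; case: ifP => _ //; rewrite normr0; exact: hw.1.
Unshelve. all: by end_near. Qed.

Lemma summable_byZ c C w : 0 <= c -> summable_by C w -> summable_by (c * C) (fun j => c * w j).
Proof.
by move=> c0 [w0 wC]; split=> [j|N]; [exact: mulr_ge0|rewrite -mulr_sumr ler_wpM2l].
Qed.

(** On sequences with norm sup |a_i| / om_i the matrix [E] has norm at most 1/2, so (1 + E) a = e is
    solved by the alternating series of iterates; the geometric series accounts for the factor 2. *)
Lemma neumann (E : nat -> nat -> R) (om w e : nat -> R) (A : R) :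
  summable_by 2^-1 w -> 0 <= A -> (forall i, 0 < om i) -> (forall i, `|e i| <= A * om i) ->
  (forall i j, `|E i j| * om j <= om i * w j) ->
  exists a : nat -> R, (forall i, `|a i| <= 2 * A * om i) /\
    forall i, a i + csum (fun j => E i j * a j) = e i.
Proof.
move=> hw A0 om0 eA hE.
have T i (b : nat -> R) K : 0 <= K -> (forall j, `|b j| <= K * om j) ->
    L1 (@counting nat R) (fun j => E i j * b j) /\ `|csum (fun j => E i j * b j)| <= K * om i * 2^-1.
  move=> K0 bK; have [] := @csum_le (fun j => E i j * b j) (K * om i * 2^-1) (fun j => K * om i * w j).
  - by apply: summable_byZ => //; rewrite mulr_ge0// ltW.
  - move=> j; rewrite normrM; apply: (@le_trans _ _ (`|E i j| * (K * om j))); first by rewrite ler_wpM2l.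
    by rewrite mulrCA -mulrA ler_wpM2l.
  - by move=> h1 h2 _.
pose d := fix d k := if k is k'.+1 then fun i => - csum (fun j => E i j * d k' j) else e.
have dS k i : d k.+1 i = - csum (fun j => E i j * d k j) by [].
have dB k i : `|d k i| <= A * om i * 2^-1 ^+ k.
  elim: k i => [|k ih] i; first by rewrite expr0 mulr1; exact: eA.
  have K0 : 0 <= A * 2^-1 ^+ k by rewrite mulr_ge0// exprn_ge0.
  have hb j : `|d k j| <= A * 2^-1 ^+ k * om j by rewrite mulrAC; exact: ih.
  by rewrite dS normrN exprSr mulrA [A * om i * _]mulrAC; exact: (T i (d k) _ K0 hb).2.
have gB i : summable_by (2 * A * om i) (fun k => A * om i * 2^-1 ^+ k).
  have Ao : 0 <= A * om i by rewrite mulr_ge0// ltW.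
  split=> [k|N]; first by rewrite mulr_ge0// exprn_ge0.
  rewrite -mulr_sumr; have := @geometric_le R 2^-1 N; rewrite (_ : (1 - 2^-1)^-1 = 2 :> R); last by field.
  rewrite (_ : 2 * A * om i = A * om i * 2); last by ring.
  by move=> h; rewrite ler_wpM2l//; apply: h; rewrite ?invf_lt1//; lra.
pose S n i := \sum_(k < n) d k i.
exists (fun i => csum (d^~ i)).
have aS i := csum_le (gB i) (fun k => dB k i).
have aB i : `|csum (d^~ i)| <= 2 * A * om i by have [] := aS i.
have aL i : S n i @[n --> \oo] --> csum (d^~ i) by have [] := aS i.
split=> // i.
have SB n j : `|S n j| <= 2 * A * om j.
  apply: (le_trans (ler_norm_sum _ _ _)); apply: le_trans ((gB j).2 n).
  by apply: ler_sum => k _; exact: dB.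
have TS n : csum (fun j => E i j * S n j) = e i - S n.+1 i.
  have hT k : L1 (@counting nat R) (fun j => E i j * d k j).
    apply: (T i (d k) (A * 2^-1 ^+ k) _ _).1; first by rewrite mulr_ge0// exprn_ge0.
    by move=> j; rewrite mulrAC.
  have -> : (fun j => E i j * S n j) = fun j => \sum_(k < n) E i j * d k j by apply/funext => j; rewrite mulr_sumr.
  rewrite /csum Int_sum; last by move=> k _; exact: hT.
  rewrite /S big_ord_recl/= opprD addrA subrr add0r -sumrN; apply: eq_bigr => k _.
  by rewrite /bump /= opprK.
have [hw1 _] := L1_count hw.
have lim : (fun n => csum (fun j => E i j * S n j)) @ \oo --> csum (fun j => E i j * csum (d^~ j)).
  apply: (Int_lim _ _ _ (L1Z (2 * A * om i) hw1)).2.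
  - by move=> n; exact: mnat.
  - by move=> j; apply: cvgMl_tmp; exact: aL.
  - move=> n j; rewrite normrM; apply: (@le_trans _ _ (`|E i j| * (2 * A * om j))); first by rewrite ler_wpM2l.
    by rewrite mulrCA -mulrA ler_wpM2l// mulr_ge0.
have lim2 : (fun n => csum (fun j => E i j * S n j)) @ \oo --> e i - csum (d^~ i).
  have -> : (fun n => csum (fun j => E i j * S n j)) = fun n => e i - S n.+1 i by apply/funext => n; exact: TS.
  by apply: cvgB; [exact: cvg_cst|rewrite (cvg_shiftS (fun n => S n i)); exact: aL].
rewrite (cvg_unique (@norm_hausdorff _ _) lim lim2); ring.
Qed.
End summation.

Section exponentials.
Variable R : realType.

Lemma powR_subadd (a b r : R) : 0 <= a -> 0 <= b -> 0 < r <= 1 -> (a + b) `^ r <= a `^ r + b `^ r.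
Proof.
move=> a0 b0 /andP[r0 r1]; have : 0 <= a + b by rewrite addr_ge0.
rewrite le_eqVlt => /orP[/eqP ab|ab].
  by rewrite -ab powR0 ?addr_ge0 ?powR_ge0// gt_eqF.
have h t : 0 <= t -> t <= a + b -> t / (a + b) * (a + b) `^ r <= t `^ r.
  move=> t0 tab; have [->|tn] := eqVneq t 0; first by rewrite mul0r mul0r powR_ge0.
  have tp : 0 < t by rewrite lt_neqAle eq_sym tn.
  have -> : t `^ r = (t / (a + b)) `^ r * (a + b) `^ r.
    by rewrite -powRM ?divr_ge0 ?(ltW ab)// divfK// gt_eqF.
  apply: ler_wpM2r; first exact: powR_ge0.
  have u0 : 0 < t / (a + b) by rewrite divr_gt0.
  have u1 : t / (a + b) <= 1 by rewrite ler_pdivrMr// mul1r.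
  rewrite -[leLHS](powRr1 (ltW u0)); apply: powR_le1 => //; exact/andP.
have ha : a <= a + b by rewrite lerDl.
have hb : b <= a + b by rewrite lerDr.
have := lerD (h a a0 ha) (h b b0 hb).
by rewrite -mulrDl -mulrDl mulfV ?mul1r// gt_eqF.
Qed.

Lemma stretched_beats (r q th K : R) k : 0 < r -> r < q -> 0 < th -> 0 <= K ->
  exists2 C, 0 < C & forall t, 0 <= t -> (1 + t) ^+ k * expR (K * t `^ r) <= C * expR (th * t `^ q).
Proof.
move=> r0 rq th0 K0; have q0 := lt_trans r0 rq.
have [C C0 HC] := @stretched_exp_decay R (th `^ (- q^-1)) q k (powR_gt0 _ th0) q0.
(* Beyond [t0] the term K t^r is at most half of th t^q; the other half pays for the polynomial, and
   the bounded range goes into the constant. *)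
pose t0 := (2 * K / th) `^ (q - r)^-1.
have qr0 : 0 < q - r by rewrite subr_gt0.
exists ((C + 1) * expR (K * t0 `^ r)); first by rewrite mulr_gt0 ?expR_gt0// ltr_wpDl.
move=> t tp; have tE : t / th `^ (- q^-1) = t * th `^ q^-1 by rewrite powRN invrK.
have e1 : (t / th `^ (- q^-1)) `^ q = th * t `^ q.
  by rewrite tE powRM ?powR_ge0// -powRrM mulVf ?gt_eqF// powRr1 ?(ltW th0)// mulrC.
have := HC t tp; rewrite e1 => h1.
have h2 : K * t `^ r <= K * t0 `^ r + th * t `^ q / 2.
  have P0 : 0 <= th * t `^ q / 2 by rewrite divr_ge0// mulr_ge0 ?powR_ge0 ?(ltW th0).
  have [tt|tt] := leP t t0.
    rewrite -[leLHS]addr0; apply: lerD => //; rewrite ler_wpM2l// ge0_ler_powR ?nnegrE ?(ltW r0)//.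
    exact: le_trans tt.
  rewrite -[leLHS]add0r; apply: lerD; first by rewrite mulr_ge0// powR_ge0.
  have t1 : 0 < t by exact: le_lt_trans (powR_ge0 _ _) tt.
  have -> : t `^ q = t `^ (q - r) * t `^ r by rewrite -powRD'// subrK.
  have : 2 * K / th <= t `^ (q - r).
    have X0 : 0 <= 2 * K / th by rewrite divr_ge0 ?mulr_ge0// ltW.
    have -> : 2 * K / th = t0 `^ (q - r) by rewrite /t0 -powRrM mulVf ?gt_eqF// powRr1.
    by apply: ge0_ler_powR; rewrite ?nnegrE ?(ltW qr0) ?powR_ge0 ?(ltW t1)//; exact: ltW.
  rewrite ler_pdivrMr// => h3; rewrite mulrA [X in _ <= X]mulrAC; apply: ler_wpM2r; first exact: powR_ge0.
  lra.
set X := th * t `^ q in h1 h2 *; set T := (1 + t) ^+ k in h1 *.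
have T0 : 0 <= T by rewrite exprn_ge0// addr_ge0.
apply: (@le_trans _ _ (T * (expR (K * t0 `^ r) * expR (X / 2)))).
  by rewrite ler_wpM2l// -expRD ler_expR.
have -> : expR (X / 2) = expR (- (X / 2)) * expR X by rewrite -expRD; congr expR; field.
rewrite (_ : T * _ = T * expR (- (X / 2)) * (expR (K * t0 `^ r) * expR X)); last by ring.
rewrite -[leRHS]mulrA; apply: ler_wpM2r; first by rewrite mulr_ge0 ?expR_ge0.
by apply: (le_trans h1); rewrite lerDl.
Qed.
End exponentials.

(** * Counting separated points *)

Section packing.
Variables (R : realType) (d : nat) (rho A B : R).
Hypothesis A0 : 0 < A <= 1.
Hypothesis B0 : 0 <= B.
Hypothesis rho0 : 0 < rho.
Local Notation V := 'rV[R]_d.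
Implicit Types (x y : V) (l : seq V).

Definition sep x := A * expR (- (B * enorm x `^ rho)).
Definition separated (S : set V) := forall x y, S x -> S y -> x != y -> sep x <= enorm (x - y).
(** Up to constants, the volume of the ball that [x] keeps free of other points, times a weight
    integrable over the space; such quantities sum up over any separated set. *)
Definition cell x := (1 + enorm x) ^- d.+1 * sep x ^+ d.

Lemma sep_gt0 x : 0 < sep x. Proof. by have /andP[a _] := A0; rewrite mulr_gt0 ?expR_gt0. Qed.

Lemma sep_le1 x : sep x <= 1.
Proof.
have /andP[a a1] := A0; apply: mulr_ile1; rewrite ?expR_ge0 ?(ltW a)// -[leRHS]expR0 ler_expR.
by rewrite oppr_le0 mulr_ge0// powR_ge0.
Qed.

Lemma cell_gt0 x : 0 < cell x.
Proof. by rewrite mulr_gt0 ?invr_gt0 ?exprn_gt0 ?sep_gt0// ltr_wpDr ?enorm_ge0. Qed.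

(* Disjoint balls of radii [sep x / 2], weighted by an integrable function. *)
Lemma packing (S : set V) : separated S ->
  exists2 C, 0 <= C & forall l, uniq l -> (forall x, x \in l -> S x) -> \sum_(x <- l) cell x <= C.
Proof.
have aux (D u v a b : R) : u <= D -> v <= D -> a < u / 2 -> b < v / 2 -> D <= a + b -> False by lra.
move=> hS; have [hb vol0] := @LR_ball R d; set v := IR _ in vol0.
pose b x y : R := (enorm ((sep x / 2)^-1 *: y + - ((sep x / 2)^-1 *: x)) < 1)%R%:R.
have s2 x : 0 < sep x / 2 by rewrite divr_gt0 ?sep_gt0.
have bE x y : b x y = (enorm (y - x) < sep x / 2)%R%:R.
  have i0 : 0 <= (sep x / 2)^-1 by rewrite invr_ge0 ltW.
  by rewrite /b -scalerBr enormZ (ger0_norm i0) mulrC ltr_pdivrMr// mul1r.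
have hLb x : LR (b x) /\ IR (b x) = (sep x / 2) ^+ d * v.
  have sn : (sep x / 2)^-1 != 0 by rewrite invr_eq0 gt_eqF.
  split; first exact: (LR_affine _ sn hb).
  have i0 : 0 <= (sep x / 2)^-1 by rewrite invr_ge0 ltW.
  by rewrite /b (IR_affine _ sn hb) (ger0_norm i0) exprVn invrK.
pose T y := 2 ^+ d.+1 * (1 + enorm y) `^ (- d.+1%:R) : R.
have hT : LR T by apply: LRZ; apply: LR_tail; rewrite ltr_nat.
have T0 y : 0 <= T y by rewrite mulr_ge0 ?exprn_ge0 ?powR_ge0.
pose C0 := 2 ^+ d / v * IR T; exists C0.
  by rewrite mulr_ge0 ?divr_ge0 ?exprn_ge0 ?(ltW vol0)//; exact: IR_ge0.
move=> l ul lS; pose F y := \sum_(x <- l) (1 + enorm x) ^- d.+1 * b x y.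
have hF : LR F by apply: L1_sum => x _; apply: LRZ; exact: (hLb x).1.
have near x y : b x y != 0 -> (1 + enorm x) ^- d.+1 * b x y <= T y.
  rewrite bE; case: ltP => /= h; last by rewrite eqxx.
  move=> _; rewrite mulr1 /T powR_invn ?addr_ge0 ?enorm_ge0//.
  have x0 := enorm_ge0 x; have y0 := enorm_ge0 y.
  rewrite -exprVn -[in leRHS]exprVn -exprMn lerXn2r ?nnegrE ?mulr_ge0 ?invr_ge0 ?addr_ge0//.
  rewrite -[X in _ <= 2 / X]/(1 + enorm y) ler_pdivlMr ?ltr_wpDr// mulrC ler_pdivrMr ?ltr_wpDr//.
  have := enormD (y - x) x; rewrite subrK; have := sep_le1 x; lra.
have FT y : F y <= T y.
  have [/hasP[x xl bx]|/hasPn h] := boolP (has (fun x => b x y != 0) l); last first.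
    rewrite /F big_seq big1// => x /h; rewrite negbK => /eqP ->; exact: mulr0.
  rewrite /F (bigD1_seq x)//= big_seq_cond big1 ?addr0; first exact: near.
  move=> x' /andP[xl' xx']; rewrite bE; case: ltP => h'; rewrite ?mulr0//; exfalso.
  move: bx; rewrite bE; case: ltP => [h _|_ /eqP//].
  have n1 := hS _ _ (lS _ xl) (lS _ xl'); rewrite eq_sym in n1; have {}n1 := n1 xx'.
  have n2 := hS _ _ (lS _ xl') (lS _ xl) xx'; rewrite enormBC in n2.
  have := enorm_triangle y x x'; rewrite [enorm (x - y)]enormBC; exact: (aux _ _ _ _ _ n1 n2 h h').
have : IR F <= IR T by apply: le_IR.
rewrite /IR Int_sum; last by move=> x _; apply: LRZ; exact: (hLb x).1.
move=> h; rewrite /C0 mulrAC ler_pdivlMr//.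
have -> : (\sum_(x <- l) cell x) * v = 2 ^+ d * \sum_(x <- l) IR (fun y => (1 + enorm x) ^- d.+1 * b x y).
  rewrite mulr_suml mulr_sumr; apply: eq_bigr => x _; rewrite (IRZ _ (hLb x).1) (hLb x).2.
  by rewrite /cell expr_div_n; field; rewrite !expf_neq0 ?gt_eqF// ltr_wpDr ?enorm_ge0.
by rewrite ler_wpM2l ?exprn_ge0.
Qed.

(** Fewer than n points can have [cell] at least (C + 1)/n, since n of them would exceed the packing
    bound [C]; the whole set is the union of these finite sets. *)
Lemma separated_countable (S : set V) : separated S -> countable S.
Proof.
move=> /packing[C C0 HC].
have -> : S = \bigcup_n [set x | S x /\ C + 1 <= n%:R * cell x].
  apply/seteqP; split=> [x Sx|x [n _ []]//].
  have [n hn] := filter_ex (nbhs_infty_gtr ((C + 1) / cell x)).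
  by exists n => //; split=> //; rewrite -ler_pdivrMr ?cell_gt0// ltW.
apply: bigcup_countable => // n _; apply: finite_set_countable.
apply: contrapT => /infiniteP/pcard_leP[f].
have inS i : S (f i) /\ C + 1 <= n%:R * cell (f i) by exact: (@funS _ _ _ _ f i I).
have ul : uniq [seq f i | i <- index_iota 0 n].
  by rewrite map_inj_uniq ?iota_uniq// => i j e; apply: (@inj _ _ _ f); rewrite ?inE.
have H : \sum_(i < n) cell (f i) <= C.
  have := HC _ ul; rewrite big_map big_mkord; apply=> x /mapP[i _ ->]; exact: (inS i).1.
have n0 : (0 < n)%N.
  have h := lt_le_trans (ltr_wpDl C0 ltr01) (inS 0%N).2.
  by move: h; rewrite (pmulr_lgt0 _ (cell_gt0 _)) ltr0n.
have : \sum_(i < n) (C + 1) <= n%:R * C.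
  apply: (@le_trans _ _ (n%:R * \sum_(i < n) cell (f i))); last by rewrite ler_wpM2l.
  by rewrite mulr_sumr; apply: ler_sum => i _; exact: (inS i).2.
by rewrite sumr_const card_ord -[(C + 1) *+ n]mulr_natl ler_pM2l ?ltr0n// leNgt ltrDl ltr01.
Qed.
End packing.

(** * Decay of derivatives from decay of the function *)

Section landau.
Variables (R : realType) (d : nat).
Local Notation V := 'rV[R]_d.
Implicit Types (f g : V -> R) (x : V).

Definition rapidly_decreasing g := forall k, exists C, decay k C g.

(* A difference quotient with step [(1 + |x|) ^ (- k)]. *)
Lemma rpartial_decay g (M : R) i : rsmooth setT g -> 0 <= M ->
  (forall i j x, `|rpartial j (rpartial i g) x| <= M) ->
  rapidly_decreasing g -> rapidly_decreasing (rpartial i g).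
Proof.
move=> sg M0 gM dg k; have [C hC] := dg (2 * k)%N.
pose M' := d%:R ^+ 2 * M; have M'0 : 0 <= M' by rewrite mulr_ge0 ?exprn_ge0.
have C0 : 0 <= C by apply: le_trans (hC 0); rewrite mulr_ge0 ?exprn_ge0 ?addr_ge0 ?enorm_ge0.
exists (2 ^+ (2 * k) * C + C + M') => x.
pose T := (1 + enorm x) ^+ k; have T1 : 1 <= T by rewrite exprn_ege1// lerDl enorm_ge0.
have T0 : 0 < T := lt_le_trans ltr01 T1.
pose e : V := T^-1 *: delta_mx 0 i.
have ne : enorm e <= 1.
  rewrite enormZ ger0_norm ?invr_ge0 ?(ltW T0)//.
  have -> : enorm (delta_mx 0 i : V) = 1.
    rewrite /enorm (bigD1 i)//= big1 ?mxE ?eqxx ?expr1n ?addr0 ?sqrtr1// => j ji.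
    by rewrite mxE (negbTE ji) andbF expr0n.
  by rewrite mulr1 invf_le1.
have le : lincomb (fun j => rpartial j g x) e = T^-1 * rpartial i g x.
  rewrite /lincomb (bigD1 i)//= big1 ?addr0 ?mxE ?eqxx ?mulr1// => j ji.
  by rewrite !mxE (negbTE ji) andbF mulr0 mul0r.
have tay : `|g (x + e) - g x - lincomb (fun j => rpartial j g x) e| <= d%:R ^+ 2 * M * `|e| ^+ 2.
  by apply: taylor2 => *; [exact: (sg [::])|exact: (sg [:: _])|exact: gM].
have Ne : `|e| <= T^-1.
  rewrite normrZ ger0_norm ?invr_ge0 ?(ltW T0)// ler_piMr ?invr_ge0 ?(ltW T0)//.
  rewrite [leLHS]/Num.norm/= mx_normrE; apply: bigmax_le => // -[a b] _ /=.
  by rewrite mxE; case: (_ && _); rewrite ?normr1 ?normr0.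
have h1 : T ^+ 2 * `|g x| <= C by rewrite /T -exprM mulnC; exact: hC.
have h2 : T ^+ 2 * `|g (x + e)| <= 2 ^+ (2 * k) * C.
  apply: (@le_trans _ _ (2 ^+ (2 * k) * ((1 + enorm (x + e)) ^+ (2 * k) * `|g (x + e)|))); last first.
    by rewrite ler_wpM2l ?exprn_ge0.
  rewrite mulrA ler_wpM2r// -exprMn /T -exprM mulnC.
  rewrite lerXn2r ?nnegrE ?mulr_ge0 ?addr_ge0 ?enorm_ge0//.
  have := enormB (x + e) e; rewrite addrK; have := enorm_ge0 (x + e); lra.
have h3 : T ^+ 2 * `|T^-1 * rpartial i g x| <= 2 ^+ (2 * k) * C + C + M'.
  apply: (@le_trans _ _ (T ^+ 2 * (`|g (x + e)| + `|g x| + M' * `|e| ^+ 2))).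
    rewrite ler_wpM2l ?sqr_ge0// -le.
    move: tay; set L := lincomb _ _; set a := g (x + e); set b := g x => tay.
    have -> : L = (a - b) - (a - b - L) by ring.
    apply: (le_trans (ler_normB _ _)); apply: lerD tay; exact: ler_normB.
  rewrite !mulrDr; apply: lerD; first exact: lerD.
  rewrite mulrCA ler_piMr//; apply: (@le_trans _ _ (T ^+ 2 * T^-1 ^+ 2)).
    by rewrite ler_wpM2l ?sqr_ge0// lerXn2r ?nnegrE ?invr_ge0 ?(ltW T0).
  by rewrite -exprMn mulfV ?expr1n// gt_eqF.
apply: le_trans h3; rewrite -/T normrM ger0_norm ?invr_ge0 ?(ltW T0)// mulrA expr2 mulfK// gt_eqF//.
Qed.

Lemma rschwartz_of_bounds f : rsmooth setT f -> (forall s, exists C, forall x, `|rpartials s f x| <= C) ->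
  rapidly_decreasing f -> rschwartz f.
Proof.
move=> sf bf df; split=> // k s; elim: s k => [|i s ih] k; first exact: df.
have [M M0 HM] : exists2 M, 0 <= M & forall (ij : 'I_d * 'I_d) (x : V), True ->
    `|rpartial ij.2 (rpartial ij.1 (rpartials s f)) x| <= M.
  apply: finite_bound => -[a b]; have [C hC] := bf [:: b, a & s]; exists C => x _; exact: hC.
apply: (@rpartial_decay (rpartials s f) M) => //; first exact: rsmooth_rpartials.
by move=> a b x; exact: (HM (a, b)).
Qed.
End landau.

Section operator_rules.
Variables (R : realType) (d : nat) (s : R).
Hypothesis hs : 0 < s < 1.
Local Notation V := 'rV[R]_d.
Local Notation nu := (nu d s).
Implicit Types (f g : V -> R) (x : V).

(* The class on which [Lop] is an absolutely convergent integral. *)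
Definition tame f := [/\ mR f, exists B, forall x, `|f x| <= B &
  exists K, forall x z, `|D2 f x z| <= K * enorm z ^+ 2].

Lemma LR_tame f x : tame f -> LR (fun z => D2 f x z * enorm z `^ (- (2 * nu))).
Proof. by move=> [mf [B fB] [K fK]]; exact: (LR_Lop hs fB (fK x) mf). Qed.

Lemma tame_smooth f C : rsmooth setT f -> (forall t x, (size t <= 2)%N -> `|rpartials t f x| <= C) -> tame f.
Proof.
move=> sf fC; split.
- by apply: mR_cont => x; apply: differentiable_continuous; exact: (sf [::]).
- by exists C => x; exact: (fC [::]).
- by exists (2 * d%:R ^+ 2 * C) => x z; apply: D2_smooth => // i j y; exact: (fC [:: j; i]).
Qed.

Lemma Lop_affine f (a : R) b x : 0 < a -> tame f ->
  Lop s (fun w => f (a *: w + b)) x = a `^ (2 * s) * Lop s f (a *: x + b).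
Proof.
move=> a0 hf; have h := LR_tame (a *: x + b) hf; have an : a != 0 by rewrite gt_eqF.
have E : (fun z => D2 (fun w => f (a *: w + b)) x z * enorm z `^ (- (2 * nu))) =
    fun z => a `^ (2 * nu) * (fun w => D2 f (a *: x + b) w * enorm w `^ (- (2 * nu))) (a *: z).
  apply/funext => z; rewrite enormZ gtr0_norm// powRM ?enorm_ge0 ?(ltW a0)//.
  have k : a `^ (2 * nu) * a `^ (- (2 * nu)) = 1 by rewrite -powRD'// subrr powRr0.
  have -> : D2 (fun w => f (a *: w + b)) x z = D2 f (a *: x + b) (a *: z).
    by rewrite /D2 scalerDr scalerBr !(addrAC _ b).
  by rewrite [RHS]mulrCA; congr (_ * _); rewrite [RHS]mulrA k mul1r.
rewrite /Lop E IRZ; last exact: (LR_scale an h).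
rewrite (IR_scale an h) gtr0_norm// mulrA -powR_invn ?(ltW a0)// -powRD'//.
by congr (_ `^ _ * _); rewrite nu2; ring.
Qed.

Lemma Lop_sum N (c : nat -> R) (F : nat -> V -> R) x : (forall j, tame (F j)) ->
  Lop s (fun w => \sum_(j < N) c j * F j w) x = \sum_(j < N) c j * Lop s (F j) x.
Proof.
move=> hF; have h j := LR_tame x (hF j).
have -> : Lop s (fun w => \sum_(j < N) c j * F j w) x =
    IR (fun z => \sum_(j < N) c j * (D2 (F j) x z * enorm z `^ (- (2 * nu)))).
  congr IR; apply/funext => z; rewrite /D2 mulr_sumr -big_split -sumrB mulr_suml.
  by apply: eq_bigr => j _ /=; ring.
rewrite /IR Int_sum; last by move=> j _; exact: (LRZ (c j) (h j)).
by apply: eq_bigr => j _; exact: (IRZ (c j) (h j)).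
Qed.

Lemma Lop_cvg (F : nat -> V -> R) f (C : R) x : (forall n, rsmooth setT (F n)) ->
  (forall n t y, (size t <= 2)%N -> `|rpartials t (F n) y| <= C) ->
  (forall y, F^~ y @ \oo --> f y) -> (fun n => Lop s (F n) x) @ \oo --> Lop s f x.
Proof.
move=> sF FC cF; have mF n : mR (F n).
  by apply: mR_cont => y; apply: differentiable_continuous; exact: (sF n [::]).
have FB n y : `|F n y| <= C by exact: (FC n [::]).
have FK n z : `|D2 (F n) x z| <= 2 * d%:R ^+ 2 * C * enorm z ^+ 2.
  by apply: D2_smooth => // i j y; exact: (FC n [:: j; i]).
apply: (IR_lim _ _ _ (LRZ _ (LR_swgt d hs))).2.
- move=> n; apply: measurable_funM; [exact: mR_D2|exact: mR_powR].
- move=> z; apply: cvgMr_tmp; rewrite /D2; apply: cvgB; last by apply: cvgMl_tmp; exact: cF.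
  by apply: cvgD; exact: cF.
- by move=> n z; exact: D2_wgt_le.
Qed.
End operator_rules.

Lemma cvg_bound (R : realType) (u : nat -> R) l C : u @ \oo --> l -> (forall N, `|u N| <= C) -> `|l| <= C.
Proof.
move=> ul uC; rewrite -(cvg_lim (@norm_hausdorff _ _) (cvg_norm ul)).
by apply: limr_le; [exact: cvgP (cvg_norm ul)|exact: nearW].
Qed.

(** * The interpolation matrix and its inverse *)

Section interpolation.
Variables (R : realType) (d : nat) (s rho A B : R).
Hypothesis d0 : (0 < d)%N.
Hypothesis hs : 0 < s < 1.
Hypothesis hrho : 0 < rho < 1.
Hypothesis A0 : 0 < A <= 1.
Hypothesis B0 : 0 <= B.
Local Notation V := 'rV[R]_d.
Implicit Types (x y : V) (t : R).

(* Exponents rho < sg < sg' < tau < 1: the bumps have width e^(-|p|^sg) and decay of order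
   tau, the coefficients have size e^(-|p|^sg'). *)
Let sg := rho + (1 - rho) / 4.
Let sg' := rho + (1 - rho) / 2.
Let tau := rho + 3 * (1 - rho) / 4.
Let exps : [/\ 0 < rho, rho < sg, sg < sg', sg' < tau & tau < 1].
Proof. by have [r0 r1] := andP hrho; split; rewrite /sg /sg' /tau; lra. Qed.

Let sg_ : 0 < sg <= 1 /\ sg <= tau.
Proof. by have [r0 r1] := andP hrho; rewrite /sg /tau; split; [apply/andP; split|]; lra. Qed.
Let sg'_ : 0 < sg' <= 1 /\ sg' <= tau.
Proof. by have [r0 r1] := andP hrho; rewrite /sg' /tau; split; [apply/andP; split|]; lra. Qed.

Let htau : 0 < tau < 1. Proof. by have [r0 r1] := andP hrho; rewrite /tau; apply/andP; split; lra. Qed.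

Local Notation phi := (@bump R d tau).
Local Notation sep := (sep rho A B).
Local Notation cell := (cell rho A B).
Let l0 := Lop s phi 0.
Let l0n : l0 < 0 := Lop_bump0 d0 hs htau.

(** The indices [j] with [act j] enumerate the conditions: [P j] is the kind of condition, true for
    a value of [Lop] and false for a value of the function, with its point. Separation is assumed
    within one kind only, so points of different kinds may coincide. *)
Variables (act : nat -> bool) (P : nat -> bool * V) (Cv : R).
Hypothesis Psep : forall i j, act i -> act j -> i != j -> (P i).1 = (P j).1 ->
  sep (P j).2 <= enorm ((P i).2 - (P j).2).
Let v j : R := if act j then cell (P j).2 else 0.
Hypothesis vsum : summable_by Cv v.

Let nrm j := enorm (P j).2.
Let nrm0 j : 0 <= nrm j := enorm_ge0 _.

Lemma powR_monoD (a b t : R) : 0 < a -> a <= b -> 0 <= t -> t `^ a <= 1 + t `^ b.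
Proof.
move=> a0 ab t0; have [t1|t1] := leP 1 t.
  by apply: (@le_trans _ _ (t `^ b)); [exact: ler_powR|rewrite lerDr].
apply: (@le_trans _ _ 1); last by rewrite lerDl powR_ge0.
have <- : 1 `^ a = 1 :> R by rewrite powR1.
by apply: ge0_ler_powR; rewrite ?nnegrE ?(ltW a0) ?(ltW t1).
Qed.

Section width.
Variable kap : R.
Hypothesis kap01 : 0 < kap <= 1.
Let k0 : 0 < kap. Proof. by case/andP: kap01. Qed.
Let k1 : kap <= 1. Proof. by case/andP: kap01. Qed.

Let q j := kap * expR (- nrm j `^ sg).
Let q0 j : 0 < q j. Proof. by rewrite mulr_gt0 ?expR_gt0. Qed.
Let expN1 t : 0 <= t -> expR (- t) <= 1 :> R.
Proof. by move=> t0; rewrite -[leRHS]expR0 ler_expR oppr_le0. Qed.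
Let qk j : q j <= kap.
Proof. by rewrite ler_piMr ?(ltW k0)// expN1// powR_ge0. Qed.
Let q1 j : q j <= 1 := le_trans (qk j) k1.

(** Points of the two kinds may coincide, so distance cannot separate them; scaling must. With
    widths q and q^3, row weight q^(4s) and column weight q^(2s) for [Lop] conditions, the powers of
    q cancel within each kind, while both cross blocks keep a factor q^(2s). *)
Let r j := if (P j).1 then q j ^+ 3 else q j.
Let r0 j : 0 < r j. Proof. by rewrite /r; case: ifP; rewrite ?exprn_gt0. Qed.
Let rq j : r j <= q j.
Proof. by rewrite /r; case: ifP => // _; rewrite exprS ler_piMr ?(ltW (q0 j))// exprn_ile1 ?(ltW (q0 j)). Qed.

Let al j := if (P j).1 then q j `^ (2 * s) / l0 else 1.
Let om j := expR (- nrm j `^ sg').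
Definition atom j x := phi ((r j)^-1 *: x + - ((r j)^-1 *: (P j).2)).
Definition test i (g : V -> R) := if (P i).1 then q i `^ (4 * s) * Lop s g (P i).2 else g (P i).2.

Let u i j : V := (r j)^-1 *: (P i).2 + - ((r j)^-1 *: (P j).2).
Let M i j := al j * (if (P i).1 then q i `^ (4 * s) * ((r j)^-1 `^ (2 * s) * Lop s phi (u i j)) else phi (u i j)).

Let phi_tame : tame phi.
Proof.
have [sm hb] := bump_smooth d0 htau; apply: (tame_smooth (C := 4) sm) => t x h2.
apply: (le_trans (hb t x)); rewrite (_ : 4 = 2 ^+ 2 :> R); last by rewrite expr2; lra.
by rewrite ler_weXn2l// ler1n.
Qed.

Lemma atom_smooth j : rsmooth setT (atom j) /\ forall (t : seq 'I_d) x, `|rpartials t (atom j) x| <= (2 / r j) ^+ size t.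
Proof.
have [sm hb] := bump_smooth d0 htau; split; first exact: rsmooth_affine.
move=> t x; rewrite rpartials_affine// normrM normrX ger0_norm ?invr_ge0 ?(ltW (r0 j))// mulrC expr_div_n exprVn.
by rewrite ler_wpM2r// invr_ge0 exprn_ge0// ltW.
Qed.

Let atom_tame j : tame (atom j).
Proof.
have [sm hb] := atom_smooth j; apply: (tame_smooth (C := 1 + (2 / r j) ^+ 2) sm) => t x h2.
have X0 : 0 <= 2 / r j by rewrite divr_ge0// ltW.
apply: (le_trans (hb t x)); case: (size t) h2 => [|[|[|//]]] _.
- by rewrite expr0 lerDl exprn_ge0.
- by rewrite expr1 expr2; nra.
- by rewrite lerDr.
Qed.

Lemma test_atom i j : al j * test i (atom j) = M i j.
Proof.
rewrite /M /test; case: (P i).1 => //; congr (_ * (_ * _)).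
by rewrite /atom Lop_affine// invr_gt0.
Qed.

Let q3V (e : R) j : (q j ^+ 3)^-1 `^ e = q j `^ (- (3 * e)).
Proof.
rewrite -powR_mulrn ?(ltW (q0 j))// -powRN -powRrM; congr (_ `^ _); ring.
Qed.

Lemma M_diag i : M i i = 1.
Proof.
rewrite /M /u subrr /al /r; case: (P i).1; last by rewrite bump0// mulr1.
rewrite -/l0 q3V; set a := _ `^ (2 * s); set b := _ `^ (4 * s); set c := _ `^ (- _).
have -> : a / l0 * (b * (c * l0)) = a * b * c by field; exact: ltr0_neq0.
by rewrite /a /b /c -!powRD'// (_ : _ + _ - _ = 0) ?powRr0//; ring.
Qed.

(** The smaller of the two gains in q: one power from the distance between points of the same kind,
    2s from the scaling between kinds. *)
Let m := Num.min 1 (2 * s).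
Let Y j := expR (- (m * nrm j `^ sg)) / sep (P j).2.

Let spos j : 0 < sep (P j).2. Proof. exact: sep_gt0. Qed.
Let m0 : 0 < m. Proof. by have [s0 _] := andP hs; rewrite lt_min ltr01 mulr_gt0. Qed.

Let q_le_Y (e : R) j : m <= e -> q j `^ e / sep (P j).2 <= kap `^ m * Y j.
Proof.
move=> me; rewrite /Y mulrA ler_wpM2r ?invr_ge0 ?(ltW (spos j))//.
apply: (@le_trans _ _ (q j `^ m)); first by apply: powR_le1 => //; rewrite q0 q1.
rewrite /q powRM ?(ltW k0) ?expR_ge0// ler_wpM2l ?powR_ge0// /powR gt_eqF ?expR_gt0// expRK.
by rewrite mulrN.
Qed.

Let D i j := enorm ((P i).2 - (P j).2).
Let D0 i j : 0 <= D i j := enorm_ge0 _.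

Let nrmD (e : R) i j : 0 < e <= 1 -> nrm i `^ e <= nrm j `^ e + D i j `^ e /\ nrm j `^ e <= nrm i `^ e + D i j `^ e.
Proof.
move=> he; have e0 : 0 <= e by case/andP: he => /ltW.
have h (a b : R) : 0 <= a -> 0 <= b -> a <= b + D i j -> a `^ e <= b `^ e + D i j `^ e.
  move=> a0 b0 ab; apply: le_trans (powR_subadd b0 (D0 i j) he).
  by apply: ge0_ler_powR; rewrite ?nnegrE ?addr_ge0 ?D0.
split; apply: h => //; rewrite /nrm.
  by have := enormD ((P i).2 - (P j).2) (P j).2; rewrite subrK addrC.
by have := enormB (P i).2 ((P i).2 - (P j).2); rewrite opprB addrC subrK.
Qed.

(** As sg <= 1, |p|^sg is subadditive, so widths at two points differ by a factor e^(D^sg) at most;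
    such factors are absorbed by the decay of order tau. *)
Let q_ratio i j : q i <= q j * expR (D i j `^ sg).
Proof.
have [r00 r1 r2 r3 r4] := exps; rewrite /q -mulrA ler_wpM2l ?(ltW k0)// -expRD ler_expR.
have h : 0 < sg <= 1 by apply/andP; split; lra.
by have [_] := nrmD i j h; lra.
Qed.

Let Ca := 1 + `|l0|^-1.
Let coef_le i j : `|al j| * (if (P i).1 then q i `^ (4 * s) * (r j)^-1 `^ (2 * s) else 1) <=
  Ca * expR (4 * D i j `^ sg) * (if (P i).1 == (P j).1 then 1 else q j `^ (2 * s)).
Proof.
have [s0 s1] := andP hs; have E1 : 1 <= expR (4 * D i j `^ sg) by rewrite -[leLHS]expR0 ler_expR mulr_ge0 ?powR_ge0.
have L0 : 0 <= `|l0|^-1 by rewrite invr_ge0.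
have Ca1 : 1 <= Ca by rewrite lerDl.
have CaL : `|l0|^-1 <= Ca by rewrite lerDr.
set E := expR _ in E1 *; have E0 : 0 <= E := le_trans ler01 E1.
have qE : q i `^ (4 * s) <= q j `^ (4 * s) * E.
  apply: (@le_trans _ _ ((q j * expR (D i j `^ sg)) `^ (4 * s))).
    apply: ge0_ler_powR (q_ratio i j).
    - by rewrite mulr_ge0// ltW.
    - by rewrite nnegrE ltW.
    - by rewrite nnegrE mulr_ge0 ?expR_ge0// ltW.
  rewrite powRM ?expR_ge0 ?(ltW (q0 j))// ler_wpM2l ?powR_ge0// /powR gt_eqF ?expR_gt0// expRK ler_expR.
  by rewrite ler_wpM2r ?powR_ge0//; lra.
have Vj (e : R) : (q j)^-1 `^ e = q j `^ (- e) by rewrite -(powR_inv1 (ltW (q0 j))) -powRrM mulN1r.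
rewrite /al /r; case: (P i).1; case: (P j).1 => /=.
- rewrite normrM (ger0_norm (powR_ge0 _ _)) normfV q3V.
  have : q j `^ (2 * s) * q i `^ (4 * s) * q j `^ (- (3 * (2 * s))) <= E.
    apply: (@le_trans _ _ (q j `^ (2 * s) * (q j `^ (4 * s) * E) * q j `^ (- (3 * (2 * s))))).
      by rewrite ler_wpM2r ?powR_ge0// ler_wpM2l ?powR_ge0.
    rewrite (_ : _ * _ * _ = q j `^ (2 * s) * q j `^ (4 * s) * q j `^ (- (3 * (2 * s))) * E); last by ring.
    by rewrite -!powRD'// (_ : _ + _ - _ = 0) ?powRr0 ?mul1r//; ring.
  move=> h; rewrite mulr1 -mulrA mulrCA [_ * (_ * q j `^ _)]mulrA.
  apply: ler_pM => //; rewrite !mulr_ge0 ?powR_ge0//.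
- rewrite normr1 mul1r Vj; apply: (@le_trans _ _ (q j `^ (4 * s) * E * q j `^ (- (2 * s)))).
    by rewrite ler_wpM2r ?powR_ge0.
  rewrite mulrAC -powRD'// (_ : 4 * s - 2 * s = 2 * s); last by ring.
  by rewrite -[leRHS]mulrA [E * _]mulrC ler_peMl// mulr_ge0 ?powR_ge0.
- rewrite normrM (ger0_norm (powR_ge0 _ _)) normfV mulr1 mulrC ler_wpM2r ?powR_ge0//.
  by rewrite -[leLHS]mulr1; apply: ler_pM.
- by rewrite normr1 !mulr1 -[leLHS]mulr1; apply: ler_pM.
Qed.

Variables (Cb kb : R).
Hypothesis Cb0 : 0 < Cb.
Hypothesis kb0 : 0 < kb.
Hypothesis phi_decay : forall x, `|phi x| <= Cb * expR (- (kb * enorm x `^ tau)).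
Hypothesis Lphi_decay : forall x, `|Lop s phi x| <= Cb * expR (- (kb * enorm x `^ tau)).
(** The comparison of widths and weights costs 4 D^sg + D^sg' <= 5 + 5 D^tau in the exponent; with
    this bound it is at most 5 plus half of the decay kb (D/q)^tau. *)
Hypothesis kap_small : 10 <= kb * kap `^ (- tau).
Variable C2 : R.
Hypothesis HC2 : forall t, 0 <= t -> (1 + t) * expR (- (kb * t `^ tau / 2)) <= C2.

Let DqE i j : D i j / q j <= enorm (u i j).
Proof.
rewrite /u -scalerBr enormZ ger0_norm ?invr_ge0 ?(ltW (r0 j))// mulrC ler_wpM2r//.
by rewrite lef_pV2 ?posrE.
Qed.

Let M_le i j : `|M i j| <= Ca * expR (4 * D i j `^ sg) * (if (P i).1 == (P j).1 then 1 else q j `^ (2 * s)) *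
  (Cb * expR (- (kb * (D i j / q j) `^ tau))).
Proof.
have [t0 t1] := andP htau; have Dq0 : 0 <= D i j / q j by rewrite divr_ge0// ltW.
have E : expR (- (kb * enorm (u i j) `^ tau)) <= expR (- (kb * (D i j / q j) `^ tau)).
  rewrite ler_expR lerN2 ler_wpM2l ?(ltW kb0)//.
  by apply: ge0_ler_powR; rewrite ?nnegrE ?(ltW t0) ?enorm_ge0.
have h := coef_le i j; set X := (X in _ <= X * _); rewrite -/X in h.
have X0 : 0 <= X by apply: le_trans h; rewrite mulr_ge0//; case: ifP => // _; rewrite mulr_ge0 ?powR_ge0.
have E' := ler_wpM2l (ltW Cb0) E.
have k1' := le_trans (phi_decay (u i j)) E'; have k2' := le_trans (Lphi_decay (u i j)) E'.
rewrite /M normrM; case: (P i).1 h => h.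
  rewrite normrM (ger0_norm (powR_ge0 _ _)) normrM (ger0_norm (powR_ge0 _ _)).
  rewrite [X in `|al j| * X]mulrA [leLHS]mulrA.
  apply: (ler_pM _ _ h k2') => //; by rewrite !mulr_ge0 ?powR_ge0.
by rewrite mulr1 in h; apply: ler_pM.
Qed.

Let C6 := Ca * Cb * expR 5 * (1 + C2).

(** For the same kind, D is at least the separation, and half of the decay of the bump at distance
    D/q gives q/D <= q/sep. For different kinds the factor q^(2s) does the work at any distance. The
    other half of the decay pays for comparing the two points. *)
Lemma M_offdiag i j : act i -> act j -> i != j -> `|M i j| * om j <= om i * (C6 * kap `^ m * Y j).
Proof.
have aux1 (a b e : R) : a <= b + e -> - b <= - a + e by lra.
have aux2 (a b e f k : R) : a <= 1 + e -> b <= 1 + e -> 10 * e <= k -> 4 * a + b - k <= 5 - k / 2 by lra.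
have aux3 (a b e k f : R) : a + b - k <= f - e -> a + (- k + b) <= f + - e by lra.
move=> ai aj ij; have [s0 s1] := andP hs; have [t0 t1] := andP htau.
have h1 : om j <= om i * expR (D i j `^ sg').
  rewrite /om -expRD ler_expR.
  by have [h1 _] := nrmD i j (proj1 sg'_); exact: aux1.
set b : R := if (P i).1 == (P j).1 then 1 else q j `^ (2 * s).
have b0 : 0 <= b by rewrite /b; case: ifP => // _; exact: powR_ge0.
pose w := (D i j / q j) `^ tau; have w0 : 0 <= w by exact: powR_ge0.
have Ca0 : 0 <= Ca by rewrite addr_ge0 ?invr_ge0.
have hexp : 4 * D i j `^ sg + D i j `^ sg' - kb * w <= 5 - kb * w / 2.
  have [/andP[sg0 _] sgt] := sg_; have [/andP[sg'0 _] sgt'] := sg'_.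
  have a1 : D i j `^ sg <= 1 + D i j `^ tau := powR_monoD sg0 sgt (D0 i j).
  have a2 : D i j `^ sg' <= 1 + D i j `^ tau := powR_monoD sg'0 sgt' (D0 i j).
  have a3 : 10 * D i j `^ tau <= kb * w.
    apply: (@le_trans _ _ (kb * kap `^ (- tau) * D i j `^ tau)); first by rewrite ler_wpM2r ?powR_ge0.
    rewrite -mulrA ler_wpM2l ?(ltW kb0)// /w powRM ?invr_ge0 ?(ltW (q0 j))// mulrC ler_wpM2l ?powR_ge0//.
    rewrite -(powR_inv1 (ltW (q0 j))) -powRrM mulN1r; apply: powR_anti; rewrite ?q0 ?qk ?(ltW t0)//.
  exact: aux2 a1 a2 a3.
have C20 : 0 <= C2.
  by apply: le_trans (HC2 (lexx 0)); rewrite mulr_ge0 ?addr_ge0 ?expR_ge0.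
have hb : b * expR (- (kb * w / 2)) <= (1 + C2) * (kap `^ m * Y j).
  have K0 : 0 <= kap `^ m * Y j by rewrite mulr_ge0 ?powR_ge0// divr_ge0 ?expR_ge0// ltW.
  have sp1 : 1 <= (sep (P j).2)^-1 by rewrite invf_ge1// sep_le1//.
  have e1 : expR (- (kb * w / 2)) <= 1 by apply: expN1; rewrite divr_ge0// mulr_ge0// ltW.
  rewrite /b; case: eqP => [e|_]; last first.
    apply: (@le_trans _ _ (q j `^ (2 * s))); first by rewrite ler_piMr ?powR_ge0.
    apply: (@le_trans _ _ (kap `^ m * Y j)); last by rewrite ler_peMl// lerDl.
    apply: le_trans (q_le_Y _ (_ : m <= 2 * s)); last by rewrite ge_min lexx orbT.
    by rewrite ler_peMr ?powR_ge0.
  have hD := Psep ai aj ij e; rewrite mul1r.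
  have Dp : 0 < D i j := lt_le_trans (spos j) hD.
  have tp : 0 < D i j / q j by rewrite divr_gt0.
  have := HC2 (ltW tp); rewrite -/w => h2.
  apply: (@le_trans _ _ (C2 * (q j `^ 1 / sep (P j).2))); last first.
    apply: (@le_trans _ _ (C2 * (kap `^ m * Y j))); last by rewrite ler_wpM2r// lerDr.
    by rewrite ler_wpM2l// q_le_Y// ge_min lexx.
  rewrite powRr1 ?(ltW (q0 j))//; apply: (@le_trans _ _ (C2 * (q j / D i j))).
    rewrite -[q j / _]invf_div ler_pdivlMr// mulrC; apply: le_trans h2.
    by rewrite ler_wpM2r ?expR_ge0// lerDr.
  by rewrite ler_wpM2l// ler_wpM2l ?(ltW (q0 j))// lef_pV2 ?posrE.
apply: (le_trans (ler_pM (normr_ge0 _) (expR_ge0 _) (M_le i j) h1)); rewrite -/b -/w.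
rewrite (_ : _ * _ * _ * _ * _ = om i * (Ca * Cb * (b * (expR (4 * D i j `^ sg) * expR (- (kb * w)) * expR (D i j `^ sg'))))); last by ring.
apply: ler_wpM2l; first exact: expR_ge0.
rewrite /C6 -!mulrA; apply: ler_wpM2l => //; apply: ler_wpM2l; first exact: ltW.
apply: (@le_trans _ _ (b * (expR 5 * expR (- (kb * w / 2))))).
  apply: ler_wpM2l => //; rewrite -!expRD ler_expR; exact: aux3 hexp.
by rewrite mulrCA; apply: ler_wpM2l; [exact: expR_ge0|exact: hb].
Qed.
Variable C5 : R.
Hypothesis C50 : 0 <= C5.
Hypothesis HC5 : forall j, Y j <= C5 * cell (P j).2.
Hypothesis C20 : 0 <= C2.
Hypothesis kap_sum : C6 * kap `^ m * C5 * Cv <= 2^-1.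

Let E i j := if [&& act i, act j & i != j] then M i j else 0.
Let w j := C6 * kap `^ m * C5 * v j.

Let cell0 j : 0 < cell (P j).2. Proof. exact: cell_gt0. Qed.
Let v0 j : 0 <= v j. Proof. by rewrite /v; case: ifP => // _; exact: ltW. Qed.
Let om0 j : 0 < om j. Proof. exact: expR_gt0. Qed.
Let Ca0 : 0 <= Ca. Proof. by rewrite addr_ge0 ?invr_ge0. Qed.
Let C60 : 0 <= C6.
Proof. by rewrite !mulr_ge0 ?expR_ge0 ?Ca0 ?(ltW Cb0)// addr_ge0. Qed.

Let E_le i j : `|E i j| * om j <= om i * w j.
Proof.
have K0 : 0 <= C6 * kap `^ m by rewrite mulr_ge0 ?powR_ge0 ?C60.
rewrite /E; case: ifP => [/and3P[ai aj ij]|_]; last first.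
  by rewrite normr0 mul0r mulr_ge0 ?(ltW (om0 i))// /w mulr_ge0// mulr_ge0.
apply: (le_trans (M_offdiag ai aj ij)); apply: ler_wpM2l; first exact: ltW.
by rewrite /w /v aj -[leRHS]mulrA; apply: ler_wpM2l.
Qed.

Let w_sum : summable_by 2^-1 w.
Proof.
have K0 : 0 <= C6 * kap `^ m * C5 by rewrite mulr_ge0// mulr_ge0 ?powR_ge0 ?C60.
have [w0 hN] := summable_byZ K0 vsum; split=> // N.
exact: le_trans (hN N) kap_sum.
Qed.

Section coefficients.
Variables (a : nat -> R) (Aa : R).
Hypothesis Aa0 : 0 <= Aa.
Hypothesis a_le : forall j, `|a j| <= Aa * om j.
Let c j := if act j then a j * al j else 0.

Let al_le j : `|al j| <= Ca.
Proof.
have [s0 s1] := andP hs; rewrite /al; case: (P j).1; last by rewrite normr1 lerDl invr_ge0.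
rewrite normrM (ger0_norm (powR_ge0 _ _)) normfV.
apply: (@le_trans _ _ `|l0|^-1); last by rewrite lerDr.
rewrite ler_piMl ?invr_ge0//.
have {2}<- : 1 `^ (2 * s) = 1 :> R by rewrite powR1.
apply: ge0_ler_powR; rewrite ?nnegrE ?(ltW (q0 j))//; first by rewrite mulr_ge0// ltW.
Qed.

Lemma coef_decay k n : exists2 K, 0 <= K & forall j, `|c j| * (1 + nrm j) ^+ k * (2 / r j) ^+ n <= K * v j.
Proof.
have [[/andP[sg0 _] _] [r00 r1 r2 _ _]] := (sg_, exps); have [A00 _] := andP A0.
have Kn : 0 <= n%:R * 3 + d%:R * B by rewrite addr_ge0 ?mulr_ge0.
have [C C0 hC] := stretched_beats (k + d.+1) sg0 r2 ltr01 Kn.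
pose K1 := (2 / kap ^+ 3) ^+ n; pose K2 := (expR B / A) ^+ d.
have K10 : 0 <= K1 by rewrite exprn_ge0// divr_ge0// exprn_ge0// ltW.
have K20 : 0 <= K2 by rewrite exprn_ge0// divr_ge0 ?expR_ge0// ltW.
exists (Aa * Ca * K1 * K2 * C) => [|j].
  by apply: mulr_ge0 (ltW C0); rewrite !mulr_ge0 ?Ca0.
rewrite /c /v; case: (act j); last by rewrite normr0 !mul0r mulr0.
pose t := nrm j; pose X := t `^ sg; have t1 : 0 < 1 + t by exact: ltr_pwDl (ltr01) (nrm0 j).
have hr : (2 / r j) ^+ n <= K1 * expR (n%:R * 3 * X).
  have -> : K1 * expR (n%:R * 3 * X) = (2 / q j ^+ 3) ^+ n.
    rewrite /K1 -mulrA expRM_natl -exprMn; congr (_ ^+ n).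
    have -> : q j ^+ 3 = kap ^+ 3 * expR (- (3 * X)) by rewrite exprMn -expRM_natl mulrN.
    by rewrite (invfM (kap ^+ 3)) -expRN opprK mulrA.
  apply: lerXn2r; rewrite ?nnegrE ?divr_ge0 ?exprn_ge0 ?(ltW (q0 j)) ?(ltW (r0 j))//.
  rewrite ler_wpM2l// lef_pV2 ?posrE ?exprn_gt0// /r; case: ifP => // _.
  by rewrite exprSr ler_piMl ?(ltW (q0 j))// exprn_ile1// ltW.
have hsep : sep (P j).2 ^- d <= K2 * expR (d%:R * B * X).
  have -> : K2 * expR (d%:R * B * X) = (expR (B * (1 + X)) / A) ^+ d.
    rewrite /K2 -mulrA expRM_natl -exprMn; congr (_ ^+ d).
    by rewrite mulrAC -expRD mulrDr mulr1.
  rewrite -exprVn; apply: lerXn2r; rewrite ?nnegrE ?divr_ge0 ?expR_ge0 ?invr_ge0 ?(ltW (spos j))// ?(ltW A00)//.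
  rewrite /sep invfM -expRN opprK mulrC ler_wpM2r ?invr_ge0 ?(ltW A00)// ler_expR ler_wpM2l//.
  by apply: powR_monoD (ltW r1) _ => //; exact: enorm_ge0.
rewrite -ler_pdivrMr// /cell invfM invrK.
apply: (@le_trans _ _ (Aa * om j * Ca * (1 + t) ^+ k * (K1 * expR (n%:R * 3 * X)) * ((1 + t) ^+ d.+1 * (K2 * expR (d%:R * B * X))))).
  apply: ler_pM; rewrite ?mulr_ge0 ?exprn_ge0 ?invr_ge0 ?exprn_ge0 ?(ltW t1) ?(ltW (spos j)) ?divr_ge0 ?(ltW (r0 j))//.
    apply: ler_pM => //; rewrite ?mulr_ge0 ?exprn_ge0 ?(ltW t1) ?divr_ge0 ?(ltW (r0 j))//.
    apply: ler_wpM2r; first by rewrite exprn_ge0// ltW.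
    by rewrite normrM; apply: ler_pM.
  by rewrite ler_wpM2l// exprn_ge0// ltW.
have -> : Aa * om j * Ca * (1 + t) ^+ k * (K1 * expR (n%:R * 3 * X)) * ((1 + t) ^+ d.+1 * (K2 * expR (d%:R * B * X))) =
  Aa * Ca * K1 * K2 * (om j * ((1 + t) ^+ (k + d.+1) * expR ((n%:R * 3 + d%:R * B) * X))).
  by rewrite exprD mulrDl expRD; ring.
rewrite ler_wpM2l ?mulr_ge0 ?Ca0// mulrC -ler_pdivlMr// /om -expRN opprK.
by have := hC t (nrm0 j); rewrite mul1r.
Qed.

Let F N x := \sum_(j < N) c j * atom j x.
Let f x := csum (fun j => c j * atom j x).

Let term_le K n : (forall j, `|c j| * (1 + nrm j) ^+ 0 * (2 / r j) ^+ n <= K * v j) ->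
  forall (t : seq 'I_d) j x, (size t <= n)%N -> `|c j * rpartials t (atom j) x| <= K * v j.
Proof.
move=> hK t j x tn; apply: le_trans (hK j).
rewrite expr0 mulr1 normrM ler_wpM2l//; apply: (le_trans ((atom_smooth j).2 t x)).
by rewrite ler_weXn2l// ler_pdivlMr// mul1r (le_trans (rq j))// (le_trans (q1 j))// ler1n.
Qed.

Let F_bound n : exists C, forall N (t : seq 'I_d) x, (size t <= n)%N -> `|rpartials t (F N) x| <= C.
Proof.
have [K K0 hK] := coef_decay 0 n; exists (K * Cv) => N t x tn.
rewrite /F rpartials_sum => [|j]; last by apply: rsmoothZ; [exact: openT|exact: (atom_smooth j).1].
apply: (le_trans (ler_norm_sum _ _ _)); apply: le_trans ((summable_byZ K0 vsum).2 N).
by apply: ler_sum => j _; rewrite rpartialsZ; [exact: term_le tn|exact: (atom_smooth j).1].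
Qed.

Let F_smooth N : rsmooth setT (F N).
Proof.
by apply: rsmooth_sum => [|j]; [exact: openT|apply: rsmoothZ; [exact: openT|exact: (atom_smooth j).1]].
Qed.

Let F_cvg x : F^~ x @ \oo --> f x.
Proof.
have [K K0 hK] := coef_decay 0 0.
by have [_ _] := csum_le (summable_byZ K0 vsum) (fun j => term_le hK j x (isT : (size [::] <= 0)%N)).
Qed.

Lemma interpolant_schwartz : rschwartz f.
Proof.
have Fb (t : seq 'I_d) : exists C, forall N x, `|rpartials t (F N) x| <= C.
  by have [C hC] := F_bound (size t); exists C => N x; exact: hC.
have [sf cf] := smooth_limit F_smooth Fb F_cvg.
apply: rschwartz_of_bounds => //.
  move=> t; have [C hC] := Fb t; exists C => x.
  apply: (cvg_bound (cf t x)) => N; exact: hC.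
move=> k; have aux (p b e g : R) : p <= b + e -> e <= g -> 0 <= b * g -> 1 + p <= (1 + b) * (1 + g) by lra.
have [K K0 hK] := coef_decay k 0.
have [t0 _] := andP htau; have t2 : tau / 2 < tau by rewrite ltr_pdivrMr// ltr_pMr// ltr1n.
have [C C0 hC] := stretched_beats k (divr_gt0 t0 (ltr0Sn R 1)) t2 kb0 (lexx 0).
exists (Cb * C * K * Cv) => x; have T0 : 0 <= (1 + enorm x) ^+ k by rewrite exprn_ge0// addr_ge0 ?enorm_ge0.
rewrite -(ger0_norm T0) -normrM.
have cx : (fun N => (1 + enorm x) ^+ k * F N x) @ \oo --> (1 + enorm x) ^+ k * f x.
  by apply: cvgMl_tmp; exact: F_cvg.
apply: (cvg_bound cx) => N; rewrite normrM (ger0_norm T0).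
apply: (@le_trans _ _ (\sum_(j < N) Cb * C * K * v j)); last first.
  by apply: (summable_byZ _ vsum).2; rewrite !mulr_ge0 ?(ltW C0) ?(ltW Cb0).
apply: (@le_trans _ _ ((1 + enorm x) ^+ k * \sum_(j < N) `|c j * atom j x|)).
  by apply: ler_wpM2l; [exact: T0|exact: ler_norm_sum].
rewrite mulr_sumr; apply: ler_sum => j _; rewrite normrM /atom.
set y : V := _ + _; have := hC (enorm y) (enorm_ge0 _); rewrite mul0r expR0 mulr1 => hy.
(* Decay in [x] is split between the point of the atom, paid by its coefficient, and the rescaled
   variable [y], paid by the bump; widths below 1 make |x| <= |p| + |y|. *)
have nx : 1 + enorm x <= (1 + nrm j) * (1 + enorm y).
  have -> : x = (P j).2 + r j *: y.
    by rewrite /y scalerDr scalerN !scalerA divff ?gt_eqF// !scale1r addrCA subrr addr0.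
  have h1 := enormD (P j).2 (r j *: y); rewrite enormZ (ger0_norm (ltW (r0 j))) in h1.
  have h2 : r j * enorm y <= enorm y by rewrite ler_piMl ?enorm_ge0// (le_trans (rq j)).
  have h3 : 0 <= nrm j * enorm y by rewrite mulr_ge0 ?enorm_ge0.
  exact: aux h1 h2 h3.
have hk : (1 + enorm x) ^+ k <= (1 + nrm j) ^+ k * (1 + enorm y) ^+ k.
  rewrite -exprMn; apply: lerXn2r nx; rewrite nnegrE ?mulr_ge0 ?addr_ge0 ?enorm_ge0//.
have hp : (1 + enorm y) ^+ k * `|phi y| <= Cb * C.
  apply: (le_trans (ler_pM _ _ hy (phi_decay y))) => //; first by rewrite exprn_ge0// addr_ge0 ?enorm_ge0.
  rewrite mulrACA -expRD subrr expR0 mulr1 mulrC; exact: lexx.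
have N0 : 0 <= (1 + nrm j) ^+ k by rewrite exprn_ge0// addr_ge0.
apply: (@le_trans _ _ ((`|c j| * (1 + nrm j) ^+ k) * ((1 + enorm y) ^+ k * `|phi y|))).
  rewrite mulrCA -[leRHS]mulrA; apply: ler_wpM2l => //.
  by rewrite [leRHS]mulrA; apply: ler_wpM2r.
have := hK j; rewrite expr0 mulr1 => hKj.
rewrite -[Cb * C * K * v j]mulrA [leRHS]mulrC; apply: ler_pM => //; first by rewrite mulr_ge0.
by rewrite mulr_ge0// exprn_ge0// addr_ge0 ?enorm_ge0.
Qed.

Let test_cvg i : (fun N => test i (F N)) @ \oo --> test i f.
Proof.
rewrite /test; case: (P i).1; last exact: F_cvg.
apply: cvgMl_tmp; have [C hC] := F_bound 2.
by apply: (@Lop_cvg _ _ s hs F f C) => // N t y; exact: hC.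
Qed.

Let test_sum i N : test i (F N) = \sum_(j < N) c j * test i (atom j).
Proof.
rewrite /test; case: (P i).1 => //; rewrite Lop_sum// mulr_sumr.
by apply: eq_bigr => j _; rewrite mulrCA.
Qed.

Lemma interpolant_test i : act i -> test i f = a i + csum (fun j => E i j * a j).
Proof.
move=> ai; have Ks : 0 <= Aa * om i by rewrite mulr_ge0// ltW.
have hg j : `|E i j * a j| <= Aa * om i * w j.
  rewrite normrM; apply: (le_trans (ler_wpM2l (normr_ge0 _) (a_le j))).
  by rewrite mulrCA -[leRHS]mulrA; apply: ler_wpM2l.
have [_ _ cE] := csum_le (summable_byZ Ks w_sum) hg.
have hT N : test i (F N) = (i < N)%:R * a i + \sum_(j < N) E i j * a j.
  have cj j : c j * test i (atom j) = (j == i)%:R * a i + E i j * a j.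
    rewrite /c /E ai /=; have [->|ji] := eqVneq j i.
      by rewrite ai /= -mulrA test_atom M_diag mulr1 mul1r mul0r addr0.
    rewrite mul0r add0r /= andbT; case: (act j); last by rewrite !mul0r.
    by rewrite -mulrA test_atom mulrC.
  rewrite test_sum; under eq_bigr do rewrite cj; rewrite big_split/=; congr (_ + _).
  elim: N => [|N ih]; first by rewrite big_ord0 mul0r.
  rewrite big_ord_recr/= ih -mulrDl -natrD ltnS; congr (_%:R * _).
  by case: ltngtP.
have c1 : (fun N => (i < N)%:R * a i + \sum_(j < N) E i j * a j) @ \oo --> a i + csum (fun j => E i j * a j).
  apply: cvgD cE; apply: cvg_near_cst; exists i.+1 => //= n iN.
  by rewrite iN mul1r.
have h := test_cvg (i := i); rewrite (funext hT) in h.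
exact: (cvg_unique (@norm_hausdorff _ _) h c1).
Qed.
End coefficients.

(** The right-hand side is a unit vector, bounded in the weighted norm by 1/[om i0]; [neumann] gives
    the coefficients, and the sum of the atoms meets all conditions because the tests pass to the
    limit of its partial sums. *)
Lemma interpolant_exists i0 : act i0 -> (P i0).1 = false ->
  exists f, [/\ rschwartz f, forall i, act i -> (P i).1 = false -> f (P i).2 = (i == i0)%:R &
    forall i, act i -> (P i).1 -> Lop s f (P i).2 = 0].
Proof.
move=> a0 p0; have Ao : 0 <= (om i0)^-1 by rewrite invr_ge0 ltW.
have he i : `|(i == i0)%:R| <= (om i0)^-1 * om i :> R.
  case: eqP => [->|_]; first by rewrite normr1 mulVf ?gt_eqF.
  by rewrite normr0 mulr_ge0// ltW.
have [a [ha hE]] := neumann w_sum Ao om0 he E_le.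
have A2 : 0 <= 2 * (om i0)^-1 by rewrite mulr_ge0.
exists (fun x => csum (fun j => (if act j then a j * al j else 0) * atom j x)); split.
- exact: interpolant_schwartz A2 ha.
- by move=> i ai pi; have := interpolant_test A2 ha ai; rewrite hE /test pi.
- move=> i ai pi; have := interpolant_test A2 ha ai; rewrite hE /test pi.
  have [ii|_] := eqVneq i i0; first by rewrite ii p0 in pi.
  by move=> /eqP; rewrite mulf_eq0 gt_eqF ?powR_gt0//= => /eqP.
Qed.
End width.

(* The rows of the interpolation matrix are normalised so that it is the identity plus a matrix
   of small norm on sequences bounded by e^(-|p|^sg'). *)
Lemma interpolation i0 : act i0 -> (P i0).1 = false ->
  exists f, [/\ rschwartz f, forall i, act i -> (P i).1 = false -> f (P i).2 = (i == i0)%:R &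
    forall i, act i -> (P i).1 -> Lop s f (P i).2 = 0].
Proof.
have aux (a b g e : R) : b != 0 -> g != 0 -> a * (b^-1 * e) = a * (e * g) / b / g.
  by move=> b0 g0; field; rewrite g0.
move=> ai0 pi0; have [Cb [kb [Cb0 kb0 h1 h2]]] := bump_Lop_decay d0 hs htau.
have [s0 s1] := andP hs; have [t0 t1] := andP htau; have [A00 _] := andP A0.
have [[/andP[sg0 _] _] [r00 r1 _ _ _]] := (sg_, exps).
have t2 : tau / 2 < tau by rewrite ltr_pdivrMr// ltr_pMr// ltr1n.
have [C2 C20 hC2] := stretched_beats 1 (divr_gt0 t0 (ltr0Sn R 1)) t2 (divr_gt0 kb0 (ltr0Sn R 1)) (lexx 0).
pose m := Num.min 1 (2 * s); have m0 : 0 < m by rewrite lt_min ltr01 mulr_gt0.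
have K0 : 0 <= d.+1%:R * B by rewrite mulr_ge0.
have [C3 C30 hC3] := stretched_beats d.+1 r00 r1 m0 K0.
pose C5 := C3 / A ^+ d.+1; have C50 : 0 <= C5 by rewrite divr_ge0 ?exprn_ge0// ltW.
pose Q := (1 + `|l0|^-1) * Cb * expR 5 * (1 + C2) * C5 * Cv.
have half0 : 0 < 2^-1 :> R by rewrite invr_gt0.
have [k1 k10 hk1] := @powR_small R Q m 2^-1 m0 half0.
have [k2 k20 hk2] := @powR_small R 10 tau kb t0 kb0.
(* Below [k1] the matrix has norm at most 1/2, below [k2] the hypothesis [kap_small] holds; the half
   makes both inequalities strict. *)
pose kap := Num.min 1 (Num.min k1 k2 / 2).
have kap0 : 0 < kap by rewrite lt_min ltr01 divr_gt0// lt_min k10.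
have kmin : kap < Num.min k1 k2.
  rewrite gt_min; apply/orP; right; rewrite ltr_pdivrMr// ltr_pMr ?ltr1n// lt_min k10//.
have [kk1 kk2] : kap < k1 /\ kap < k2 by apply/andP; rewrite -lt_min.
have kap01 : 0 < kap <= 1 by rewrite kap0 ge_min lexx.
have ks : 10 <= kb * kap `^ (- tau).
  by rewrite powRN ler_pdivlMr ?powR_gt0//; apply: ltW; exact: hk2 (ltW kap0) kk2.
have h5 t : 0 <= t -> (1 + t) * expR (- (kb * t `^ tau / 2)) <= C2.
  move=> tp; have := hC2 t tp; rewrite mul0r expR0 mulr1 expr1 expRN => h.
  by rewrite ler_pdivrMr ?expR_gt0// [_ / 2]mulrAC.
have h6 j : expR (- (m * nrm j `^ sg)) / sep (P j).2 <= C5 * cell (P j).2.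
  have sp : 0 < sep (P j).2 by exact: sep_gt0.
  have hs1 : sep (P j).2 ^- d.+1 = expR (d.+1%:R * B * nrm j `^ rho) / A ^+ d.+1.
    rewrite -exprVn /sep invfM -expRN opprK exprMn -expRM_natl exprVn mulrA mulrC.
    by [].
  have N1 : 0 < 1 + nrm j by exact: ltr_pwDl ltr01 (nrm0 j).
  have -> : C5 * cell (P j).2 = C5 * sep (P j).2 ^+ d.+1 / (1 + nrm j) ^+ d.+1 / sep (P j).2.
    by rewrite [in RHS]exprSr; apply: aux; rewrite ?expf_neq0// gt_eqF.
  rewrite ler_wpM2r ?invr_ge0 ?(ltW sp)// ler_pdivlMr ?exprn_gt0// -ler_pdivrMr ?exprn_gt0// hs1.
  rewrite mulrA ler_wpM2r ?invr_ge0 ?exprn_ge0 ?(ltW A00)// -mulrA mulrC -ler_pdivlMr ?expR_gt0// -expRN opprK.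
  exact: hC3.
have h7 : (1 + `|l0|^-1) * Cb * expR 5 * (1 + C2) * kap `^ m * C5 * Cv <= 2^-1.
  apply: ltW; apply: le_lt_trans (hk1 _ (ltW kap0) kk1).
  by rewrite /Q le_eqVlt; apply/orP; left; apply/eqP; ring.
exact: (interpolant_exists kap01 Cb0 kb0 h1 h2 ks h5 C50 h6 (ltW C20) h7 ai0 pi0).
Qed.
End interpolation.

Lemma separated_interpolation (R : realType) d (s rho A B : R) (S : bool -> set 'rV[R]_d) p0 :
  (0 < d)%N -> 0 < s < 1 -> 0 < rho < 1 -> 0 < A <= 1 -> 0 <= B ->
  (forall b, separated rho A B (S b)) -> S false p0 ->
  exists f, [/\ rschwartz f, f p0 = 1, forall x, S false x -> x != p0 -> f x = 0 &
    forall x, S true x -> Lop s f x = 0].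
Proof.
move=> d0 hs hrho A0 B0 sS Sp.
have inj b : exists f : 'rV[R]_d -> nat, {in S b &, injective f}.
  by have := separated_countable A0 B0 (sS b) => /countable_injP.
have [f fI] := choice inj.
(* Both sets are enumerated by one index: its parity is the kind, its half the code of the point.
   Codes that no point carries are inactive. *)
pose pt j := [set x | S (odd j) x /\ f (odd j) x = j./2].
pose act j := `[< exists x, pt j x >]; pose P j := (odd j, xget 0 (pt j)).
have Pact j : act j -> pt j (P j).2 by move=> /asboolP[x hx]; rewrite /P/=; case: xgetP => [y _ //|/(_ x)].
have Pinj i j : act i -> act j -> (P i).1 = (P j).1 -> (P i).2 = (P j).2 -> i = j.
  move=> /Pact[_ hi] /Pact[_ hj] o e; have {}o : odd i = odd j := o; rewrite -(odd_double_half i) -(odd_double_half j) -hi -hj.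
  by rewrite o e.
pose idx (b : bool) x := (b + (f b x).*2)%N.
have idxP b x : S b x -> act (idx b x) /\ P (idx b x) = (b, x).
  move=> Sx; have o : odd (idx b x) = b by rewrite oddD odd_double addbF oddb.
  have h : (idx b x)./2 = f b x by rewrite half_bit_double.
  have ax : act (idx b x) by apply/asboolP; exists x; rewrite /pt/= o h.
  split=> //; have [] := Pact _ ax; rewrite /= o h => S1 f1.
  by rewrite /P o; congr pair; apply: (fI b); rewrite ?inE.
have cellP b := packing A0 B0 (sS b).
have [C0 C00 h0] := cellP false; have [C1 C10 h1] := cellP true.
have part (b : bool) C : (forall l, uniq l -> (forall x, x \in l -> S b x) -> \sum_(x <- l) cell rho A B x <= C) ->
    forall N, \sum_(j < N) (if act j && (odd j == b) then cell rho A B (P j).2 else 0) <= C.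
  move=> hC N; rewrite -(big_mkord xpredT (fun j => if act j && (odd j == b) then cell rho A B (P j).2 else 0)).
  rewrite -big_mkcond -big_filter -(big_map (fun j => (P j).2) xpredT); apply: hC.
    rewrite map_inj_in_uniq ?filter_uniq ?iota_uniq// => i j.
    rewrite !mem_filter => /andP[/andP[ai /eqP oi] _] /andP[/andP[aj /eqP oj] _]; apply: Pinj => //.
    by rewrite /= oi oj.
  move=> x /mapP[j]; rewrite mem_filter => /andP[/andP[aj /eqP oj] _] ->.
  by have [] := Pact _ aj; rewrite oj.
have vsum : summable_by (C0 + C1) (fun j => if act j then cell rho A B (P j).2 else 0).
  split=> [j|N]; first by case: ifP => // _; apply: ltW; exact: cell_gt0.
  apply: le_trans (lerD (part false C0 h0 N) (part true C1 h1 N)).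
  rewrite -big_split/=; apply: ler_sum => j _.
  by case: (act j); case: (odd j); rewrite /= ?addr0 ?add0r.
have Psep i j : act i -> act j -> i != j -> (P i).1 = (P j).1 ->
    sep rho A B (P j).2 <= enorm ((P i).2 - (P j).2).
  move=> ai aj ij o; have [Si _] := Pact _ ai; have [Sj _] := Pact _ aj.
  rewrite enormBC; apply: (sS (odd j)) => //; first by move: Si; rewrite (_ : odd i = odd j).
  by apply: contra_neq ij => e; apply: Pinj.
have [a0 e0] := idxP _ _ Sp.
have [g [sg g1 g2]] := interpolation d0 hs hrho A0 B0 Psep vsum a0 (congr1 fst e0).
exists g; split=> // [|x Sx xp|x Sx].
- by have := g1 _ a0 (congr1 fst e0); rewrite e0 eqxx.
- have [ax ex] := idxP _ _ Sx; have := g1 _ ax (congr1 fst ex); rewrite ex => ->.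
  by case: eqP => // e; move: xp; rewrite -[x]/((false, x).2) -ex e e0 eqxx.
- by have [ax ex] := idxP _ _ Sx; have := g2 _ ax; rewrite ex; exact.
Qed.

Section separated_pairs.
Variables (R : realType) (d : nat) (rho : R).
Local Notation V := 'rV[R]_d.
Implicit Types (x y p : V) (G Lambda M : set V).

Lemma rho_separated_pair G : rho_separated rho G -> exists A B : R, [/\ 0 < A, 0 < B &
  forall x y, G x -> G y -> x != y -> sep rho A B x <= enorm (x - y)].
Proof.
move=> [_ [A [B [A0 B0 h]]]]; exists A, B; split=> // x y Gx Gy xy.
rewrite -lee_fin /sep -mulNr; apply: le_trans (h x Gx) _; apply: ereal_inf_lbound.
by exists y => //; split=> //; apply/eqP; rewrite eq_sym.
Qed.

Lemma sep_mono (A A' B B' : R) x : 0 <= A -> A <= A' -> B' <= B -> sep rho A B x <= sep rho A' B' x.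
Proof.
move=> A0 AA BB; rewrite /sep; apply: (ler_pM A0 (expR_ge0 _) AA).
by rewrite ler_expR lerN2 ler_wpM2r ?powR_ge0.
Qed.

Lemma sep_leA (A B : R) x : 0 <= A -> 0 <= B -> sep rho A B x <= A.
Proof.
by move=> A0 B0; rewrite ler_piMr// -[leRHS]expR0 ler_expR oppr_le0 mulr_ge0 ?powR_ge0.
Qed.

Lemma enorm_delta (i : 'I_d) : enorm (delta_mx 0 i : V) = 1.
Proof.
rewrite /enorm (bigD1 i)//= mxE !eqxx expr1n big1 ?addr0 ?sqrtr1// => j ji.
by rewrite mxE (negbTE ji) andbF expr0n.
Qed.

(** Since 0 is not an accumulation point, a punctured ball around it is free of [G]; a point halfway
    out keeps its distance both from 0 and from everything outside the ball. *)
Lemma discrete_gap G : (0 < d)%N -> discrete_in G ->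
  exists p, exists2 del, 0 < del & forall x, G x -> del <= enorm (p - x).
Proof.
move=> d0 dG; have : ~ limit_point G 0 by rewrite dG.
rewrite /limit_point/= => /existsNP[U /not_implyP[/nbhs_ballP[e /= e0 eU] hU]].
have far x : G x -> x != 0 -> e <= enorm x.
  move=> Gx x0; rewrite leNgt; apply/negP => xe; apply: hU; exists x; split=> //; apply: eU.
  by rewrite -ball_normE /ball_/= sub0r normrN; exact: le_lt_trans (norm_le_enorm _) xe.
pose i : 'I_d := Ordinal d0; pose p : V := (e / 2) *: delta_mx 0 i.
have e2 : 0 <= e / 2 by rewrite divr_ge0// ltW.
have np : enorm p = e / 2 by rewrite enormZ enorm_delta mulr1 ger0_norm.
exists p, (e / 2); first exact: divr_gt0.
move=> x Gx; have [->|x0] := eqVneq x 0; first by rewrite subr0 np.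
have := enormD (x - p) p; rewrite subrK np enormBC => h; have := far x Gx x0.
lra.
Qed.
End separated_pairs.

Lemma rho_separated_interpolation (R : realType) d (s rho : R) (Lambda M : set 'rV[R]_d) :
  (0 < d)%N -> 0 < s < 1 -> 0 < rho < 1 -> rho_separated rho Lambda -> rho_separated rho M ->
  exists (f : 'rV[R]_d -> R) p, [/\ rschwartz f, f p = 1, forall x, Lambda x -> f x = 0 &
    forall x, M x -> Lop s f x = 0].
Proof.
move=> d0 hs hrho hL hM; have [p [del del0 hdel]] := discrete_gap (G := Lambda) d0 hL.1.
have [A1 [B1 [A10 B10 h1]]] := rho_separated_pair hL; have [A2 [B2 [A20 B20 h2]]] := rho_separated_pair hM.
(* Including [del] makes the extra point [p] separated from [Lambda], as [sep] never exceeds [A];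
   the bound 1 is required by [packing]. *)
pose A := Num.min (Num.min 1 del) (Num.min A1 A2); pose B := Num.max B1 B2.
have A0 : 0 < A by rewrite !lt_min ltr01 del0 A10.
have [A1' A1d AA1 AA2] : [/\ A <= 1, A <= del, A <= A1 & A <= A2] by rewrite !ge_min !lexx !orbT.
have [BB1 BB2] : B1 <= B /\ B2 <= B by rewrite !le_max !lexx orbT.
have B0 : 0 <= B by apply: le_trans BB1; exact: ltW.
pose S (b : bool) := if b then M else p |` Lambda.
have sS b : separated rho A B (S b).
  case: b => x y /=; first by move=> Mx My xy; apply: le_trans (h2 x y Mx My xy); exact: sep_mono (ltW A0) _ _.
  have hp z : Lambda z -> sep rho A B p <= enorm (p - z) /\ sep rho A B z <= enorm (p - z).
    by move=> Lz; split; apply: le_trans (hdel z Lz); apply: le_trans A1d; exact: sep_leA (ltW A0) _.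
  move=> [->|Lx] [->|Ly] xy; first by rewrite eqxx in xy.
  - exact: (hp y Ly).1.
  - by rewrite enormBC; exact: (hp x Lx).2.
  - by apply: le_trans (h1 x y Lx Ly xy); exact: sep_mono (ltW A0) _ _.
have A01 : 0 < A <= 1 by rewrite A0.
have [f [sf fp fL fM]] := separated_interpolation d0 hs hrho A01 B0 sS (or_introl erefl : S false p).
exists f, p; split=> // x Lx; apply: fL; first by right.
by apply: contraTneq (hdel x Lx) => ->; rewrite subrr enorm0 -ltNge.
Qed.

Lemma rschwartz_complex (R : realType) d (f : 'rV[R]_d -> R) : rschwartz f -> schwartz (fun x => (f x)%:C%C).
Proof.
move=> [sf hf]; split; first by apply/smooth_onE; split=> //; apply: rsmooth_cst; exact: openT.
move=> k s; have [C hC] := hf k s; exists C => x; rewrite partialsE.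
have -> : rpartials s (fun _ : 'rV[R]_d => 0 : R) = fun=> 0.
  by elim: s {C hC} => [//|i s ih]; apply/funext => z; rewrite /rpartials/= -/(rpartials s _) ih rpartial_cst.
rewrite (normc_rc (rpartials s f x)); apply: le_trans (hC x); rewrite ler_wpM2r//.
by apply: lerXn2r; rewrite ?nnegrE ?addr_ge0 ?enorm_ge0// lerDr.
Qed.

Local Open Scope complex_scope.

Theorem corollary6p1 (R : realType) (d : nat) (alpha rho s c beta : R)
    (hd : (1 <= d)%N)
    (halpha : 0 < alpha < 1) (hrho : 0 < rho < 1) (hs : 0 < s < 1)
    (hc : 0 < c) (hbeta : beta = 1 / alpha) :
  (forall (Lambda M : set 'rV[R]_d)
      (f : 'rV[R]_d -> R[i]) (u : 'rV[R]_(d + 1) -> R[i]),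
    discrete_in Lambda -> discrete_in M ->
    (0 < lower_density 1 c Lambda)%E -> (0 < lower_density beta c M)%E ->
    schwartz f -> cs_extension s f u ->
    (forall x, Lambda x -> trace_vanishes_at u x) ->
    (forall x, M x -> weighted_normal_vanishes_at s u x) ->
    forall z, half_space z -> u z = 0)
  /\
  (forall Lambda M : set 'rV[R]_d,
    rho_separated rho Lambda -> rho_separated rho M ->
    exists (f : 'rV[R]_d -> R[i]) (u : 'rV[R]_(d + 1) -> R[i]),
      [/\ schwartz f, cs_extension s f u,
          exists z, half_space z /\ u z <> 0,
          forall x, Lambda x -> trace_vanishes_at u x
        & forall x, M x -> weighted_normal_vanishes_at s u x]).
Proof.
split=> [Lambda M f u _ _ dL dM sf eu tL nM|Lambda M hL hM].
  rewrite hbeta in dM; have [a0 _] := andP halpha.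
  exact: (extension_eq0 hd hs hc a0 dL dM sf eu tL nM).
have [f [p [sf fp fL fM]]] := rho_separated_interpolation hd hs hrho hL hM.
exists (fun x => (f x)%:C), (fun z => (ext s f z)%:C); split.
- exact: rschwartz_complex.
- exact: cs_extension_schwartz.
(* A vanishing extension would have trace 0 at [p], where f = 1. *)
- apply: contrapT => h; have z0 z : half_space z -> ext s f z = 0.
    move=> hz; apply: contrapT => uz; apply: h; exists z; split=> //.
    by move=> /(congr1 (fun w : R[i] => complex.Re w)).
  have t1 := ext_trace hs sf (x := p); rewrite fp in t1.
  have t0 : ext s f (half_point p y) @[y --> 0^'+] --> (0 : R).
    apply: cvg_near_cst; apply: filterS (nbhs_right_gt _) => y y0; apply: z0.
    by rewrite /half_space/= height_half.
  have e10 : (1 : R) = 0 by exact: (cvg_unique (@norm_hausdorff _ _) t1 t0).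
  by move/eqP: e10; rewrite oner_eq0.
- move=> x Lx; have t1 := ext_trace hs sf (x := x); rewrite fL// in t1.
  apply/cvgr0Pnorm_lt => e e0; move/cvgr0Pnorm_lt : t1 => /(_ e e0).
  by apply: filterS => y; rewrite /slice subr0 normc_rc normr_id.
- move=> x Mx; have t1 := ext_normal_derivative hs sf (x := x); rewrite fM// mulr0 in t1.
  apply/cvgr0Pnorm_lt => e e0; move/cvgr0Pnorm_lt : t1 => /(_ e e0).
  apply: filterS => y; rewrite subr0 /weighted_dy.
  have -> : partial (ycoord d) (fun z => (ext s f z)%:C) (half_point x y) =
      (rpartial (ycoord d) (ext s f) (half_point x y))%:C.
    rewrite /partial; congr (_ +i* _); exact: rpartial_cst.
  by rewrite -rmorphM normc_rc normr_id.
Qed.
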